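(* The following statements hold. (1) The commutator ideal $\mathfrak{CT}$ of $\mathfrak{T}$ is equal to the ideal $\mathcal{K}$ of compact operators on $b^2_\nu$. (2) Any element of $\mathfrak{T}$ has the form $T_f+K$ for some $f\in C(\bar{\mathbb{B}})$ and $K\in\mathcal{K}$, and there is a short exact sequence (of $C^*$-algebras and $*$-homomorphisms) $$0\rightarrow\mathcal{K}\rightarrow\mathfrak{T}\rightarrow C(\mathbb{S})\rightarrow 0.$$
   Context: Fix an integer $n\ge 2$. $\mathbb{B}$ is the open unit ball, $\bar{\mathbb{B}}$ the closed unit ball and $\mathbb{S}$ the unit sphere in $\mathbb{R}^n$; $|x|$ is the Euclidean norm. $\nu$ is a regular Borel probability measure on $\mathbb{B}$ that is invariant under the orthogonal group $O(n)$ and satisfies $\nu(\{x\in\mathbb{B}:|x|\ge r\})>0$ for all $0<r<1$. $L^2_\nu=L^2(\mathbb{B},\nu)$ (complex-valued functions), and $b^2_\nu$ is the closed subspace of $L^2_\nu$ consisting of the harmonic functions on $\mathbb{B}$ that belong to $L^2_\nu$. $Q:L^2_\nu\to b^2_\nu$ is the orthogonal projection. For a bounded measurable function $f$ on $\mathbb{B}$, the Toeplitz operator $T_f:b^2_\nu\to b^2_\nu$ is $T_fu=Q(fu)$. $C(\bar{\mathbb{B}})$ and $C(\mathbb{S})$ are the algebras of continuous complex-valued functions on $\bar{\mathbb{B}}$ and $\mathbb{S}$. $\mathfrak{T}$ is the $C^*$-algebra of operators on $b^2_\nu$ generated by all $T_f$ with $f\in C(\bar{\mathbb{B}})$. $\mathfrak{CT}$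 is the closed two-sided ideal of $\mathfrak{T}$ generated by the commutators $[T_f,T_g]=T_fT_g-T_gT_f$ for $f,g\in C(\bar{\mathbb{B}})$. *)

(* Defs.v *)
From HB Require Import structures.
From mathcomp Require Import all_boot all_order all_algebra.
From mathcomp Require Import all_classical all_reals all_analysis.
From mathcomp Require Import measurable_realfun complex ring.

Set Implicit Arguments.
Unset Strict Implicit.
Unset Printing Implicit Defensive.
Import Order.TTheory GRing.Theory Num.Theory numFieldNormedType.Exports.

Local Open Scope classical_set_scope.
Local Open Scope ring_scope.
Local Open Scope complex_scope.

Local Notation Re := complex.Re.
Local Notation Im := complex.Im.

(* The topology of the complex numbers is the one of their modulus. *)
HB.instance Definition _ (R : realType) := NormedModule.copy R[i] R[i]^o.

Section euclidean_space.
Context {R : realType} {n : nat}.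
Implicit Types (h : 'rV[R]_n -> R) (U : set 'rV[R]_n).

(* The library norm on 'rV[R]_n is the sup norm. *)
Definition enorm (x : 'rV[R]_n) : R := Num.sqrt (\sum_(i < n) x ord0 i ^+ 2).

Definition unit_ball : set 'rV[R]_n := [set x | enorm x < 1].
Definition closed_unit_ball : set 'rV[R]_n := [set x | enorm x <= 1].
Definition unit_sphere : set 'rV[R]_n := [set x | enorm x = 1].

Definition partial h (i : 'I_n) : 'rV[R]_n -> R := fun x => 'D_'e_i h x.

Fixpoint Ck (k : nat) U h : Prop :=
  (forall x, U x -> {for x, continuous h}) /\
  (if k is k'.+1 then
     forall i, (forall x, U x -> derivable h x 'e_i) /\ Ck k' U (partial h i)
   else True).

Definition harmonic U h : Prop :=
  Ck 2 U h /\ forall x, U x -> \sum_(i < n) partial (partial h i) i x = 0.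

End euclidean_space.

Definition borel_rV (R : realType) (n : nat) : Type :=
  g_sigma_algebraType (@open 'rV[R]_n).
HB.instance Definition _ (R : realType) (n : nat) :=
  Measurable.on (borel_rV R n).

(* A Borel measure on the unit ball is represented by the Borel measure on R^n
   that extends it by zero. *)
Section ball_measure.
Context {R : realType} {n : nat}.
Variable nu : probability (borel_rV R n) R.

Definition carried_by_ball : Prop := nu unit_ball = 1%E.

Definition regular_on_ball : Prop :=
  forall A : set (borel_rV R n), measurable A -> A `<=` unit_ball ->
    nu A = ereal_inf [set nu U | U in
      [set U : set 'rV[R]_n | [/\ open U, A `<=` U & U `<=` unit_ball]]] /\
    nu A = ereal_sup [set nu K | K in
      [set K : set 'rV[R]_n | compact K /\ K `<=` A]].

Definition orthogonally_invariant : Prop :=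
  forall M : 'M[R]_n, M *m M^T = 1%:M ->
  forall A : set (borel_rV R n), measurable A ->
    nu ((fun x : 'rV[R]_n => x *m M) @^-1` A) = nu A.

Definition charges_boundary : Prop :=
  forall r : R, 0 < r < 1 ->
    (0 < nu (unit_ball `&` [set x : 'rV[R]_n | (r <= enorm x)%R]))%E.

End ball_measure.

Section L2_ball.
Context {R : realType} {n : nat}.
Variable nu : probability (borel_rV R n) R.
Implicit Types f g h u : 'rV[R]_n -> R[i].

(* Only the values of f, g, h, u in the ball matter: every integral below is
   taken over the ball. *)
Definition sqmod (z : R[i]) : R := Re z ^+ 2 + Im z ^+ 2.

Definition in_L2 h : Prop :=
  [/\ measurable_fun (unit_ball : set (borel_rV R n)) (fun x => Re (h x)),
      measurable_fun (unit_ball : set (borel_rV R n)) (fun x => Im (h x)) &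
      (\int[nu]_(x in unit_ball) (sqmod (h x))%:E < +oo)%E].

Definition Cintegral h : R[i] :=
  Rintegral nu unit_ball (fun x => Re (h x)) +i*
  Rintegral nu unit_ball (fun x => Im (h x)).

Definition inner g h : R[i] := Cintegral (fun x => g x * conjc (h x)).

Definition L2norm h : R :=
  Num.sqrt (Rintegral nu unit_ball (fun x => sqmod (h x))).

(* Functions on the ball are represented by functions on R^n that vanish
   outside the ball, so that Leibniz equality is equality on the ball. *)
Definition harmonic_L2 : {pred 'rV[R]_n -> R[i]} := fun u =>
  `[< [/\ forall x, ~ unit_ball x -> u x = 0,
          harmonic unit_ball (fun x => Re (u x)),
          harmonic unit_ball (fun x => Im (u x)) &
          in_L2 u] >].

Lemma open_unit_ball : open (@unit_ball R n).
Proof.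
have cont : continuous (@enorm R n).
  move=> x; apply: (@continuous_comp _ _ _
     (fun y : 'rV[R]_n => \sum_(i < n) y ord0 i ^+ 2) (@Num.sqrt R));
    last exact: sqrt_continuous.
  rewrite /prop_for; move: (index_enum _) => s; elim: s => [|i s IH].
    have -> : (fun y : 'rV[R]_n => \sum_(i <- [::]) y ord0 i ^+ 2) = cst 0.
      by apply/funext => y; rewrite big_nil.
    exact: cst_continuous.
  have -> : (fun y : 'rV[R]_n => \sum_(j <- i :: s) y ord0 j ^+ 2) =
      (fun y : 'rV[R]_n => y ord0 i ^+ 2) +
      (fun y : 'rV[R]_n => \sum_(j <- s) y ord0 j ^+ 2).
    by apply/funext => y; rewrite big_cons.
  apply: continuousD => //.
  apply: (@continuous_comp _ _ _ (fun y : 'rV[R]_n => y ord0 i)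
           (fun z : R => z ^+ 2)); first exact: coord_continuous.
  exact: exprn_continuous.
have -> : @unit_ball R n = enorm @^-1` [set r | r < 1] by [].
apply: open_comp => [x _|]; [exact: cont|exact: open_lt].
Qed.

Lemma measurable_unit_ball :
  measurable (unit_ball : set (borel_rV R n)).
Proof.
have : <<s (@open 'rV[R]_n) >> unit_ball.
  by apply: sub_sigma_algebra; exact: open_unit_ball.
by [].
Qed.

Lemma near_open_eq (U : set 'rV[R]_n) (h1 h2 : 'rV[R]_n -> R) x :
  open U -> U x -> (forall y, U y -> h1 y = h2 y) ->
  \forall y \near x, h1 y = h2 y.
Proof.
move=> oU Ux E; near=> y; apply: E; near: y.
by apply: open_nbhs_nbhs; split.
Unshelve. all: by end_near. Qed.

Lemma continuous_open_ext (U : set 'rV[R]_n) (h1 h2 : 'rV[R]_n -> R) x :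
  open U -> U x -> (forall y, U y -> h1 y = h2 y) ->
  {for x, continuous h1} -> {for x, continuous h2}.
Proof.
move=> oU Ux E; rewrite /prop_for /continuous_at -(E x Ux) => c.
apply: cvg_trans c; apply: (@near_eq_cvg _ _ (nbhs x)).
by apply: (near_open_eq oU Ux) => y Uy; rewrite E.
Qed.

Lemma Ck_ext k (U : set 'rV[R]_n) (h1 h2 : 'rV[R]_n -> R) :
  open U -> (forall x, U x -> h1 x = h2 x) -> Ck k U h1 -> Ck k U h2.
Proof.
move=> oU; elim: k h1 h2 => [|k IH] h1 h2 E /= [c d].
  by split=> // x Ux; exact: (continuous_open_ext oU Ux E (c x Ux)).
split; first by move=> x Ux; exact: (continuous_open_ext oU Ux E (c x Ux)).
move=> i; have [d1 d2] := d i; split.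
  by move=> x Ux; apply: near_eq_derivable (d1 x Ux); exact: (near_open_eq oU Ux E).
apply: IH d2 => x Ux; apply: near_eq_derive; exact: (near_open_eq oU Ux E).
Qed.

Lemma partial_lin (a b : R) (h1 h2 : 'rV[R]_n -> R) i x :
  derivable h1 x 'e_i -> derivable h2 x 'e_i ->
  partial (fun y => a * h1 y + b * h2 y) i x =
  a * partial h1 i x + b * partial h2 i x.
Proof.
move=> d1 d2; rewrite /partial.
have -> : (fun y => a * h1 y + b * h2 y) = (a *: h1) + (b *: h2) by [].
rewrite deriveD; [|exact: derivableZ|exact: derivableZ].
by rewrite !deriveZ.
Qed.

Lemma continuous_lin (a b : R) (h1 h2 : 'rV[R]_n -> R) x :
  {for x, continuous h1} -> {for x, continuous h2} ->
  {for x, continuous (fun y => a * h1 y + b * h2 y)}.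
Proof.
move=> c1 c2.
apply: (@continuousD _ _ _ (fun y => a * h1 y) (fun y => b * h2 y)).
  by apply: (@continuousM _ _ (cst a) h1) => //; exact: cst_continuous.
by apply: (@continuousM _ _ (cst b) h2) => //; exact: cst_continuous.
Qed.

Lemma Ck_lin k (U : set 'rV[R]_n) (a b : R) (h1 h2 : 'rV[R]_n -> R) :
  open U -> Ck k U h1 -> Ck k U h2 ->
  Ck k U (fun y => a * h1 y + b * h2 y).
Proof.
move=> oU; elim: k h1 h2 => [|k IH] h1 h2 /= [c1 d1] [c2 d2].
  by split=> // x Ux; apply: continuous_lin; [exact: c1|exact: c2].
split.
  by move=> x Ux; apply: continuous_lin; [exact: c1|exact: c2].
move=> i; have [e1 f1] := d1 i; have [e2 f2] := d2 i; split.
  move=> x Ux.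
  have -> : (fun y => a * h1 y + b * h2 y) = (a *: h1) + (b *: h2) by [].
  by apply: derivableD; apply: derivableZ; [exact: e1|exact: e2].
apply: Ck_ext (IH _ _ f1 f2) => // x Ux.
by rewrite partial_lin//; [exact: e1|exact: e2].
Qed.

Lemma harmonic_lin (U : set 'rV[R]_n) (a b : R) (h1 h2 : 'rV[R]_n -> R) :
  open U -> harmonic U h1 -> harmonic U h2 ->
  harmonic U (fun y => a * h1 y + b * h2 y).
Proof.
move=> oU [C1 L1] [C2 L2]; split; first exact: Ck_lin.
move=> x Ux; have [_ D1] := C1; have [_ D2] := C2.
have sum_lin (F1 F2 F : 'I_n -> R) : (forall i, F i = a * F1 i + b * F2 i) ->
    \sum_(i < n) F1 i = 0 -> \sum_(i < n) F2 i = 0 -> \sum_(i < n) F i = 0.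
  move=> FE F10 F20; rewrite (eq_bigr _ (fun i _ => FE i)) big_split /=.
  by rewrite -!mulr_sumr F10 F20 !mulr0 addr0.
apply: sum_lin (L1 x Ux) (L2 x Ux) => i.
have [e1 [_ f1]] := D1 i; have [e2 [_ f2]] := D2 i.
rewrite -partial_lin; [|exact: (f1 i).1|exact: (f2 i).1].
apply: near_eq_derive; apply: (near_open_eq oU Ux) => y Uy.
by rewrite partial_lin//; [exact: e1|exact: e2].
Qed.

Lemma in_L2_lin (a : R[i]) u v : in_L2 u -> in_L2 v -> in_L2 (a *: u + v).
Proof.
move=> [mru miu iu] [mrv miv iv].
have mB := measurable_unit_ball.
have ReE x : Re ((a *: u + v) x) =
    (Re a * Re (u x) - Im a * Im (u x)) + Re (v x).
  have E p q r : Re (p * q + r : R[i]) = Re p * Re q - Im p * Im q + Re r.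
    by case: p q r => [? ?] [? ?] [? ?].
  exact: E.
have ImE x : Im ((a *: u + v) x) =
    (Re a * Im (u x) + Im a * Re (u x)) + Im (v x).
  have E p q r : Im (p * q + r : R[i]) = Re p * Im q + Im p * Re q + Im r.
    by case: p q r => [? ?] [? ?] [? ?].
  exact: E.
have msq (w : 'rV[R]_n -> R[i]) : measurable_fun (unit_ball : set (borel_rV R n))
      (fun x => Re (w x)) ->
    measurable_fun (unit_ball : set (borel_rV R n)) (fun x => Im (w x)) ->
    measurable_fun (unit_ball : set (borel_rV R n))
      (EFin \o (fun x => sqmod (w x))).
  move=> m1 m2; apply/measurable_EFinP.
  by apply: measurable_funD; apply: measurable_funX.
have mr : measurable_fun (unit_ball : set (borel_rV R n))
    (fun x => Re ((a *: u + v) x)).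
  under eq_fun do rewrite ReE.
  apply: measurable_funD => //; apply: measurable_funB;
  by apply: measurable_funM => //; exact: measurable_cst.
have mi : measurable_fun (unit_ball : set (borel_rV R n))
    (fun x => Im ((a *: u + v) x)).
  under eq_fun do rewrite ImE.
  apply: measurable_funD => //; apply: measurable_funD;
  by apply: measurable_funM => //; exact: measurable_cst.
split=> //.
have sq0 z : 0 <= sqmod z by rewrite addr_ge0// sqr_ge0.
pose c : R := 2 * sqmod a.
have c0 : 0 <= c by rewrite mulr_ge0.
apply: (@le_lt_trans _ _ (\int[nu]_(x in unit_ball)
   (c%:E * (sqmod (u x))%:E + 2%:E * (sqmod (v x))%:E)))%E.
  apply: ge0_le_integral => //.
  - by move=> x _; rewrite lee_fin.
  - exact: msq.
  - by apply: emeasurable_funD; apply: emeasurable_funM => //; exact: msq.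
  move=> x _; rewrite -!EFinM -EFinD lee_fin {1}/sqmod ReE ImE /c /sqmod.
  set p := Re a; set q := Im a; set r := Re (u x); set s := Im (u x).
  set t := Re (v x); set w := Im (v x).
  rewrite -subr_ge0.
  suff -> : 2 * (p ^+ 2 + q ^+ 2) * (r ^+ 2 + s ^+ 2) +
     2 * (t ^+ 2 + w ^+ 2) -
     ((p * r - q * s + t) ^+ 2 + (p * s + q * r + w) ^+ 2) =
     (p * r - q * s - t) ^+ 2 + (p * s + q * r - w) ^+ 2.
    by rewrite addr_ge0// sqr_ge0.
  by rewrite !expr2; ring.
rewrite ge0_integralD//=.
- rewrite !ge0_integralZl//.
  + by apply: lte_add_pinfty; apply: lte_mul_pinfty => //; rewrite lee_fin.
  + exact: msq.
  + by move=> x _; rewrite lee_fin.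
  + exact: msq.
  + by move=> x _; rewrite lee_fin.
- by move=> x _; rewrite mule_ge0// lee_fin.
- by apply: emeasurable_funM => //; exact: msq.
- by move=> x _; rewrite mule_ge0// lee_fin.
- by apply: emeasurable_funM => //; exact: msq.
Qed.

Lemma harmonic_L2_submod_closed : submod_closed harmonic_L2.
Proof.
split=> [|a u v /asboolP[u0 hru hiu Lu] /asboolP[v0 hrv hiv Lv]].
  have H0 : harmonic (@unit_ball R n) (fun=> 0).
    have C0 k : Ck k (@unit_ball R n) (fun=> 0).
      elim: k => [|k IH]; first by split=> // x _; exact: cst_continuous.
      split=> [x _|i]; first exact: cst_continuous.
      split=> [x _|]; first exact: derivable_cst.
      apply: Ck_ext IH => [|x _]; first exact: open_unit_ball.
      by rewrite /partial derive_cst.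
    split=> // x _; apply: big1 => i _; rewrite /partial.
    have -> : (fun y : 'rV[R]_n => 'D_'e_i (fun=> 0 : R) y) = cst 0.
      by apply/funext => y; rewrite derive_cst.
    by rewrite derive_cst.
  apply/asboolP; split=> //; split; [exact: measurable_cst..|].
  rewrite (_ : (fun x => _) = cst 0%E) ?integral0 ?ltry//.
  by apply/funext => x /=; rewrite /sqmod /= expr0n addr0.
have oB := @open_unit_ball.
have harm (h h' : 'rV[R]_n -> R) : h =1 h' ->
    harmonic unit_ball h -> harmonic unit_ball h'.
  by move=> /funext ->.
apply/asboolP; split.
- by move=> x Bx; rewrite !fctE u0// v0// scaler0 addr0.
- apply: (harm (fun x => 1 * (Re a * Re (u x) + (- Im a) * Im (u x)) +
                         1 * Re (v x))).
    move=> x; rewrite !mul1r !fctE; case: (a) (u x) (v x) => [p q] [r t] [y z].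
    by rewrite /= mulNr.
  exact: (@harmonic_lin _ 1 1 _ _ oB
    (@harmonic_lin _ (Re a) (- Im a) _ _ oB hru hiu) hrv).
- apply: (harm (fun x => 1 * (Re a * Im (u x) + Im a * Re (u x)) +
                         1 * Im (v x))).
    by move=> x; rewrite !mul1r !fctE; case: (a) (u x) (v x) => [p q] [r t] [y z].
  exact: (@harmonic_lin _ 1 1 _ _ oB
    (@harmonic_lin _ (Re a) (Im a) _ _ oB hiu hru) hiv).
- exact: in_L2_lin.
Qed.

Record b2 : Type := B2 {
  b2val :> 'rV[R]_n -> R[i] ;
  _ : b2val \in harmonic_L2
}.

HB.instance Definition _ := [isSub for b2val].
HB.instance Definition _ := [Choice of b2 by <:].
HB.instance Definition _ :=
  GRing.SubChoice_isSubLmodule.Build _ _ _ b2 harmonic_L2_submod_closed.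

(* The orthogonal projection of h, i.e. the point v of b^2 with h - v
   orthogonal to b^2; it is only used for h in L^2. *)
Definition Qproj (h : 'rV[R]_n -> R[i]) : b2 :=
  xget 0 [set v : b2 | forall w : b2, inner (fun x => h x - v x) w = 0].

Definition toeplitz f : b2 -> b2 := fun u : b2 => Qproj (fun x => f x * u x).

End L2_ball.

Section operators.
Context {R : realType} {n : nat}.
Variable nu : probability (borel_rV R n) R.
Local Notation H := (b2 nu).
Implicit Types (S T : H -> H) (A I : set (H -> H)).

Definition op_mul S T : H -> H := S \o T.

Definition bounded_op T : Prop :=
  linear T /\
  exists M : R, forall u : H, L2norm nu (T u) <= M * L2norm nu u.

Definition opnorm T : R :=
  sup [set L2norm nu (T u) | u in [set u : H | L2norm nu u <= 1]].

(* The default value 0 is used only when T has no bounded adjoint. *)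
Definition adjoint T : H -> H :=
  xget 0 [set S | bounded_op S /\
    forall u v : H, inner nu (T u) v = inner nu u (S v)].

Definition compact_op T : Prop :=
  bounded_op T /\
  forall u : nat -> H, (exists M : R, forall k, L2norm nu (u k) <= M) ->
    exists (phi : nat -> nat) (v : H),
      {homo phi : i j / (i < j)%N} /\
      (fun k => L2norm nu (T (u (phi k)) - v)) @ \oo --> (0 : R).

Definition compact_ops : set (H -> H) := [set T | compact_op T].

Definition op_subspace A : Prop :=
  A 0 /\ forall (a : R[i]) S T, A S -> A T -> A (a *: S + T).

Definition norm_closed A : Prop :=
  forall T, bounded_op T ->
    (forall e : R, 0 < e -> exists2 S, A S & opnorm (T - S) < e) -> A T.

Definition cstar_subalgebra A : Prop :=
  [/\ A `<=` bounded_op, op_subspace A,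
      forall S T, A S -> A T -> A (op_mul S T),
      forall T, A T -> A (adjoint T) & norm_closed A].

Definition closed_ideal A I : Prop :=
  [/\ I `<=` A, op_subspace I,
      forall S T, A S -> I T -> I (op_mul S T) /\ I (op_mul T S) & norm_closed I].

Definition continuous_closed_ball : set ('rV[R]_n -> R[i]) :=
  [set f | {within closed_unit_ball, continuous f}].

Definition toeplitz_algebra : set (H -> H) :=
  smallest cstar_subalgebra [set toeplitz f | f in continuous_closed_ball].

Definition commutator_ideal : set (H -> H) :=
  smallest (closed_ideal toeplitz_algebra)
    [set op_mul (toeplitz f) (toeplitz g) - op_mul (toeplitz g) (toeplitz f) |
       f in continuous_closed_ball & g in continuous_closed_ball].

End operators.

Arguments op_mul {R n nu} S T.
Arguments adjoint {R n nu} T.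
Arguments compact_ops {R n} nu _.
Arguments toeplitz_algebra {R n} nu _.
Arguments commutator_ideal {R n} nu _.

Section sphere.
Context {R : realType} {n : nat}.
Local Notation S := (set_type (@unit_sphere R n)).

Definition continuous_sphere : set (S -> R[i]) := [set g | continuous g].

Definition sphere_mul (g h : S -> R[i]) : S -> R[i] := fun x => g x * h x.

Definition sphere_conj (g : S -> R[i]) : S -> R[i] := fun x => conjc (g x).

End sphere.

(* p is a *-homomorphism from A to B, for the given products and involutions
   of the ambient spaces. *)
Definition star_hom (R : realType) (V W : lmodType R[i])
    (mulV : V -> V -> V) (starV : V -> V) (mulW : W -> W -> W) (starW : W -> W)
    (A : set V) (B : set W) (p : V -> W) : Prop :=
  [/\ set_fun A B p,
      forall (a : R[i]) x y, A x -> A y -> p (a *: x + y) = a *: p x + p y,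
      forall x y, A x -> A y -> p (mulV x y) = mulW (p x) (p y) &
      forall x, A x -> p (starV x) = starW (p x)].

(* Exactness of 0 -> A -> B -> C -> 0, with maps j and p. *)
Definition short_exact (R : realType) (U V W : lmodType R[i])
    (A : set U) (B : set V) (C : set W) (j : U -> V) (p : V -> W) : Prop :=
  [/\ set_inj A j, j @` A = B `&` [set x | p x = 0] & p @` B = C].

(* Main.v *)
(* Everything reduces to the orthonormal basis of b^2_nu made of spherical
   harmonics: by O(n)-invariance of nu, the homogeneous harmonic polynomials of
   different degrees k are orthogonal, and an operator is compact iff it is small
   on the span of the degrees >= k for k large. There T_{|x|^2} is the scalar
   lam k = m_(k+1) / m_k, where m_k is the integral of |x|^(2k); as nu charges
   every neighbourhood of the sphere, lam k increases to 1. Hence: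
   - multiplication by f is compact on b^2_nu if f = 0 on the sphere, since |f| is
     dominated by d + C (1 - |x|^2);
   - the Hankel operator of x_i is dominated by multiplication by 1 - |x|^2,
     because x_i h = w + |x|^2 d_i h / (n + 2k - 2) with w harmonic, for h harmonic
     of degree k, so that w + d_i h / (n + 2k - 2) is harmonic too. By Weierstrass,
     T_f T_g - T_(fg) is compact for all continuous f and g;
   - |f| <= |T_f + K| on the sphere for K compact. Otherwise
     phi = max(|f|^2 - |T_f + K|^2, 0) is such that T_(phi^3) is bounded above by
     a compact operator; taking traces over the harmonics of degree k shows that
     the mean of phi^3 against |x|^(2k) nu tends to 0, hence phi = 0 on the sphere.
     So {T_f + K} is norm closed, f is determined on the sphere, and {T_f + K} is
     the whole Toeplitz algebra once K is known to belong to it;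
   - (T_(1 - |x|^2) / (1 - lam 0))^m tends to the projection P_0 on the constants,
     and the operators T_h P_0 T_h' with h, h' basis elements span a dense subspace
     of the compact operators; also P_0 T_(x_i) [T_(|x|^2), T_(x_i)] P_0 is a
     nonzero multiple of P_0, so that P_0 is in the commutator ideal. *)

Require Import Defs.
From HB Require Import structures.
From mathcomp Require Import all_boot all_order all_algebra.
From mathcomp Require Import all_classical all_reals all_analysis.
From mathcomp Require Import measurable_realfun complex ring lra zify.

Set Implicit Arguments.
Unset Strict Implicit.
Unset Printing Implicit Defensive.
Import Order.TTheory GRing.Theory Num.Theory numFieldNormedType.Exports.
Local Open Scope classical_set_scope.
Local Open Scope ring_scope.
Local Open Scope complex_scope.
Local Notation Re := complex.Re.
Local Notation Im := complex.Im.

(** Apart from charging the boundary, the radial distribution of [nu] is arbitrary: it may live on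
    countably many spheres, so the norm of [b2 nu] comes with no mean value property and even its
    definiteness must be earned. Two facts make up for this. Rotation invariance, once
    differentiated, makes the eigenspaces of the angular Laplacian orthogonal on every centred ball
    and for every weight [|x|^(2m)], so that inner products at different radii are proportional
    through moments. And mass near the sphere makes the moments decay more slowly than any geometric
    sequence of ratio below 1; as the dimensions grow polynomially, square summable coefficients
    give locally uniformly convergent series. A function of [b2 nu] may be unbounded near the
    sphere, so completeness is proved on balls of radius [t < 1], where harmonic polynomials
    approximate uniformly, and is related to radius 1 by the proportionality of moments. The
    spherical harmonics are generated from 1 by the operators [raise]: structural facts become
    inductions, and the same formula later controls the Hankel operators. *)

(* A sealed copy of [partial]: rewriting with the rules of differentiation would
   otherwise unfold it down to limits. *)
HB.lock Definition pd (R : realType) (n : nat) (h : 'rV[R]_n -> R) (i : 'I_n) :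
  'rV[R]_n -> R := partial h i.

Lemma pdE (R : realType) (n : nat) : @pd R n = @partial R n.
Proof. by rewrite pd.unlock. Qed.

(** * Polynomial functions *)

Section polynomial_functions.
Context {R : realType} {n : nat}.
Local Notation V := 'rV[R]_n.
Implicit Types (f g h p : V -> R) (i j : 'I_n) (x y v : V).

(** Polynomials are functions carrying an inductive certificate: bounds, derivatives, rotations and
    expansions below are all proved by induction on it. *)
Inductive polyfun : (V -> R) -> Prop :=
| polyfun_cst c : polyfun (fun=> c)
| polyfun_coord i : polyfun (fun x => x ord0 i)
| polyfunD f g : polyfun f -> polyfun g -> polyfun (fun x => f x + g x)
| polyfunM f g : polyfun f -> polyfun g -> polyfun (fun x => f x * g x).

Definition sqn x : R := \sum_(i < n) x ord0 i ^+ 2.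

Lemma polyfun_sum I (s : seq I) (P : pred I) (F : I -> V -> R) :
  (forall k, polyfun (F k)) -> polyfun (fun x => \sum_(i <- s | P i) F i x).
Proof.
move=> pF; elim: s => [|k s IH].
  rewrite (_ : (fun _ => _) = fun=> 0); first exact: polyfun_cst.
  by apply/funext => x; rewrite big_nil.
rewrite (_ : (fun _ => _) = fun x => (if P k then F k x else 0) +
    \sum_(i <- s | P i) F i x).
  by apply: polyfunD => //; case: (P k) => //; exact: polyfun_cst.
by apply/funext => x; rewrite big_cons; case: (P k) => //; rewrite add0r.
Qed.

Lemma polyfunX p m : polyfun p -> polyfun (fun x => p x ^+ m).
Proof.
move=> pp; elim: m => [|m IH]; first exact: polyfun_cst.
rewrite (_ : (fun _ => _) = fun x => p x * p x ^+ m); first exact: polyfunM.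
by apply/funext => x; rewrite exprS.
Qed.

Lemma polyfun_sqn : polyfun sqn.
Proof.
apply: (@polyfun_sum 'I_n _ _ (fun i x => x ord0 i ^+ 2)) => i; by apply: polyfunX; exact: polyfun_coord.
Qed.

Lemma polyfunN p : polyfun p -> polyfun (fun x => - p x).
Proof.
move=> pp; rewrite (_ : (fun _ => _) = fun x => (-1) * p x); last first.
  by apply/funext => x; rewrite mulN1r.
by apply: polyfunM => //; exact: polyfun_cst.
Qed.

Lemma continuous_coord i : continuous (fun x : V => x ord0 i).
Proof. exact: coord_continuous. Qed.

Lemma continuous_polyfun p : polyfun p -> continuous p.
Proof.
elim=> [c|i|f g _ cf _ cg|f g _ cf _ cg] x.
- exact: cst_continuous.
- exact: continuous_coord.
- by apply: (@continuousD _ _ _ f g); [exact: cf|exact: cg].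
- by apply: (@continuousM _ _ f g); [exact: cf|exact: cg].
Qed.

Lemma is_derive_coord i x v : is_derive x v (fun y : V => y ord0 i) (v ord0 i).
Proof.
have E : (fun h : R => h^-1 *: ((h *: v + x) ord0 i - x ord0 i)) @ 0^'
    --> v ord0 i.
  apply: (@cvg_trans _ ((fun _ : R => v ord0 i) @ 0^')); last exact: cvg_cst.
  apply: near_eq_cvg; near=> h.
  have h0 : h != 0 by near: h; exact: nbhs_dnbhs_neq.
  by rewrite !mxE addrK /GRing.scale/= mulKf.
apply: DeriveDef; last by apply/cvg_lim.
by apply/cvg_ex; exists (v ord0 i).
Unshelve. all: by end_near. Qed.

Lemma derivable_polyfun p x v : polyfun p -> derivable p x v.
Proof.
elim=> [c|i|f g _ df _ dg|f g _ df _ dg].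
- exact: derivable_cst.
- by have [] := is_derive_coord i x v.
- exact: (@derivableD _ _ _ f g x v df dg).
- exact: (@derivableM _ _ f g x v df dg).
Qed.

Lemma pd_cst c i : pd (fun _ : V => c) i = fun=> 0.
Proof. by apply/funext => x; rewrite pdE /partial derive_cst. Qed.

Lemma pd_coord j i :
  pd (fun x : V => x ord0 j) i = fun=> (j == i)%:R.
Proof.
apply/funext => x; rewrite pdE /partial (@derive_val _ _ _ _ _ _ _ (is_derive_coord j x 'e_i)).
by rewrite mxE eqxx.
Qed.

Lemma pdD f g i : polyfun f -> polyfun g ->
  pd (fun x => f x + g x) i = fun x => pd f i x + pd g i x.
Proof.
move=> pf pg; apply/funext => x; rewrite pdE /partial.
rewrite (_ : (fun _ => _) = f + g)// deriveD//; exact: derivable_polyfun.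
Qed.

Lemma pdM f g i : polyfun f -> polyfun g ->
  pd (fun x => f x * g x) i =
  fun x => f x * pd g i x + pd f i x * g x.
Proof.
move=> pf pg; apply/funext => x; rewrite pdE /partial.
rewrite (_ : (fun _ => _) = f * g)// deriveM; [|exact: derivable_polyfun..].
by congr (_ + _); rewrite mulrC.
Qed.

Lemma pdZ c f i : polyfun f ->
  pd (fun x => c * f x) i = fun x => c * pd f i x.
Proof.
move=> pf; rewrite (pdM _ (polyfun_cst c))//; apply/funext => x.
by rewrite pd_cst mul0r addr0.
Qed.

Lemma pdB f g i : polyfun f -> polyfun g ->
  pd (fun x => f x - g x) i = fun x => pd f i x - pd g i x.
Proof.
move=> pf pg; rewrite (_ : (fun _ => _) = fun x => f x + (-1) * g x); last first.
  by apply/funext => x; rewrite mulN1r.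
rewrite pdD//; last by apply: polyfunM => //; exact: polyfun_cst.
by apply/funext => x; rewrite pdZ// mulN1r.
Qed.

Lemma pd_sum I (s : seq I) (P : pred I) (F : I -> V -> R) i :
  (forall k, polyfun (F k)) ->
  pd (fun x => \sum_(k <- s | P k) F k x) i =
  fun x => \sum_(k <- s | P k) pd (F k) i x.
Proof.
move=> pF; apply/funext => x; elim: s => [|k s IH].
  rewrite big_nil (_ : (fun _ => _) = fun=> 0) ?pd_cst//.
  by apply/funext => y; rewrite big_nil.
rewrite big_cons (_ : (fun _ => _) = fun y => (if P k then F k y else 0) +
    \sum_(k <- s | P k) F k y).
  rewrite pdD ?IH; [|by case: (P k) => //; exact: polyfun_cst|exact: polyfun_sum].
  by case: (P k) => //; rewrite pd_cst add0r.
by apply/funext => y; rewrite big_cons; case: (P k) => //; rewrite add0r.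
Qed.

Lemma pd_sqn i : pd sqn i = fun x => 2 * x ord0 i.
Proof.
rewrite /sqn (@pd_sum _ _ _ (fun j x => x ord0 j ^+ 2))/=; last first.
  by move=> j; apply: polyfunX; exact: polyfun_coord.
apply/funext => x; rewrite (bigD1 i)//= big1 ?addr0.
  rewrite (_ : (fun _ => _) = fun y : V => y ord0 i * y ord0 i)//.
  by rewrite pdM ?pd_coord ?eqxx/=; [ring|exact: polyfun_coord..].
move=> j ji; rewrite (_ : (fun _ => _) = fun y : V => y ord0 j * y ord0 j)//.
by rewrite pdM ?pd_coord ?(negbTE ji)/=; [ring|exact: polyfun_coord..].
Qed.

Lemma polyfun_pd p i : polyfun p -> polyfun (pd p i).
Proof.
elim=> [c|j|f g pf df pg dg|f g pf df pg dg].
- by rewrite pd_cst; exact: polyfun_cst.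
- by rewrite pd_coord; exact: polyfun_cst.
- by rewrite pdD//; apply: polyfunD.
- by rewrite pdM//; apply: polyfunD; apply: polyfunM.
Qed.

End polynomial_functions.

Ltac pf := solve [repeat match goal with
  | H : polyfun ?p |- polyfun ?p => exact H
  | H : forall i, polyfun _ |- polyfun _ => exact: H
  | |- polyfun (fun _ => ?c) => exact: polyfun_cst
  | |- polyfun (fun x => fun_of_matrix x ord0 ?i) => exact: polyfun_coord
  | |- polyfun sqn => exact: polyfun_sqn
  | |- polyfun (fun x => sqn x) => exact: polyfun_sqn
  | |- polyfun (pd ?p ?i) => apply: polyfun_pd
  | |- polyfun (fun x => pd ?p ?i x) => refine (polyfun_pd (p := p) i _)
  | |- polyfun (fun x => - @?f x) => refine (polyfunN (p := f) _)
  | |- polyfun (fun x => @?f x + @?g x) => refine (polyfunD (f := f) (g := g) _ _)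
  | |- polyfun (fun x => @?f x * @?g x) => refine (polyfunM (f := f) (g := g) _ _)
  | |- polyfun (fun x => @?f x ^+ ?m) => refine (polyfunX (p := f) m _)
  | |- polyfun (fun x => \sum_(i <- ?s | @?P i) @?F i x) =>
      refine (polyfun_sum (F := F) s P _) => ?
  | |- polyfun (fun x => ?p x) => change (polyfun p)
  end].

(** * Second derivatives and the mean value theorem for polynomials *)

Section polynomial_derivatives.
Context {R : realType} {n : nat}.
Local Notation V := 'rV[R]_n.
Implicit Types (f g h p : V -> R) (i j : 'I_n) (x y v : V).

(** Symmetry of second derivatives holds for the generators and passes through the Leibniz rule, so
    no limit is taken. *)
Lemma pdC p i j : polyfun p ->
  pd (pd p i) j = pd (pd p j) i.
Proof.
elim=> [c|k|f g pf df pg dg|f g pf df pg dg].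
- by rewrite !pd_cst.
- by rewrite !pd_coord !pd_cst.
- rewrite !pdD; [|pf..].
  by rewrite df dg.
- rewrite !pdM; [|pf..].
  rewrite !pdD; [|pf..].
  rewrite !pdM; [|pf..].
  rewrite df dg.
  by apply/funext => x; ring.
Qed.

Lemma is_derive_polyfun p x v : polyfun p ->
  is_derive x v p (\sum_(i < n) v ord0 i * pd p i x).
Proof.
elim=> [c|k|f g pf df pg dg|f g pf df pg dg].
- rewrite big1 => [|i _]; last by rewrite pd_cst mulr0.
  exact: (is_derive_cst c).
- rewrite (bigD1 k)//= big1 ?addr0 => [|i ik].
    by rewrite pd_coord eqxx mulr1; exact: is_derive_coord.
  by rewrite pd_coord eq_sym (negbTE ik) mulr0.
- rewrite (_ : \sum_(i < n) _ = \sum_(i < n) v ord0 i * pd f i x +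
      \sum_(i < n) v ord0 i * pd g i x).
    exact: (@is_deriveD _ _ _ f g).
  by rewrite -big_split/=; apply: eq_bigr => i _; rewrite pdD// mulrDr.
- rewrite (_ : \sum_(i < n) _ = f x *: (\sum_(i < n) v ord0 i * pd g i x) +
      g x *: (\sum_(i < n) v ord0 i * pd f i x)).
    exact: (@is_deriveM _ _ f g).
  rewrite /GRing.scale/= !mulr_sumr -big_split/=; apply: eq_bigr => i _.
  by rewrite pdM//; ring.
Qed.

Lemma is_derive_line p x v (t : R) : polyfun p ->
  is_derive t 1 (fun s : R => p (x + s *: v))
    (\sum_(i < n) v ord0 i * pd p i (x + t *: v)).
Proof.
move=> pp; have [d e] := is_derive_polyfun (x + t *: v) v pp.
have E : (fun s : R => s^-1 *: (p (s *: v + (x + t *: v)) - p (x + t *: v))) =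
    (fun s : R => s^-1 *: ((fun s => p (x + s *: v)) (s *: 1 + t) -
      (fun s => p (x + s *: v)) t)).
  apply/funext => s; congr (_ *: (p _ - _)).
  by rewrite scalerDl addrCA /GRing.scale/= mulr1.
rewrite /derive /derivable in d e *; apply: DeriveDef.
  by rewrite /derivable; move: d; rewrite E.
rewrite -e; exact: (esym (congr1 (fun F : R -> R => lim (F @ 0^')) E)).
Qed.

Lemma polyfun_MVT p x y : polyfun p -> exists2 s : R, 0 <= s <= 1 &
  p y - p x = \sum_(i < n) (y - x) ord0 i * pd p i (x + s *: (y - x)).
Proof.
move=> pp; pose f s := p (x + s *: (y - x)).
have df (s : R) : is_derive s 1 f
    (\sum_(i < n) (y - x) ord0 i * pd p i (x + s *: (y - x))).
  exact: is_derive_line.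
have cf : {within `[0, 1], continuous f}.
  apply: derivable_within_continuous => s _; by have [] := df s.
have [s] := @MVT R f _ 0 1 ltr01 (fun s _ => df s) cf.
rewrite in_itv/= => /andP[s0 s1].
rewrite /f scale0r addr0 scale1r (_ : x + (y - x) = y); last by rewrite addrC subrK.
rewrite subr0 mulr1 => E; exists s => //; by rewrite !ltW.
Qed.

(** The mean value theorem on a segment. It is meant for partial sums of series, whose gradients are
    bounded on smaller balls independently of the number of terms. *)
Lemma polyfun_lipschitz p (C t : R) : polyfun p ->
  (forall x, enorm x < t -> forall i, `|pd p i x| <= C) ->
  forall x y, (forall s : R, 0 <= s <= 1 -> enorm (x + s *: (y - x)) < t) ->
  `|p y - p x| <= C * \sum_(i < n) `|(y - x) ord0 i|.
Proof.
move=> pp pC x y seg; have [s s01 ->] := polyfun_MVT x y pp.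
rewrite mulr_sumr; apply: (le_trans (ler_norm_sum _ _ _)).
by apply: ler_sum => i _; rewrite normrM mulrC ler_wpM2r// pC// seg.
Qed.

End polynomial_derivatives.

(** * Harmonic polynomials *)

Section harmonic_polynomials.
Context {R : realType} {n : nat}.
Local Notation V := 'rV[R]_n.
Implicit Types (f g h p q : V -> R) (i j : 'I_n) (x y v : V) (k d m : nat).

Inductive homog : nat -> (V -> R) -> Prop :=
| homog0 d : homog d (fun=> 0)
| homog_cst c : homog 0 (fun=> c)
| homogX d i p : homog d p -> homog d.+1 (fun x => x ord0 i * p x)
| homogD d p q : homog d p -> homog d q -> homog d (fun x => p x + q x).

Lemma homog_polyfun d p : homog d p -> polyfun p.
Proof. by elim=> *; pf. Qed.

Lemma homog_scale d p (t : R) x : homog d p -> p (t *: x) = t ^+ d * p x.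
Proof.
elim=> [d'|c|d' i q _ IH|d' q r _ IHq _ IHr]; rewrite ?mulr0 ?mul1r//.
- by rewrite IH mxE exprS; ring.
- by rewrite IHq IHr mulrDr.
Qed.

Lemma homog_euler d p x : homog d p ->
  \sum_(i < n) x ord0 i * pd p i x = d%:R * p x.
Proof.
elim=> [d'|c|d' i q Hq IH|d' q r Hq IHq Hr IHr].
- by rewrite mulr0 big1// => i _; rewrite pd_cst mulr0.
- by rewrite mul0r big1// => i _; rewrite pd_cst mulr0.
- have pq := homog_polyfun Hq.
  rewrite (eq_bigr (fun j => x ord0 i * (x ord0 j * pd q j x) +
      (i == j)%:R * (x ord0 j * q x))); last first.
    by move=> j _; rewrite pdM ?pd_coord; [ring|pf..].
  rewrite big_split/= -mulr_sumr IH (bigD1 i)//= eqxx big1 ?addr0.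
    by rewrite -natr1/=; ring.
  by move=> j ji; rewrite eq_sym (negbTE ji) mul0r.
- have pq := homog_polyfun Hq; have pr := homog_polyfun Hr.
  rewrite mulrDr -IHq -IHr -big_split/=; apply: eq_bigr => i _.
  by rewrite pdD// mulrDr.
Qed.

Lemma homog_pd0 p i : homog 0 p -> pd p i = fun=> 0.
Proof.
move=> Hp; rewrite (_ : p = fun=> p 0) ?pd_cst//.
apply/funext => x; have := homog_scale 0 x Hp.
by rewrite scale0r expr0 mul1r.
Qed.

Lemma homogZ d p (c : R) : homog d p -> homog d (fun x => c * p x).
Proof.
elim=> [d'|c'|d' i q _ IH|d' q r _ IHq _ IHr].
- by under eq_fun do rewrite mulr0; exact: homog0.
- exact: homog_cst.
- under eq_fun do rewrite mulrCA.
  exact: homogX.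
- under eq_fun do rewrite mulrDr.
  exact: homogD.
Qed.

Lemma homog_sum d I (s : seq I) (P : pred I) (F : I -> V -> R) :
  (forall l, homog d (F l)) -> homog d (fun x => \sum_(l <- s | P l) F l x).
Proof.
move=> pF; elim: s => [|l s IH].
  by under eq_fun do rewrite big_nil; exact: homog0.
rewrite (_ : (fun _ => _) = fun x => (if P l then F l x else 0) +
    \sum_(l <- s | P l) F l x).
  by apply: homogD => //; case: (P l) => //; exact: homog0.
by apply/funext => x; rewrite big_cons; case: (P l) => //; rewrite add0r.
Qed.

Lemma homog_pd d p i : homog d p -> homog d.-1 (pd p i).
Proof.
elim=> [d'|c|d' j q Hq IH|d' q r Hq IHq Hr IHr].
- by rewrite pd_cst; exact: homog0.
- by rewrite pd_cst; exact: homog0.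
- have pq := homog_polyfun Hq.
  rewrite pdM ?pd_coord; [|pf..]; apply: homogD; last exact: homogZ.
  case: d' Hq IH => [|d'] Hq IH; last exact: homogX.
  rewrite (homog_pd0 _ Hq); under eq_fun do rewrite mulr0.
  exact: homog0.
- have pq := homog_polyfun Hq; have pr := homog_polyfun Hr.
  by rewrite pdD//; exact: homogD.
Qed.

Lemma homogM d d' p q : homog d p -> homog d' q ->
  homog (d + d') (fun x => p x * q x).
Proof.
move=> Hp Hq; elim: Hp => [e|c|e i r _ IH|e r s _ IHr _ IHs].
- by under eq_fun do rewrite mul0r; exact: homog0.
- exact: homogZ.
- under eq_fun do rewrite -mulrA.
  exact: homogX.
- under eq_fun do rewrite mulrDl.
  exact: homogD.
Qed.

Lemma homog_sqnM d p : homog d p -> homog d.+2 (fun x => sqn x * p x).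
Proof.
move=> Hp; rewrite (_ : (fun _ => _) =
    fun x => \sum_(i < n) x ord0 i * (x ord0 i * p x)).
  apply: (@homog_sum _ _ _ _ (fun i x => x ord0 i * (x ord0 i * p x))) => i.
  by do 2!apply: homogX.
by apply/funext => x; rewrite /sqn mulr_suml; apply: eq_bigr => i _; rewrite mulrA.
Qed.

(* With the truncated subtraction, [hcoef 0] is [0] when [n = 2]. *)
Definition hcoef k : R := ((n + k.*2 - 2)%N%:R)^-1.

(* The harmonic part of [x_i h] when [h] is harmonic of degree [k]. *)
Definition raise k i h : V -> R :=
  fun x => x ord0 i * h x - hcoef k * (sqn x * pd h i x).

(** The spherical harmonics of degree [k], as what the raising operators generate from 1. That they
    are harmonic is [HP_lap]; that there are enough of them is [homog_decomp]. *)
Inductive HP : nat -> (V -> R) -> Prop :=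
| HP1 : HP 0 (fun=> 1)
| HP0 k : HP k (fun=> 0)
| HPlin k (a : R) f g : HP k f -> HP k g -> HP k (fun x => a * f x + g x)
| HPraise k i h : HP k h -> HP k.+1 (raise k i h).

Lemma HP_homog k h : HP k h -> homog k h.
Proof.
elim=> [|k'|k' a f g _ Hf _ Hg|k' i g _ Hg].
- exact: homog_cst.
- exact: homog0.
- by apply: homogD => //; exact: homogZ.
rewrite /raise (_ : (fun _ => _) = fun x => x ord0 i * g x +
   (- hcoef k') * (sqn x * pd g i x)); last first.
  by apply/funext => x; rewrite mulNr.
apply: homogD; first exact: homogX.
apply: homogZ; case: k' Hg => [|k'] Hg; last first.
  by apply: homog_sqnM; exact: (homog_pd i Hg).
rewrite (homog_pd0 _ Hg); under eq_fun do rewrite mulr0.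
exact: homog0.
Qed.

Lemma HP_polyfun k h : HP k h -> polyfun h.
Proof. by move=> /HP_homog/homog_polyfun. Qed.

Lemma HP_scale k h (t : R) x : HP k h -> h (t *: x) = t ^+ k * h x.
Proof. by move=> /HP_homog; exact: homog_scale. Qed.

Lemma HP_euler k h x : HP k h ->
  \sum_(i < n) x ord0 i * pd h i x = k%:R * h x.
Proof. by move=> /HP_homog; exact: homog_euler. Qed.

Lemma HPZ k (a : R) f : HP k f -> HP k (fun x => a * f x).
Proof.
move=> Hf; under eq_fun do rewrite -[_ * _]addr0.
by apply: HPlin => //; exact: HP0.
Qed.

Lemma HPD k f g : HP k f -> HP k g -> HP k (fun x => f x + g x).
Proof.
move=> Hf Hg; under eq_fun do rewrite -[f _]mul1r.
exact: HPlin.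
Qed.

Lemma HPB k f g : HP k f -> HP k g -> HP k (fun x => f x - g x).
Proof.
move=> Hf Hg; rewrite (_ : (fun _ => _) = fun x => (-1) * g x + f x).
  exact: HPlin.
by apply/funext => x; rewrite mulN1r addrC.
Qed.

Lemma HP_sum k I (s : seq I) (P : pred I) (F : I -> V -> R) :
  (forall l, HP k (F l)) -> HP k (fun x => \sum_(l <- s | P l) F l x).
Proof.
move=> pF; elim: s => [|l s IH].
  by under eq_fun do rewrite big_nil; exact: HP0.
rewrite (_ : (fun _ => _) = fun x => (if P l then F l x else 0) +
    \sum_(l <- s | P l) F l x).
  by apply: HPD => //; case: (P l) => //; exact: HP0.
by apply/funext => x; rewrite big_cons; case: (P l) => //; rewrite add0r.
Qed.

Lemma HP_cst h : HP 0 h -> exists c, h = fun=> c.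
Proof.
move=> Hh; exists (h 0); apply/funext => x.
by have := HP_scale 0 x Hh; rewrite scale0r expr0 mul1r.
Qed.

Lemma HP_pd0 h i : HP 0 h -> pd h i = fun=> 0.
Proof. by move=> /HP_homog; exact: homog_pd0. Qed.

Lemma HP_coord i : HP 1 (fun x => x ord0 i).
Proof.
rewrite (_ : (fun _ => _) = raise 0 i (fun=> 1)); first exact/HPraise/HP1.
by apply/funext => x; rewrite /raise pd_cst !mulr0 mulr1 subr0.
Qed.

Lemma pd_raise k i h j : polyfun h -> pd (raise k i h) j =
  fun x => (i == j)%:R * h x + x ord0 i * pd h j x -
    hcoef k * (2 * x ord0 j * pd h i x + sqn x * pd (pd h i) j x).
Proof.
move=> ph; rewrite /raise pdB ?pdM ?pd_cst ?pd_coord ?pd_sqn; [|pf..].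
by apply/funext => x; ring.
Qed.

Hypothesis hn : (2 <= n)%N.

Lemma hcoef_gt0 k : (0 < k)%N -> 0 < hcoef k.
Proof.
case: k => // k _; rewrite /hcoef invr_gt0 ltr0n doubleS.
by rewrite !addnS !subSS subn0 addn_gt0 (leq_trans _ hn).
Qed.

Lemma hcoefS k : hcoef k.+1 = ((n + k.*2)%N%:R)^-1.
Proof. by rewrite /hcoef doubleS !addnS !subSS subn0. Qed.

(** Differentiating [raise] gives back raised derivatives of [g], plus a multiple of
    [|x|^2 d_i d_j g] that vanishes because the inverses of consecutive [hcoef] differ by 2. *)
Lemma HP_pd k h j : HP k h -> HP k.-1 (pd h j).
Proof.
move=> Hh; elim: Hh j => [|k'|k' a f g Hf IHf Hg IHg|k' i g Hg IH] j.
- by rewrite pd_cst; exact: HP0.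
- by rewrite pd_cst; exact: HP0.
- have pf := HP_polyfun Hf; have pg := HP_polyfun Hg.
  by rewrite pdD ?pdZ; [exact: HPlin|pf..].
have pg := HP_polyfun Hg; rewrite pd_raise//=.
case: k' Hg IH => [|k'] Hg IH.
  rewrite !(HP_pd0 _ Hg) pd_cst.
  rewrite (_ : (fun _ => _) = fun x => (i == j)%:R * g x); first exact: HPZ.
  by apply/funext => x; ring.
rewrite (_ : (fun _ => _) = fun x => (i == j)%:R * g x +
   (raise k' i (pd g j) x - 2 * hcoef k'.+1 * raise k' j (pd g i) x)).
  apply: HPlin => //; apply: HPB; first exact/HPraise/(IH j).
  by apply: HPZ; exact/HPraise/(IH i).
apply/funext => x; rewrite /raise -addrA; congr (_ + _).
rewrite (pdC j i pg).
suff : (hcoef k' - 2 * hcoef k'.+1 * hcoef k' - hcoef k'.+1) * pd (pd g i) j x = 0.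
  by move=> e; apply/eqP; rewrite -subr_eq0 -[X in _ == X](mulr0 (sqn x)) -e; apply/eqP; ring.
(* When [g] has degree 1 its second derivatives vanish, so the truncated value of [hcoef 0] does not
   matter. *)
case: k' Hg IH => [|k'] Hg IH; first by rewrite (HP_pd0 _ (IH i)) mulr0.
rewrite !hcoefS doubleS !addnS.
have : ((n + k'.*2)%N%:R : R) != 0.
  by rewrite pnatr_eq0 -lt0n addn_gt0 (leq_trans _ hn).
have : ((n + k'.*2).+2%:R : R) != 0 by rewrite pnatr_eq0.
rewrite -[_.+2]addn2 natrD; set a := _%:R => a2 a0.
rewrite [X in X * _](_ : _ = 0) ?mul0r//; field.
by rewrite -natrD a2 a0.
Qed.

(** For [g] of degree [k'.+1], the Laplacian of [x_i g] is [2 d_i g], and that of [|x|^2 d_i g] is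
    [(2 n + 4 k') d_i g] by Euler's identity: [hcoef] is the coefficient that makes them cancel. *)
Lemma HP_lap k h x : HP k h -> \sum_(j < n) pd (pd h j) j x = 0.
Proof.
move=> Hh; elim: Hh x => [|k'|k' a f g Hf IHf Hg IHg|k' i g Hg IH] x.
- by rewrite big1// => j _; rewrite !pd_cst.
- by rewrite big1// => j _; rewrite !pd_cst.
- have pf := HP_polyfun Hf; have pg := HP_polyfun Hg.
  rewrite (eq_bigr (fun j => a * pd (pd f j) j x + pd (pd g j) j x)).
    by rewrite big_split/= -mulr_sumr IHf IHg mulr0 addr0.
  move=> j _; rewrite pdD; [|pf..].
  rewrite pdZ//.
  rewrite pdD; [|pf..].
  by rewrite pdZ//; pf.
have pg := HP_polyfun Hg.
case: k' Hg IH => [|k'] Hg IH.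
  rewrite big1// => j _; rewrite pd_raise// !(HP_pd0 _ Hg) pd_cst.
  rewrite (_ : (fun _ => _) = fun x => (i == j)%:R * g x); last first.
    by apply/funext => y; ring.
  by rewrite pdZ// (HP_pd0 _ Hg) mulr0.
have lapd : \sum_(j < n) pd (pd (pd g i) j) j x = 0.
  have e : pd (fun y => \sum_(j < n) pd (pd g j) j y) i x = 0.
    by rewrite (_ : (fun _ => _) = fun=> 0) ?pd_cst//; apply/funext => y.
  rewrite -[RHS]e (@pd_sum R n _ _ _ (fun j y => pd (pd g j) j y)); last first.
    by move=> j; pf.
  apply: eq_bigr => j _; rewrite (pdC i j pg).
  by rewrite (pdC i j (polyfun_pd j pg)).
have eul := HP_euler x (HP_pd i Hg).
rewrite (eq_bigr (fun j => 2 * ((i == j)%:R * pd g j x) + x ord0 i * pd (pd g j) j x -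
   hcoef k'.+1 * (2 * pd g i x + 4 * (x ord0 j * pd (pd g i) j x) +
     sqn x * pd (pd (pd g i) j) j x))); last first.
  move=> j _; rewrite pd_raise// pdB; [|pf..].
  rewrite pdD; [|pf..].
  rewrite !pdM; [|pf..].
  rewrite pdD; [|pf..].
  rewrite !pdM; [|pf..].
  by rewrite !pd_cst !pd_coord pd_sqn eqxx/=; ring.
rewrite sumrB big_split/= -!mulr_sumr !big_split/= IH -!mulr_sumr eul lapd.
rewrite (bigD1 i)//= big1; last first.
  by move=> j ji; rewrite eq_sym (negbTE ji) mul0r.
rewrite eqxx/= sumr_const card_ord hcoefS -mulr_natl.
have : ((n + k'.*2)%N%:R : R) != 0.
  by rewrite pnatr_eq0 -lt0n addn_gt0 (leq_trans _ hn).
rewrite natrD -muln2 natrM; set N := n%:R; set K := k'%:R => NK.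
by field.
Qed.

(** The total degree is recorded so that the exponent of the purely radial term is known in
    [sqn_decomp_mom]. *)
Inductive sqn_decomp : nat -> (V -> R) -> Prop :=
| sqn_decomp0 d : sqn_decomp d (fun=> 0)
| sqn_decompD m k h d p : HP k h -> d = (m.*2 + k)%N -> sqn_decomp d p ->
    sqn_decomp d (fun x => sqn x ^+ m * h x + p x).

Lemma sqn_decompDD d p q : sqn_decomp d p -> sqn_decomp d q ->
  sqn_decomp d (fun x => p x + q x).
Proof.
move=> Dp; elim: Dp q => [d'|m k h d' r Hh e _ IH] q Dq.
  by under eq_fun do rewrite add0r.
by under eq_fun do rewrite -addrA; apply: sqn_decompD Hh e _; exact: IH.
Qed.

Lemma sqn_decomp1 m k h : HP k h ->
  sqn_decomp (m.*2 + k) (fun x => sqn x ^+ m * h x).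
Proof.
move=> Hh; under eq_fun do rewrite -[_ * _]addr0.
by apply: sqn_decompD Hh _ _ => //; exact: sqn_decomp0.
Qed.

(** By the definition of [raise], multiplication by [x_i] sends [|x|^(2m) h] to [|x|^(2m) raise h]
    plus a multiple of [|x|^(2m+2) d_i h]. This yields the Fischer decomposition of polynomials by
    mere induction. *)
Lemma sqn_decompX d p i : sqn_decomp d p ->
  sqn_decomp d.+1 (fun x => x ord0 i * p x).
Proof.
elim=> [d'|m k h d' r Hh -> _ IH].
  by under eq_fun do rewrite mulr0; exact: sqn_decomp0.
under eq_fun do rewrite mulrDr.
apply: sqn_decompDD => //.
rewrite (_ : (fun _ => _) = fun x => sqn x ^+ m * raise k i h x +
   hcoef k * (sqn x ^+ m.+1 * pd h i x)); last first.
  by apply/funext => x; rewrite /raise exprS; ring.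
rewrite -addnS; apply: sqn_decompDD; first exact/sqn_decomp1/HPraise.
case: k Hh {IH} => [|k] Hh.
  rewrite (HP_pd0 _ Hh); under eq_fun do rewrite !mulr0.
  exact: sqn_decomp0.
under eq_fun do rewrite mulrCA.
rewrite (_ : (m.*2 + k.+2)%N = (m.+1.*2 + k)%N); last by rewrite doubleS !addnS !addSn.
by apply: sqn_decomp1; apply: HPZ; exact: (HP_pd i Hh).
Qed.

Lemma homog_decomp d p : homog d p -> sqn_decomp d p.
Proof.
elim=> [d'|c|d' i q _|d' q r _ Dq _ Dr].
- exact: sqn_decomp0.
- rewrite (_ : (fun _ => _) = fun x => sqn x ^+ 0 * c).
    apply: (sqn_decomp1 0 (h := fun=> c)).
    rewrite (_ : (fun=> c) = fun=> c * 1); first exact/HPZ/HP1.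
    by apply/funext => x; rewrite mulr1.
  by apply/funext => x; rewrite mul1r.
- exact: sqn_decompX.
- exact: sqn_decompDD.
Qed.

Inductive hpoly : (V -> R) -> Prop :=
| hpoly0 : hpoly (fun=> 0)
| hpolyD k h p : HP k h -> hpoly p -> hpoly (fun x => h x + p x).

Lemma hpoly_polyfun p : hpoly p -> polyfun p.
Proof.
elim=> [|k h q /HP_polyfun ph _ pq]; [exact: polyfun_cst|exact: polyfunD].
Qed.

Lemma hpolyDD p q : hpoly p -> hpoly q -> hpoly (fun x => p x + q x).
Proof.
move=> Hp Hq; elim: Hp => [|k h r Hh _ IH].
  by under eq_fun do rewrite add0r.
under eq_fun do rewrite -addrA.
by apply: hpolyD Hh _; exact: IH.
Qed.

Lemma HP_hpoly k h : HP k h -> hpoly h.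
Proof.
move=> Hh; rewrite (_ : h = fun x => h x + 0); first exact/(hpolyD Hh)/hpoly0.
by apply/funext => x; rewrite addr0.
Qed.

Lemma sqn_decomp_sphere d p : sqn_decomp d p ->
  exists2 q, hpoly q & forall x, sqn x = 1 -> p x = q x.
Proof.
elim=> [d'|m k h d' r Hh _ _ [q Hq qE]].
  by exists (fun=> 0) => //; exact: hpoly0.
exists (fun x => h x + q x); first exact: hpolyD Hh Hq.
by move=> x x1; rewrite x1 expr1n mul1r qE.
Qed.

Lemma hpolyM_sphere p q : hpoly p -> hpoly q ->
  exists2 r, hpoly r & forall x, sqn x = 1 -> p x * q x = r x.
Proof.
move=> Hp Hq; elim: Hp => [|k h r Hh _ [s Hs sE]].
  by exists (fun=> 0) => [|x _]; [exact: hpoly0|rewrite mul0r].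
have [t Ht tE] : exists2 t, hpoly t & forall x, sqn x = 1 -> h x * q x = t x.
  elim: Hq {Hs sE} => [|k' h' r' Hh' _ [s' Hs' s'E]].
    by exists (fun=> 0) => [|x _]; [exact: hpoly0|rewrite mulr0].
  have [t Ht tE] := sqn_decomp_sphere
    (homog_decomp (homogM (HP_homog Hh) (HP_homog Hh'))).
  exists (fun x => t x + s' x); first exact: hpolyDD.
  by move=> x x1; rewrite mulrDr tE// s'E.
exists (fun x => t x + s x); first exact: hpolyDD.
by move=> x x1; rewrite mulrDl tE// sE.
Qed.

(** On the sphere the factors [|x|^(2m)] of the decomposition disappear: this solves the Dirichlet
    problem for polynomial boundary data. *)
Lemma polyfun_sphere p : polyfun p ->
  exists2 q, hpoly q & forall x, sqn x = 1 -> p x = q x.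
Proof.
elim=> [c|i|f g _ [q Hq qE] _ [r Hr rE]|f g _ [q Hq qE] _ [r Hr rE]].
- exists (fun=> c * 1) => [|x _]; last by rewrite mulr1.
  exact: (HP_hpoly (HPZ c HP1)).
- by exists (fun x => x ord0 i) => //; exact: (HP_hpoly (HP_coord i)).
- exists (fun x => q x + r x) => [|x x1]; first exact: hpolyDD.
  by rewrite qE ?rE.
- have [s Hs sE] := hpolyM_sphere Hq Hr.
  by exists s => // x x1; rewrite qE ?rE ?sE.
Qed.

End harmonic_polynomials.

(** * Orthogonal invariance *)

Section rotations.
Context {R : realType} {n : nat}.
Local Notation V := 'rV[R]_n.
Implicit Types (f g h p q : V -> R) (i j : 'I_n) (x y v : V) (k d m : nat).
Implicit Types (M : 'M[R]_n).

Lemma sqn_ge0 x : 0 <= sqn x.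
Proof. by apply: sumr_ge0 => i _; exact: sqr_ge0. Qed.

Lemma sqn_mul x : (x *m x^T) ord0 ord0 = sqn x.
Proof. by rewrite mxE /sqn; apply: eq_bigr => i _; rewrite mxE expr2. Qed.

Lemma enormE x : enorm x = Num.sqrt (sqn x).
Proof. by []. Qed.

Lemma sqr_enorm x : enorm x ^+ 2 = sqn x.
Proof. by rewrite sqr_sqrtr// sqn_ge0. Qed.

Lemma enorm_ge0 x : 0 <= enorm x.
Proof. exact: sqrtr_ge0. Qed.

Lemma enorm_lt x (t : R) : 0 <= t -> (enorm x < t) = (sqn x < t ^+ 2).
Proof. by move=> t0; rewrite -sqr_enorm ltr_pXn2r// nnegrE// enorm_ge0. Qed.

Lemma enorm_le x (t : R) : 0 <= t -> (enorm x <= t) = (sqn x <= t ^+ 2).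
Proof. by move=> t0; rewrite -sqr_enorm ler_pXn2r// nnegrE// enorm_ge0. Qed.

Lemma sqnZ (t : R) x : sqn (t *: x) = t ^+ 2 * sqn x.
Proof.
by rewrite /sqn mulr_sumr; apply: eq_bigr => i _; rewrite mxE exprMn.
Qed.

Lemma enormZ (t : R) x : 0 <= t -> enorm (t *: x) = t * enorm x.
Proof.
by move=> t0; rewrite !enormE sqnZ sqrtrM ?sqr_ge0// sqrtr_sqr ger0_norm.
Qed.

Lemma sqn_eq0 x : sqn x = 0 -> x = 0.
Proof.
move=> /eqP; rewrite psumr_eq0 => [|i _]; last exact: sqr_ge0.
move=> /allP s0; apply/rowP => i; rewrite mxE; apply/eqP.
by rewrite -sqrf_eq0; apply: s0; rewrite mem_index_enum.
Qed.

Lemma sqn_rot M x : M *m M^T = 1%:M -> sqn (x *m M) = sqn x.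
Proof.
by move=> MM; rewrite -!sqn_mul trmx_mul mulmxA -(mulmxA x) MM mulmx1.
Qed.

Lemma enorm_rot M x : M *m M^T = 1%:M -> enorm (x *m M) = enorm x.
Proof. by move=> MM; rewrite !enormE sqn_rot. Qed.

Lemma coord_le_enorm x i : `|x ord0 i| <= enorm x.
Proof.
rewrite -sqrtr_sqr ler_sqrt ?sqn_ge0// /sqn (bigD1 i)//= lerDl.
by apply: sumr_ge0 => j _; exact: sqr_ge0.
Qed.

(* The reflection in the hyperplane orthogonal to [x - y]. *)
Lemma rotation_transitive x y : sqn x = sqn y ->
  exists2 M : 'M[R]_n, M *m M^T = 1%:M & x *m M = y.
Proof.
move=> xy; have [->|nxy] := eqVneq x y.
  by exists 1%:M; rewrite ?trmx1 mulmx1.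
have [v vE] : {v | v = x - y} by exists (x - y).
have v0 : sqn v != 0.
  by apply/eqP => /sqn_eq0/eqP; rewrite vE subr_eq0 (negbTE nxy).
have vv : v *m v^T = (sqn v)%:M.
  by rewrite [v *m v^T]mx11_scalar sqn_mul.
pose c := 2 / sqn v; pose A := v^T *m v.
have AA : A *m A = sqn v *: A.
  by rewrite /A mulmxA -(mulmxA v^T) vv mul_mx_scalar -scalemxAl.
pose M : 'M[R]_n := 1%:M - c *: A.
have Ms : M^T = M.
  by rewrite /M linearB linearZ/= trmx1 trmx_mul trmxK.
exists M.
  rewrite Ms /M mulmxBl mul1mx mulmxBr mulmx1 -scalemxAr -scalemxAl AA !scalerA.
  rewrite (_ : c * c * sqn v = c + c); last by rewrite /c; field.
  by rewrite scalerDl; apply/matrixP => a b; rewrite !mxE; ring.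
rewrite /M mulmxBr mulmx1 -scalemxAr /A mulmxA.
have xv : x *m v^T = (sqn v / 2)%:M.
  rewrite [x *m v^T]mx11_scalar; congr _%:M.
  have : sqn v = sqn x + sqn y - 2 * (x *m y^T) ord0 ord0.
    rewrite vE /sqn mxE mulr_sumr -big_split -sumrB; apply: eq_bigr => i _ /=.
    by rewrite !mxE; ring.
  rewrite -xy => ->; rewrite vE linearB/= mulmxBr [in LHS]mxE sqn_mul [X in _ + X]mxE.
  by field.
rewrite xv mul_scalar_mx scalerA (_ : c * (sqn v / 2) = 1); last by rewrite /c; field.
by rewrite scale1r vE opprB addrC subrK.
Qed.

Lemma polyfun_rot M p : polyfun p -> polyfun (fun x => p (x *m M)).
Proof.
elim=> [c|i|f g _ pf _ pg|f g _ pf _ pg]; [exact: polyfun_cst| |pf..].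
rewrite (_ : (fun _ => _) = fun x => \sum_j x ord0 j * M j i); first by pf.
by apply/funext => x; rewrite mxE.
Qed.

Lemma pd_rot M p j : polyfun p ->
  pd (fun x => p (x *m M)) j = fun x => \sum_i M j i * pd p i (x *m M).
Proof.
elim=> [c|i|f g pf df pg dg|f g pf df pg dg].
- apply/funext => x; rewrite pd_cst big1// => i _; rewrite pd_cst mulr0//.
- rewrite (_ : (fun _ => _) = fun x => \sum_l x ord0 l * M l i); last first.
    by apply/funext => x; rewrite mxE.
  rewrite (@pd_sum R n _ _ _ (fun l x => x ord0 l * M l i)); last first.
    by move=> l; pf.
  apply/funext => x; transitivity (M j i).
    rewrite (bigD1 j)//= big1 ?addr0 => [|l lj].
      by rewrite pdM ?pd_coord ?pd_cst ?eqxx/=; [ring|pf..].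
    by rewrite pdM ?pd_coord ?pd_cst ?(negbTE lj)/=; [ring|pf..].
  rewrite (bigD1 i)//= big1 ?addr0 => [|l li].
    by rewrite pd_coord eqxx mulr1.
  by rewrite pd_coord eq_sym (negbTE li) mulr0.
- have pf' := polyfun_rot M pf; have pg' := polyfun_rot M pg.
  apply/funext => x.
  rewrite (pdD j pf' pg') df dg -big_split/=; apply: eq_bigr => i _.
  by rewrite pdD// mulrDr.
- have pf' := polyfun_rot M pf; have pg' := polyfun_rot M pg.
  apply/funext => x; rewrite (pdM j pf' pg') df dg mulr_sumr mulr_suml -big_split/=.
  by apply: eq_bigr => i _; rewrite pdM//; ring.
Qed.

(** A rotation only mixes the indices of [raise]: multiplication by [x] and the gradient both
    transform as vectors, the latter because [M^T M = 1]. *)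
Lemma HP_rot k h M : M *m M^T = 1%:M -> HP k h -> HP k (fun x => h (x *m M)).
Proof.
move=> MM; elim=> [|k'|k' a f g _ Hf _ Hg|k' i g Hg IH].
- exact: HP1.
- exact: HP0.
- exact: HPlin.
have pg := HP_polyfun Hg.
rewrite (_ : (fun _ => _) = fun x => \sum_j M j i *
    raise k' j (fun x => g (x *m M)) x).
  apply: (@HP_sum _ _ _ _ _ _ (fun j x => M j i * raise k' j (fun x => g (x *m M)) x)).
  by move=> j; exact/HPZ/HPraise.
apply/funext => x; rewrite /raise sqn_rot// mxE.
transitivity (\sum_j (x ord0 j * M j i * g (x *m M) -
    @hcoef R n k' * sqn x * (\sum_l (M^T i j * M j l) * pd g l (x *m M)))).
  rewrite sumrB -mulr_suml -mulr_sumr exchange_big/=; congr (_ - _).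
  rewrite (eq_bigr (fun l => (i == l)%:R * pd g l (x *m M))).
    rewrite (bigD1 i)//= big1 ?addr0 => [|l li].
      by rewrite eqxx mul1r mulrA.
    by rewrite eq_sym (negbTE li) mul0r.
  move=> l _; rewrite -mulr_suml; congr (_ * _).
  have : M^T *m M = 1%:M by apply: mulmx1C.
  by move/matrixP => /(_ i l); rewrite !mxE.
apply: eq_bigr => j _; rewrite pd_rot// mulrBr; congr (_ - _); first by ring.
rewrite (_ : \sum_l M^T i j * M j l * _ = M j i * \sum_l M j l * pd g l (x *m M)).
  by ring.
by rewrite mulr_sumr; apply: eq_bigr => l _; rewrite mxE mulrA.
Qed.

End rotations.

(** * Dimension of the spaces of spherical harmonics *)

Section dimension.
Context {R : realType} {n : nat}.
Local Notation V := 'rV[R]_n.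
Implicit Types (f g h p q : V -> R) (i j : 'I_n) (x y v : V) (k d m : nat).

Inductive lspan (s : seq (V -> R)) : (V -> R) -> Prop :=
| lspan0 : lspan s (fun=> 0)
| lspanD (a : R) g f : List.In g s -> lspan s f -> lspan s (fun x => a * g x + f x).

Lemma lspan_lin s (a : R) f g : lspan s f -> lspan s g ->
  lspan s (fun x => a * f x + g x).
Proof.
move=> Hf Hg; elim: Hf => [|b h f' hs _ IH].
  by under eq_fun do rewrite mulr0 add0r.
under eq_fun do rewrite mulrDr -addrA mulrA.
exact: lspanD.
Qed.

Lemma lspan_in s g : List.In g s -> lspan s g.
Proof.
move=> gs; rewrite (_ : g = fun x => 1 * g x + 0).
  by apply: lspanD => //; exact: lspan0.
by apply/funext => x; rewrite mul1r addr0.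
Qed.

Lemma lspan_polyfun s f : (forall g, List.In g s -> polyfun g) ->
  lspan s f -> polyfun f.
Proof.
move=> ps; elim=> [|a g f' /ps pg _ pf']; [exact: polyfun_cst|pf].
Qed.

Lemma raise_lin k i (a : R) f g : polyfun f -> polyfun g ->
  raise k i (fun x => a * f x + g x) =
  fun x => a * raise k i f x + raise k i g x.
Proof.
move=> pf pg; apply/funext => x; rewrite /raise pdD; [|pf..].
by rewrite pdZ//; ring.
Qed.

Lemma HPS_ind k (P : (V -> R) -> Prop) :
  P (fun=> 0) -> (forall a f g, P f -> P g -> P (fun x => a * f x + g x)) ->
  (forall i h, HP k h -> P (raise k i h)) -> forall h, HP k.+1 h -> P h.
Proof.
move=> P0 Plin Praise h.
suff : forall m g, HP m g -> m = k.+1 -> P g by move=> H /H; exact.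
move=> m g; elim=> [//|k' _ //|k' a f g' _ IHf _ IHg e|k' i g' Hg _ [e]].
  by apply: Plin; [exact: IHf|exact: IHg].
by rewrite e in Hg *; exact: Praise.
Qed.

Lemma HP_finite k : exists2 s : seq (V -> R),
  (forall h, List.In h s -> HP k h) & (forall h, HP k h -> lspan s h).
Proof.
elim: k => [|k [s sH Hs]].
  exists [:: fun=> 1] => [h [<-|[]]|h /HP_cst[c ->]]; first exact: HP1.
  rewrite (_ : (fun=> c) = fun x : V => c * 1 + 0).
    by apply: (@lspanD _ c (fun=> 1)); [left|exact: lspan0].
  by apply/funext => x; rewrite mulr1 addr0.
have inI (i : 'I_n) (e : seq 'I_n) : i \in e -> List.In i e.
  elim: e => // j e IH; rewrite inE => /predU1P[->|/IH]; [by left|by right].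
exists (List.flat_map (fun i => List.map (raise k i) s) (enum 'I_n)).
  move=> h /List.in_flat_map[i [_ /List.in_map_iff[g [<- gs]]]].
  exact/HPraise/sH.
apply: HPS_ind => [|a f g|i h /Hs]; [exact: lspan0|exact: lspan_lin|].
elim=> [|a g f gs sf IH].
  rewrite (_ : raise k i _ = fun=> 0); first exact: lspan0.
  by apply/funext => x; rewrite /raise pd_cst !mulr0 subr0.
have pf : polyfun f by apply: lspan_polyfun sf => g' /sH/HP_polyfun.
rewrite raise_lin//; last exact: (HP_polyfun (sH _ gs)).
apply: lspan_lin => //; apply: lspan_in; apply/List.in_flat_map.
exists i; split; first by apply: inI; rewrite mem_enum.
exact: List.in_map.
Qed.

(** If every [raise k i h] vanished, multiplying by [x_i] and summing would give
    [|x|^2 h = hcoef k * k * |x|^2 h] by Euler's identity, and [hcoef k * k] is not 1. *)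
Lemma raise_neq0 k h : (2 <= n)%N -> HP k h -> (exists x, h x != 0) ->
  exists i x, raise k i h x != 0.
Proof.
move=> hn Hh [x hx0]; apply: contrapT => r0.
have {}r0 i y : raise k i h y = 0.
  by apply/eqP; apply: contrapT => /negP ry; apply: r0; exists i, y.
have Z y : sqn y != 0 -> h y = 0.
  move=> y0.
  have E : sqn y * h y = @hcoef R n k * sqn y * (k%:R * h y).
    rewrite -(HP_euler y Hh) {1}/sqn mulr_suml mulr_sumr; apply: eq_bigr => i _.
    have := r0 i y; rewrite /raise => /eqP; rewrite subr_eq0 => /eqP e.
    by rewrite expr2 -mulrA e; ring.
  have {}E : h y * (1 - @hcoef R n k * k%:R) = 0.
    by apply: (mulfI y0); rewrite mulr0 mulrBr mulrA mulr1 mulrBr E; ring.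
  move/eqP: E; rewrite mulf_eq0 => /orP[/eqP//|].
  rewrite subr_eq0 eq_sym => /eqP; case: k Hh {r0} => [|k] Hh.
    by rewrite mulr0 => /esym/eqP; rewrite oner_eq0.
  rewrite hcoefS => e.
  have : (n + k.*2)%N%:R != 0 :> R.
    by rewrite pnatr_eq0 -lt0n addn_gt0 (leq_trans _ hn).
  move=> nk0; have : (n + k.*2)%N%:R = k.+1%:R :> R.
    by rewrite -[LHS]mulr1 -[X in _ * X]e mulrA mulfV ?mul1r.
  move/eqP; rewrite eqr_nat -addnn addnA => /eqP e'.
  have : (k.+1 < n + k + k)%N by rewrite -[k.+1]addn1; lia.
  by rewrite e' ltnn.
case: (eqVneq (sqn x) 0) => [/sqn_eq0 x0|/Z hx]; last by rewrite hx eqxx in hx0.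
have i0 : 'I_n by exact: (Ordinal (ltn_trans (ltnSn 0) hn)).
case: k Hh r0 Z => [|k] Hh r0 Z; last first.
  by move: hx0; rewrite x0 -(scale0r x) (HP_scale _ _ Hh) exprS !mul0r eqxx.
have [c hc] := HP_cst Hh; have := r0 i0 'e_i0.
rewrite /raise (HP_pd0 _ Hh) !mulr0 subr0 mxE !eqxx mul1r => h0.
by move: hx0; rewrite hc; rewrite hc in h0; rewrite h0 eqxx.
Qed.

(** Makes the dimension positive in every degree; the comparison of traces divides by it. *)
Lemma HP_neq0 k : (2 <= n)%N -> exists2 h, HP k h & exists x, h x != 0.
Proof.
move=> hn; elim: k => [|k [h Hh h0]].
  by exists (fun=> 1); [exact: HP1|exists 0; rewrite oner_eq0].
have [i [x rx]] := raise_neq0 hn Hh h0.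
by exists (raise k i h); [exact: HPraise|exists x].
Qed.

Definition monom (a : 'I_n -> nat) : V -> R := fun x => \prod_i x ord0 i ^+ a i.

Inductive mspan m : (V -> R) -> Prop :=
| mspan0 : mspan m (fun=> 0)
| mspanD (c : R) a f : (forall i, a i < m)%N -> mspan m f ->
    mspan m (fun x => c * monom a x + f x).

Lemma mspan_lin m (c : R) f g : mspan m f -> mspan m g ->
  mspan m (fun x => c * f x + g x).
Proof.
move=> Hf Hg; elim: Hf => [|b a f' am _ IH].
  by under eq_fun do rewrite mulr0 add0r.
under eq_fun do rewrite mulrDr -addrA mulrA.
exact: mspanD.
Qed.

Lemma mspanX m i f : mspan m f -> mspan m.+1 (fun x => x ord0 i * f x).
Proof.
elim=> [|c a f' am _ IH]; first by under eq_fun do rewrite mulr0; exact: mspan0.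
rewrite (_ : (fun _ => _) = fun x => c * monom (fun j => a j + (j == i))%N x +
   x ord0 i * f' x).
  by apply: mspanD => // j; have := am j; case: (j == i); rewrite ?addn0 ?addn1 ?ltnS// => /ltnW.
apply/funext => x; rewrite mulrDr; congr (_ + _).
rewrite mulrCA; congr (_ * _); rewrite /monom (bigD1 i)//= [in RHS](bigD1 i)//=.
rewrite eqxx addn1 exprS mulrA; congr (_ * _); apply: eq_bigr => j ji.
by rewrite (negbTE ji) addn0.
Qed.

Lemma mspanW m m' f : (m <= m')%N -> mspan m f -> mspan m' f.
Proof.
move=> mm; elim=> [|c a f' am _ IH]; first exact: mspan0.
by apply: mspanD => // i; exact: leq_trans (am i) mm.
Qed.

Lemma mspan_sum m I (s : seq I) (F : I -> V -> R) :
  (forall l, mspan m (F l)) -> mspan m (fun x => \sum_(l <- s) F l x).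
Proof.
move=> pF; elim: s => [|l s IH].
  by under eq_fun do rewrite big_nil; exact: mspan0.
under eq_fun do rewrite big_cons -[F _ _]mul1r.
exact: mspan_lin.
Qed.

(** The bound on the exponents is crude on purpose: only the polynomial growth of the dimension in
    [k] is used. *)
Lemma HP_mspan k h : (2 <= n)%N -> HP k h -> mspan k.*2.+1 h.
Proof.
move=> hn; elim/ltn_ind: k h => -[_|k IH].
  move=> h /HP_cst[c ->]; rewrite (_ : (fun=> c) = fun x => c * monom (fun=> 0)%N x + 0).
    by apply: mspanD => //; exact: mspan0.
  by apply/funext => x; rewrite /monom big1// mulr1 addr0.
apply: HPS_ind => [|a f g|i h Hh]; [exact: mspan0|exact: mspan_lin|].
rewrite (_ : raise k i h = fun x => (- @hcoef R n k) *
    (\sum_(j <- enum 'I_n) x ord0 j * (x ord0 j * pd h i x)) + x ord0 i * h x).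
  apply: mspan_lin.
    apply: (@mspan_sum _ _ _ (fun j x => x ord0 j * (x ord0 j * pd h i x))) => j.
    apply/mspanX/mspanX; case: k IH Hh => [|k] IH Hh.
      by rewrite (HP_pd0 _ Hh); exact: mspan0.
    apply: mspanW (IH k (leqnSn _) _ (HP_pd hn i Hh)).
    exact: (leqW (leqW (leqnn k.*2.+1))).
  by apply/mspanX; apply: mspanW (IH k (ltnSn _) _ Hh); rewrite doubleS leqnSn.
apply/funext => x; rewrite /raise big_enum/= /sqn mulr_suml addrC mulNr.
by congr (- (_ * _) + _); apply: eq_bigr => j _; rewrite expr2 mulrA.
Qed.

Lemma mspan_sum_monom m f : mspan m f ->
  exists c : {ffun 'I_n -> 'I_m} -> R,
    forall x, f x = \sum_a c a * monom (fun i => a i) x.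
Proof.
elim=> [|b a f' am _ [c cE]].
  by exists (fun=> 0) => x; rewrite big1// => a _; rewrite mul0r.
pose a' : {ffun 'I_n -> 'I_m} := [ffun i => Ordinal (am i)].
exists (fun a0 => b * (a0 == a')%:R + c a0) => x.
under eq_bigr do rewrite mulrDl.
rewrite big_split/= -cE; congr (_ + _).
rewrite (bigD1 a')//= big1 ?addr0 => [|d' da].
  rewrite eqxx mulr1; congr (_ * _); rewrite /monom.
  by apply: eq_bigr => i _; rewrite ffunE.
by rewrite (negbTE da) mulr0 mul0r.
Qed.

(** With more functions than monomials, the matrix of coefficients would have a nonzero left kernel
    vector. *)
Lemma HP_dim k d (e : 'I_d -> V -> R) : (2 <= n)%N -> (forall l, HP k (e l)) ->
  (forall v : 'I_d -> R, (forall x, \sum_l v l * e l x = 0) -> forall l, v l = 0) ->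
  (d <= k.*2.+1 ^ n)%N.
Proof.
move=> hn eH ind.
have /choice[c cE] l := mspan_sum_monom (HP_mspan hn (eH l)).
pose I : finType := {ffun 'I_n -> 'I_(k.*2.+1)}.
have <- : #|I| = (k.*2.+1 ^ n)%N by rewrite card_ffun !card_ord.
pose C : 'M[R]_(d, #|I|) := \matrix_(l, a) c l (enum_val a).
rewrite leqNgt; apply/negP => dI.
have : kermx C != 0.
  by rewrite kermx_eq0 /row_free neq_ltn (leq_ltn_trans (rank_leq_col C)).
move=> /matrix0Pn[i0 [l0 /eqP K0]]; apply: K0.
apply: (ind (fun l => kermx C i0 l)) => x.
have KC := mulmx_ker C.
under eq_bigr do rewrite cE mulr_sumr.
rewrite exchange_big/= big1// => a _.
under eq_bigr do rewrite mulrA.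
rewrite -mulr_suml.
have /matrixP/(_ i0 (enum_rank a)) := KC.
rewrite mxE [RHS]mxE => e0; rewrite [X in X * _](_ : _ = 0) ?mul0r// -[RHS]e0.
have Ca l : C l (enum_rank a) = c l a by rewrite mxE enum_rankK.
by apply: eq_bigr => l _; rewrite Ca.
Qed.

End dimension.

(** * Integration over balls *)

Section ball_integrals.
Context {R : realType} {n : nat}.
Variable nu : probability (borel_rV R n) R.
Local Notation V := 'rV[R]_n.
Local Notation BV := (borel_rV R n).
Implicit Types (f g h p q : V -> R) (i j : 'I_n) (x y v : V) (k d m : nat).
Implicit Types (M : 'M[R]_n) (t : R).

Definition ball_of (t : R) : set V := [set x | enorm x < t].

Lemma continuous_sqn : continuous (@sqn R n).
Proof. exact/continuous_polyfun/polyfun_sqn. Qed.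

Lemma continuous_enorm : continuous (@enorm R n).
Proof.
move=> x; apply: (@continuous_comp _ _ _ (@sqn R n) (@Num.sqrt R)).
  exact: continuous_sqn.
exact: sqrt_continuous.
Qed.

Lemma open_ball_of t : open (ball_of t).
Proof.
rewrite (_ : ball_of t = (@enorm R n) @^-1` [set r | r < t])//.
by apply: open_comp => [x _|]; [exact: continuous_enorm|exact: open_lt].
Qed.

Lemma open_measurable_rV (U : set V) : open U -> measurable (U : set BV).
Proof. by move=> oU; apply: sub_sigma_algebra. Qed.

Lemma measurable_ball_of t : measurable (ball_of t : set BV).
Proof. by apply: open_measurable_rV; exact: open_ball_of. Qed.

Lemma measurable_fun_open (U : set V) f : open U ->
  (forall x, U x -> {for x, continuous f}) ->
  measurable_fun (U : set BV) (f : BV -> R).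
Proof.
move=> oU cf; apply: (measurability _ (RGenOpens.measurableE R)).
move=> _ [_ [a [b ->] <-]].
have oo : open (U `&` f @^-1` `]a, b[%classic : set V).
  rewrite openE => x [Ux fx].
  apply: filterI; first by apply: open_nbhs_nbhs; split.
  by apply: (cf x Ux); apply: open_nbhs_nbhs; split.
exact: (open_measurable_rV oo).
Qed.

Lemma measurable_fun_rV f (D : set BV) : continuous f ->
  measurable_fun D (f : BV -> R).
Proof.
move=> cf; apply: measurable_funTS.
by apply: (@measurable_fun_open setT) => [|x _]; [exact: openT|exact: cf].
Qed.

Lemma continuous_rV (T : topologicalType) (phi : T -> V) (z : T) :
  (forall i, {for z, continuous (fun w => phi w ord0 i)}) ->
  {for z, continuous phi}.
Proof.
move=> cphi A [P nP sPA]; rewrite /nbhs/=.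
have : \forall w \near z, forall i, P ord0 i (phi w ord0 i).
  by apply: filter_forall => i; exact: (cphi i _ (nP ord0 i)).
by apply: filterS => w Pw; apply: sPA => i j; rewrite ord1.
Qed.

Lemma continuous_rot M : continuous (fun x : V => x *m M).
Proof.
move=> x; apply: continuous_rV => i.
by apply: (@continuous_polyfun R n); apply: (polyfun_rot M (polyfun_coord i)).
Qed.

Lemma measurable_rot M : measurable_fun setT ((fun x : V => x *m M) : BV -> BV).
Proof.
apply: (@measurability _ _ BV BV setT _ (@open V)) => //.
move=> _ [U oU <-]; rewrite setTI.
have oo : open ((fun x : V => x *m M) @^-1` U).
  by apply: open_comp => // x _; exact: continuous_rot.
exact: (open_measurable_rV oo).
Qed.

Definition ibl t f := nu.-integrable (ball_of t : set BV) (EFin \o f).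
(** The radius is a parameter since functions of the Bergman space are only known to be bounded on
    smaller balls; [J 1] is the integral over the whole ball. *)
Definition J t f : R := Rintegral nu (ball_of t : set BV) f.

Lemma ibl_bounded t f (C : R) : measurable_fun (ball_of t : set BV) f ->
  (forall x, ball_of t x -> `|f x| <= C) -> ibl t f.
Proof.
move=> mf bf; apply: measurable_bounded_integrable => //.
- exact: measurable_ball_of.
- by apply: (le_lt_trans (probability_le1 _ _)); [exact: measurable_ball_of|rewrite ltry].
- exists C; split; first exact: num_real.
  by move=> e Ce x /bf /le_trans; apply; exact: ltW.
Qed.

Lemma polyfun_bounded p t : polyfun p ->
  exists C : R, forall x, enorm x <= t -> `|p x| <= C.
Proof.
elim=> [c|i|f g _ [C fC] _ [D gD]|f g _ [C fC] _ [D gD]].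
- by exists `|c|.
- by exists t => x; apply: le_trans; exact: coord_le_enorm.
- exists (C + D) => x xt; apply: le_trans (ler_normD _ _) _.
  by rewrite lerD ?fC ?gD.
- exists (C * D) => x xt; rewrite normrM.
  by rewrite ler_pM ?fC ?gD.
Qed.

Lemma ibl_polyfun t p : polyfun p -> ibl t p.
Proof.
move=> pp; have [C pC] := polyfun_bounded t pp.
apply: (@ibl_bounded _ _ C) => [|x /ltW]; last exact: pC.
by apply: measurable_fun_rV; exact: continuous_polyfun.
Qed.

Lemma iblD t f g : ibl t f -> ibl t g -> ibl t (fun x => f x + g x).
Proof.
move=> ff gg; rewrite /ibl (_ : EFin \o _ = (EFin \o f) \+ (EFin \o g))//.
by apply: integrableD => //; exact: measurable_ball_of.
Qed.

Lemma iblZ t (c : R) f : ibl t f -> ibl t (fun x => c * f x).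
Proof.
move=> ff; rewrite /ibl (_ : EFin \o _ = (fun x => c%:E * (EFin \o f) x)%E)//.
by apply: integrableZl => //; exact: measurable_ball_of.
Qed.

Lemma JD t f g : ibl t f -> ibl t g -> J t (fun x => f x + g x) = J t f + J t g.
Proof. by move=> ff gg; rewrite /J RintegralD//; exact: measurable_ball_of. Qed.

Lemma JB t f g : ibl t f -> ibl t g -> J t (fun x => f x - g x) = J t f - J t g.
Proof. by move=> ff gg; rewrite /J RintegralB//; exact: measurable_ball_of. Qed.

Lemma JZ t (c : R) f : ibl t f -> J t (fun x => c * f x) = c * J t f.
Proof. by move=> ff; rewrite /J RintegralZl//; exact: measurable_ball_of. Qed.

Lemma iblB t f g : ibl t f -> ibl t g -> ibl t (fun x => f x - g x).
Proof.
move=> ff gg; rewrite (_ : (fun _ => _) = fun x => f x + (-1) * g x).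
  by apply: iblD => //; exact: iblZ.
by apply/funext => x; rewrite mulN1r.
Qed.

Lemma J_ge0 t f : (forall x, ball_of t x -> 0 <= f x) -> 0 <= J t f.
Proof. by move=> f0; apply: Rintegral_ge0. Qed.

Lemma le_J t f g : ibl t f -> ibl t g ->
  (forall x, ball_of t x -> f x <= g x) -> J t f <= J t g.
Proof. by move=> ff gg fg; apply: le_Rintegral => //; exact: measurable_ball_of. Qed.

Lemma eq_J t f g : (forall x, ball_of t x -> f x = g x) -> J t f = J t g.
Proof. by move=> fg; apply: eq_Rintegral => x; rewrite inE => /fg. Qed.

Lemma eq_ibl t f g : (forall x, ball_of t x -> f x = g x) -> ibl t f -> ibl t g.
Proof.
move=> fg; apply: eq_integrable; first exact: measurable_ball_of.
by move=> x; rewrite inE /= => /fg ->.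
Qed.

Lemma ibl_sum t I (s : seq I) (F : I -> V -> R) : (forall l, ibl t (F l)) ->
  ibl t (fun x => \sum_(l <- s) F l x).
Proof.
move=> iF; elim: s => [|l s IH].
  by under eq_fun do rewrite big_nil; exact/ibl_polyfun/polyfun_cst.
by under eq_fun do rewrite big_cons; exact: iblD.
Qed.

Lemma J_sum t I (s : seq I) (F : I -> V -> R) : (forall l, ibl t (F l)) ->
  J t (fun x => \sum_(l <- s) F l x) = \sum_(l <- s) J t (F l).
Proof.
move=> iF; elim: s => [|l s IH].
  under eq_fun do rewrite big_nil.
  by rewrite big_nil /J /Rintegral integral0.
under eq_fun do rewrite big_cons.
by rewrite big_cons JD ?IH//; exact: ibl_sum.
Qed.

Hypothesis nu_invariant : orthogonally_invariant nu.

Lemma ball_of_rot t M : M *m M^T = 1%:M ->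
  (fun x : V => x *m M) @^-1` ball_of t = ball_of t.
Proof.
by move=> MM; apply/seteqP; split=> x; rewrite /ball_of /= enorm_rot.
Qed.

Lemma integral_rot t M f : M *m M^T = 1%:M ->
  measurable_fun (ball_of t : set BV) (f : BV -> R) ->
  (forall x, ball_of t x -> 0 <= f x) ->
  (\int[nu]_(x in (ball_of t : set BV)) (f (x *m M))%:E =
  \int[nu]_(x in (ball_of t : set BV)) (f x)%:E)%E.
Proof.
move=> MM mf f0; pose phi : BV -> BV := fun x : V => x *m M.
have mphi : measurable_fun setT phi := measurable_rot M.
have mB := measurable_ball_of t.
transitivity (\int[pushforward nu phi]_(y in (ball_of t : set BV)) (f y)%:E)%E.
  rewrite ge0_integral_pushforward//.
  - by rewrite [phi @^-1` _](ball_of_rot t MM).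
  - exact/measurable_EFinP.
  - by move=> y; rewrite inE lee_fin => /f0.
apply: eq_measure_integral => A mA _; rewrite /pushforward.
exact: nu_invariant.
Qed.

Lemma J_rot t M f (C : R) : M *m M^T = 1%:M ->
  measurable_fun (ball_of t : set BV) (f : BV -> R) ->
  (forall x, ball_of t x -> `|f x| <= C) ->
  J t (fun x => f (x *m M)) = J t f.
Proof.
move=> MM mf bf.
have ic : ibl t (fun=> C) by exact/ibl_polyfun/polyfun_cst.
have ifn : ibl t f := ibl_bounded mf bf.
have fM x : ball_of t x -> ball_of t (x *m M) by rewrite /ball_of /= enorm_rot.
have mfM : measurable_fun (ball_of t : set BV) ((fun x : V => f (x *m M)) : BV -> R).
  apply: (@measurable_comp _ _ _ BV BV R (ball_of t) (f : BV -> R) (ball_of t)) => //.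
  - exact: measurable_ball_of.
  - by move=> _ [x /fM ? <-].
  - by apply: measurable_funTS; exact: measurable_rot.
have ifM : ibl t (fun x => f (x *m M)).
  by apply: (ibl_bounded mfM) => x /fM; exact: bf.
(* The change of variables [integral_rot] is for nonnegative functions, hence the shift by the bound
   [C]. *)
apply: (@addIr _ (J t (fun=> C))); rewrite -!JD//.
congr fine; apply: (@integral_rot t M (fun x => f x + C)) => //.
  by apply: measurable_funD => //; exact: measurable_cst.
by move=> x /bf; rewrite ler_norml => /andP[+ _]; rewrite lerNl -subr_ge0 opprK addrC.
Qed.

Lemma J_rot_polyfun t M p : M *m M^T = 1%:M -> polyfun p ->
  J t (fun x => p (x *m M)) = J t p.
Proof.
move=> MM pp; have [C pC] := polyfun_bounded t pp.
apply: (@J_rot _ _ _ C) => // [|x /ltW]; last exact: pC.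
by apply: measurable_fun_rV; exact: continuous_polyfun.
Qed.

(* Differentiating a rotation in the plane of two coordinates gives the
   generator [x_i d_j - x_j d_i]. *)
Definition Lop i j p : V -> R := fun x => x ord0 i * pd p j x - x ord0 j * pd p i x.

Lemma polyfun_Lop i j p : polyfun p -> polyfun (Lop i j p).
Proof. by move=> pp; rewrite /Lop; pf. Qed.

Lemma LopM i j p q : polyfun p -> polyfun q ->
  Lop i j (fun x => p x * q x) = fun x => p x * Lop i j q x + Lop i j p x * q x.
Proof.
by move=> pp pq; apply/funext => x; rewrite /Lop !pdM//; ring.
Qed.

Definition plane_rot i j (c s : R) : 'M[R]_n :=
  \matrix_(a, b) (if a == i then (b == i)%:R * c + (b == j)%:R * s
    else if a == j then (b == j)%:R * c - (b == i)%:R * s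
    else (a == b)%:R).

Lemma plane_rotE i j c s x : i != j ->
  x *m plane_rot i j c s = \row_a (if a == i then c * x ord0 i - s * x ord0 j
    else if a == j then s * x ord0 i + c * x ord0 j else x ord0 a).
Proof.
move=> ij; apply/rowP => b; rewrite !mxE (bigD1 i)//= (bigD1 j) 1?eq_sym//=.
have ji : (j == i) = false by rewrite eq_sym (negbTE ij).
have ij' := negbTE ij.
rewrite !mxE !eqxx ji.
have [->|bi] := eqVneq b i.
  rewrite ij' big1 ?addr0; first by rewrite /=; ring.
  by move=> a /andP[ai aj]; rewrite mxE (negbTE ai) (negbTE aj) mulr0.
have [->|bj] := eqVneq b j.
  rewrite big1 ?addr0; first by rewrite /=; ring.
  by move=> a /andP[ai aj]; rewrite mxE (negbTE ai) (negbTE aj) mulr0.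
rewrite (bigD1 b)/= ?bi ?bj// big1 ?addr0.
  by rewrite mxE (negbTE bi) (negbTE bj) eqxx /=; ring.
by move=> a /andP[/andP[ai aj] ab]; rewrite mxE (negbTE ai) (negbTE aj) (negbTE ab) mulr0.
Qed.

Lemma plane_rot_orth i j c s : i != j -> c ^+ 2 + s ^+ 2 = 1 ->
  plane_rot i j c s *m (plane_rot i j c s)^T = 1%:M.
Proof.
move=> ij cs.
have ij' := negbTE ij.
have ji : (j == i) = false by rewrite eq_sym (negbTE ij).
have -> : (plane_rot i j c s)^T = plane_rot i j c (- s).
  apply/matrixP => a b; rewrite !mxE.
  have [->|ai] := eqVneq a i; have [->|bi] := eqVneq b i;
    rewrite ?ij' ?ji ?eqxx /=; try ring.
  - by case: (b == j) => /=; ring.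
  - by case aj: (a == j) => /=; rewrite ?(negbTE ai)/=; ring.
  - case aj: (a == j); case bj: (b == j) => /=; try ring.
    + by rewrite (eqP aj) bj/=; ring.
    + by rewrite (eqP bj) aj/=; ring.
    + by rewrite eq_sym.
apply/row_matrixP => a; rewrite !rowE mulmxA mulmx1 !plane_rotE//.
apply/rowP => b; rewrite mxE; have [->|bi] := eqVneq b i.
  rewrite !mxE !eqxx ji /=; set u := (_ == a)%:R; set v := (_ == a)%:R.
  transitivity ((c ^+ 2 + s ^+ 2) * u); [by ring|by rewrite cs mul1r].
have [->|bj] := eqVneq b j.
  rewrite !mxE !eqxx ji /=; set u := (_ == a)%:R; set v := (_ == a)%:R.
  transitivity ((c ^+ 2 + s ^+ 2) * v); [by ring|by rewrite cs mul1r].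
by rewrite mxE (negbTE bi) (negbTE bj).
Qed.

(** [s] is the tangent of half the angle: with this rational parametrization the expansion at
    [s = 0] is pure algebra. The angle is [2 s] to first order. *)
Definition half_angle i j (s : R) : 'M[R]_n :=
  plane_rot i j ((1 - s ^+ 2) / (1 + s ^+ 2)) (2 * s / (1 + s ^+ 2)).

Lemma half_angle_orth i j s : i != j ->
  half_angle i j s *m (half_angle i j s)^T = 1%:M.
Proof.
move=> ij; apply: plane_rot_orth => //; field.
by rewrite gt_eqF// ltr_pwDl// sqr_ge0.
Qed.

(** A first-order expansion whose remainder is uniform on the ball, so that it can be integrated.
    For a product, the expansions of the factors are multiplied out. *)
Lemma half_angle_expand i j p t : i != j -> polyfun p ->
  exists C, forall x (s : R), enorm x <= t -> `|s| <= 1 ->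
    `|p (x *m half_angle i j s) - p x - 2 * s * Lop i j p x| <= C * s ^+ 2.
Proof.
move=> ij; elim=> [c|a|f g pf [C fC] pg [D gD]|f g pf [C fC] pg [D gD]].
- exists 0 => x s _ _.
  by rewrite /Lop !pd_cst !mulr0 subr0 mulr0 subrr subr0 normr0 mul0r.
- exists (4 * t) => x s xt s1.
  have xa b : `|x ord0 b| <= t by rewrite (le_trans (coord_le_enorm x b)).
  have s0 : 0 <= s ^+ 2 := sqr_ge0 s.
  have t0 : 0 <= t := le_trans (normr_ge0 _) (xa i).
  have d0 : 0 < 1 + s ^+ 2 by rewrite ltr_pwDl.
  have d0' := lt0r_neq0 d0.
  have key (y z : R) : `|y| <= t -> `|z| <= t ->
      `|- (2 * s ^+ 2 / (1 + s ^+ 2)) * y + 2 * s ^+ 3 / (1 + s ^+ 2) * z| <= 4 * t * s ^+ 2.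
    move=> yt zt; apply: (le_trans (ler_normD _ _)).
    rewrite (_ : 4 * t * s ^+ 2 = 2 * s ^+ 2 * t + 2 * s ^+ 2 * t); last by ring.
    have le2 : 2 * s ^+ 2 / (1 + s ^+ 2) <= 2 * s ^+ 2.
      by rewrite ler_pdivrMr// mulrDr mulr1 lerDl; apply: mulr_ge0 => //; exact: mulr_ge0.
    have q0 : 0 <= 2 * s ^+ 2 / (1 + s ^+ 2).
      by apply: divr_ge0; [exact: mulr_ge0|exact: ltW].
    rewrite (_ : 2 * s ^+ 3 / _ = s * (2 * s ^+ 2 / (1 + s ^+ 2))); last first.
      by rewrite exprS; field.
    rewrite lerD// normrM ler_pM// ?normrN ?(ger0_norm q0)//.
    by rewrite normrM (ger0_norm q0) -[leRHS]mul1r ler_pM.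
  rewrite plane_rotE// mxE /Lop !pd_coord.
  have ij' := negbTE ij.
  have ji : (j == i) = false by rewrite eq_sym (negbTE ij).
  have [->|ai] := eqVneq a i.
    rewrite ij' /=; apply: le_trans (key (x ord0 i) (x ord0 j) (xa i) (xa j)).
    rewrite le_eqVlt; apply/orP; left; apply/eqP; congr `|_|.
    by field.
  have [->|aj] := eqVneq a j.
    rewrite /=; apply: le_trans (key (x ord0 j) (- x ord0 i) (xa j) _); last first.
      by rewrite normrN.
    rewrite le_eqVlt; apply/orP; left; apply/eqP; congr `|_|.
    by field.
  by rewrite /= !mulr0 !subr0 mulr0 subr0 subrr normr0 mulr_ge0// mulr_ge0.
- exists (C + D) => x s xt s1; rewrite [leRHS]mulrDl.
  apply: le_trans (lerD (fC x s xt s1) (gD x s xt s1)).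
  apply: le_trans (ler_normD _ _).
  rewrite le_eqVlt; apply/orP; left; apply/eqP; congr `|_|.
  by rewrite /Lop !pdD//; ring.
have [F fF] := polyfun_bounded t pf.
have [G gG] := polyfun_bounded t pg.
have [F' fF'] := polyfun_bounded t (polyfun_Lop i j pf).
have [G' gG'] := polyfun_bounded t (polyfun_Lop i j pg).
(* One constant for each of the four terms into which the remainder of the product is rewritten
   below. *)
exists (F * D + 4 * (F' * G') + 2 * (F' * D) + C * G) => x s xt s1.
rewrite LopM//.
have xt' : enorm (x *m half_angle i j s) <= t.
  by rewrite enorm_rot//; exact: half_angle_orth.
have := fC x s xt s1; have := gD x s xt s1.
have := fF x xt; have := gG _ xt'; have := fF' x xt; have := gG' x xt.
set a := f (x *m _); set b := g (x *m _).
set lf := Lop i j f x; set lg := Lop i j g x.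
set rf := _ - _ - 2 * s * lf; set rg := _ - _ - 2 * s * lg.
move=> hlg hlf hb hf hrg hrf.
rewrite (_ : a * b - _ - _ = f x * rg + 4 * s ^+ 2 * (lf * lg) +
   2 * s * (lf * rg) + rf * b); last by rewrite /rf /rg; ring.
have s0 : 0 <= s ^+ 2 := sqr_ge0 s.
rewrite [leRHS]mulrDl [X in _ <= X + _]mulrDl [X in _ <= X + _ + _]mulrDl.
apply: (le_trans (ler_normD _ _)); apply: lerD; last first.
  rewrite normrM mulrAC ler_pM//.
apply: (le_trans (ler_normD _ _)); apply: lerD; last first.
  rewrite !normrM (ger0_norm (ler0n _ 2)) -!mulrA ler_pM2l//.
  rewrite -[leRHS]mul1r ler_pM//.
  by rewrite ler_pM.
apply: (le_trans (ler_normD _ _)); apply: lerD.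
  by rewrite normrM -mulrA ler_pM.
have s4 : 0 <= 4 * s ^+ 2 by exact: mulr_ge0.
rewrite normrM (ger0_norm s4) [leRHS]mulrAC ler_wpM2l//.
by rewrite normrM ler_pM.
Qed.

Lemma J_norm_le t f (C : R) : 0 <= C -> ibl t f ->
  (forall x, ball_of t x -> `|f x| <= C) -> `|J t f| <= C.
Proof.
move=> C0 ff fC; have mB := measurable_ball_of t.
apply: (le_trans (le_normr_Rintegral _ _)) => //.
apply: (@le_trans _ _ (J t (fun=> C))).
  apply: le_J => //; last exact/ibl_polyfun/polyfun_cst.
  exact: (integrable_norm ff).
rewrite /J Rintegral_cst// ler_piMr// -lee_fin fineK ?probability_le1//.
exact: fin_num_measure.
Qed.

(** The integral of [p] does not change under the rotation of parameter [s], so the expansion leaves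
    [2 |s| |J t (Lop i j p)| <= C s^2] for all small [s]. *)
Lemma J_Lop t i j p : polyfun p -> J t (Lop i j p) = 0.
Proof.
move=> pp; have [->|ij] := eqVneq i j.
  rewrite (_ : Lop j j p = fun=> 0) ?/J /Rintegral ?integral0//.
  by apply/funext => x; rewrite /Lop subrr.
have [C pC] := half_angle_expand t ij pp.
have pL := polyfun_Lop i j pp.
move: (Lop i j p) pL pC => L pL pC.
have bnd (s : R) : `|s| <= 1 -> 2 * `|s| * `|J t L| <= `|C| * s ^+ 2.
  move=> s1; have orth := half_angle_orth s ij.
  have pr := polyfun_rot (half_angle i j s) pp.
  rewrite (_ : 2 * `|s| * _ = `|J t (fun x => p (x *m half_angle i j s) - p x -
      2 * s * L x)|).
    apply: J_norm_le => [||x /ltW xt].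
    - by rewrite mulr_ge0// sqr_ge0.
    - by apply: ibl_polyfun; pf.
    - by apply: (le_trans (pC x s xt s1)); rewrite ler_wpM2r ?sqr_ge0// ler_norm.
  rewrite JB; [|by apply: ibl_polyfun; pf..].
  rewrite JB; [|by apply: ibl_polyfun; pf..].
  rewrite JZ ?J_rot_polyfun//; last exact: ibl_polyfun.
  by rewrite subrr sub0r normrN !normrM (ger0_norm (ler0n _ 2)).
apply/eqP; rewrite -normr_eq0; apply/negPn/negP => J0.
set a := `|J t _| in J0 bnd; have a0 : 0 < a by rewrite lt_def J0 normr_ge0.
(* Then [|C| s <= a], while the bound at [s] says [2 a <= |C| s]. *)
pose s := Num.min 1 (a / (`|C| + 1)).
have C1 : 0 < `|C| + 1 by rewrite ltr_wpDl.
have s0 : 0 < s by rewrite /s lt_min ltr01 divr_gt0.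
have s1 : `|s| <= 1 by rewrite gtr0_norm// /s ge_min lexx.
have := bnd s s1; rewrite gtr0_norm// expr2 mulrAC [leRHS]mulrA ler_pM2r//.
have : `|C| * s <= a.
  apply: (@le_trans _ _ ((`|C| + 1) * s)); first by rewrite ler_wpM2r ?ltW// ltrDl.
  by rewrite mulrC -ler_pdivlMr// /s ge_min lexx orbT.
by move=> h1 h2; have := le_trans h2 h1; rewrite mulr_natl mulr2n gerDl leNgt a0.
Qed.

Lemma Lop_sqn i j : Lop i j (@sqn R n) = fun=> 0.
Proof. by apply/funext => x; rewrite /Lop !pd_sqn; ring. Qed.

Lemma Lop_sqnX i j m : Lop i j (fun x => sqn x ^+ m) = fun=> 0.
Proof.
elim: m => [|m IH]; first by apply/funext => x; rewrite /Lop !pd_cst; ring.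
rewrite (_ : (fun _ => _) = fun x => sqn x * sqn x ^+ m); last first.
  by apply/funext => x; rewrite exprS.
rewrite LopM; [|pf..].
by rewrite IH Lop_sqn; apply/funext => x; ring.
Qed.

(** The generators are skew-symmetric, by [J_Lop] applied to the product; radial weights go through
    because [Lop] kills [|x|^2]. *)
Lemma J_Lop_parts t i j m p q : polyfun p -> polyfun q ->
  J t (fun x => sqn x ^+ m * (Lop i j p x * q x)) =
  - J t (fun x => sqn x ^+ m * (p x * Lop i j q x)).
Proof.
move=> pp pq; have pLp := polyfun_Lop i j pp; have pLq := polyfun_Lop i j pq.
apply/eqP; rewrite -subr_eq0 opprK -JD; [|by apply: ibl_polyfun; pf..].
rewrite -[X in _ == X](J_Lop t i j (p := fun x => sqn x ^+ m * (p x * q x))); last by pf.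
rewrite LopM; [|pf..].
rewrite Lop_sqnX LopM//; apply/eqP; apply: eq_J => x _; ring.
Qed.

(** The squares of the generators add up to the angular Laplacian, whose eigenvalue in degree [k] is
    [- k (k + n - 2)]; the factor 2 comes from counting each pair of coordinates twice. *)
Lemma casimir k h x : (2 <= n)%N -> HP k h ->
  \sum_i \sum_j Lop i j (Lop i j h) x = - 2 * (k%:R * (k%:R + n%:R - 2)) * h x.
Proof.
move=> hn Hh; have ph := HP_polyfun Hh.
have E : \sum_i \sum_j x ord0 i * x ord0 j * pd (pd h j) i x =
    k%:R * (k%:R - 1) * h x.
  case: k Hh => [|k] Hh.
    rewrite !mul0r big1// => i _; rewrite big1// => j _.
    by rewrite (HP_pd0 _ Hh) pd_cst mulr0.
  rewrite exchange_big/= -natr1 addrK mulrAC natr1 -(HP_euler x Hh).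
  rewrite [RHS]mulr_suml; apply: eq_bigr => j _.
  rewrite -mulrA [pd h j x * _]mulrC -(HP_euler x (HP_pd hn j Hh)) mulr_sumr.
  by apply: eq_bigr => i _; ring.
transitivity (\sum_i \sum_j ((i == j)%:R * (2 * x ord0 i * pd h i x) +
    x ord0 i ^+ 2 * pd (pd h j) j x + x ord0 j ^+ 2 * pd (pd h i) i x
    - x ord0 i * pd h i x - x ord0 j * pd h j x
    - 2 * (x ord0 i * x ord0 j * pd (pd h j) i x))).
  apply: eq_bigr => i _; apply: eq_bigr => j _.
  rewrite /Lop !pdB; [|pf..].
  rewrite !pdM; [|pf..].
  rewrite !pd_coord !eqxx (pdC j i ph) [j == i]eq_sym.
  by have [->|_] := eqVneq i j; rewrite /=; ring.
under eq_bigr do rewrite !sumrB !big_split/=.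
rewrite !sumrB !big_split/=.
have -> : \sum_i \sum_j (i == j)%:R * (2 * x ord0 i * pd h i x) = 2 * (k%:R * h x).
  rewrite -(HP_euler x Hh) mulr_sumr; apply: eq_bigr => i _.
  rewrite (bigD1 i)//= big1 ?addr0 => [|j ji].
    by rewrite eqxx mul1r mulrA.
  by rewrite eq_sym (negbTE ji) mul0r.
have -> : \sum_i \sum_j x ord0 i ^+ 2 * pd (pd h j) j x = 0.
  by rewrite big1// => i _; rewrite -mulr_sumr (HP_lap hn x Hh) mulr0.
have -> : \sum_i \sum_j x ord0 j ^+ 2 * pd (pd h i) i x = 0.
  rewrite exchange_big big1// => j _ /=.
  by rewrite -mulr_sumr (HP_lap hn x Hh) mulr0.
have -> : \sum_i \sum_(j < n) x ord0 i * pd h i x = n%:R * (k%:R * h x).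
  rewrite -(HP_euler x Hh) mulr_sumr; apply: eq_bigr => i _.
  by rewrite sumr_const card_ord mulr_natl.
have -> : \sum_(i < n) \sum_j x ord0 j * pd h j x = n%:R * (k%:R * h x).
  by rewrite (HP_euler x Hh) sumr_const card_ord -[LHS]mulr_natl.
have -> : \sum_i \sum_j 2 * (x ord0 i * x ord0 j * pd (pd h j) i x) =
    2 * (k%:R * (k%:R - 1) * h x).
  by rewrite -E mulr_sumr; apply: eq_bigr => i _; rewrite mulr_sumr.
ring.
Qed.

(** The angular Laplacian is symmetric for [J t] with any weight [|x|^(2m)], and its eigenvalues in
    two distinct degrees differ by a multiple of [(l - k) (k + l + n - 2)], which is not 0. *)
Lemma HP_orth t m k l h g : (2 <= n)%N -> HP k h -> HP l g -> k != l ->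
  J t (fun x => sqn x ^+ m * (h x * g x)) = 0.
Proof.
move=> hn Hh Hg kl; have ph := HP_polyfun Hh; have pg := HP_polyfun Hg.
have pL i j p : polyfun p -> polyfun (Lop i j (Lop i j p)).
  by move=> ?; do 2!apply: polyfun_Lop.
have eig k' h' g' : polyfun g' -> HP k' h' ->
    - 2 * (k'%:R * (k'%:R + n%:R - 2)) * J t (fun x => sqn x ^+ m * (h' x * g' x)) =
    \sum_i \sum_j J t (fun x => sqn x ^+ m * (Lop i j (Lop i j h') x * g' x)).
  move=> pg' Hh'; have ph' := HP_polyfun Hh'.
  rewrite -JZ; last by apply: ibl_polyfun; pf.
  transitivity (J t (fun x => \sum_i \sum_j
      (sqn x ^+ m * (Lop i j (Lop i j h') x * g' x)))).
    apply: eq_J => x _; transitivity (sqn x ^+ m *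
      ((- 2 * (k'%:R * (k'%:R + n%:R - 2)) * h' x) * g' x)); first by ring.
    rewrite -(casimir x hn Hh') mulr_suml mulr_sumr; apply: eq_bigr => i _.
    by rewrite mulr_suml mulr_sumr.
  rewrite (J_sum _ (F := fun i x => \sum_j
      (sqn x ^+ m * (Lop i j (Lop i j h') x * g' x)))); last first.
    by move=> i; apply: ibl_sum => j; apply: ibl_polyfun; have := pL i j _ ph'; move=> ?; pf.
  apply: eq_bigr => i _.
  rewrite (J_sum _ (F := fun j x =>
      (sqn x ^+ m * (Lop i j (Lop i j h') x * g' x))))//.
  by move=> j; apply: ibl_polyfun; have := pL i j _ ph'; move=> ?; pf.
have e : \sum_i \sum_j J t (fun x => sqn x ^+ m * (Lop i j (Lop i j h) x * g x)) =
    \sum_i \sum_j J t (fun x => sqn x ^+ m * (Lop i j (Lop i j g) x * h x)).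
  apply: eq_bigr => i _; apply: eq_bigr => j _.
  rewrite J_Lop_parts//; last exact: polyfun_Lop.
  rewrite [in RHS]J_Lop_parts//; last exact: polyfun_Lop.
  congr (- _); apply: eq_J => x _; ring.
have := eig k h g pg Hh; rewrite e -(eig l g h ph Hg).
rewrite (@eq_J t (fun x => sqn x ^+ m * (g x * h x)) (fun x => sqn x ^+ m * (h x * g x))); last first.
  by move=> x _; rewrite [g x * _]mulrC.
set I := J t _ => /eqP; rewrite -subr_eq0 -mulrBl mulf_eq0 => /orP[|/eqP//].
have -> : - 2 * (k%:R * (k%:R + n%:R - 2)) - - 2 * (l%:R * (l%:R + n%:R - 2)) =
   2 * (l%:R - k%:R) * (k%:R + l%:R + (n%:R - 2)) :> R by ring.
rewrite !mulf_eq0 pnatr_eq0 subr_eq0 eqr_nat [l == k]eq_sym (negbTE kl) /=.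
rewrite gt_eqF// ltr_wpDr//; first by rewrite subr_ge0 ler_nat.
by rewrite -natrD ltr0n; lia.
Qed.

End ball_integrals.

(** * Moments, orthonormal bases and reproducing kernels *)

Section moments.
Context {R : realType} {n : nat}.
Variable nu : probability (borel_rV R n) R.
Local Notation V := 'rV[R]_n.
Local Notation BV := (borel_rV R n).
Local Notation J := (J nu).
Local Notation ibl := (ibl nu).
Implicit Types (f g h p q : V -> R) (i j : 'I_n) (x y v : V) (k d m l : nat).
Implicit Types (M : 'M[R]_n) (t r : R).

Definition mom t k : R := J t (fun x => sqn x ^+ k).

Lemma ibl_indic t (A : set BV) : measurable A -> ibl t (\1_A).
Proof.
move=> mA; apply: (@ibl_bounded _ _ _ _ _ 1).
  by apply: measurable_funTS; exact: measurable_indic.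
by move=> x _; rewrite indicE; case: (_ \in _); rewrite ?normr1 ?normr0.
Qed.

Lemma J_indic t (A : set BV) : measurable A ->
  J t (\1_A) = fine (nu (A `&` (ball_of t : set BV))).
Proof.
by move=> mA; rewrite /J /Rintegral integral_indic//; exact: measurable_ball_of.
Qed.

Hypothesis hn : (2 <= n)%N.
Hypothesis nu_invariant : orthogonally_invariant nu.
Hypothesis nu_boundary : charges_boundary nu.

Lemma measurable_far r : measurable ([set x | r <= enorm x] : set BV).
Proof.
rewrite (_ : [set x | _] = ~` (ball_of r : set BV)).
  by apply: measurableC; exact: measurable_ball_of.
by apply/seteqP; split=> x /=; rewrite /ball_of/= leNgt => /negP.
Qed.

(* Quantitative form of the hypothesis that [nu] charges every neighbourhood of
   the sphere, inside a smaller ball. *)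
Lemma mom_lower_bound r : 0 < r < 1 ->
  exists t, exists2 a, 0 < t < 1 /\ 0 < a & forall k s, t <= s ->
    a * r ^+ (2 * k) <= mom s k.
Proof.
move=> r01; have /andP[r0 r1] := r01.
pose A : set BV := [set x | r <= enorm x].
have mA : measurable A := measurable_far r.
(* Radii increasing to 1; the shift by 2 keeps them positive. The shell is the increasing union of
   its parts in these balls, so one of the parts has positive measure. *)
pose tt (m : nat) : R := 1 - m.+2%:R^-1.
have tt1 m : 0 < tt m < 1.
  rewrite /tt subr_gt0 invf_lt1// ltr1n/= gtrBl invr_gt0//.
pose F m : set BV := A `&` ball_of (tt m).
have mF m : measurable (F m) by apply: measurableI => //; exact: measurable_ball_of.
have UF : \bigcup_m F m = unit_ball `&` A.
  apply/seteqP; split=> x.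
    move=> [m _ [Ax Bx]]; split => //; apply: lt_trans Bx _.
    by case/andP: (tt1 m).
  move=> [Bx Ax]; have : 0 < 1 - enorm x by rewrite subr_gt0.
  move=> /ltr_add_invr[m]; rewrite add0r => hm; exists m => //; split => //.
  rewrite /ball_of /= /tt ltrBrDr -ltrBrDl (le_lt_trans _ hm)//.
  by rewrite lef_pV2 ?posrE ?ltr0n// ler_nat.
have cF : nu \o F @ \oo --> nu (\bigcup_m F m).
  apply: nondecreasing_cvg_mu => //; first exact: bigcupT_measurable.
  move=> m m' mm'; apply/subsetPset => x [Ax Bx]; split => //.
  apply: lt_le_trans Bx _; rewrite /tt lerD2l lerN2.
  by rewrite lef_pV2 ?posrE ?ltr0n// ler_nat !ltnS.
have [m m0] : exists m, (0 < nu (F m))%E.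
  apply: contrapT => /forallNP F0.
  have := nu_boundary r01; rewrite -UF -(cvg_lim _ cF)//.
  rewrite (_ : nu \o F = cst 0%E) ?lim_cst ?ltxx//.
  by apply/funext => m /=; apply/eqP; rewrite -measure_le0 leNgt; apply/negP/F0.
exists (tt m), (fine (nu (F m))).
  split => //; apply: fine_gt0; rewrite m0 /=.
  by apply: (le_lt_trans (probability_le1 _ _)) => //; rewrite ltry.
move=> k s ts.
rewrite /F -J_indic// mulrC -JZ; last exact: ibl_indic.
apply: (@le_trans _ _ (J s (fun x => r ^+ (2 * k) * \1_A x))).
  have mAt u : measurable (A `&` (ball_of u : set BV)).
    by apply: measurableI => //; exact: measurable_ball_of.
  rewrite !JZ; [|exact: ibl_indic..].
  apply: ler_wpM2l; first by rewrite exprn_ge0// ltW.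
  rewrite !J_indic//; apply: fine_le; rewrite ?fin_num_measure//.
  apply: le_measure; rewrite ?inE// => x [Ax Bx]; split => //.
  exact: lt_le_trans Bx ts.
apply: le_J.
- exact/iblZ/ibl_indic.
- by apply: ibl_polyfun; pf.
- move=> x _; rewrite indicE; case: (boolP (x \in A)); rewrite ?inE => Ax.
    rewrite mulr1 exprM -sqr_enorm.
    apply: lerXn2r; rewrite ?nnegrE ?sqr_ge0//.
    by apply: lerXn2r; rewrite ?nnegrE ?enorm_ge0 ?(ltW r0).
  by rewrite mulr0 exprn_ge0// sqn_ge0.
Qed.

Lemma mom_gt0 k : 0 < mom 1 k.
Proof.
have h01 : 0 < (2^-1 : R) < 1 by rewrite invr_gt0 ltr0n invf_lt1// ltr1n.
have [t [a [/andP[t0 t1] a0] ak]] := mom_lower_bound h01.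
apply: lt_le_trans (ak k 1 (ltW t1)).
by rewrite mulr_gt0// exprn_gt0//; case/andP: h01.
Qed.

Lemma mom_le1 k : mom 1 k <= 1.
Proof.
apply: (le_trans (ler_norm _)); apply: J_norm_le => //.
  by apply: ibl_polyfun; pf.
move=> x x1; rewrite ger0_norm ?exprn_ge0 ?sqn_ge0// exprn_ile1 ?sqn_ge0//.
by have := ltW x1; rewrite enorm_le// expr1n.
Qed.

(** Components of positive degree are orthogonal to the constant 1, so only the radial term
    [|x|^(2k)] is left, and its coefficient does not see [m] or [t]. *)
Lemma sqn_decomp_mom d k p : sqn_decomp d p -> d = k.*2 ->
  exists c, forall m t, J t (fun x => sqn x ^+ m * p x) = c * mom t (m + k).
Proof.
elim=> [d' _|l k' h d' q Hh -> Hq IH e].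
  exists 0 => m t; rewrite mul0r /J /Rintegral.
  by under eq_integral do rewrite mulr0; rewrite integral0.
have [c cE] := IH e; have ph := HP_polyfun Hh.
have pq : polyfun q.
  by elim: Hq {IH cE} => [d''|l' k'' h' d'' q' /HP_polyfun ? _ _ ?]; pf.
case: k' Hh e {Hq IH} => [|k'] Hh e.
  have [a ha] := HP_cst Hh; have kl : k = l by apply: double_inj; rewrite -e addn0.
  exists (a + c) => m t; rewrite mulrDl -cE /mom -JZ; last by apply: ibl_polyfun; pf.
  rewrite -JD; [|by apply: ibl_polyfun; pf..].
  by apply: eq_J => x _; rewrite ha kl exprD; ring.
exists c => m t; rewrite -cE.
rewrite (_ : J t (fun x => sqn x ^+ m * q x) = J t (fun x => sqn x ^+ (m + l) * (h x * 1)) +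
    J t (fun x => sqn x ^+ m * q x)); last first.
  by rewrite (HP_orth nu_invariant _ _ hn Hh (@HP1 R n))// add0r.
rewrite -JD; [|by apply: ibl_polyfun; pf..].
by apply: eq_J => x _; rewrite exprD; ring.
Qed.

(* The ratio [J t (sqn ^ m h g) / mom t (k + m)] is an inner product on the
   sphere: it depends neither on [t] nor on [m]. *)
Lemma J_scaling k h g t m : HP k h -> HP k g ->
  J t (fun x => sqn x ^+ m * (h x * g x)) * mom 1 k =
  mom t (m + k) * J 1 (fun x => h x * g x).
Proof.
move=> Hh Hg.
have [c cE] := sqn_decomp_mom (homog_decomp hn (homogM (HP_homog Hh) (HP_homog Hg)))
  (addnn k).
have c1 : J 1 (fun x => h x * g x) = c * mom 1 k.
  by rewrite -[k]add0n -cE; apply: eq_J => x _; rewrite mul1r.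
by rewrite cE c1; ring.
Qed.

(** In [x_i h = raise h + hcoef |x|^2 d_i h] the two terms have different degrees, hence are
    orthogonal, so the second has at most the norm of [|x| h]. Then [J_scaling] trades the radial
    weights for moments. *)
Lemma HP_pd_le k h i : HP k.+1 h ->
  @hcoef R n k.+1 ^+ 2 * J 1 (fun x => pd h i x * pd h i x) * mom 1 k.+1 <=
  J 1 (fun x => h x * h x) * mom 1 k.
Proof.
move=> Hh; have ph := HP_polyfun Hh; set b := hcoef k.+1.
have Hd : HP k (pd h i) := HP_pd hn i Hh.
have Hr := HPraise i Hh; have pr := HP_polyfun Hr.
have E1 : J 1 (fun x => (x ord0 i * h x) * (x ord0 i * h x)) =
   J 1 (fun x => raise k.+1 i h x * raise k.+1 i h x) +
   b ^+ 2 * J 1 (fun x => sqn x ^+ 2 * (pd h i x * pd h i x)).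
  have z := HP_orth nu_invariant 1 1 hn Hr Hd.
  rewrite -[RHS]addr0 -[X in _ = _ + X](mulr0 (2 * b)) -z; last by rewrite gtn_eqF// ltnS leqnSn.
  rewrite -!JZ; [|by apply: ibl_polyfun; pf..].
  rewrite -JD; [|by apply: ibl_polyfun; pf..].
  rewrite -JD; [|by apply: ibl_polyfun; pf..].
  by apply: eq_J => x _; rewrite /raise -/b; ring.
have E2 : b ^+ 2 * J 1 (fun x => sqn x ^+ 2 * (pd h i x * pd h i x)) <=
   J 1 (fun x => sqn x ^+ 1 * (h x * h x)).
  apply: (@le_trans _ _ (J 1 (fun x => (x ord0 i * h x) * (x ord0 i * h x)))).
    rewrite E1 lerDr; apply: J_ge0 => x _.
    by rewrite -expr2 sqr_ge0.
  apply: le_J; [by apply: ibl_polyfun; pf..|move=> x _].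
  rewrite expr1 mulrACA ler_wpM2r// -?expr2 ?sqr_ge0//.
  by rewrite -sqr_enorm -real_normK ?num_real// lerXn2r ?nnegrE ?enorm_ge0// coord_le_enorm.
have E3 := J_scaling 1 2 Hd Hd; have E4 := J_scaling 1 1 Hh Hh.
rewrite add2n in E3; rewrite add1n in E4.
have m2 := mom_gt0 k.+2.
(* Both applications of [J_scaling] produce the moment of index [k.+2], which cancels. *)
rewrite -(ler_pM2l m2).
rewrite [leLHS](_ : _ = (b ^+ 2 * J 1 (fun x => sqn x ^+ 2 * (pd h i x * pd h i x))) *
   mom 1 k * mom 1 k.+1); last first.
  set A := J 1 (fun x => sqn x ^+ 2 * _) in E3 *.
  rewrite (_ : b ^+ 2 * A * _ * _ = b ^+ 2 * (A * mom 1 k) * mom 1 k.+1); last by ring.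
  by rewrite E3; ring.
rewrite [leRHS](_ : _ = J 1 (fun x => sqn x ^+ 1 * (h x * h x)) * mom 1 k * mom 1 k.+1); last first.
  by rewrite mulrAC E4; ring.
by rewrite !ler_wpM2r// ltW// mom_gt0.
Qed.

(** Vanishing almost everywhere says little when [nu] is singular. Instead, [HP_pd_le] gives the
    derivatives norm 0, they vanish by induction on the degree, and Euler's identity recovers
    [h]. *)
Lemma HP_definite k h : HP k h -> J 1 (fun x => h x * h x) = 0 -> h = fun=> 0.
Proof.
elim: k h => [|k IH] h Hh h0.
  have [c hc] := HP_cst Hh; move: h0; rewrite hc.
  rewrite (_ : J 1 _ = c * c * mom 1 0).
    by move=> /eqP; rewrite !mulf_eq0 (gt_eqF (mom_gt0 0)) orbF orbb => /eqP ->.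
  by rewrite /mom -JZ; [apply: eq_J => x _; rewrite mulr1|apply: ibl_polyfun; pf].
have d0 i : pd h i = fun=> 0.
  apply: IH; first exact: (HP_pd hn i Hh).
  have := HP_pd_le i Hh; rewrite h0 mul0r.
  set a := J 1 _ => le0; have a0 : 0 <= a.
    by apply: J_ge0 => x _; rewrite -expr2 sqr_ge0.
  have hc : 0 < @hcoef R n k.+1 ^+ 2 by rewrite exprn_gt0// hcoef_gt0.
  apply/eqP; rewrite eq_le a0 andbT -(pmulr_rle0 _ hc) -(pmulr_lle0 _ (mom_gt0 k.+1)).
  exact: le0.
apply/funext => x; have := HP_euler x Hh.
rewrite big1 => [/esym/eqP|i _]; last by rewrite d0 mulr0.
by rewrite mulf_eq0 pnatr_eq0 /= => /eqP.
Qed.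

Fixpoint orthonormal (s : seq (V -> R)) : Prop :=
  if s is f :: s' then [/\ J 1 (fun x => f x * f x) = 1,
    forall g, List.In g s' -> J 1 (fun x => f x * g x) = 0 & orthonormal s']
  else True.

Definition expands (s : seq (V -> R)) h : Prop :=
  h = fun x => \sum_(f <- s) J 1 (fun y => h y * f y) * f x.

Lemma expands_lin s a f g : (forall e, List.In e s -> polyfun e) ->
  polyfun f -> polyfun g -> expands s f -> expands s g ->
  expands s (fun x => a * f x + g x).
Proof.
move=> ps pf pg ef eg; apply/funext => x.
rewrite [in LHS]ef [in LHS]eg mulr_sumr -big_split/=.
elim: s ps {ef eg} => [|e s IH] ps; first by rewrite !big_nil.
rewrite !big_cons IH => [|e' e's]; last by apply: ps; right.
have pe : polyfun e by apply: ps; left.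
congr (_ + _); rewrite mulrA -mulrDl; congr (_ * _).
rewrite -JZ; last by apply: ibl_polyfun; pf.
rewrite -JD; [|by apply: ibl_polyfun; pf..].
by apply: eq_J => y _; ring.
Qed.

Lemma JC t f g : J t (fun x => f x * g x) = J t (fun x => g x * f x).
Proof. by apply: eq_J => x _; rewrite mulrC. Qed.

Lemma sum_In_eq0 e (G : (V -> R) -> R) : (forall f, List.In f e -> G f = 0) ->
  \sum_(f <- e) G f = 0.
Proof.
elim: e => [|f e IH] G0; first by rewrite big_nil.
by rewrite big_cons G0 ?add0r; [apply: IH => g ge; apply: G0; right|left].
Qed.

Lemma lincomb_polyfun e (c : (V -> R) -> R) : (forall f, List.In f e -> polyfun f) ->
  polyfun (fun x => \sum_(f <- e) c f * f x).
Proof.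
elim: e => [|f e IH] pe; first by under eq_fun do rewrite big_nil; pf.
under eq_fun do rewrite big_cons.
have pf : polyfun f by apply: pe; left.
have ps := IH (fun h hh => pe h (or_intror hh)).
by pf.
Qed.

Lemma J_lincomb t e (c : (V -> R) -> R) g : (forall f, List.In f e -> polyfun f) ->
  polyfun g -> J t (fun x => (\sum_(f <- e) c f * f x) * g x) =
  \sum_(f <- e) c f * J t (fun x => f x * g x).
Proof.
move=> + pg; elim: e => [|f e IH] pe.
  rewrite big_nil /J /Rintegral.
  by under eq_integral do rewrite big_nil mul0r; rewrite integral0.
have pf : polyfun f by apply: pe; left.
have pe' h : List.In h e -> polyfun h by move=> he; apply: pe; right.
have ps := lincomb_polyfun c pe'.
rewrite big_cons -IH// -JZ; last by apply: ibl_polyfun; pf.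
rewrite -JD; [|by apply: ibl_polyfun; pf..].
by apply: eq_J => x _; rewrite big_cons; ring.
Qed.

Lemma orthonormal_lincomb e (c : (V -> R) -> R) g :
  (forall f, List.In f e -> polyfun f) -> orthonormal e -> List.In g e ->
  \sum_(f <- e) c f * J 1 (fun x => f x * g x) = c g.
Proof.
elim: e => // f e IH pe [f1 f0 eo] [fg|ge]; rewrite big_cons.
  subst f; rewrite f1 mulr1 sum_In_eq0 ?addr0// => h he.
  by rewrite JC f0// mulr0.
by rewrite f0// mulr0 add0r IH// => h he; apply: pe; right.
Qed.

(** The list may be dependent: a residue of norm 0 is the zero polynomial by [HP_definite] and adds
    nothing to the basis. *)
Lemma gram_schmidt k s : (forall h, List.In h s -> HP k h) ->
  exists e, [/\ forall h, List.In h e -> HP k h, orthonormal e &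
    forall h, List.In h s -> expands e h].
Proof.
elim: s => [|g s IH] sH; first by exists [::].
have [e [eH eo ee]] := IH (fun h hs => sH h (or_intror hs)).
have Hg : HP k g by apply: sH; left.
have pg := HP_polyfun Hg.
have pe f : List.In f e -> polyfun f by move=> /eH/HP_polyfun.
pose pr x := \sum_(f <- e) J 1 (fun y => g y * f y) * f x.
have Hpr : HP k pr.
  rewrite /pr; elim: e eH {eo ee pe pr} => [|f e IHe] eH.
    by under eq_fun do rewrite big_nil; exact: HP0.
  under eq_fun do rewrite big_cons.
  by apply: HPlin; [apply: eH; left|apply: IHe => h he; apply: eH; right].
have ppr := HP_polyfun Hpr.
pose w x := g x - pr x.
have Hw : HP k w by exact: HPB.
have pw := HP_polyfun Hw.
have we f : List.In f e -> J 1 (fun x => w x * f x) = 0.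
  move=> fe; have pf := pe f fe.
  rewrite (@eq_J _ _ _ _ _ (fun x => g x * f x - pr x * f x)) => [|x _]; last by rewrite mulrBl.
  rewrite JB; [|by apply: ibl_polyfun; pf..].
  rewrite [X in _ - X]J_lincomb// orthonormal_lincomb//.
  by rewrite subrr.
have Jw0 : 0 <= J 1 (fun x => w x * w x).
  by apply: J_ge0 => x _; rewrite -expr2 sqr_ge0.
have gwE : g = fun x => w x + pr x by apply/funext => x; rewrite /w subrK.
have [w0|w0] := eqVneq (J 1 (fun x => w x * w x)) 0.
  exists e; split => // h [<-|/ee//].
  by rewrite /expands {1}gwE (HP_definite Hw w0); apply/funext => x; rewrite add0r.
pose c := (Num.sqrt (J 1 (fun x => w x * w x)))^-1.
have cE : c * c * J 1 (fun x => w x * w x) = 1.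
  rewrite -[X in _ * X](sqr_sqrtr Jw0) /c; field.
  by rewrite sqrtr_eq0 -ltNge lt_def w0.
pose w' x := c * w x.
have Hw' : HP k w' by exact: HPZ.
have pw' := HP_polyfun Hw'.
have w'e f : List.In f e -> J 1 (fun x => w' x * f x) = 0.
  move=> fe; have pf := pe f fe; rewrite -[RHS](mulr0 c) -(we f fe) -JZ.
    by apply: eq_J => x _; rewrite /w' mulrA.
  by apply: ibl_polyfun; pf.
have ew' (a : (V -> R) -> R) : J 1 (fun x => (\sum_(f <- e) a f * f x) * w' x) = 0.
  by rewrite J_lincomb// sum_In_eq0// => f fe; rewrite JC w'e// mulr0.
exists (w' :: e); split.
- by move=> h [<-//|/eH].
- split => //; rewrite -[RHS]cE -JZ; last by apply: ibl_polyfun; pf.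
  by apply: eq_J => x _; rewrite /w'; ring.
move=> h [<-|/ee he]; apply/funext => x; rewrite big_cons.
  rewrite -/(pr x) [in LHS]gwE; congr (_ + _).
  have pprw : J 1 (fun x => pr x * w' x) = 0 by exact: ew'.
  rewrite (@eq_J _ _ _ _ _ (fun x => c * (w x * w x) + pr x * w' x)); last first.
    by move=> y _; rewrite {1}gwE /w'; ring.
  rewrite JD; [|by apply: ibl_polyfun; pf..].
  rewrite pprw addr0 JZ; last by apply: ibl_polyfun; pf.
  transitivity (c * c * J 1 (fun x0 => w x0 * w x0) * w x); last by rewrite /w'; ring.
  by rewrite cE mul1r.
rewrite (_ : J 1 _ = 0) ?mul0r ?add0r; first by rewrite {1}he.
rewrite -[RHS](ew' (fun f => J 1 (fun y => h y * f y))).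
by apply: eq_J => y _; rewrite {1}he.
Qed.

Lemma HP_basis k : exists e, [/\ forall h, List.In h e -> HP k h, orthonormal e &
    forall h, HP k h -> expands e h].
Proof.
have [s sH Hs] := @HP_finite R n k.
have [e [eH eo se]] := gram_schmidt sH.
have pe f : List.In f e -> polyfun f by move=> /eH/HP_polyfun.
exists e; split => // h /Hs.
elim=> [|a g f gs sf ef].
  apply/funext => x; rewrite sum_In_eq0// => f fe.
  rewrite (_ : J 1 _ = 0) ?mul0r// /J /Rintegral.
  by under eq_integral do rewrite mul0r; rewrite integral0.
apply: expands_lin => //; first by exact: (HP_polyfun (sH _ gs)).
  by apply: lspan_polyfun sf => g' /sH/HP_polyfun.
exact: se.
Qed.

Definition hbasis k : seq (V -> R) := projT1 (cid (HP_basis k)).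
Definition hdim k : nat := size (hbasis k).
(** Beyond [hdim k] the default is the zero function, so that membership in [HP k] needs no bound on
    [l]. *)
Definition he k l : V -> R := nth (fun=> 0) (hbasis k) l.

Lemma In_nth (e : seq (V -> R)) l : (l < size e)%N -> List.In (nth (fun=> 0) e l) e.
Proof. by elim: e l => // f e IH [|l] /=; [left|rewrite ltnS => /IH; right]. Qed.

Lemma he_HP k l : HP k (he k l).
Proof.
rewrite /he /hbasis; case: cid => e [eH _ _] /=.
have [le|le] := ltnP l (size e); first exact/eH/In_nth.
by rewrite nth_default//; exact: HP0.
Qed.

Lemma he_orthonormal k l l' : (l < hdim k)%N -> (l' < hdim k)%N ->
  J 1 (fun x => he k l x * he k l' x) = (l == l')%:R.
Proof.
rewrite /hdim /he /hbasis; case: cid => e [_ eo _] /=.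
elim: e l l' eo => // f e IH [|l] [|l'] [f1 f0 eo] //=.
- by rewrite ltnS => _ l'e; rewrite f0//; exact: In_nth.
- by rewrite ltnS => le _; rewrite JC f0//; exact: In_nth.
- by rewrite !ltnS => le l'e; rewrite IH.
Qed.

Lemma he_expand k h x : HP k h ->
  h x = \sum_(l < hdim k) J 1 (fun y => h y * he k l y) * he k l x.
Proof.
rewrite /hdim /he /hbasis; case: cid => e [_ _ ee] /= /ee eh.
by rewrite {1}eh (big_nth (fun=> 0)) big_mkord.
Qed.

Lemma he_parseval k h : HP k h ->
  J 1 (fun x => h x * h x) = \sum_(l < hdim k) J 1 (fun y => h y * he k l y) ^+ 2.
Proof.
move=> Hh; have ph := HP_polyfun Hh.
have pe l : polyfun (he k l) := HP_polyfun (he_HP k l).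
transitivity (J 1 (fun x => \sum_(l < hdim k)
   J 1 (fun y => h y * he k l y) * (h x * he k l x))).
  apply: eq_J => x _; rewrite {2}(he_expand x Hh) mulr_sumr.
  by apply: eq_bigr => l _; rewrite mulrCA.
rewrite (J_sum _ (F := fun (l : 'I_(hdim k)) x => J 1 (fun y => h y * he k l y) * (h x * he k l x))).
  by apply: eq_bigr => l _; rewrite JZ ?expr2//; apply: ibl_polyfun; pf.
by move=> l; apply: ibl_polyfun; pf.
Qed.

Lemma hdim_le k : (hdim k <= k.*2.+1 ^ n)%N.
Proof.
apply: (@HP_dim R n k _ (fun l : 'I_(hdim k) => he k l)) => // [l|v v0 l]; first exact: he_HP.
have pe l : polyfun (he k l) := HP_polyfun (he_HP k l).
transitivity (J 1 (fun x => (\sum_(l' < hdim k) v l' * he k l' x) * he k l x)).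
  transitivity (J 1 (fun x => \sum_(l' < hdim k) v l' * (he k l' x * he k l x))); last first.
    by apply: eq_J => x _; rewrite mulr_suml; apply: eq_bigr => l' _; rewrite mulrA.
  rewrite (J_sum _ (F := fun (l' : 'I_(hdim k)) x => v l' * (he k l' x * he k l x))).
    rewrite (bigD1 l)//= big1 ?addr0 => [|l' l'l]; rewrite JZ; try by apply: ibl_polyfun; pf.
      by rewrite he_orthonormal// eqxx mulr1.
    by rewrite he_orthonormal// val_eqE (negbTE l'l) mulr0.
  by move=> l'; apply: ibl_polyfun; pf.
by rewrite /J /Rintegral; under eq_integral do rewrite v0 mul0r; rewrite integral0.
Qed.

(** The diagonal of the reproducing kernel of degree [k]. *)
Definition zonal k x : R := \sum_(l < hdim k) he k l x ^+ 2.

Lemma zonal_ge0 k x : 0 <= zonal k x.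
Proof. by apply: sumr_ge0 => l _; exact: sqr_ge0. Qed.

Lemma zonal_bound k h x : HP k h ->
  h x ^+ 2 <= zonal k x * J 1 (fun y => h y * h y).
Proof.
move=> Hh; rewrite (he_parseval Hh); pose c l := J 1 (fun y => h y * he k l y).
pose K := zonal k x; pose C := \sum_(l < hdim k) c l ^+ 2.
have hE : h x = \sum_(l < hdim k) c l * he k l x by exact: he_expand.
have [K0|K0] := eqVneq K 0.
  rewrite -/K K0 mul0r hE big1 ?expr0n// => l _.
  have /eqP := K0; rewrite /K /zonal psumr_eq0 => [/allP/(_ l)|l' _]; last exact: sqr_ge0.
  by rewrite mem_index_enum sqrf_eq0 => /(_ isT)/eqP ->; rewrite mulr0.
have Kp : 0 < K by rewrite lt_def K0 zonal_ge0.
have : 0 <= \sum_(l < hdim k) (c l * K - h x * he k l x) ^+ 2.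
  by apply: sumr_ge0 => l _; exact: sqr_ge0.
have -> : \sum_(l < hdim k) (c l * K - h x * he k l x) ^+ 2 =
   K * (K * C - h x ^+ 2).
  have E (l : 'I_(hdim k)) : (c l * K - h x * he k l x) ^+ 2 =
      K ^+ 2 * c l ^+ 2 - 2 * K * h x * (c l * he k l x) + h x ^+ 2 * he k l x ^+ 2.
    by ring.
  rewrite (eq_bigr _ (fun a _ => E a)) big_split/= sumrB -!mulr_sumr -hE.
  by rewrite -/(zonal k x) -/K -/C; ring.
by rewrite pmulr_rge0// subr_ge0.
Qed.

(** [h] is the kernel with one argument fixed at [x]: its value at [x] and its square norm are both
    [zonal k x]. A rotated copy has the same norm and takes that value at [x M], where [zonal_bound]
    is applied. *)
Lemma zonal_rot k x M : M *m M^T = 1%:M -> zonal k x <= zonal k (x *m M).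
Proof.
move=> MM; pose h y := \sum_(l < hdim k) he k l x * he k l y.
have Hh : HP k h.
  apply: (@HP_sum _ _ _ _ _ _ (fun (l : 'I_(hdim k)) y => he k l x * he k l y)) => l.
  exact/HPZ/he_HP.
have ph := HP_polyfun Hh.
have pe l : polyfun (he k l) := HP_polyfun (he_HP k l).
have hc l : (l < hdim k)%N -> J 1 (fun y => h y * he k l y) = he k l x.
  move=> ld; transitivity (J 1 (fun y => \sum_(l' < hdim k)
      he k l' x * (he k l' y * he k l y))).
    by apply: eq_J => y _; rewrite mulr_suml; apply: eq_bigr => l' _; rewrite mulrA.
  rewrite (J_sum _ (F := fun (l' : 'I_(hdim k)) y => he k l' x * (he k l' y * he k l y))); last first.
    by move=> l'; apply: ibl_polyfun; pf.
  rewrite (bigD1 (Ordinal ld))//= big1 ?addr0 => [|l' l'l]; rewrite JZ; try by apply: ibl_polyfun; pf.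
    by rewrite he_orthonormal// eqxx mulr1.
  by rewrite he_orthonormal//; move: l'l; rewrite -val_eqE => /negbTE -> /=; rewrite mulr0.
have hh : J 1 (fun y => h y * h y) = zonal k x.
  by rewrite (he_parseval Hh); apply: eq_bigr => l _; rewrite hc.
have hx : h x = zonal k x by apply: eq_bigr => l _; rewrite expr2.
have MM' : M^T *m M^T^T = 1%:M by rewrite trmxK; exact: mulmx1C.
have := zonal_bound (x *m M) (HP_rot MM' Hh).
rewrite -mulmxA MM mulmx1 hx.
rewrite (J_rot_polyfun nu_invariant 1 MM' (p := fun y => h y * h y)) ?hh; last by pf.
have [->|K0] := eqVneq (zonal k x) 0; first by rewrite zonal_ge0.
by rewrite expr2 ler_pM2r// lt_def K0 zonal_ge0.
Qed.

Lemma zonal_eq k x y : sqn x = sqn y -> zonal k x = zonal k y.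
Proof.
move=> xy; apply/eqP; rewrite eq_le.
have [M MM <-] := rotation_transitive xy; rewrite zonal_rot//=.
have MM' : M^T *m M^T^T = 1%:M by rewrite trmxK; exact: mulmx1C.
by rewrite -{2}[x]mulmx1 -MM mulmxA zonal_rot.
Qed.

(** By invariance and homogeneity [zonal k] is a multiple of [|x|^(2k)]; its integral counts the
    elements of the basis, which determines the multiple. *)
Lemma zonalE k x : zonal k x * mom 1 k = (hdim k)%:R * sqn x ^+ k.
Proof.
have i0 : 'I_n by exact: (Ordinal (ltn_trans (ltnSn 0) hn)).
pose u : V := 'e_i0.
have u1 : sqn u = 1.
  rewrite /sqn (bigD1 i0)//= big1 ?addr0 => [|i ii].
    by rewrite mxE !eqxx expr1n.
  by rewrite mxE (negbTE ii) andbF expr0n.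
have zE y : zonal k y = sqn y ^+ k * zonal k u.
  rewrite (@zonal_eq k y (enorm y *: u)); last by rewrite sqnZ sqr_enorm u1 mulr1.
  rewrite /zonal mulr_sumr; apply: eq_bigr => l _.
  by rewrite (HP_scale _ _ (he_HP k l)) exprMn -sqr_enorm -!exprM mulnC.
have pe l : polyfun (he k l) := HP_polyfun (he_HP k l).
have dE : (hdim k)%:R = zonal k u * mom 1 k.
  rewrite /mom -JZ; last by apply: ibl_polyfun; pf.
  transitivity (J 1 (fun x => \sum_(l < hdim k) he k l x * he k l x)).
    rewrite (J_sum _ (F := fun (l : 'I_(hdim k)) x => he k l x * he k l x)).
      under eq_bigr do rewrite he_orthonormal// eqxx.
      by rewrite sumr_const card_ord.
    by move=> l; apply: ibl_polyfun; pf.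
  apply: eq_J => y _; rewrite mulrC -zE; apply: eq_bigr => l _; exact: esym (expr2 _).
by rewrite zE dE; ring.
Qed.

Lemma HP_sup k h x : HP k h ->
  h x ^+ 2 * mom 1 k <= (hdim k)%:R * sqn x ^+ k * J 1 (fun y => h y * h y).
Proof.
move=> Hh; rewrite -zonalE [leRHS]mulrAC ler_pM2r ?mom_gt0//; exact: zonal_bound.
Qed.

End moments.

(** * Series of spherical harmonics *)

Section subexponential.
Context {R : realType}.
Implicit Types (a b : nat -> R) (q t : R).

(** Growth below every exponential. Such coefficients are summable against [t^k] for [t < 1], and
    are stable under products because [q] splits as the square of [sqrt q]. *)
Definition subexp a := forall q, 0 < q < 1 -> exists C, forall k, a k * q ^+ k <= C.

Lemma subexp_le a b : (forall k, a k <= b k) -> subexp b -> subexp a.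
Proof.
move=> ab sb q q01; have [C bC] := sb q q01; exists C => k.
apply: le_trans (bC k); rewrite ler_wpM2r// exprn_ge0//.
by case/andP: q01 => /ltW.
Qed.

Lemma sqrt_01 q : 0 < q < 1 -> 0 < Num.sqrt q < 1.
Proof.
move=> /andP[q0 q1]; rewrite sqrtr_gt0 q0 /=.
by rewrite -(sqrtr1 R) ltr_sqrt.
Qed.

Lemma subexpM a b : (forall k, 0 <= a k) -> (forall k, 0 <= b k) ->
  subexp a -> subexp b -> subexp (fun k => a k * b k).
Proof.
move=> a0 b0 sa sb q q01; have s01 := sqrt_01 q01.
have [C aC] := sa _ s01; have [D bD] := sb _ s01.
have /andP[s0 _] := s01; have /andP[q0 _] := q01.
exists (C * D) => k.
rewrite -{1}(sqr_sqrtr (ltW q0)) expr2 exprMn mulrACA.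
by rewrite ler_pM// mulr_ge0// exprn_ge0// ltW.
Qed.

Lemma subexp_cst (c : R) : subexp (fun=> c).
Proof.
move=> q /andP[q0 q1]; exists `|c| => k.
have qk0 : 0 <= q ^+ k by rewrite exprn_ge0// ltW.
have qk1 : q ^+ k <= 1 by rewrite exprn_ile1// ltW.
by rewrite (le_trans (ler_wpM2r qk0 (ler_norm c)))// ler_piMr.
Qed.

Lemma bernoulli_ineq (x : R) k : 0 <= x -> 1 + k%:R * x <= (1 + x) ^+ k.
Proof.
move=> x0; elim: k => [|k IH]; first by rewrite mul0r addr0 expr0.
rewrite exprS; apply: (@le_trans _ _ ((1 + x) * (1 + k%:R * x))).
  rewrite -natr1 -subr_ge0.
  rewrite (_ : _ - _ = k%:R * x * x); last by ring.
  by rewrite !mulr_ge0.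
by rewrite ler_wpM2l// addr_ge0.
Qed.

Lemma subexp_linear (c : nat) : subexp (fun k => (c + k.*2)%:R).
Proof.
move=> q /andP[q0 q1]; pose x := q^-1 - 1.
have x0 : 0 < x by rewrite /x subr_gt0 invf_gt1.
exists (c%:R + 2 / x) => k.
have qk1 : q ^+ k <= 1 by rewrite exprn_ile1// ltW.
have qk0 : 0 <= q ^+ k by rewrite exprn_ge0// ltW.
rewrite natrD mulrDl lerD//; first by rewrite -[leRHS]mulr1 ler_wpM2l.
rewrite -mul2n natrM -mulrA ler_wpM2l// -[leLHS]mulr1.
rewrite -[X in _ * X](mulVf (lt0r_neq0 x0)) mulrCA ler_piMr ?invr_ge0 ?(ltW x0)//.
have kx : k%:R * x <= (1 + x) ^+ k.
  by apply: le_trans (bernoulli_ineq k (ltW x0)); rewrite lerDr.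
rewrite mulrAC; apply: (@le_trans _ _ ((1 + x) ^+ k * q ^+ k)).
  by rewrite ler_wpM2r.
by rewrite -exprMn /x addrC subrK mulVf ?expr1n// gt_eqF.
Qed.

Lemma subexpX a m : (forall k, 0 <= a k) -> subexp a -> subexp (fun k => a k ^+ m).
Proof.
move=> a0 sa; elim: m => [|m IH]; first exact: subexp_cst.
rewrite (_ : (fun _ => _) = fun k => a k * a k ^+ m).
  by apply: subexpM => // k; exact: exprn_ge0.
by apply/funext => k; rewrite exprS.
Qed.

Lemma subexp_sqrt a : (forall k, 0 <= a k) -> subexp a ->
  subexp (fun k => Num.sqrt (a k)).
Proof.
move=> a0 sa q /andP[q0 q1]; have q01 : 0 < q ^+ 2 < 1.
  by rewrite exprn_gt0//= exprn_ilt1// ltW.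
have [C aC] := sa _ q01; exists (Num.sqrt C) => k.
have qk0 : 0 <= q ^+ k by rewrite exprn_ge0// ltW.
rewrite -[X in _ * X](ger0_norm qk0) -sqrtr_sqr -sqrtrM//.
by rewrite ler_wsqrtr// -exprM mulnC exprM.
Qed.

Lemma subexpS a : subexp a -> subexp (fun k => a k.+1).
Proof.
move=> sa q q01; have [C aC] := sa q q01; have /andP[q0 _] := q01.
exists (C / q) => k; rewrite ler_pdivlMr// -mulrA -exprSr.
exact: aC.
Qed.

Lemma subexp_sum a t : (forall k, 0 <= a k) -> subexp a -> 0 <= t < 1 ->
  exists B, forall N, \sum_(0 <= k < N) a k * t ^+ k <= B.
Proof.
(* A rate strictly between [t] and 1: [a k * q^k] stays bounded and [t / q] leaves a convergent
   geometric series. *)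
move=> a0 sa /andP[t0 t1]; pose q := (1 + t) / 2.
have tq : t < q by rewrite /q ltr_pdivlMr// mulr_natr mulr2n ltrD2r.
have q1 : q < 1 by rewrite /q ltr_pdivrMr// mul1r [X in _ < X](_ : 2 = 1 + 1)// ltrD2l.
have q0 : 0 < q := le_lt_trans t0 tq.
have [|C aC] := sa q; first by rewrite q0.
pose r := t / q.
have r0 : 0 <= r by rewrite divr_ge0// ltW.
have r1 : r < 1 by rewrite /r ltr_pdivrMr// mul1r.
have C0 : 0 <= C by apply: le_trans (aC 0%N); rewrite mulr1.
exists (C / (1 - r)) => N.
apply: (@le_trans _ _ (C * \sum_(0 <= k < N) r ^+ k)).
  rewrite mulr_sumr; apply: ler_sum => k _.
  rewrite (_ : t ^+ k = q ^+ k * r ^+ k).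
    by rewrite mulrA ler_wpM2r// exprn_ge0.
  by rewrite -exprMn /r mulrCA mulfV ?mulr1// gt_eqF.
rewrite ler_wpM2l// -[leRHS]mul1r ler_pdivlMr ?subr_gt0//.
suff -> : (\sum_(0 <= k < N) r ^+ k) * (1 - r) = 1 - r ^+ N.
  by rewrite lerBlDr lerDl exprn_ge0.
rewrite big_mkord; elim: N => [|N IH]; first by rewrite big_ord0 mul0r expr0 subrr.
by rewrite big_ord_recr/= mulrDl IH exprS; ring.
Qed.

End subexponential.

(** * Convergence, differentiation and integration of the series *)

Section harmonic_series.
Context {R : realType} {n : nat}.
Variable nu : probability (borel_rV R n) R.
Local Notation V := 'rV[R]_n.
Local Notation BV := (borel_rV R n).
Local Notation J := (J nu).
Local Notation mom := (mom nu).
Implicit Types (f g p q : V -> R) (i j : 'I_n) (x y v : V) (k d m l N : nat).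
Implicit Types (M : 'M[R]_n) (t r : R) (h : nat -> V -> R).

Hypothesis hn : (2 <= n)%N.
Hypothesis nu_invariant : orthogonally_invariant nu.
Hypothesis nu_boundary : charges_boundary nu.

Lemma subexp_hdim : subexp (fun k => (hdim hn nu_invariant nu_boundary k)%:R : R).
Proof.
apply: (@subexp_le _ _ (fun k => ((1 + k.*2)%:R : R) ^+ n)) => [k|].
  by rewrite -natrX ler_nat; exact: hdim_le.
by apply: subexpX => [k|]; [exact: ler0n|exact: (@subexp_linear R 1)].
Qed.

(** Here the mass near the sphere enters: it bounds the moments below by [a r^(2k)] for every
    [r < 1], used with [r^2 = q]. *)
Lemma subexp_mom : subexp (fun k => (mom 1 k)^-1).
Proof.
move=> q q01; have [t [a [/andP[t0 t1] a0] ak]] :=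
  mom_lower_bound nu_boundary (sqrt_01 q01).
exists a^-1 => k; have m0 := mom_gt0 nu_boundary k.
rewrite mulrC ler_pdivrMr// mulrC ler_pdivlMr// mulrC.
apply: le_trans (ak k 1 (ltW t1)).
by rewrite exprM sqr_sqrtr//; case/andP: q01 => /ltW.
Qed.

Definition hseries h := (forall k, HP k (h k)) /\
  subexp (fun k => J 1 (fun x => h k x * h k x)).

Lemma J_sqr_ge0 t f : 0 <= J t (fun x => f x * f x).
Proof. by apply: J_ge0 => x _; rewrite -expr2 sqr_ge0. Qed.

(** [HP_sup] bounds the term of degree [k] by its norm, the dimension and the inverse moment, all of
    them subexponential. *)
Lemma hseries_sup h : hseries h -> exists2 s : nat -> R, subexp s /\ (forall k, 0 <= s k) &
  forall k x, `|h k x| <= s k * enorm x ^+ k.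
Proof.
move=> [Hh sh]; pose d k : R := (hdim hn nu_invariant nu_boundary k)%:R.
exists (fun k => Num.sqrt (d k * (mom 1 k)^-1 * J 1 (fun x => h k x * h k x))).
  split => [|k]; last exact: sqrtr_ge0.
  apply: subexp_sqrt => [k|].
    by rewrite !mulr_ge0// ?J_sqr_ge0// invr_ge0 ltW// mom_gt0.
  apply: subexpM => //; [|by move=> k; exact: J_sqr_ge0|].
    by move=> k; rewrite mulr_ge0// invr_ge0 ltW// mom_gt0.
  apply: subexpM; [by []| |exact: subexp_hdim|exact: subexp_mom].
  by move=> k; rewrite invr_ge0 ltW// mom_gt0.
move=> k x; have m0 := mom_gt0 nu_boundary k.
rewrite -[X in _ * X]ger0_norm ?exprn_ge0 ?enorm_ge0//.
rewrite -!sqrtr_sqr -sqrtrM; last first.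
  by rewrite !mulr_ge0// ?J_sqr_ge0// invr_ge0 ltW.
rewrite ler_wsqrtr// -(ler_pM2r m0).
apply: (le_trans (HP_sup hn nu_invariant nu_boundary x (Hh k))).
rewrite -/(d k) -exprM mulnC exprM sqr_enorm.
rewrite le_eqVlt; apply/orP; left; apply/eqP.
by field; rewrite gt_eqF.
Qed.

(** The shift puts the derivative of degree [k.+1] at its own degree [k], so the derived series is
    of the same kind and can be differentiated again. *)
Lemma hseries_pd h i : hseries h -> hseries (fun k => pd (h k.+1) i).
Proof.
move=> [Hh sh]; split => [k|]; first exact: (HP_pd hn i (Hh k.+1)).
apply: (@subexp_le _ _ (fun k => J 1 (fun x => h k.+1 x * h k.+1 x) *
    ((mom 1 k.+1)^-1 * (n + k.*2)%:R ^+ 2))).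
  move=> k; have := HP_pd_le hn nu_invariant nu_boundary i (Hh k.+1).
  set a := J 1 _; set b := J 1 _.
  have m0 := mom_gt0 nu_boundary k.+1; have m1 := mom_le1 nu k.
  have N0 : 0 < (n + k.*2)%:R :> R.
    by rewrite ltr0n addn_gt0 (leq_trans _ hn).
  have b0 : 0 <= b := J_sqr_ge0 _ _.
  rewrite hcoefS exprVn => H.
  rewrite mulrA -ler_pdivrMr ?exprn_gt0// ler_pdivlMr// [a / _]mulrC.
  by apply: (le_trans H); rewrite ler_piMr.
apply: subexpM.
- by move=> k; exact: J_sqr_ge0.
- by move=> k; rewrite mulr_ge0 ?invr_ge0 ?exprn_ge0// ltW// mom_gt0.
- exact: (subexpS (a := fun k => J 1 (fun x => h k x * h k x))).
- apply: subexpM.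
  + by move=> k; rewrite invr_ge0 ltW// mom_gt0.
  + by move=> k; rewrite exprn_ge0.
  + exact: (subexpS (a := fun k => (mom 1 k)^-1) subexp_mom).
  + by apply: subexpX => //; exact: subexp_linear.
Qed.

Definition hpart h N : V -> R := fun x => \sum_(0 <= k < N) h k x.
Definition hsum h : V -> R := fun x => limn (fun N => hpart h N x).

Lemma hpart_polyfun h N : (forall k, HP k (h k)) -> polyfun (hpart h N).
Proof. by move=> Hh; apply: polyfun_sum => k; exact: HP_polyfun (Hh k). Qed.

Lemma pd_hpart h N i : (forall k, HP k (h k)) ->
  pd (hpart h N.+1) i = hpart (fun k => pd (h k.+1) i) N.
Proof.
move=> Hh; rewrite /hpart (@pd_sum R n _ _ _ h); last by move=> k; exact: HP_polyfun (Hh k).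
by apply/funext => x; rewrite big_nat_recl// (HP_pd0 _ (Hh 0)) add0r.
Qed.

Lemma hseries_abs_bound h t : hseries h -> 0 <= t < 1 -> exists B,
  forall N x, enorm x <= t -> \sum_(0 <= k < N) `|h k x| <= B.
Proof.
move=> hh t01; have [s [ss s0] hs] := hseries_sup hh.
have [B sB] := subexp_sum s0 ss t01; exists B => N x xt.
apply: le_trans (sB N); apply: ler_sum => k _; apply: (le_trans (hs k x)).
rewrite ler_wpM2l// lerXn2r ?nnegrE ?enorm_ge0//.
by case/andP: t01.
Qed.

Lemma hpart_bound h t : hseries h -> 0 <= t < 1 -> exists B,
  forall N x, enorm x <= t -> `|hpart h N x| <= B.
Proof.
move=> hh t01; have [B hB] := hseries_abs_bound hh t01; exists B => N x xt.
by apply: le_trans (hB N x xt); exact: ler_norm_sum.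
Qed.

Lemma hpart_cvg h x : hseries h -> unit_ball x ->
  hpart h N x @[N --> \oo] --> hsum h x.
Proof.
move=> hh x1; apply: (@normed_cvg R R^o (fun k => h k x)).
have [|B hB] := @hseries_abs_bound h (enorm x) hh; first by rewrite enorm_ge0 x1.
apply: nondecreasing_is_cvgn.
  apply: nondecreasing_series => k _ _; exact: normr_ge0.
by exists B => _ [N _ <-]; exact: hB.
Qed.

Lemma segment_ball x y t (s : R) : enorm x < t -> enorm y < t -> 0 <= s <= 1 ->
  enorm (x + s *: (y - x)) < t.
Proof.
move=> xt yt /andP[s0 s1]; have t0 : 0 <= t := ltW (le_lt_trans (enorm_ge0 x) xt).
move: xt yt; rewrite !enorm_lt// => xt yt.
have c : sqn (x + s *: (y - x)) <= (1 - s) * sqn x + s * sqn y.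
  rewrite /sqn !mulr_sumr -big_split/=; apply: ler_sum => i _.
  rewrite !mxE -subr_ge0.
  rewrite (_ : _ - _ = s * (1 - s) * (y ord0 i - x ord0 i) ^+ 2); last by ring.
  by apply: mulr_ge0; [apply: mulr_ge0 => //; rewrite subr_ge0|exact: sqr_ge0].
apply: (le_lt_trans c); rewrite -[X in _ < X](_ : (1 - s) * t ^+ 2 + s * t ^+ 2 = _); last by ring.
have [->|s1'] := eqVneq s 1; first by rewrite subrr !mul0r !add0r !mul1r.
apply: ltr_leD; last by rewrite ler_wpM2l// ltW.
by rewrite ltr_pM2l// subr_gt0 lt_neqAle s1' s1.
Qed.

(** The gradient of a partial sum is a partial sum of the derived series, so the constant does not
    depend on [N] and survives in the limit. *)
Lemma hpart_lipschitz h t : hseries h -> 0 <= t < 1 -> exists2 C : R, 0 <= C &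
  forall N x y, enorm x < t -> enorm y < t ->
  `|hpart h N y - hpart h N x| <= C * \sum_(i < n) `|(y - x) ord0 i|.
Proof.
move=> hh t01.
have /choice[B hB] i := hpart_bound (hseries_pd i hh) t01.
pose C := \sum_(i < n) `|B i|; exists C; first exact: sumr_ge0.
move=> -[|N] x y xt yt.
  by rewrite /hpart !big_geq// subrr normr0 mulr_ge0// sumr_ge0.
apply: (@polyfun_lipschitz R n _ C t).
- exact: (hpart_polyfun _ hh.1).
- move=> z zt i; rewrite pd_hpart; last exact: hh.1.
  apply: (le_trans (hB i N z (ltW zt))).
  rewrite /C (bigD1 i)//= (le_trans (ler_norm _))// lerDl.
  by apply: sumr_ge0.
- by move=> s; exact: segment_ball.
Qed.

Lemma hsum_lipschitz h t : hseries h -> 0 <= t < 1 -> exists2 C : R, 0 <= C &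
  forall x y, enorm x < t -> enorm y < t ->
  `|hsum h y - hsum h x| <= C * \sum_(i < n) `|(y - x) ord0 i|.
Proof.
move=> hh t01; have [C C0 hC] := hpart_lipschitz hh t01; exists C => // x y xt yt.
have /andP[t0 t1] := t01.
have cx : unit_ball x := lt_trans xt t1.
have cy : unit_ball y := lt_trans yt t1.
have c : `|hpart h N y - hpart h N x| @[N --> \oo] --> `|hsum h y - hsum h x|.
  by apply: cvg_norm; apply: cvgB; exact: hpart_cvg.
apply: (ler_cvg_to c (cvg_cst (C * \sum_(i < n) `|(y - x) ord0 i|))).
by apply: nearW => N; exact: hC.
Qed.

Lemma ball_between x : unit_ball x -> exists2 t : R, 0 <= t < 1 & enorm x < t.
Proof.
move=> x1; exists ((enorm x + 1) / 2).
  rewrite divr_ge0 ?addr_ge0 ?enorm_ge0//= ltr_pdivrMr// mul1r.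
  by rewrite [X in _ < X](_ : 2 = 1 + 1)// ltrD2r.
by rewrite ltr_pdivlMr// mulr_natr mulr2n ltrD2l.
Qed.

Lemma near_ball x t : enorm x < t -> \forall y \near x, enorm y < t.
Proof. by move=> xt; apply: open_nbhs_nbhs; split; [exact: (@open_ball_of R n t)|exact: xt]. Qed.

Lemma hsum_continuous h x : hseries h -> unit_ball x ->
  {for x, continuous (hsum h)}.
Proof.
move=> hh x1; have [t t01 xt] := ball_between x1.
have [C _ hC] := hsum_lipschitz hh t01.
have cs (s : seq 'I_n) (z : V) :
    {for z, continuous (fun y : V => \sum_(i <- s) `|(y - x) ord0 i|)}.
  elim: s => [|i s IH].
    rewrite (_ : (fun _ => _) = cst 0); first exact: cst_continuous.
    by apply/funext => y; rewrite big_nil.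
  rewrite (_ : (fun _ => _) = (fun y : V => `|y ord0 i - x ord0 i|) +
      (fun y : V => \sum_(i <- s) `|(y - x) ord0 i|)); last first.
    by apply/funext => y; rewrite big_cons !mxE.
  apply: continuousD => //.
  apply: (@continuous_comp _ _ _ (fun y : V => y ord0 i - x ord0 i) (fun r : R => `|r|)).
    by apply: continuous_polyfun; pf.
  exact: norm_continuous.
have c0 : (fun y : V => C * \sum_(i < n) `|(y - x) ord0 i|) @ x --> 0.
  have e0 : C * \sum_(i < n) `|(x - x) ord0 i| = 0.
    by rewrite subrr big1 ?mulr0// => i _; rewrite mxE normr0.
  rewrite -[X in _ --> X]e0.
  by apply: (@continuousM _ _ (cst C)); [exact: cst_continuous|exact: cs].
move=> A /nbhs_ballP[e /= e0 eA].
have H1 : nbhs x [set y : V | ball (0 : R) e (C * \sum_(i < n) `|(y - x) ord0 i|)].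
  exact: c0 _ (nbhsx_ballx (0 : R) e e0).
suff : nbhs x [set y : V | A (hsum h y)] by [].
apply: filterS (filterI H1 (near_ball xt)) => y [] /=.
rewrite /ball /= sub0r normrN => ye yt; apply: eA; rewrite /ball /= distrC.
apply: le_lt_trans ye; apply: le_trans (hC x y xt yt) _; exact: ler_norm.
Qed.

(** The mean value theorem, with the Lipschitz bound of the derived series, gives every partial sum
    a first-order expansion with remainder [C s^2]. The bound is uniform in [N], so the limit
    inherits it. *)
Lemma hsum_is_derive h x i : hseries h -> unit_ball x ->
  is_derive x 'e_i (hsum h) (hsum (fun k => pd (h k.+1) i) x).
Proof.
move=> hh x1; have [t t01 xt] := ball_between x1.
have hi := hseries_pd i hh; set G := hsum (fun k => pd (h k.+1) i).
have [C C0 hC] := hpart_lipschitz hi t01.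
have /andP[t0 t1] := t01.
have ei a : ('e_i : V) ord0 a = (a == i)%:R by rewrite mxE eqxx.
have bnd (s : R) : enorm (s *: 'e_i + x) < t ->
    `|hsum h (s *: 'e_i + x) - hsum h x - s * G x| <= C * s ^+ 2.
  move=> st; set z := s *: 'e_i + x in st *.
  have c : `|hpart h N.+1 z - hpart h N.+1 x -
      s * hpart (fun k => pd (h k.+1) i) N x| @[N --> \oo] -->
      `|hsum h z - hsum h x - s * G x|.
    apply: cvg_norm; apply: cvgB; last first.
      apply: cvgM; first exact: cvg_cst.
      exact: hpart_cvg.
    have cS w : unit_ball w -> hpart h N.+1 w @[N --> \oo] --> hsum h w.
      move=> w1; rewrite (cvg_shiftS (fun N => hpart h N w)).
      exact: hpart_cvg.
    by apply: cvgB; apply: cS => //; exact: lt_trans st t1.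
  apply: (ler_cvg_to c (cvg_cst (C * s ^+ 2))); apply: nearW => N.
  have [u u01 ->] := polyfun_MVT x z (hpart_polyfun N.+1 hh.1).
  have zx : z - x = s *: 'e_i by rewrite /z addrK.
  rewrite zx (bigD1 i)//= big1 ?addr0 => [|a ai]; last first.
    by rewrite mxE ei (negbTE ai) mulr0 mul0r.
  rewrite mxE ei eqxx mulr1 pd_hpart; last exact: hh.1.
  rewrite -mulrBr normrM.
  have ut : enorm (x + u *: (s *: 'e_i)) < t by rewrite -zx; exact: segment_ball.
  have uE : x + u *: (s *: 'e_i) - x = u *: (s *: 'e_i) by rewrite addrC addKr.
  have := hC N x _ xt ut; rewrite uE.
  rewrite (bigD1 i)//= big1 ?addr0 => [|a ai]; last first.
    by rewrite !mxE /= (negbTE ai) !mulr0 normr0.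
  rewrite !mxE eqxx /= mulr1 => H.
  rewrite -real_normK ?num_real// expr2 mulrCA ler_wpM2l//.
  apply: (le_trans H); rewrite ler_wpM2l// normrM.
  by case/andP: u01 => u0 u1; rewrite ger0_norm// ler_piMl.
have nsx : \forall s \near (0 : R), enorm (s *: 'e_i + x) < t.
  have e0 : (0 : R) *: ('e_i : V) + x = x by rewrite scale0r add0r.
  have H : (fun s : R => s *: ('e_i : V) + x) @ (0 : R) --> (0 : R) *: ('e_i : V) + x.
    by apply: cvgD; [exact: scalel_continuous|exact: cvg_cst].
  by rewrite e0 in H; exact: (H _ (near_ball xt)).
have cvg1 : (fun s : R => s^-1 *: (hsum h (s *: 'e_i + x) - hsum h x)) @ 0^' --> G x.
  apply/cvgrPdist_le => e e0.
  have eC : 0 < e / (C + 1) by rewrite divr_gt0// ltr_wpDl.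
  near=> s; have s0 : s != 0 by near: s; exact: nbhs_dnbhs_neq.
  have sx : enorm (s *: 'e_i + x) < t by near: s; apply: cvg_within; exact: nsx.
  have := bnd s sx.
  rewrite (_ : _ - _ = s * (s^-1 *: (hsum h (s *: 'e_i + x) - hsum h x) - G x)); last first.
    by rewrite /GRing.scale/= mulrBr mulrA mulfV// mul1r.
  rewrite normrM -real_normK ?num_real// expr2 mulrCA ler_pM2l ?normr_gt0// distrC.
  move=> /le_trans; apply.
  have se : `|s| <= e / (C + 1) by near: s; exact: dnbhs0_le.
  apply: (@le_trans _ _ ((C + 1) * `|s|)); first by rewrite ler_wpM2r// lerDl.
  by rewrite mulrC -ler_pdivlMr// ltr_wpDl.
apply: DeriveDef; last exact/cvg_lim.
by apply/cvg_ex; exists (G x).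
Unshelve. all: by end_near. Qed.

Lemma hsum_partial h x i : hseries h -> unit_ball x ->
  partial (hsum h) i x = hsum (fun k => pd (h k.+1) i) x.
Proof. by move=> hh x1; have [] := hsum_is_derive i hh x1. Qed.

Lemma hsum_Ck h m : hseries h -> Ck m unit_ball (hsum h).
Proof.
elim: m h => [|m IH] h hh; first by split=> // x x1; exact: hsum_continuous.
split=> [x x1|i]; first exact: hsum_continuous.
split=> [x x1|]; first by have [] := hsum_is_derive i hh x1.
apply: Ck_ext (IH _ (hseries_pd i hh)); first exact: open_unit_ball.
by move=> x x1; rewrite hsum_partial.
Qed.

Lemma hsum_harmonic h : hseries h -> Defs.harmonic unit_ball (hsum h).
Proof.
move=> hh; split=> [|x x1]; first exact: hsum_Ck.
have E i : partial (partial (hsum h) i) i x =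
    hsum (fun k => pd (pd (h k.+2) i) i) x.
  have hi := hseries_pd i hh.
  transitivity (partial (hsum (fun k => pd (h k.+1) i)) i x); last exact: hsum_partial.
  apply: near_eq_derive; apply: (near_open_eq (@open_unit_ball R n) x1) => y y1.
  exact: hsum_partial.
rewrite (eq_bigr _ (fun i _ => E i)).
have c : \sum_(i < n) hpart (fun k => pd (pd (h k.+2) i) i) N x @[N --> \oo] -->
    \sum_(i < n) hsum (fun k => pd (pd (h k.+2) i) i) x.
  apply: (@cvg_big _ _ +%R _ _ _ _ _ _ _ _ _) => [|i _]; first exact: add_continuous.
  exact: (hpart_cvg (hseries_pd i (hseries_pd i hh)) x1).
rewrite -(cvg_lim _ c)// (_ : (fun N => _) = cst 0) ?lim_cst//.
apply/funext => N /=; rewrite /hpart exchange_big/= big1// => k _.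
exact: (HP_lap hn x (hh.1 k.+2)).
Qed.

Lemma J_hpart_sqr t h N m : (forall k, HP k (h k)) ->
  J t (fun x => (hpart h (N + m) x - hpart h N x) * (hpart h (N + m) x - hpart h N x)) =
  \sum_(N <= k < N + m) J t (fun x => h k x * h k x).
Proof.
move=> Hh; have ph k := HP_polyfun (Hh k).
have pp N' := hpart_polyfun N' Hh.
elim: m => [|m IH].
  rewrite addn0 big_geq// /J /Rintegral.
  by under eq_integral do rewrite subrr mul0r; rewrite integral0.
rewrite addnS big_nat_recr ?leq_addr//= -IH.
set D := fun x => hpart h (N + m) x - hpart h N x.
have pD : polyfun D by have := pp (N + m)%N; have := pp N; move=> ? ?; rewrite /D; pf.
have DE x : hpart h (N + m).+1 x - hpart h N x = D x + h (N + m)%N x.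
  by rewrite /D /hpart [in LHS]big_nat_recr//=; ring.
have ph' := ph (N + m)%N.
have D0 : J t (fun x => D x * h (N + m)%N x) = 0.
  rewrite (@eq_J _ _ _ _ _ (fun x => \sum_(N <= k < N + m) (h k x * h (N + m)%N x))).
    rewrite (J_sum _ (F := fun k x => h k x * h (N + m)%N x)).
      rewrite big_nat_cond big1// => k /andP[/andP[_ km] _].
      rewrite -[RHS](HP_orth nu_invariant t 0 hn (Hh k) (Hh (N + m)%N)); last by rewrite ltn_eqF.
      by apply: eq_J => x _; rewrite mul1r.
    by move=> k; apply: ibl_polyfun; have := ph k; move=> ?; pf.
  move=> x _; rewrite /D /hpart -mulr_suml; congr (_ * _).
  by rewrite [X in X - _](@big_cat_nat _ _ _ N) ?leq_addr//= addrC addrK.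
transitivity (J t (fun x => D x * D x + 2 * (D x * h (N + m)%N x) +
   h (N + m)%N x * h (N + m)%N x)).
  by apply: eq_J => x _; rewrite DE; ring.
rewrite JD; [|by apply: ibl_polyfun; pf..].
rewrite JD; [|by apply: ibl_polyfun; pf..].
rewrite JZ ?D0 ?mulr0 ?addr0//.
by apply: ibl_polyfun; pf.
Qed.

(** Fatou's lemma along the pointwise convergent partial sums, whose differences are computed by
    Pythagoras. When [B] is the supremum of the sums of squares, the error bound tends to 0. *)
Lemma hsum_L2 h (B : R) :
  (forall k, HP k (h k)) ->
  (forall N, \sum_(0 <= k < N) J 1 (fun x => h k x * h k x) <= B) ->
  hseries h /\ forall N,
    (\int[nu]_(x in (unit_ball : set BV)) (((hsum h x - hpart h N x) ^+ 2)%:E) <=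
    (B - \sum_(0 <= k < N) J 1 (fun x => h k x * h k x))%:E)%E.
Proof.
move=> Hh hB; have ph k := HP_polyfun (Hh k).
have hh : hseries h.
  split => //; apply: subexp_le (subexp_cst B) => k; apply: le_trans (hB k.+1).
  rewrite big_nat_recr//= lerDr; apply: sumr_ge0 => l _; exact: J_sqr_ge0.
split=> // N; have mB : measurable (unit_ball : set BV) := measurable_ball_of 1.
pose f m x : \bar R := ((hpart h (N + m) x - hpart h N x) ^+ 2)%:E.
have pD m : polyfun (fun x => (hpart h (N + m) x - hpart h N x) ^+ 2).
  have := hpart_polyfun (N + m) Hh; have := hpart_polyfun N Hh; move=> ? ?; pf.
have mf m : measurable_fun (unit_ball : set BV) (f m).
  apply/measurable_EFinP; apply: measurable_fun_rV; exact: continuous_polyfun (pD m).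
have f0 m x : unit_ball x -> (0 <= f m x)%E by move=> _; rewrite lee_fin sqr_ge0.
have := @fatou _ _ _ nu (unit_ball : set BV) mB f mf f0.
have -> : (\int[nu]_(x in (unit_ball : set BV)) limn_einf (f^~ x) =
    \int[nu]_(x in (unit_ball : set BV)) ((hsum h x - hpart h N x) ^+ 2)%:E)%E.
  apply: eq_integral => x; rewrite inE => x1.
  have cN : hpart h (N + m) x @[m --> \oo] --> hsum h x.
    rewrite (_ : (fun m => _) = fun m => hpart h (m + N) x); last first.
      by apply/funext => m; rewrite addnC.
    by have := hpart_cvg hh x1; rewrite -(cvg_shiftn N).
  have c : f m x @[m --> \oo] --> ((hsum h x - hpart h N x) ^+ 2)%:E.
    apply: cvg_EFin; first exact: nearW.
    rewrite [X in X @ _ --> _](_ : _ = fun m => (hpart h (N + m) x - hpart h N x) * (hpart h (N + m) x - hpart h N x)); last first.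
      by apply/funext => m; rewrite /f /= expr2.
    rewrite expr2; apply: cvgM; (apply: cvgB; last exact: cvg_cst).
      exact: cN.
    exact: cN.
  rewrite is_cvg_limn_einfE; last by apply/cvg_ex; eexists; exact: c.
  exact/cvg_lim.
move=> /le_trans; apply.
pose s m := \sum_(0 <= k < m) J 1 (fun x => h k x * h k x).
have intf m : (\int[nu]_(x in (unit_ball : set BV)) f m x = (s (N + m)%N - s N)%:E)%E.
  rewrite /s [X in X - _](@big_cat_nat _ _ _ N) ?leq_addr//= [X in X - _]addrC addrK.
  rewrite -J_hpart_sqr// /J /Rintegral fineK.
    by apply: eq_integral => x _; rewrite /f expr2.
  apply: integrable_fin_num; first exact: mB.
  have := pD m; under eq_fun do rewrite expr2; exact: ibl_polyfun.
under eq_fun do rewrite intf.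
have nd : {homo (fun m => (s (N + m)%N - s N)%:E) : a b / (a <= b)%N >-> (a <= b)%E}.
  move=> a b ab; rewrite lee_fin lerD2r /s.
  rewrite [leRHS](@big_cat_nat _ _ _ (N + a))//= ?leq_add2l// lerDl.
  by apply: sumr_ge0 => l _; exact: J_sqr_ge0.
rewrite is_cvg_limn_einfE; last exact: ereal_nondecreasing_is_cvgn.
apply: lime_le; first exact: ereal_nondecreasing_is_cvgn.
by apply: nearW => m; rewrite lee_fin lerD2r; exact: hB.
Qed.

End harmonic_series.

(** * The Weierstrass theorem on the ball *)

Section weierstrass.
Context {R : realType} {n : nat}.
Local Notation V := 'rV[R]_n.
Implicit Types (f g F G p q : V -> R) (i j : 'I_n) (x y z : V) (N : nat).
Implicit Types (w : seq 'I_n) (r t e : R).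

Lemma compact_closed_ball (t : R) : compact [set x : V | enorm x <= t].
Proof.
have cc : compact [set x : V | forall i, `[- t, t]%classic (x ord0 i)].
  by apply: (@rV_compact R n (fun=> `[- t, t]%classic)) => i; exact: segment_compact.
apply: (subclosed_compact _ cc).
  rewrite (_ : [set x | _] = (@enorm R n) @^-1` [set r | r <= t])//.
  by apply: closed_comp => [x _|]; [exact: continuous_enorm|exact: closed_le].
by move=> x /= xt i; rewrite in_itv/= -ler_norml (le_trans (coord_le_enorm x i)).
Qed.

(** Only [x] is confined to the ball: the random walk below may end outside of it. *)
Lemma uniform_modulus F (t e : R) : continuous F -> 0 < e ->
  exists2 d : R, 0 < d & forall x z, enorm x <= t ->
    (forall i, `|z ord0 i - x ord0 i| < d) -> `|F z - F x| < e.
Proof.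
move=> cF e0; have /compact_near_coveringP K : compact [set x : V | enorm x <= t].
  exact: compact_closed_ball.
pose P (d : R) x := forall z, (forall i, `|z ord0 i - x ord0 i| < d) -> `|F z - F x| < e.
have : \forall d \near (0 : R)^'+, [set x : V | enorm x <= t] `<=` P d.
  apply: K => x _; have e2 : 0 < e / 2 by rewrite divr_gt0.
  have /nbhs_ballP[/= r r0 rF] : nbhs x [set w : V | `|F w - F x| < e / 2].
    have nF := cF x _ (nbhsx_ballx (F x) _ e2).
    apply: (@filterS _ (nbhs x) _ _ _ _ nF) => w.
    by rewrite /= distrC.
  near=> x' d => z zd.
  have bx' : ball x (r / 2) x'.
    by near: x'; apply: nbhsx_ballx; rewrite divr_gt0.
  have dr : d < r / 2 by near: d; apply: nbhs_right_lt; rewrite divr_gt0.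
  have Fx' : `|F x' - F x| < e / 2.
    apply: rF; case: bx' => _ bx'; split => // i j.
    by apply: le_ball (bx' i j); lra.
  have Fz : `|F z - F x| < e / 2.
    apply: rF; split => // i j; rewrite ord1.
    have [_ /(_ ord0 j)] := bx'; rewrite /ball /= => b1.
    have b2 : `|x' ord0 j - z ord0 j| < r / 2.
      by rewrite distrC; apply: lt_trans (zd j) dr.
    rewrite -[X in _ < X](_ : r / 2 + r / 2 = _); last by field.
    by apply: le_lt_trans (ltrD b1 b2); apply: ler_distD.
  rewrite -[X in _ < X](_ : e / 2 + e / 2 = _); last by field.
  rewrite distrC in Fx'; apply: le_lt_trans (ltrD Fz Fx'); exact: ler_distD.
move=> H; have [d [d0 Hd]] : exists d : R, 0 < d /\ [set x : V | enorm x <= t] `<=` P d.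
  near (0 : R)^'+ => d; exists d; split; last by near: d.
  by near: d; exact: nbhs_right_gt.
by exists d => // x z xt; exact: Hd.
Unshelve. all: by end_near. Qed.

(* Expectation of [G] at the end of a random walk from [z]: the step [i] adds
   [s] to the [i]-th coordinate with probability [(1 + x_i) / 2]. With [N] steps
   in each direction, [s = 2 / N] and [z = (-1, .., -1)] the end point is
   concentrated at [x] and the expectation is a polynomial in [x]. *)
Fixpoint walk (s : R) w G z x : R :=
  if w is i :: w' then
    (1 + x ord0 i) / 2 * walk s w' G (z + s *: 'e_i) x +
    (1 - x ord0 i) / 2 * walk s w' G z x
  else G z.

Lemma polyfun_walk s w G z : polyfun (walk s w G z).
Proof.
elim: w z => [|i w IH] z /=; first exact: polyfun_cst.
have p1 := IH z; have p2 := IH (z + s *: 'e_i).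
by pf.
Qed.

Lemma walk_cst s w c z x : walk s w (fun=> c) z x = c.
Proof. by elim: w z => //= i w IH z; rewrite !IH; field. Qed.

Lemma walkD s w F G z x : walk s w (fun y => F y + G y) z x =
  walk s w F z x + walk s w G z x.
Proof. by elim: w z => //= i w IH z; rewrite !IH; ring. Qed.

Lemma walkZ s w c G z x : walk s w (fun y => c * G y) z x = c * walk s w G z x.
Proof. by elim: w z => //= i w IH z; rewrite !IH; ring. Qed.

Lemma le_walk s w F G z x : (forall i, `|x ord0 i| <= 1) ->
  (forall y, F y <= G y) -> walk s w F z x <= walk s w G z x.
Proof.
move=> x1 FG; elim: w z => //= i w IH z.
have := x1 i; rewrite ler_norml => /andP[xi1 xi2].
by rewrite lerD// ler_wpM2l// divr_ge0// ?subr_ge0// -lerBlDl sub0r.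
Qed.

Lemma walk_sum s w (I : finType) (F : I -> V -> R) z x :
  walk s w (fun y => \sum_k F k y) z x = \sum_k walk s w (F k) z x.
Proof.
elim: (index_enum I) => [|k e IH].
  under eq_fun do rewrite big_nil.
  by rewrite big_nil walk_cst.
under eq_fun do rewrite big_cons.
by rewrite big_cons walkD IH.
Qed.

Lemma walk_variance s w j (c : R) z x :
  walk s w (fun y => (y ord0 j - c) ^+ 2) z x =
  (z ord0 j + (count_mem j w)%:R * ((1 + x ord0 j) / 2) * s - c) ^+ 2 +
  (count_mem j w)%:R * ((1 + x ord0 j) / 2) * ((1 - x ord0 j) / 2) * s ^+ 2.
Proof.
elim: w z => [|i w IH] z /=; first by rewrite !mul0r !addr0.
rewrite !IH !mxE eqxx [j == i]eq_sym; have [->|ij] := eqVneq i j.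
  by rewrite natrD /=; field.
by rewrite /= add0n; field.
Qed.

Lemma weierstrass F e : continuous F -> (exists B : R, forall x, `|F x| <= B) ->
  0 < e -> exists2 p, polyfun p & forall x, enorm x <= 1 -> `|F x - p x| <= e.
Proof.
move=> cF [B FB] e0; have e2 : 0 < e / 2 by rewrite divr_gt0.
have [d d0 dF] := uniform_modulus 1 cF e2.
have B0 : 0 <= B := le_trans (normr_ge0 _) (FB 0).
(* Chebyshev: either every coordinate of [z] is within [d] of that of [x], or [C] times the square
   distance is already at least [2 B]. *)
pose C := 2 * B / d ^+ 2.
have C0 : 0 <= C.
  by apply: divr_ge0; [exact: mulr_ge0|apply: exprn_ge0; exact: ltW].
have mod x z : enorm x <= 1 ->
    `|F z - F x| <= e / 2 + C * \sum_i (z ord0 i - x ord0 i) ^+ 2.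
  move=> x1; have S0 : 0 <= \sum_i (z ord0 i - x ord0 i) ^+ 2.
    by apply: sumr_ge0 => i _; exact: sqr_ge0.
  have [close|] := pselect (forall i, `|z ord0 i - x ord0 i| < d).
    by apply: (le_trans (ltW (dF x z x1 close))); rewrite lerDl mulr_ge0.
  move=> /existsNP[i /negP]; rewrite -leNgt => di.
  apply: (@le_trans _ _ (2 * B)).
    rewrite mulr_natl mulr2n; apply: (le_trans (ler_normB _ _)).
    exact: lerD.
  apply: (@le_trans _ _ (C * \sum_i (z ord0 i - x ord0 i) ^+ 2)); last first.
    by rewrite lerDr ltW.
  rewrite /C mulrAC ler_pdivlMr ?exprn_gt0// ler_wpM2l ?mulr_ge0//.
  rewrite (bigD1 i)//= -(real_normK (num_real (z ord0 i - x ord0 i))) ler_wpDr//.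
    by apply: sumr_ge0 => j _; exact: sqr_ge0.
  by apply: lerXn2r => //; rewrite nnegrE// ltW.
(* The walk has variance at most [1 / N] in each coordinate, hence expected square distance at most
   [n / N]. *)
have [N N0 CN] : exists2 N, (0 < N)%N & C * (n%:R / N%:R) <= e / 2.
  have X0 : 0 <= C * n%:R / (e / 2).
    by apply: divr_ge0; [exact: mulr_ge0|exact: ltW].
  exists (Num.bound (C * n%:R / (e / 2))).+1 => //.
  rewrite mulrA ler_pdivrMr ?ltr0n// [leRHS]mulrC -ler_pdivrMr//.
  by apply: ltW; apply: (lt_le_trans (archi_boundP X0)); rewrite ler_nat.
pose w := flatten (nseq N (enum 'I_n)); pose z0 : V := const_mx (-1).
have cw j : count_mem j w = N.
  rewrite /w; elim: (N) => //= N' IH; rewrite count_cat IH.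
  by rewrite count_uniq_mem ?enum_uniq// mem_enum.
exists (walk (2 / N%:R) w F z0); first exact: polyfun_walk.
move=> x x1; have xi i : `|x ord0 i| <= 1 := le_trans (coord_le_enorm x i) x1.
pose D y := e / 2 + C * \sum_i (y ord0 i - x ord0 i) ^+ 2.
have DE : walk (2 / N%:R) w D z0 x <= e.
  rewrite walkD walk_cst walkZ walk_sum.
  rewrite [leRHS](_ : e = e / 2 + e / 2); last by field.
  rewrite lerD2l; apply: le_trans CN; rewrite ler_wpM2l//.
  rewrite (_ : n%:R / N%:R = \sum_(i < n) (1 / N%:R)); last first.
    by rewrite sumr_const card_ord -[RHS]mulr_natl mul1r.
  apply: ler_sum => i _; rewrite walk_variance cw mxE.
  have NN : (N%:R : R) != 0 by rewrite pnatr_eq0 -lt0n.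
  rewrite [leLHS](_ : _ = (1 - x ord0 i ^+ 2) * (1 / N%:R)); last by field.
  rewrite ler_piMl ?divr_ge0// gerBl.
  exact: sqr_ge0.
have H1 : walk (2 / N%:R) w F z0 x <= F x + e.
  apply: (@le_trans _ _ (walk (2 / N%:R) w (fun y => F x + D y) z0 x)).
    apply: le_walk => // y; rewrite -lerBlDl.
    by apply: le_trans (mod x y x1); exact: ler_norm.
  by rewrite walkD walk_cst lerD2l.
have H2 : F x <= walk (2 / N%:R) w F z0 x + e.
  rewrite -[leLHS](walk_cst (2 / N%:R) w (F x) z0 x).
  apply: (@le_trans _ _ (walk (2 / N%:R) w (fun y => F y + D y) z0 x)).
    apply: le_walk => // y; rewrite -lerBlDl.
    by apply: le_trans (mod x y x1); rewrite distrC; exact: ler_norm.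
  by rewrite walkD lerD2l.
by rewrite ler_norml; apply/andP; split; lra.
Qed.

(** Composing with it extends a function continuous on the closed ball to a bounded continuous
    function on the whole space, as [weierstrass] requires. *)
Definition retract x : V := (Num.max 1 (enorm x))^-1 *: x.

Lemma retract_ball x : enorm (retract x) <= 1.
Proof.
have m0 : 0 < Num.max 1 (enorm x) by rewrite lt_max ltr01.
have m1 : 0 <= (Num.max 1 (enorm x))^-1 by rewrite invr_ge0 ltW.
rewrite /retract enormZ// ler_pdivrMl// mulr1.
by rewrite le_max lexx orbT.
Qed.

Lemma retract_id x : enorm x <= 1 -> retract x = x.
Proof. by move=> x1; rewrite /retract max_l// invr1 scale1r. Qed.

Lemma continuous_retract : continuous retract.
Proof.
move=> x; apply: continuous_rV => i.
rewrite (_ : (fun y => _) = (fun y => (Num.max 1 (enorm y))^-1) * (fun y : V => y ord0 i)).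
  apply: continuousM; last exact: continuous_coord.
  apply: continuousV; first by rewrite gt_eqF// lt_max ltr01.
  apply: (@continuous_comp _ _ _ (@enorm R n) (fun r : R => Num.max 1 r)).
    exact: continuous_enorm.
  by apply: continuous_max; [exact: cst_continuous|exact: cvg_id].
by apply/funext => y; rewrite mxE.
Qed.

Lemma within_ball_retract (T : topologicalType) (f : V -> T) :
  {within closed_unit_ball, continuous f} -> continuous (f \o retract).
Proof.
move=> /subspace_continuousP cf x A nA.
have nB := cf _ (retract_ball x) A nA.
have nR := @continuous_retract x _ nB.
apply: (@filterS _ (nbhs x) _ _ _ _ nR) => y /=; apply.
exact: retract_ball.
Qed.

Lemma weierstrass_ball f e : {within closed_unit_ball, continuous f} ->
  0 < e -> exists2 p, polyfun p & forall x, enorm x <= 1 -> `|f x - p x| <= e.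
Proof.
move=> cf e0; have cF := within_ball_retract cf.
have [|p pp fp] := weierstrass cF _ e0.
  have cN : {within [set x : V | enorm x <= 1], continuous (fun x => `|(f \o retract) x|)}.
    apply: continuous_subspaceT => x; apply: continuous_comp; first exact: cF.
    exact: norm_continuous.
  have b0 : [set x : V | enorm x <= 1] !=set0.
    by exists (retract 0); exact: retract_ball.
  have [c _ cM] := EVT_max_rV b0 (compact_closed_ball (t := 1)) cN.
  exists `|(f \o retract) c| => x; have := cM (retract x).
  rewrite /= (retract_id (retract_ball x)); apply.
  by rewrite inE /=; exact: retract_ball.
by exists p => // x x1; rewrite -{1}(retract_id x1); exact: fp.
Qed.

End weierstrass.

(** * The maximum principle for harmonic functions *)

Section maximum_principle.
Context {R : realType}.
Implicit Types (phi dphi : R -> R) (r s t e : R).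

(** If [D] were positive, [dphi], which vanishes at 0, would be positive just to the right of it,
    and by the mean value theorem [phi] would exceed [phi 0] there. *)
Lemma second_derivative_max phi dphi r (D : R) : 0 < r ->
  (forall s, `|s| < r -> is_derive s 1 phi (dphi s)) ->
  is_derive (0 : R) (1 : R) dphi D -> (forall s, `|s| < r -> phi s <= phi 0) -> D <= 0.
Proof.
move=> r0 dp [ddp Dd] pmax.
have in_r s : s \in `]-r, r[ -> `|s| < r by rewrite in_itv/= ltr_norml.
have d0 : dphi 0 = 0.
  have [|s /in_r /dp[//]|//| |_ e0] := @derive1_at_max R phi (- r) r 0.
  - by rewrite ge0_cp ?ltW.
  - by rewrite in_itv/= oppr_lt0 r0.
  - by move=> s /in_r /pmax.
  by have [_ <-] : is_derive (0 : R) (1 : R) phi (dphi 0) by apply: dp; rewrite normr0.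
rewrite leNgt; apply/negP => Dpos.
have : \forall h \near 0^', 0 < h^-1 *: (dphi (h *: 1 + 0) - dphi 0).
  have c : h^-1 *: (dphi (h *: 1 + 0) - dphi 0) @[h --> 0^'] --> D.
    by move: ddp; rewrite /derivable/= => /cvgP; rewrite -Dd.
  exact: (cvgr_gt D c 0 Dpos).
rewrite near_withinE => /nbhs_ballP[e /= e0 He].
pose b := Num.min r e / 2.
have b0 : 0 < b by rewrite divr_gt0// lt_min r0.
have br : b < r.
  by rewrite /b ltr_pdivrMr// (@le_lt_trans _ _ r) ?ge_min ?lexx// ltr_pMr// ltr1n.
have be : b < e.
  by rewrite /b ltr_pdivrMr// (@le_lt_trans _ _ e) ?ge_min ?lexx ?orbT// ltr_pMr// ltr1n.
have nr s : 0 <= s <= b -> `|s| < r.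
  by move=> /andP[s0 sb]; rewrite ger0_norm// (le_lt_trans sb).
have [s|  |s sb] := @MVT R phi dphi 0 b b0.
- by rewrite in_itv/= => /andP[s0 sb]; apply/dp/nr; rewrite !ltW.
- apply: derivable_within_continuous => s; rewrite in_itv/= => sb.
  by have [] := dp s (nr s sb).
rewrite subr0 => E; move: sb; rewrite in_itv/= => /andP[s0 sb].
have := pmax b; rewrite ger0_norm; last exact: ltW.
move=> /(_ br).
rewrite -subr_le0 E leNgt => /negP; apply; apply: mulr_gt0 => //.
have bs : ball (0 : R) e s.
  by rewrite /ball/= sub0r normrN gtr0_norm// (lt_trans sb be).
have := He s bs; rewrite gt_eqF// => /(_ isT).
by rewrite d0 subr0 [_ *: 1]mulr1 addr0 [_ *: _]mulrC pmulr_lgt0 ?invr_gt0.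
Qed.

Context {n : nat}.
Hypothesis hn : (2 <= n)%N.
Local Notation V := 'rV[R]_n.
Implicit Types (u w h p : V -> R) (x y : V) (i j : 'I_n).

Lemma is_derive_shift u c i s : derivable u (c + s *: 'e_i) 'e_i ->
  is_derive s 1 (fun s : R => u (c + s *: 'e_i)) (partial u i (c + s *: 'e_i)).
Proof.
move=> d.
have E : (fun h : R => h^-1 *: (u (h *: 'e_i + (c + s *: 'e_i)) - u (c + s *: 'e_i))) =
    (fun h : R => h^-1 *: ((fun s => u (c + s *: 'e_i)) (h *: 1 + s) -
       u (c + s *: 'e_i))).
  apply/funext => h /=; congr (_ *: (u _ - _)).
  by rewrite addrCA -scalerDl [_ *: 1]mulr1.
split; first by rewrite /derivable -E.
by rewrite /partial /derive -E.
Qed.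

Lemma laplacian_max w t c : 0 < t <= 1 ->
  Ck 2 unit_ball w -> enorm c < t ->
  (forall x, enorm x < t -> w x <= w c) ->
  \sum_i partial (partial w i) i c <= 0.
Proof.
move=> /andP[t0 t1] [cw dw] ct wmax; apply: sumr_le0 => i _.
have [dwi [_ ddwi]] := dw i.
have : nbhs (0 : R) [set s : R | enorm (c + s *: 'e_i) < t].
  have ec : {for 0, continuous (fun s : R => enorm (c + s *: 'e_i))}.
    apply: continuous_comp; last exact: continuous_enorm.
    apply: continuousD; first exact: cst_continuous.
    by apply: continuousZr_tmp; exact: cvg_id.
  have := cvgr_lt _ ec t; rewrite /= scale0r addr0 => /(_ _ ct); exact.
move=> /nbhs_ballP[r /= r0 rt].
have rt' s : `|s| < r -> enorm (c + s *: 'e_i) < t.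
  by move=> sr; apply: rt; rewrite /ball/= sub0r normrN.
have rb s : `|s| < r -> unit_ball (c + s *: 'e_i).
  by move=> /rt' h; apply: lt_le_trans h t1.
have D1 s : `|s| < r -> is_derive s (1 : R) (fun s : R => w (c + s *: 'e_i))
    (partial w i (c + s *: 'e_i)).
  by move=> /rb sb; apply: is_derive_shift; exact: dwi.
have D2 : is_derive (0 : R) (1 : R) (fun s : R => partial w i (c + s *: 'e_i))
    (partial (partial w i) i c).
  have cB : unit_ball c by exact: lt_le_trans ct t1.
  have := @is_derive_shift (partial w i) c i 0; rewrite scale0r addr0; apply.
  exact: (ddwi i).1.
have mx s : `|s| < r -> w (c + s *: 'e_i) <= w (c + 0 *: 'e_i).
  by move=> /rt' sb; rewrite scale0r addr0; exact: wmax.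
exact: (second_derivative_max r0 D1 D2 mx).
Qed.

Lemma Ck_polyfun k (U : set V) p : polyfun p -> Ck k U p.
Proof.
elim: k p => [|k IH] p pp; first by split=> // x _; exact: continuous_polyfun.
split=> [x _|i]; first exact: continuous_polyfun.
split=> [x _|]; first exact: derivable_polyfun.
by rewrite -pdE; apply: IH; pf.
Qed.

(** Adding [d |x|^2] makes the Laplacian positive, which excludes interior maxima by
    [laplacian_max]; [d] is arbitrary. *)
Lemma max_principle w t e x : 0 < t < 1 -> Defs.harmonic unit_ball w ->
  (forall y, enorm y = t -> w y <= e) -> enorm x <= t -> w x <= e.
Proof.
move=> /andP[t0 t1] [Cw Lw] we xt.
have pS : polyfun (@sqn R n) := polyfun_sqn.
suff H : forall d : R, 0 < d -> w x <= e + d.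
  by apply/ler_addgt0Pr.
move=> d d0; pose g y := 1 * w y + d * sqn y.
have Cg : Ck 2 unit_ball g.
  exact: (Ck_lin 1 d (@open_unit_ball R n) Cw (Ck_polyfun 2 _ pS)).
have b0 : [set y : V | enorm y <= t] !=set0 by exists x.
have cg : {within [set y : V | enorm y <= t], continuous g}.
  apply: continuous_in_subspaceT => y; rewrite inE/= => yt.
  by apply: Cg.1; exact: le_lt_trans yt t1.
have [c /[1!inE]/= ct gc] := EVT_max_rV b0 (compact_closed_ball (t := t)) cg.
have {}gc y : enorm y <= t -> g y <= g c by move=> yt; apply: gc; rewrite inE.
have [ct'|ct'] := ltP (enorm c) t.
  have := @laplacian_max g t c; rewrite t0 ltW// => /(_ isT Cg ct').
  have -> : \sum_i partial (partial g i) i c = d * (2 * n%:R).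
    have B : unit_ball c by exact: le_lt_trans ct t1.
    have oB := @open_unit_ball R n.
    have Dw i : (forall z, unit_ball z -> derivable w z 'e_i) /\
                Ck 1 unit_ball (partial w i) := Cw.2 i.
    transitivity (\sum_i (partial (partial w i) i c + d * 2)); last first.
      rewrite big_split/= Lw// add0r sumr_const card_ord.
      by rewrite -mulrnAr mulr_natr.
    apply: eq_bigr => i _; rewrite -[partial (partial w i) i c]mul1r.
    have -> : 2 = pd (pd (@sqn R n) i) i c.
      have -> : pd (@sqn R n) i = fun y => 2 * y ord0 i.
        by apply/funext => y; rewrite pd_sqn.
      by rewrite pdZ ?pd_coord ?eqxx ?mulr1//; pf.
    rewrite pdE -partial_lin; first last.
    - by rewrite -pdE; apply: derivable_polyfun; pf.
    - exact: ((Dw i).2.2 i).1.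
    apply: near_eq_derive; apply: (near_open_eq oB B) => z Bz.
    rewrite /g partial_lin//; first exact: (Dw i).1.
    exact: derivable_polyfun.
  have n0 : (0 : R) < n%:R by rewrite ltr0n; exact: ltn_trans hn.
  have d2 : 0 < d * (2 * n%:R) by apply: mulr_gt0 => //; exact: mulr_gt0.
  rewrite leNgt d2 => H; exfalso; suff : false by [].
  by apply: H => y /ltW; exact: gc.
have {}ct : enorm c = t by apply/eqP; rewrite eq_le ct.
have := gc x xt; rewrite /g !mul1r => gx.
have s1 : sqn c <= 1.
  by rewrite -sqr_enorm ct exprn_ile1// ltW.
have h1 := we c ct; have := sqn_ge0 x.
move: (sqn x) (sqn c) (w x) (w c) gx s1 h1 => a b W Wc; nra.
Qed.

End maximum_principle.

(** * Completeness of the spherical harmonics *)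

Section harmonic_completeness.
Context {R : realType} {n : nat}.
Variable nu : probability (borel_rV R n) R.
Local Notation V := 'rV[R]_n.
Local Notation BV := (borel_rV R n).
Local Notation J := (J nu).
Local Notation ibl := (ibl nu).
Local Notation mom := (mom nu).
Implicit Types (f g u w p q h : V -> R) (i j : 'I_n) (x y v : V) (k d m l N : nat).
Implicit Types (t r s e : R).

Hypothesis hn : (2 <= n)%N.
Hypothesis nu_invariant : orthogonally_invariant nu.
Hypothesis nu_boundary : charges_boundary nu.

Lemma J_cvg f : ibl 1 f -> J (1 - m.+2%:R^-1) f @[m --> \oo] --> J 1 f.
Proof.
move=> f1; pose t m : R := 1 - m.+2%:R^-1.
have t1 m : t m < 1 by rewrite /t ltrBlDr ltrDl invr_gt0.
have sub m : ball_of (t m) `<=` ball_of 1 .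
  by move=> x; rewrite /ball_of/= => /lt_trans; apply.
have mB m := @measurable_ball_of R n (t m); have mB1 := @measurable_ball_of R n 1.
have E m : J (t m) f = fine (\int[nu]_(x in (ball_of 1 : set BV))
    ((EFin \o f) \_ (ball_of (t m) : set BV)) x).
  by rewrite -integral_mkcondr setIidr//; exact: sub.
under eq_fun do rewrite -[J _ _]/(J (t _) f) E.
have /integrableP[mf _] := f1.
have c := @dominated_cvg _ BV R nu (ball_of 1 : set BV) mB1
  (fun m => (EFin \o f) \_ (ball_of (t m) : set BV)) (EFin \o f) (abse \o (EFin \o f)).
apply: fine_cvg; rewrite fineK; last exact: integrable_fin_num.
apply: c => //.
- move=> m; apply/(measurable_restrict _ _ _).1 => //.
  by apply: (measurable_funS mB1 _ mf); exact: subIsetl.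
- move=> x x1; apply: cvg_near_cst.
  have : \forall m \near \oo, m.+2%:R^-1 < 1 - enorm x.
    have e0 : 0 < 1 - enorm x by rewrite subr_gt0.
    have := @cvgr_lt _ _ _ _ (fun m => (m.+1%:R : R)^-1) 0 (@cvg_harmonic R) _ e0.
    move=> [N _ HN]; exists N => // m /= Nm; apply: le_lt_trans (HN m Nm).
    by rewrite lef_pV2 ?posrE// ler_nat.
  apply: filterS => m xm; rewrite /patch mem_set//.
  by rewrite /ball_of/= /t ltrBrDr -ltrBrDl.
- exact: integrable_abse.
- move=> m x x1; rewrite /patch; case: ifP => _ //=.
  by rewrite normr0 lee_fin.
Qed.

Lemma hpoly_harmonic p : hpoly p -> Defs.harmonic unit_ball p.
Proof.
move=> Hp; split=> [|x _]; first exact/Ck_polyfun/hpoly_polyfun.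
rewrite -pdE; elim: Hp => [|k h q Hh Hq IH].
  by rewrite big1// => i _; rewrite !pd_cst.
have ph := HP_polyfun Hh; have pq := hpoly_polyfun Hq.
rewrite -[RHS]addr0 -[in X in _ = X + _](HP_lap hn x Hh) -[in X in _ = _ + X]IH -big_split/=.
by apply: eq_bigr => i _; rewrite !pdD//; pf.
Qed.

Lemma hpoly_scale p s : hpoly p -> hpoly (fun x => p (s *: x)).
Proof.
elim=> [|k h q Hh _ IH]; first exact: hpoly0.
rewrite (_ : (fun _ => _) = fun x => s ^+ k * h x + q (s *: x)).
  exact: (hpolyD (HPZ _ Hh) IH).
by apply/funext => x; rewrite (HP_scale s x Hh).
Qed.

(** The dilation [u (t x)] is continuous on the closed ball, hence close to a polynomial there. The
    harmonic polynomial with the same values on the sphere is close to it on the sphere, and the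
    maximum principle carries the estimate inside. *)
Lemma harmonic_approx u t e : Defs.harmonic unit_ball u -> 0 < t < 1 -> 0 < e ->
  exists2 p, hpoly p & forall x, enorm x <= t -> `|u x - p x| <= e.
Proof.
move=> hu t01 e0; have /andP[t0 t1] := t01; have [Cu _] := hu.
have t0' := ltW t0; have ti0 : 0 <= t^-1 by rewrite invr_ge0.
have tx x : enorm x <= 1 -> enorm (t *: x) <= t.
  by move=> x1; rewrite enormZ// ler_piMr.
have cu : {within closed_unit_ball, continuous (fun x => u (t *: x))}.
  apply: continuous_in_subspaceT => x; rewrite inE/= => x1.
  apply: (@continuous_comp _ _ _ (fun x : V => t *: x) u); first exact: scaler_continuous.
  by apply: Cu.1; exact: le_lt_trans (tx x x1) t1.
have [p pp pu] := weierstrass_ball cu e0.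
have [q Hq qE] := polyfun_sphere hn pp.
have Hr := hpoly_scale t^-1 Hq.
exists (fun x => q (t^-1 *: x)) => //.
have hr := hpoly_harmonic Hr.
have bd (a b : R) x : (forall y, enorm y = t -> a * u y + b * q (t^-1 *: y) <= e) ->
    enorm x <= t -> a * u x + b * q (t^-1 *: x) <= e.
  move=> H; apply: (max_principle hn t01 _ H).
  exact: (harmonic_lin a b (@open_unit_ball R n) hu hr).
have on_sphere y : enorm y = t -> `|u y - q (t^-1 *: y)| <= e.
  move=> yt; have y1 : enorm (t^-1 *: y) = 1.
    by rewrite enormZ// yt mulVf// gt_eqF.
  have := pu (t^-1 *: y); rewrite y1 scalerA divff ?gt_eqF// scale1r qE//.
    by apply.
  by rewrite -sqr_enorm y1 expr1n.
move=> x xt; have B1 := bd (-1) 1 x; have B2 := bd 1 (-1) x.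
rewrite ler_norml; apply/andP; split.
  suff : -1 * u x + 1 * q (t^-1 *: x) <= e by lra.
  by apply: B1 => // y /on_sphere; rewrite ler_norml => /andP[? ?]; lra.
suff : 1 * u x + -1 * q (t^-1 *: x) <= e by lra.
by apply: B2 => // y /on_sphere; rewrite ler_norml => /andP[? ?]; lra.
Qed.

Lemma hpoly_parts p : hpoly p -> exists (h : nat -> V -> R) N,
  (forall k, HP k (h k)) /\ forall M, (N <= M)%N -> p = hpart h M.
Proof.
elim=> [|k g q Hg _ [h [N [Hh E]]]].
  exists (fun=> fun=> 0), 0%N; split=> [k|M _]; first exact: HP0.
  by apply/funext => x; rewrite /hpart big1.
exists (fun j : nat => if j == k then (fun x => g x + h k x) else h j), (maxn N k.+1).
split=> [j|M]; first by case: eqP => [->|_] //; exact: HPD.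
rewrite geq_max => /andP[NM kM]; apply/funext => x.
rewrite (E M NM) /hpart !big_mkord (bigD1 (Ordinal kM))//=.
rewrite [RHS](bigD1 (Ordinal kM))//= eqxx -addrA; congr (_ + (_ + _)).
apply: eq_bigr => a /negbTE ak; case: eqP => // ak'.
by move: ak; rewrite -val_eqE /= ak' eqxx.
Qed.

Lemma hpart_sqr t (h' : nat -> V -> R) N : (forall k, HP k (h' k)) ->
  J t (fun x => hpart h' N x * hpart h' N x) = \sum_(0 <= k < N) J t (fun x => h' k x * h' k x).
Proof.
move=> Hh; rewrite -[N in RHS]add0n -(J_hpart_sqr hn nu_invariant)// add0n.
by apply: eq_J => x _; rewrite /hpart [X in _ - X]big_geq// subr0.
Qed.

(** One constant serves all radii [t >= t0]. With [r] between [s] and 1, [mom_lower_bound] bounds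
    the component of degree [k] at [x] by [(s / r)^k] times a subexponential factor and the norm on
    the ball of radius [t]. *)
Lemma hpoly_point_evaluation s : 0 <= s < 1 ->
  exists t0, exists2 C : R, 0 < t0 < 1 /\ 0 <= C & forall t p x, t0 <= t -> hpoly p ->
    enorm x <= s -> p x ^+ 2 <= C * J t (fun y => p y * p y).
Proof.
move=> /andP[s0 s1]; pose r := (1 + s) / 2.
have r01 : 0 < r < 1 by apply/andP; split; rewrite /r; lra.
have sr : 0 <= s / r < 1.
  case/andP: r01 => r0 _; rewrite divr_ge0 ?(ltW r0)//= ltr_pdivrMr// mul1r /r; lra.
have [t0 [a [t01 a0] mb]] := mom_lower_bound nu_boundary r01.
pose D k : R := (hdim hn nu_invariant nu_boundary k)%:R.
have D0 k : 0 <= D k by exact: ler0n.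
have [|B Bs] := subexp_sum _ (subexp_sqrt D0 (subexp_hdim hn nu_invariant nu_boundary)) sr.
  by move=> k; exact: sqrtr_ge0.
exists t0, (B ^+ 2 / a); first by split => //; rewrite divr_ge0 ?sqr_ge0// ltW.
move=> t p x tt Hp xs; have [h [N [Hh pE]]] := hpoly_parts Hp.
rewrite (pE N (leqnn N)) (hpart_sqr t N Hh).
set X := \sum_(0 <= k < N) _.
have Jk0 k : 0 <= J t (fun x => h k x * h k x).
  by apply: J_ge0 => y _; rewrite -expr2 sqr_ge0.
have X0 : 0 <= X by apply: sumr_ge0.
have hk k : (k < N)%N ->
    `|h k x| <= Num.sqrt (D k) * (s / r) ^+ k * Num.sqrt (X / a).
  move=> kN; have r0 : 0 < r by case/andP: r01.
  have m0 := mom_gt0 nu_boundary k.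
  rewrite -(@ler_pXn2r _ 2) ?nnegrE//; last first.
    by rewrite !mulr_ge0 ?sqrtr_ge0// exprn_ge0//; case/andP: sr.
  rewrite real_normK ?num_real// !exprMn !sqr_sqrtr//; last by rewrite divr_ge0// ltW.
  have JX : J t (fun x => h k x * h k x) <= X.
    rewrite /X (big_cat_nat _ (n := k))//=; last exact: ltnW.
    rewrite (big_ltn kN) -[leLHS]add0r -[leLHS]addr0 -!addrA lerD//.
      by apply: sumr_ge0.
    by rewrite lerD// sumr_ge0.
  have S := J_scaling hn nu_invariant t 0 (Hh k) (Hh k).
  have {}S : J t (fun x => h k x * h k x) * mom 1 k = mom t k * J 1 (fun x => h k x * h k x).
    by rewrite -[k in mom t k]add0n -S; congr (_ * _); apply: eq_J => y _; rewrite mul1r.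
  have Hs := HP_sup hn nu_invariant nu_boundary x (Hh k); rewrite -/(D k) in Hs.
  have mt := mb k t tt.
  have rk : 0 < r ^+ (2 * k) by exact: exprn_gt0.
  have ark : 0 < a * r ^+ (2 * k) by exact: mulr_gt0.
  have H1 : h k x ^+ 2 * mom t k <= D k * sqn x ^+ k * J t (fun x => h k x * h k x).
    rewrite -(ler_pM2r m0) -[leRHS]mulrA S.
    rewrite [leRHS]mulrCA mulrAC [leRHS]mulrC [leLHS]mulrC [leRHS]mulrC.
    rewrite ler_wpM2l//.
      by apply: ltW; exact: lt_le_trans mt.
  have xk : sqn x ^+ k <= s ^+ (2 * k).
    rewrite -sqr_enorm -exprM; apply: lerXn2r; rewrite ?nnegrE ?enorm_ge0//.
  rewrite -!exprM [(k * 2)%N]mulnC exprVn.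
  have -> : D k * (s ^+ (2 * k) / r ^+ (2 * k)) * (X / a) =
            D k * s ^+ (2 * k) * X / (a * r ^+ (2 * k)).
    by field; rewrite !gt_eqF.
  rewrite ler_pdivlMr//; apply: (@le_trans _ _ (h k x ^+ 2 * mom t k)).
    by rewrite ler_wpM2l// sqr_ge0.
  apply: (le_trans H1); apply: ler_pM => //.
    by rewrite mulr_ge0// exprn_ge0// sqn_ge0.
  by rewrite ler_wpM2l.
have : `|hpart h N x| <= B * Num.sqrt (X / a).
  apply: (le_trans (ler_norm_sum _ _ _)).
  apply: (@le_trans _ _ (\sum_(0 <= k < N) Num.sqrt (D k) * (s / r) ^+ k * Num.sqrt (X / a))).
    by rewrite !big_mkord; apply: ler_sum => k _; exact: hk.
  by rewrite -mulr_suml ler_wpM2r ?sqrtr_ge0//; exact: Bs.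
have B0 : 0 <= B by apply: le_trans (Bs 0%N); rewrite big_geq.
rewrite -(@ler_pXn2r _ 2) ?nnegrE//; last by rewrite mulr_ge0 ?sqrtr_ge0.
rewrite real_normK ?num_real// exprMn sqr_sqrtr; last by rewrite divr_ge0// ltW.
by rewrite mulrA [_ * X]mulrAC.
Qed.

Lemma ibl_mul t f g : measurable_fun (ball_of t : set BV) f ->
  measurable_fun (ball_of t : set BV) g ->
  ibl t (fun x => f x * f x) -> ibl t (fun x => g x * g x) -> ibl t (fun x => f x * g x).
Proof.
move=> mf mg ff gg; have mB := @measurable_ball_of R n t.
apply: (le_integrable mB _ _ (iblD ff gg)).
  by apply/measurable_EFinP; exact: measurable_funM.
move=> x _ /=; rewrite lee_fin [leRHS]ger0_norm; last first.
  by rewrite addr_ge0// -expr2 sqr_ge0.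
by rewrite ler_norml; apply/andP; split; nra.
Qed.

Lemma eps_eq0 (a K : R) : (forall e, 0 < e <= 1 -> `|a| <= K * e) -> a = 0.
Proof.
move=> H; apply/eqP; rewrite -normr_le0 leNgt; apply/negP => a0.
have K0 : 0 <= K by have := H 1; rewrite ltr01 lexx mulr1 => /(_ isT); apply: le_trans.
pose D := (1 + `|a|) * (K + 1).
have D0 : 0 < D by apply: mulr_gt0; lra.
have /H : 0 < `|a| / D <= 1.
  rewrite divr_gt0//= ler_pdivrMr// mul1r /D; nra.
rewrite mulrA ler_pdivlMr// /D; nra.
Qed.

Lemma harmonic_measurable u t : Defs.harmonic unit_ball u -> t <= 1 ->
  measurable_fun (ball_of t : set BV) u.
Proof.
move=> [[cu _] _] t1; apply: measurable_fun_open; first exact: open_ball_of.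
by move=> x xt; apply: cu; exact: lt_le_trans xt t1.
Qed.

Lemma harmonic_bounded u t : Defs.harmonic unit_ball u -> 0 < t < 1 ->
  exists C : R, forall x, enorm x <= t -> `|u x| <= C.
Proof.
move=> hu t01; have [p Hp pu] := harmonic_approx hu t01 ltr01.
have [C pC] := polyfun_bounded t (hpoly_polyfun Hp).
exists (C + 1) => x xt; rewrite -[u x](subrK (p x)) addrC.
by apply: (le_trans (ler_normD _ _)); apply: lerD; [exact: pC|exact: pu].
Qed.

Lemma hpoly_J_scaling p k h t r : hpoly p -> HP k h ->
  mom t k * J r (fun x => p x * h x) = mom r k * J t (fun x => p x * h x).
Proof.
move=> + Hh; have ph := HP_polyfun Hh; elim=> [|l g q Hg Hq IH].
  have Z s : J s (fun x => 0 * h x) = 0.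
    by rewrite /J /Rintegral; under eq_integral do rewrite mul0r; rewrite integral0.
  by rewrite !Z !mulr0.
have pg := HP_polyfun Hg; have pq := hpoly_polyfun Hq.
have E s : J s (fun x => (g x + q x) * h x) =
    J s (fun x => g x * h x) + J s (fun x => q x * h x).
  rewrite -JD; [|by apply: ibl_polyfun; pf..].
  by apply: eq_J => x _; rewrite mulrDl.
rewrite !E !mulrDr IH; congr (_ + _).
have [lk|lk] := eqVneq l k.
  rewrite lk in Hg.
  have m0 : mom 1 k != 0 by rewrite gt_eqF// (mom_gt0 nu_boundary).
  have S s : J s (fun x => g x * h x) * mom 1 k = mom s k * J 1 (fun x => g x * h x).
    rewrite -[k in mom s k]add0n -(J_scaling hn nu_invariant s 0 Hg Hh).
    by congr (_ * _); apply: eq_J => x _; rewrite mul1r.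
  by apply: (mulIf m0); rewrite -!mulrA !S mulrCA.
have Z s : J s (fun x => g x * h x) = 0.
  rewrite -[RHS](HP_orth nu_invariant s 0 hn Hg Hh lk).
  by apply: eq_J => x _; rewrite mul1r.
by rewrite !Z !mulr0.
Qed.

(** The coefficient of [u] along [h] is the same at all radii, up to the moment; this transports
    orthogonality. It is exact for harmonic polynomials and passes to uniform limits on the larger
    of the two balls. *)
Lemma harmonic_J_scaling u k h t r : Defs.harmonic unit_ball u -> HP k h ->
  0 < t < 1 -> 0 < r < 1 ->
  mom t k * J r (fun x => u x * h x) = mom r k * J t (fun x => u x * h x).
Proof.
move=> hu Hh t01 r01; apply/eqP; rewrite -subr_eq0; apply/eqP.
have ph := HP_polyfun Hh.
have [C hC] := polyfun_bounded 1 ph.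
have C0 : 0 <= C.
  by apply: le_trans (hC 0 _); rewrite // enormE /sqn big1 ?sqrtr0// => i _; rewrite mxE expr0n.
apply: (@eps_eq0 _ (C * (`|mom t k| + `|mom r k|))) => e /andP[e0 e1].
pose s := Num.max t r.
have s01 : 0 < s < 1.
  by move: t01 r01 => /andP[? ?] /andP[? ?]; rewrite lt_max gt_max; apply/andP; split;
     [apply/orP; left|apply/andP; split].
have [p Hp pu] := harmonic_approx hu s01 e0.
have pp := hpoly_polyfun Hp.
have D (v : R) : 0 < v < 1 -> v <= s ->
    `|J v (fun x => u x * h x) - J v (fun x => p x * h x)| <= C * e.
  move=> v01 vs; have /andP[v0 v1] := v01.
  have [B uB] := harmonic_bounded hu v01.
  have iu : ibl v (fun x => u x * h x).
    apply: (@ibl_bounded _ _ _ _ _ (B * C)).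
      apply: measurable_funM; first exact: harmonic_measurable hu (ltW v1).
      by apply: measurable_fun_rV; exact: continuous_polyfun.
    move=> x xv; rewrite normrM; apply: ler_pM => //; first exact/uB/ltW.
    by apply: hC; apply: ltW; exact: lt_trans xv v1.
  have ip : ibl v (fun x => p x * h x) by apply: ibl_polyfun; pf.
  rewrite -JB//; apply: J_norm_le => //; first by rewrite mulr_ge0// ltW.
    exact: iblB.
  move=> x xv; rewrite -mulrBl normrM mulrC; apply: ler_pM => //.
    by apply: hC; apply: ltW; exact: lt_trans xv v1.
  by apply: pu; apply: ltW; exact: lt_le_trans xv vs.
have Dt := D t t01 (ltac:(by rewrite /s le_max lexx)).
have Dr := D r r01 (ltac:(by rewrite /s le_max lexx orbT)).
have E := hpoly_J_scaling t r Hp Hh.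
set A := J r _ in Dr E *; set A' := J r _ in Dr E *.
set B := J t _ in Dt E *; set B' := J t _ in Dt E *.
have -> : mom t k * A - mom r k * B = mom t k * (A - A') - mom r k * (B - B').
  by rewrite !mulrBr E; ring.
apply: (le_trans (ler_normB _ _)); rewrite !normrM mulrAC [leRHS]mulrC mulrDl.
by apply: lerD; apply: ler_wpM2l.
Qed.

(** Orthogonality is first moved from radius 1 to [t < 1], by letting one radius of
    [harmonic_J_scaling] tend to 1. There [u] is a uniform limit of harmonic polynomials, hence
    orthogonal to itself. As [nu] may not charge the vicinity of [x], the value [u x] is reached
    through [hpoly_point_evaluation] of the approximants. *)
Lemma harmonic_complete u : Defs.harmonic unit_ball u -> ibl 1 (fun x => u x * u x) ->
  (forall k h, HP k h -> J 1 (fun x => u x * h x) = 0) ->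
  forall x, unit_ball x -> u x = 0.
Proof.
move=> hu uu u0.
have iuh p : polyfun p -> ibl 1 (fun x => u x * p x).
  move=> pp; apply: ibl_mul => //.
  - exact: harmonic_measurable.
  - by apply: measurable_fun_rV; exact: continuous_polyfun.
  - by apply: ibl_polyfun; pf.
have iuh' t p : t <= 1 -> polyfun p -> ibl t (fun x => u x * p x).
  move=> t1 pp; apply: (integrableS (@measurable_ball_of R n 1)) (iuh p pp).
    exact: measurable_ball_of.
  by move=> x xt; exact: lt_le_trans xt t1.
have Z t k h : 0 < t < 1 -> HP k h -> J t (fun x => u x * h x) = 0.
  move=> t01 Hh; have m0 : mom 1 k != 0 by rewrite gt_eqF// (mom_gt0 nu_boundary).
  have ph := HP_polyfun Hh.
  have c1 : mom t k * J (1 - m.+2%:R^-1) (fun x => u x * h x) @[m --> \oo] -->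
      mom t k * J 1 (fun x => u x * h x).
    by apply: cvgMl_tmp; exact: J_cvg (iuh _ ph).
  have c2 : mom (1 - m.+2%:R^-1) k * J t (fun x => u x * h x) @[m --> \oo] -->
      mom 1 k * J t (fun x => u x * h x).
    by apply: cvgMr_tmp; apply: J_cvg; apply: ibl_polyfun; pf.
  have E : (fun m : nat => mom t k * J (1 - m.+2%:R^-1) (fun x => u x * h x)) =
      fun m : nat => mom (1 - m.+2%:R^-1) k * J t (fun x => u x * h x).
    apply/funext => m; apply: harmonic_J_scaling => //.
    by rewrite subr_gt0 invf_lt1// ltr1n/= ltrBlDr ltrDl invr_gt0.
  rewrite E (u0 k h Hh) mulr0 in c1.
  by apply: (mulfI m0); rewrite mulr0; exact: cvg_unique c2 c1.
have Zp t p : 0 < t < 1 -> hpoly p -> J t (fun x => u x * p x) = 0.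
  move=> t01; elim=> [|k h q Hh Hq IH].
    by rewrite /J /Rintegral; under eq_integral do rewrite mulr0; rewrite integral0.
  have ph := HP_polyfun Hh; have pq := hpoly_polyfun Hq; have /andP[_ /ltW t1] := t01.
  under [X in J t X]funext do rewrite mulrDr.
  by rewrite JD ?IH ?(Z t k)// ?addr0//; exact: iuh'.
have iu2 t : t <= 1 -> ibl t (fun x => u x * u x).
  move=> t1; apply: (integrableS (@measurable_ball_of R n 1)) uu.
    exact: measurable_ball_of.
  by move=> x xt; exact: lt_le_trans xt t1.
have Zu t : 0 < t < 1 -> J t (fun x => u x * u x) = 0.
  move=> t01; have /andP[t0 /ltW t1] := t01; have [C uC] := harmonic_bounded hu t01.
  apply: (@eps_eq0 _ `|C|) => e /andP[e0 _].
  have [p Hp pu] := harmonic_approx hu t01 e0; have pp := hpoly_polyfun Hp.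
  rewrite -[X in `|X|]subr0 -(Zp t p t01 Hp) -JB; [|exact: iu2|exact: iuh'].
  apply: J_norm_le; [by rewrite mulr_ge0// ltW|by apply: iblB; [exact: iu2|exact: iuh']|].
  move=> x /ltW xt; rewrite -mulrBr normrM; apply: ler_pM => //; last exact: pu.
  by apply: (le_trans (uC x xt)); exact: ler_norm.
move=> x x1; have s01 : 0 <= enorm x < 1 by rewrite enorm_ge0.
have [t0 [C [/andP[t00 t01] C0] bpe]] := hpoly_point_evaluation s01.
pose t := Num.max t0 (enorm x).
have tt : 0 < t < 1 by rewrite lt_max gt_max t00 t01.
have /andP[_ /ltW t1] := tt.
have tx : enorm x <= t by rewrite le_max lexx orbT.
apply/eqP; rewrite -sqrf_eq0; apply/eqP; apply: (@eps_eq0 _ (2 + 2 * C)) => e /andP[e0 e1].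
have [p Hp pu] := harmonic_approx hu tt e0; have pp := hpoly_polyfun Hp.
have := bpe t p x (ltac:(by rewrite le_max lexx)) Hp (lexx _).
have iup : ibl t (fun y => (u y - p y) * (u y - p y)).
  rewrite (_ : (fun _ => _) = fun y => (u y * u y - 2 * (u y * p y)) + p y * p y).
    by apply: iblD; [apply: iblB; [exact: iu2|exact/iblZ/iuh']|apply: ibl_polyfun; pf].
  by apply/funext => y; ring.
(* On this ball [u] is orthogonal to [p] and to itself, so subtracting it does not change the norm
   of [p]. *)
have -> : J t (fun y => p y * p y) = J t (fun y => (u y - p y) * (u y - p y)).
  rewrite -[RHS]addr0 -[in X in _ = _ + X](mulr0 2) -(Zp t p tt Hp) -JZ; last exact: iuh'.
  rewrite -[LHS]addr0 -(Zu t tt) -!JD//.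
  - by apply: eq_J => y _; ring.
  - by apply: ibl_polyfun; pf.
  - exact: iu2.
  - exact/iblZ/iuh'.
have Je : J t (fun y => (u y - p y) * (u y - p y)) <= e ^+ 2.
  apply: (le_trans (ler_norm _)); apply: J_norm_le => //; first exact: sqr_ge0.
  by move=> y /ltW yt; rewrite normrM expr2; apply: ler_pM => //; exact: pu.
have := pu x tx; rewrite ler_norml => /andP[u1 u2] pC.
have e2 : e ^+ 2 <= e by rewrite expr2 ler_piMl// ltW.
rewrite ger0_norm ?sqr_ge0//.
have up : (u x - p x) ^+ 2 <= e ^+ 2 by rewrite expr2 [leRHS]expr2; nra.
have {pC} pC : p x ^+ 2 <= C * e by apply: (le_trans pC); rewrite ler_wpM2l// (le_trans Je).
have -> : u x ^+ 2 = 2 * (u x - p x) ^+ 2 + 2 * p x ^+ 2 - (u x - 2 * p x) ^+ 2 by ring.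
have := sqr_ge0 (u x - 2 * p x); lra.
Qed.

End harmonic_completeness.

(** * Complex-valued functions *)

Section complex_modulus.
Context {R : realType}.
Implicit Types (z w a : R[i]).

Lemma complex_ext z w : Re z = Re w -> Im z = Im w -> z = w.
Proof. by case: z w => [? ?] [? ?] /= -> ->. Qed.

Lemma ReD z w : Re (z + w) = Re z + Re w. Proof. by case: z w => [? ?] [? ?]. Qed.
Lemma ImD z w : Im (z + w) = Im z + Im w. Proof. by case: z w => [? ?] [? ?]. Qed.
Lemma ReN z : Re (- z) = - Re z. Proof. by case: z. Qed.
Lemma ImN z : Im (- z) = - Im z. Proof. by case: z. Qed.
Lemma ReM z w : Re (z * w) = Re z * Re w - Im z * Im w.
Proof. by case: z w => [? ?] [? ?]. Qed.
Lemma ImM z w : Im (z * w) = Re z * Im w + Im z * Re w.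
Proof. by case: z w => [? ?] [? ?]. Qed.
Lemma ReJ z : Re (conjc z) = Re z. Proof. by case: z. Qed.
Lemma ImJ z : Im (conjc z) = - Im z. Proof. by case: z. Qed.

Lemma conjcD z w : conjc (z + w) = conjc z + conjc w.
Proof. by apply: complex_ext; rewrite !(ReJ, ImJ, ReD, ImD)// opprD. Qed.
Lemma conjcN z : conjc (- z) = - conjc z. Proof. by case: z. Qed.
Lemma conjcM z w : conjc (z * w) = conjc z * conjc w.
Proof. by apply: complex_ext; rewrite !(ReJ, ImJ, ReM, ImM); ring. Qed.

Definition cE := (ReD, ImD, ReN, ImN, ReM, ImM, ReJ, ImJ).

Lemma Re_sum I (s : seq I) (P : pred I) (F : I -> R[i]) :
  Re (\sum_(i <- s | P i) F i) = \sum_(i <- s | P i) Re (F i).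
Proof. exact: (big_morph _ ReD). Qed.

Lemma Im_sum I (s : seq I) (P : pred I) (F : I -> R[i]) :
  Im (\sum_(i <- s | P i) F i) = \sum_(i <- s | P i) Im (F i).
Proof. exact: (big_morph _ ImD). Qed.

Lemma sqmod_ge0 z : 0 <= sqmod z.
Proof. by rewrite addr_ge0 ?sqr_ge0. Qed.

Lemma sqmodM z w : sqmod (z * w) = sqmod z * sqmod w.
Proof. by rewrite /sqmod !cE; ring. Qed.

Lemma sqmodJ z : sqmod (conjc z) = sqmod z.
Proof. by rewrite /sqmod !cE sqrrN. Qed.

Lemma mulcJ z : z * conjc z = (sqmod z)%:C.
Proof. by apply: complex_ext; rewrite /sqmod !cE /=; ring. Qed.

(** The norm of [R[i]] takes its values in [R[i]]; the estimates need a modulus in [R]. *)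
Definition cmod z : R := Num.sqrt (sqmod z).

Lemma normcE z : `|z| = (cmod z)%:C.
Proof. by rewrite normc_def. Qed.

Lemma sqr_cmod z : cmod z ^+ 2 = sqmod z.
Proof. by rewrite sqr_sqrtr ?sqmod_ge0. Qed.

Lemma cmod_ge0 z : 0 <= cmod z. Proof. exact: sqrtr_ge0. Qed.

Lemma cmodJ z : cmod (conjc z) = cmod z.
Proof. by rewrite /cmod sqmodJ. Qed.

Lemma cmodR (r : R) : cmod r%:C = `|r|.
Proof. by rewrite /cmod /sqmod /= expr0n addr0 sqrtr_sqr. Qed.

Lemma cmod_eq0 z : cmod z = 0 -> z = 0.
Proof.
move=> z0; have := sqr_cmod z; rewrite z0 expr0n /sqmod => /esym/eqP.
by rewrite paddr_eq0 ?sqr_ge0// !sqrf_eq0 => /andP[/eqP ? /eqP ?]; exact: complex_ext.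
Qed.

Lemma cmod0 : cmod 0 = 0.
Proof. by rewrite (cmodR 0) normr0. Qed.

Lemma cmodD z w : cmod (z + w) <= cmod z + cmod w.
Proof. by have := ler_normD z w; rewrite !normcE -rmorphD lecR. Qed.

Lemma cmodN z : cmod (- z) = cmod z.
Proof. by rewrite /cmod /sqmod !cE !sqrrN. Qed.

Lemma Re_le_cmod z : `|Re z| <= cmod z.
Proof. by rewrite -sqrtr_sqr ler_wsqrtr// lerDl sqr_ge0. Qed.

Lemma Im_le_cmod z : `|Im z| <= cmod z.
Proof. by rewrite -sqrtr_sqr ler_wsqrtr// lerDr sqr_ge0. Qed.

Lemma cmod_le z : cmod z <= `|Re z| + `|Im z|.
Proof.
rewrite -(@ler_pXn2r _ 2) ?nnegrE ?cmod_ge0 ?addr_ge0// sqr_cmod /sqmod.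
rewrite -(real_normK (num_real (Re z))) -(real_normK (num_real (Im z))).
have := normr_ge0 (Re z); have := normr_ge0 (Im z); nra.
Qed.

Lemma cvg_complexP (T : Type) (F : set_system T) (FF : Filter F) (f : T -> R[i]) (l : R[i]) :
  f @ F --> l <-> ((fun x => Re (f x)) @ F --> Re l) /\ ((fun x => Im (f x)) @ F --> Im l).
Proof.
split=> [/cvgrPdist_lt cf|[/cvgrPdist_lt cr /cvgrPdist_lt ci]].
  split; apply/cvgrPdist_lt => e e0.
    have := cf e%:C; rewrite ltcR => /(_ e0); apply: filterS => x.
    rewrite normcE ltcR => /(le_lt_trans _); apply.
    by have := Re_le_cmod (l - f x); rewrite !cE.
  have := cf e%:C; rewrite ltcR => /(_ e0); apply: filterS => x.
  rewrite normcE ltcR => /(le_lt_trans _); apply.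
  by have := Im_le_cmod (l - f x); rewrite !cE.
(* A positive element of [R[i]] has imaginary part 0, so its real part serves as the radius. *)
apply/cvgrPdist_lt => e; rewrite ltcE/= => /andP[/eqP ie re].
have e2 : 0 < Re e / 2 by rewrite divr_gt0.
apply: filterS2 (cr _ e2) (ci _ e2) => x /= h1 h2.
rewrite normcE ltcE/= ie eqxx/=; apply: le_lt_trans (cmod_le _) _.
by rewrite !cE [ltRHS](_ : _ = Re e / 2 + Re e / 2); [exact: ltrD|field].
Qed.

Lemma continuous_complexP (T : topologicalType) (f : T -> R[i]) :
  continuous f <-> continuous (fun x => Re (f x)) /\ continuous (fun x => Im (f x)).
Proof.
split=> [cf|[cr ci] x]; last by apply/cvg_complexP; split; [exact: cr|exact: ci].
by split=> x; have /cvg_complexP[] := cf x.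
Qed.

End complex_modulus.

Ltac ib := repeat first [assumption | apply: iblB | apply: iblD | apply: iblZ].

(** * The inner product on square integrable functions *)

Section complex_L2.
Context {R : realType} {n : nat}.
Variable nu : probability (borel_rV R n) R.
Local Notation V := 'rV[R]_n.
Local Notation BV := (borel_rV R n).
Local Notation J := (J nu).
Local Notation ibl := (ibl nu).
Local Notation inner := (inner nu).
Local Notation N := (L2norm nu).
Local Notation L2 := (in_L2 nu).
Implicit Types (u v w : V -> R[i]) (x y : V) (a : R[i]).

Lemma in_L2P u : L2 u <->
  [/\ measurable_fun (ball_of 1 : set BV) (fun x => Re (u x)),
      measurable_fun (ball_of 1 : set BV) (fun x => Im (u x)),
      ibl 1 (fun x => Re (u x) * Re (u x)) & ibl 1 (fun x => Im (u x) * Im (u x))].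
Proof.
have mB := @measurable_ball_of R n 1.
split=> [[mr mi fi]|[mr mi ir ii]]; last first.
  split=> //; have /integrableP[_] := iblD ir ii.
  by apply: le_lt_trans; apply: ge0_le_integral => //;
    [move=> x _; rewrite lee_fin sqmod_ge0
    |apply/measurable_EFinP; apply: measurable_funD; exact: measurable_funX
    |apply/measurable_EFinP; apply: measurableT_comp => //;
      apply: measurable_funD; exact: measurable_funM
    |move=> x _ /=; rewrite lee_fin -!expr2 ler_norm].
have mS : measurable_fun (ball_of 1 : set BV) (fun x => sqmod (u x)).
  by apply: measurable_funD; exact: measurable_funX.
have iS : ibl 1 (fun x => sqmod (u x)).
  apply/integrableP; split; first exact/measurable_EFinP.
  apply: le_lt_trans fi; apply: ge0_le_integral => //.
  - by apply/measurable_EFinP; exact: measurableT_comp.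
  - exact/measurable_EFinP.
  - by move=> x _ /=; rewrite lee_fin ger0_norm ?sqmod_ge0.
split=> //; apply: (le_integrable mB _ _ iS).
- by apply/measurable_EFinP; exact: measurable_funM.
- move=> x _ /=; rewrite lee_fin ger0_norm -?expr2 ?sqr_ge0//.
  by rewrite ger0_norm ?sqmod_ge0// lerDl sqr_ge0.
- by apply/measurable_EFinP; exact: measurable_funM.
- move=> x _ /=; rewrite lee_fin ger0_norm -?expr2 ?sqr_ge0//.
  by rewrite ger0_norm ?sqmod_ge0// lerDr sqr_ge0.
Qed.

Lemma L2_ibl u v : L2 u -> L2 v ->
  [/\ ibl 1 (fun x => Re (u x) * Re (v x)), ibl 1 (fun x => Im (u x) * Im (v x)),
      ibl 1 (fun x => Re (u x) * Im (v x)) & ibl 1 (fun x => Im (u x) * Re (v x))].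
Proof. by move=> /in_L2P[? ? ? ?] /in_L2P[? ? ? ?]; split; exact: ibl_mul. Qed.

Lemma Re_inner u v : Re (inner u v) =
  J 1 (fun x => Re (u x) * Re (v x) + Im (u x) * Im (v x)).
Proof. by apply: eq_J => x _; rewrite !cE; ring. Qed.

Lemma Im_inner u v : Im (inner u v) =
  J 1 (fun x => Im (u x) * Re (v x) - Re (u x) * Im (v x)).
Proof. by apply: eq_J => x _; rewrite !cE; ring. Qed.

Lemma inner_linl a u v w : L2 u -> L2 v -> L2 w ->
  inner (fun x => a * u x + v x) w = a * inner u w + inner v w.
Proof.
move=> Lu Lv Lw; have [r1 r2 r3 r4] := L2_ibl Lu Lw; have [s1 s2 s3 s4] := L2_ibl Lv Lw.
apply: complex_ext; rewrite !cE !(Re_inner, Im_inner).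
  rewrite -!JZ; [|by ib..]; rewrite -JB; [|by ib..]; rewrite -JD; [|by ib..].
  by apply: eq_J => x _; rewrite !cE; ring.
rewrite -!JZ; [|by ib..]; rewrite -!JD; [|by ib..].
by apply: eq_J => x _; rewrite !cE; ring.
Qed.

Lemma innerJ u v : L2 u -> L2 v -> inner v u = conjc (inner u v).
Proof.
move=> Lu Lv; have [r1 r2 r3 r4] := L2_ibl Lu Lv.
apply: complex_ext; rewrite !cE !(Re_inner, Im_inner).
  by apply: eq_J => x _; ring.
rewrite -mulN1r -JZ; last exact: iblB.
by apply: eq_J => x _; ring.
Qed.

Lemma L2norm_ge0 u : 0 <= N u. Proof. exact: sqrtr_ge0. Qed.

Lemma innerE u : inner u u = (N u ^+ 2)%:C.
Proof.
apply: complex_ext; rewrite (Re_inner, Im_inner) /=; last first.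
  rewrite (_ : (fun _ => _) = fun=> 0); first by rewrite /J /Rintegral integral0.
  by apply/funext => x; ring.
rewrite sqr_sqrtr; first by apply: eq_J => x _; rewrite -!expr2.
by apply: (@J_ge0 _ _ nu 1) => x _; exact: sqmod_ge0.
Qed.

Lemma L2_lin a u v : L2 u -> L2 v -> L2 (fun x => a * u x + v x).
Proof. exact: in_L2_lin. Qed.

Lemma L2_0 : L2 (fun=> 0).
Proof.
split; [exact: measurable_cst..|].
rewrite (_ : (fun x => _) = cst 0%E) ?integral0 ?ltry//.
by apply/funext => x /=; rewrite /sqmod /= expr0n addr0.
Qed.

Lemma sqr_L2norm_lin a u v : L2 u -> L2 v ->
  N (fun x => a * u x + v x) ^+ 2 =
  sqmod a * N u ^+ 2 + N v ^+ 2 + 2 * Re (a * inner u v).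
Proof.
move=> Lu Lv; have Lw := L2_lin a Lu Lv.
suff -> : N (fun x => a * u x + v x) ^+ 2 = Re (a * inner u (fun x => a * u x + v x) +
    inner v (fun x => a * u x + v x)).
  rewrite (innerJ Lw Lu) (innerJ Lw Lv) !inner_linl// (innerJ Lu Lv) !innerE.
  by rewrite !cE /= /sqmod; ring.
by rewrite -inner_linl// innerE.
Qed.

Lemma cauchy_schwarz u v : L2 u -> L2 v -> cmod (inner u v) <= N u * N v.
Proof.
move=> Lu Lv; have Nu0 := L2norm_ge0 u; have Nv0 := L2norm_ge0 v.
rewrite -(@ler_pXn2r _ 2) ?nnegrE ?cmod_ge0 ?mulr_ge0// sqr_cmod exprMn.
set z := inner u v.
have H (s : R) : 0 <= s ^+ 2 * sqmod z * N u ^+ 2 + N v ^+ 2 + 2 * s * sqmod z.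
  have := sqr_ge0 (N (fun x => (s%:C * conjc z) * u x + v x)).
  rewrite sqr_L2norm_lin// sqmodM sqmodJ -/z.
  suff -> : sqmod s%:C * sqmod z * N u ^+ 2 + N v ^+ 2 + 2 * Re (s%:C * conjc z * z) =
    s ^+ 2 * sqmod z * N u ^+ 2 + N v ^+ 2 + 2 * s * sqmod z by [].
  by rewrite !cE /sqmod /=; ring.
have z0 := sqmod_ge0 z; move: H z0; move: (sqmod z) (N u ^+ 2) (sqr_ge0 (N u)) (N v ^+ 2)
  (sqr_ge0 (N v)) => Z A A0 B B0 H Z0.
have [Z1|Z1] := eqVneq Z 0; first by rewrite Z1 mulr_ge0.
have Zp : 0 < Z by rewrite lt_def Z1.
(* A function of norm 0 need not vanish, so this case is separate: the inequality is then affine in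
   [s], with positive slope, and fails for [s] very negative. *)
have [A1|A1] := eqVneq A 0.
  have := H (- (B + 1) / Z); rewrite A1 mulr0 add0r.
  have -> : B + 2 * (- (B + 1) / Z) * Z = - B - 2 by field.
  by lra.
have Ap : 0 < A by rewrite lt_def A1.
have := H (- A^-1).
have -> : (- A^-1) ^+ 2 * Z * A + B + 2 * - A^-1 * Z = (A * B - Z) / A by field.
by rewrite pmulr_lge0 ?invr_gt0// subr_ge0.
Qed.

Lemma L2normD u v : L2 u -> L2 v -> N (fun x => u x + v x) <= N u + N v.
Proof.
move=> Lu Lv; have Nu0 := L2norm_ge0 u; have Nv0 := L2norm_ge0 v.
rewrite -(@ler_pXn2r _ 2) ?nnegrE ?L2norm_ge0 ?addr_ge0//.
have -> : (fun x => u x + v x) = (fun x => 1 * u x + v x).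
  by apply/funext => x; rewrite mul1r.
rewrite sqr_L2norm_lin// mul1r.
have := cauchy_schwarz Lu Lv; have := Re_le_cmod (inner u v); rewrite ler_norml.
rewrite /sqmod /= expr1n expr0n addr0 => /andP[_ h1] h2; nra.
Qed.

Lemma L2normZ a u : L2 u -> N (fun x => a * u x) = cmod a * N u.
Proof.
move=> /in_L2P[_ _ ir ii]; rewrite /L2norm /cmod -sqrtrM ?sqmod_ge0//.
congr Num.sqrt; rewrite -[in RHS]/(J 1 _) -JZ.
  by apply: eq_J => x _; rewrite sqmodM.
by apply: eq_ibl (iblD ir ii) => x _; rewrite -!expr2.
Qed.

Definition multiplier (f : V -> R[i]) (C : R) : Prop :=
  [/\ measurable_fun (ball_of 1 : set BV) (fun x => Re (f x)),
      measurable_fun (ball_of 1 : set BV) (fun x => Im (f x)), 0 <= C &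
      forall x, unit_ball x -> cmod (f x) <= C].

Lemma multiplier_L2 f C u : multiplier f C -> L2 u ->
  L2 (fun x => f x * u x) /\ N (fun x => f x * u x) <= C * N u.
Proof.
move=> [mr mi C0 fC] Lu; have /in_L2P[ur ui ir ii] := Lu.
have mB := @measurable_ball_of R n 1.
have iS : ibl 1 (fun x => sqmod (u x)).
  by apply: eq_ibl (iblD ir ii) => x _; rewrite -!expr2.
have mR : measurable_fun (ball_of 1 : set BV) (fun x => Re (f x * u x)).
  under eq_fun do rewrite cE; by apply: measurable_funB; exact: measurable_funM.
have mI : measurable_fun (ball_of 1 : set BV) (fun x => Im (f x * u x)).
  under eq_fun do rewrite cE; by apply: measurable_funD; exact: measurable_funM.
have le x : ball_of 1 x -> sqmod (f x * u x) <= C ^+ 2 * sqmod (u x).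
  move=> x1; rewrite sqmodM ler_wpM2r ?sqmod_ge0// -sqr_cmod.
  by rewrite lerXn2r ?nnegrE ?cmod_ge0//; exact: fC.
have mS : measurable_fun (ball_of 1 : set BV) (fun x => sqmod (f x * u x)).
  by apply: measurable_funD; exact: measurable_funX.
have iS' : ibl 1 (fun x => sqmod (f x * u x)).
  apply: (le_integrable mB _ _ (iblZ (C ^+ 2) iS)); first exact/measurable_EFinP.
  move=> x x1 /=; rewrite lee_fin ger0_norm ?sqmod_ge0// ger0_norm; first exact: le.
  by rewrite mulr_ge0 ?sqr_ge0 ?sqmod_ge0.
split.
  split=> //; have /integrableP[_] := iS'; apply: le_lt_trans.
  apply: ge0_le_integral => //.
  - by move=> x _; rewrite lee_fin sqmod_ge0.
  - exact/measurable_EFinP.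
  - by apply/measurable_EFinP; exact: measurableT_comp.
  - by move=> x _ /=; rewrite lee_fin ler_norm.
rewrite -[leRHS]ger0_norm; last by rewrite mulr_ge0 ?L2norm_ge0.
rewrite -sqrtr_sqr /L2norm ler_wsqrtr// exprMn sqr_sqrtr; last first.
  by apply: (@J_ge0 _ _ nu 1) => x _; exact: sqmod_ge0.
rewrite -[in leRHS]/(J 1 _) -JZ//; apply: le_J => //.
exact: iblZ.
Qed.

Lemma inner_mul f u v : inner (fun x => f x * u x) v = inner u (fun x => conjc (f x) * v x).
Proof.
by apply: complex_ext; rewrite (Re_inner, Im_inner) (Re_inner, Im_inner);
  apply: eq_J => x _; rewrite !cE; ring.
Qed.

End complex_L2.

(** * The harmonic Bergman space *)

Section bergman_space.
Context {R : realType} {n : nat}.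
Variable nu : probability (borel_rV R n) R.
Local Notation V := 'rV[R]_n.
Local Notation BV := (borel_rV R n).
Local Notation J := (J nu).
Local Notation ibl := (ibl nu).
Local Notation ip := (inner nu).
Local Notation N := (L2norm nu).
Local Notation L2 := (in_L2 nu).
Local Notation H := (b2 nu).
Implicit Types (u v w : H) (f g : V -> R) (x y : V) (a : R[i]) (k l M : nat).

Lemma b2_mem u : (u : V -> R[i]) \in harmonic_L2 nu.
Proof. by case: u. Qed.

Lemma b2_L2 u : L2 u.
Proof. by have /asboolP[] := b2_mem u. Qed.

Lemma b2_out u x : ~ unit_ball x -> u x = 0.
Proof. by have /asboolP[h _ _ _] := b2_mem u; exact: h. Qed.

Lemma b2_harmonic u : Defs.harmonic unit_ball (fun x => Re (u x)) /\
  Defs.harmonic unit_ball (fun x => Im (u x)).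
Proof. by have /asboolP[_ h1 h2 _] := b2_mem u. Qed.

Lemma b2_eq u v : (forall x, unit_ball x -> u x = v x) -> u = v.
Proof.
move=> uv; apply: val_inj; apply/funext => x.
by have [/uv//|x1] := pselect (unit_ball x); rewrite /= !b2_out.
Qed.

Lemma b2D u v x : (u + v) x = u x + v x.
Proof. by []. Qed.
Lemma b2Z a u x : (a *: u) x = a * u x.
Proof. by []. Qed.
Lemma b2N u x : (- u) x = - u x.
Proof. by []. Qed.
Lemma b20 x : (0 : H) x = 0.
Proof. by []. Qed.

Lemma b2_sum I (s : seq I) (P : pred I) (F : I -> H) x :
  (\sum_(i <- s | P i) F i) x = \sum_(i <- s | P i) F i x.
Proof. exact: (big_morph (fun u : H => u x) (fun u v => b2D u v x) (b20 x)). Qed.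

(** Elements of [b2 nu] must vanish outside the ball, which harmonic polynomials do not. *)
Definition cut f g : V -> R[i] := fun x => if enorm x < 1 then f x +i* g x else 0.

Lemma cut_in f g x : unit_ball x -> cut f g x = f x +i* g x.
Proof. by rewrite /unit_ball/cut/= => ->. Qed.

Lemma cut_mem f g : Defs.harmonic unit_ball f -> Defs.harmonic unit_ball g ->
  ibl 1 (fun x => f x * f x) -> ibl 1 (fun x => g x * g x) ->
  cut f g \in harmonic_L2 nu.
Proof.
move=> hf hg ff gg.
have hE h h' : (forall x, unit_ball x -> h x = h' x) -> Defs.harmonic unit_ball h ->
    Defs.harmonic (@unit_ball R n) h'.
  move=> E hh; have := harmonic_lin 1 0 (@open_unit_ball R n) hh hh.
  move=> [C L]; split; first by apply: Ck_ext C => [|x x1]; [exact: open_unit_ball|rewrite mul0r mul1r addr0 E].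
  move=> x x1; rewrite -[RHS](L x x1); apply: eq_bigr => i _.
  apply: near_eq_derive; apply: (near_open_eq (@open_unit_ball R n) x1) => y y1.
  apply: near_eq_derive; apply: (near_open_eq (@open_unit_ball R n) y1) => z z1.
  by rewrite mul0r mul1r addr0 E.
apply/asboolP; split.
- by move=> x /negP; rewrite /cut => /negbTE ->.
- by apply: hE hf => x x1; rewrite cut_in.
- by apply: hE hg => x x1; rewrite cut_in.
apply/in_L2P; split.
- apply: (@eq_measurable_fun _ _ BV R _ f) (harmonic_measurable hf (lexx 1)) => x.
  by rewrite inE => x1; rewrite cut_in.
- apply: (@eq_measurable_fun _ _ BV R _ g) (harmonic_measurable hg (lexx 1)) => x.
  by rewrite inE => x1; rewrite cut_in.
- by apply: eq_ibl ff => x x1; rewrite cut_in.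
- by apply: eq_ibl gg => x x1; rewrite cut_in.
Qed.

Lemma ip_linl a u v w : ip (a *: u + v) w = a * ip u w + ip v w.
Proof. exact: (inner_linl _ (b2_L2 u) (b2_L2 v) (b2_L2 w)). Qed.

Lemma ipJ u v : ip v u = conjc (ip u v).
Proof. exact: (innerJ (b2_L2 u) (b2_L2 v)). Qed.

Lemma ipDl u v w : ip (u + v) w = ip u w + ip v w.
Proof. by have := ip_linl 1 u v w; rewrite scale1r mul1r. Qed.

Lemma ip0l w : ip (0 : H) w = 0.
Proof. by apply: (addrI (ip (0 : H) w)); rewrite -ipDl !addr0. Qed.

Lemma ipZl a u w : ip (a *: u) w = a * ip u w.
Proof. by have := ip_linl a u 0 w; rewrite ip0l !addr0. Qed.

Lemma ipNl u w : ip (- u) w = - ip u w.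
Proof. by rewrite -scaleN1r ipZl mulN1r. Qed.

Lemma ipBl u v w : ip (u - v) w = ip u w - ip v w.
Proof. by rewrite ipDl ipNl. Qed.

Lemma ip_suml I (s : seq I) (P : pred I) (F : I -> H) w :
  ip (\sum_(i <- s | P i) F i) w = \sum_(i <- s | P i) ip (F i) w.
Proof. exact: (big_morph (fun u : H => ip u w) (fun u v => ipDl u v w) (ip0l w)). Qed.

Lemma ipDr u v w : ip w (u + v) = ip w u + ip w v.
Proof. by rewrite ipJ ipDl conjcD -!ipJ. Qed.

Lemma ipZr a u w : ip w (a *: u) = conjc a * ip w u.
Proof. by rewrite ipJ ipZl conjcM -!ipJ. Qed.

Lemma ipNr u w : ip w (- u) = - ip w u.
Proof. by rewrite ipJ ipNl conjcN -!ipJ. Qed.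

Lemma ipBr u v w : ip w (u - v) = ip w u - ip w v.
Proof. by rewrite ipDr ipNr. Qed.

Lemma ip0r w : ip w (0 : H) = 0.
Proof. by rewrite ipJ ip0l conjc0. Qed.

Lemma ip_sumr I (s : seq I) (P : pred I) (F : I -> H) w :
  ip w (\sum_(i <- s | P i) F i) = \sum_(i <- s | P i) ip w (F i).
Proof. exact: (big_morph (fun u : H => ip w u) (fun u v => ipDr u v w) (ip0r w)). Qed.

Lemma ip_cs u v : cmod (ip u v) <= N u * N v.
Proof. exact: (cauchy_schwarz (b2_L2 u) (b2_L2 v)). Qed.

Lemma hnormD u v : N (u + v) <= N u + N v.
Proof. exact: (L2normD (b2_L2 u) (b2_L2 v)). Qed.

Lemma hnormZ a u : N (a *: u) = cmod a * N u.
Proof. exact: (L2normZ _ (b2_L2 u)). Qed.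

Lemma hnorm0 : N (0 : H) = 0.
Proof. by rewrite -(scale0r (0 : H)) hnormZ cmod0 mul0r. Qed.

Lemma hnormN u : N (- u) = N u.
Proof. by rewrite -scaleN1r hnormZ cmodN (cmodR 1) normr1 mul1r. Qed.

Lemma hnormB u v : N (u - v) <= N u + N v.
Proof. by rewrite -(hnormN v) hnormD. Qed.

Hypothesis hn : (2 <= n)%N.
Hypothesis nu_invariant : orthogonally_invariant nu.
Hypothesis nu_boundary : charges_boundary nu.
Local Notation he := (he hn nu_invariant nu_boundary).
Local Notation hdim := (hdim hn nu_invariant nu_boundary).

Lemma e_subproof k l : {u : H | forall x, unit_ball x -> u x = (he k l x)%:C}.
Proof.
have ph := HP_polyfun (he_HP hn nu_invariant nu_boundary k l).
have m : cut (he k l) (fun=> 0) \in harmonic_L2 nu.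
  apply: cut_mem.
  - exact/(hpoly_harmonic hn)/HP_hpoly/he_HP.
  - exact/(hpoly_harmonic hn)/hpoly0.
  - by apply: ibl_polyfun; pf.
  - by apply: ibl_polyfun; pf.
by exists (B2 m) => x x1; rewrite /= cut_in.
Qed.

Definition e k l : H := sval (e_subproof k l).

Lemma eE k l x : unit_ball x -> e k l x = (he k l x)%:C.
Proof. exact: (svalP (e_subproof k l)). Qed.

Lemma ip_e u k l : ip u (e k l) =
  J 1 (fun x => Re (u x) * he k l x) +i* J 1 (fun x => Im (u x) * he k l x).
Proof.
by apply: complex_ext; rewrite (Re_inner, Im_inner); apply: eq_J => x x1;
  rewrite eE//= mulr0 ?addr0 ?subr0.
Qed.

Lemma e_orthonormal k l k' l' : (l < hdim k)%N -> (l' < hdim k')%N ->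
  ip (e k l) (e k' l') = ((k == k') && (l == l'))%:R.
Proof.
move=> kl kl'; rewrite ip_e.
have -> : J 1 (fun x => Im (e k l x) * he k' l' x) = 0.
  rewrite (@eq_J _ _ _ _ _ (fun=> 0)) => [|x x1]; first by rewrite /J /Rintegral integral0.
  by rewrite eE//= mul0r.
have -> : J 1 (fun x => Re (e k l x) * he k' l' x) = J 1 (fun x => he k l x * he k' l' x).
  by apply: eq_J => x x1; rewrite eE.
have [kk|kk] := eqVneq k k'; last first.
  have := HP_orth nu_invariant 1 0 hn (he_HP hn nu_invariant nu_boundary k l)
    (he_HP hn nu_invariant nu_boundary k' l') kk.
  by rewrite (@eq_J _ _ _ _ _ (fun x => he k l x * he k' l' x)) => [->//|x _]; rewrite mul1r.
by subst k'; rewrite he_orthonormal//=; case: eqP.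
Qed.

Lemma norm_e k l : (l < hdim k)%N -> N (e k l) = 1.
Proof.
move=> kl; have := innerE nu (e k l); rewrite e_orthonormal// !eqxx /=.
move=> /(congr1 (@Re R))/=/esym/eqP; rewrite sqrf_eq1 => /orP[/eqP//|/eqP E].
by have := L2norm_ge0 nu (e k l); rewrite E ler0N1.
Qed.

Definition lincomb (c : nat -> nat -> R[i]) M : H :=
  \sum_(0 <= k < M) \sum_(l < hdim k) c k l *: e k l.

Lemma ip_lincomb c M k l : (l < hdim k)%N ->
  ip (lincomb c M) (e k l) = if (k < M)%N then c k l else 0.
Proof.
move=> kl; rewrite /lincomb ip_suml.
have E k' : ip (\sum_(l' < hdim k') c k' l' *: e k' l') (e k l) =
    if k' == k then c k l else 0.
  rewrite ip_suml; have [kk|kk] := eqVneq k' k; last first.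
    by rewrite big1// => l' _; rewrite ipZl e_orthonormal// (negbTE kk) mulr0.
  subst k'; rewrite (bigD1 (Ordinal kl))//= ipZl e_orthonormal// !eqxx mulr1.
  rewrite big1 ?addr0// => l' ll; rewrite ipZl e_orthonormal// eqxx/=.
  by move: ll; rewrite -val_eqE/= => /negbTE ->; rewrite mulr0.
rewrite (eq_bigr _ (fun k' _ => E k')); case: ifPn => kM.
  rewrite big_mkord (bigD1 (Ordinal kM))//= eqxx big1 ?addr0// => k' kk.
  by move: kk; rewrite -val_eqE/= => /negbTE ->.
rewrite big_nat_cond big1// => k' /andP[/andP[_ kM'] _]; case: eqP => // kk.
by move: kM; rewrite -kk kM'.
Qed.

Definition sqsum (c : nat -> nat -> R[i]) M : R :=
  \sum_(0 <= k < M) \sum_(l < hdim k) sqmod (c k l).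

Lemma norm_lincomb c M : N (lincomb c M) ^+ 2 = sqsum c M.
Proof.
have -> : N (lincomb c M) ^+ 2 = Re (ip (lincomb c M) (lincomb c M)) by rewrite innerE.
rewrite {2}/lincomb ip_sumr Re_sum /sqsum big_nat_cond [RHS]big_nat_cond.
apply: eq_bigr => k /andP[/andP[_ kM] _]; rewrite ip_sumr Re_sum.
by apply: eq_bigr => l _; rewrite ipZr ip_lincomb// kM mulrC mulcJ.
Qed.

Lemma real_riesz_fischer (h : nat -> V -> R) (B : R) : (forall k, HP k (h k)) ->
  (forall M, \sum_(0 <= k < M) J 1 (fun x => h k x * h k x) <= B) ->
  exists f, [/\ Defs.harmonic unit_ball f, ibl 1 (fun x => f x * f x) &
    forall d : R, 0 < d -> exists M0, forall M, (M0 <= M)%N ->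
      J 1 (fun x => (f x - hpart h M x) ^+ 2) <= d].
Proof.
move=> Hh hB; pose s M := \sum_(0 <= k < M) J 1 (fun x => h k x * h k x).
(* [B] is replaced by the least bound, so that the error [sup S - s M] given by [hsum_L2] tends to
   0. *)
pose S := [set s M | M in [set: nat]].
have S0 : S !=set0 by exists (s 0%N), 0%N.
have Sb : has_ubound S by exists B => _ [M _ <-]; exact: hB.
have hS M : s M <= sup S by apply: ub_le_sup => //; exists M.
have [hh dist] := hsum_L2 hn nu_invariant nu_boundary Hh hS.
have hf := hsum_harmonic hn nu_invariant nu_boundary hh.
have m M : measurable_fun (ball_of 1 : set BV) (fun x => hsum h x - hpart h M x).
  apply: measurable_funB; first exact: harmonic_measurable.
  by apply: measurable_fun_rV; exact/continuous_polyfun/hpart_polyfun.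
have id M : ibl 1 (fun x => (hsum h x - hpart h M x) ^+ 2).
  apply/integrableP; split; first by apply/measurable_EFinP; exact: measurable_funX.
  apply: le_lt_trans (le_lt_trans (dist M) (ltry _)); apply: ge0_le_integral => //.
  - exact: (@measurable_ball_of R n 1).
  - by apply/measurable_EFinP/measurableT_comp => //; exact: measurable_funX.
  - by apply/measurable_EFinP; exact: measurable_funX.
  - by move=> x _ /=; rewrite lee_fin ger0_norm ?sqr_ge0.
exists (hsum h); split=> //.
  apply: eq_ibl (id 0%N) => x _; rewrite /hpart big_geq// subr0 expr2; reflexivity.
move=> d d0; have [_ [M0 _ <-] M0d] := sup_adherent d0 (conj S0 Sb).
exists M0 => M M0M; apply: (@le_trans _ _ (sup S - s M)).
  have := dist M; rewrite -(fineK (integrable_fin_num _ (id M))) ?lee_fin//.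
  exact: (@measurable_ball_of R n 1).
suff : s M0 <= s M by move: M0d; rewrite -/(s M0); lra.
rewrite /s [leRHS](big_cat_nat _ (n := M0))//= lerDl.
by apply: sumr_ge0 => k _; exact: J_sqr_ge0.
Qed.

Lemma J_he_lincomb k (a : nat -> R) :
  J 1 (fun x => (\sum_(l < hdim k) a l * he k l x) * (\sum_(l < hdim k) a l * he k l x)) =
  \sum_(l < hdim k) a l ^+ 2.
Proof.
have ph l := HP_polyfun (he_HP hn nu_invariant nu_boundary k l).
have Hh : HP k (fun x => \sum_(l < hdim k) a l * he k l x).
  apply: (@HP_sum _ _ _ _ _ _ (fun (l : 'I_(hdim k)) x => a l * he k l x)) => l.
  exact/HPZ/he_HP.
rewrite (he_parseval hn nu_invariant nu_boundary Hh); apply: eq_bigr => l _.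
congr (_ ^+ 2); under eq_fun do rewrite mulr_suml.
rewrite (J_sum _ (F := fun (l' : 'I_(hdim k)) x => a l' * he k l' x * he k l x)); last first.
  by move=> l'; apply: ibl_polyfun; have := ph l; have := ph l'; move=> ? ?; pf.
rewrite (bigD1 l)//= big1 ?addr0 => [|l' ll].
  under eq_fun do rewrite -mulrA.
  rewrite JZ ?he_orthonormal ?eqxx ?mulr1//.
  by apply: ibl_polyfun; have := ph l; move=> ?; pf.
under eq_fun do rewrite -mulrA.
rewrite JZ; first by rewrite he_orthonormal// val_eqE (negbTE ll) mulr0.
by apply: ibl_polyfun; have := ph l; have := ph l'; move=> ? ?; pf.
Qed.

Lemma lincomb_in c M x : unit_ball x -> lincomb c M x =
  hpart (fun k x => \sum_(l < hdim k) Re (c k l) * he k l x) M x +i*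
  hpart (fun k x => \sum_(l < hdim k) Im (c k l) * he k l x) M x.
Proof.
move=> x1; rewrite /lincomb b2_sum /hpart.
apply: complex_ext; rewrite (Re_sum, Im_sum) /=; apply: eq_bigr => k _;
  rewrite b2_sum (Re_sum, Im_sum); apply: eq_bigr => l _;
  by rewrite b2Z eE// !cE /= mulr0 ?subr0 ?add0r.
Qed.

Lemma riesz_fischer c (B : R) : (forall M, sqsum c M <= B) ->
  exists v : H, (forall k l, (l < hdim k)%N -> ip v (e k l) = c k l) /\
    forall d : R, 0 < d -> exists M0, forall M, (M0 <= M)%N -> N (v - lincomb c M) <= d.
Proof.
move=> cB.
pose hr k x := \sum_(l < hdim k) Re (c k l) * he k l x.
pose hi k x := \sum_(l < hdim k) Im (c k l) * he k l x.
have HH (a : nat -> nat -> R) k : HP k (fun x => \sum_(l < hdim k) a k l * he k l x).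
  apply: (@HP_sum _ _ _ _ _ _ (fun (l : 'I_(hdim k)) x => a k l * he k l x)) => l.
  exact/HPZ/he_HP.
have Hr k : HP k (hr k) := HH (fun k l => Re (c k l)) k.
have Hi k : HP k (hi k) := HH (fun k l => Im (c k l)) k.
have [|f [hf ff cf]] := @real_riesz_fischer hr B Hr.
  move=> M; apply: le_trans (cB M); apply: ler_sum => k _.
  by rewrite /hr (J_he_lincomb _ (fun l => Re (c k l))); apply: ler_sum => l _; rewrite lerDl sqr_ge0.
have [|g [hg gg cg]] := @real_riesz_fischer hi B Hi.
  move=> M; apply: le_trans (cB M); apply: ler_sum => k _.
  by rewrite /hi (J_he_lincomb _ (fun l => Im (c k l))); apply: ler_sum => l _; rewrite lerDr sqr_ge0.
pose v : H := B2 (cut_mem hf hg ff gg).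
have vx x : unit_ball x -> v x = f x +i* g x by move=> x1; rewrite [LHS]cut_in.
have cv (d : R) : 0 < d -> exists M0, forall M, (M0 <= M)%N -> N (v - lincomb c M) <= d.
  move=> d0; have d2 : 0 < d ^+ 2 / 2 by rewrite divr_gt0// exprn_gt0.
  have [M1 h1] := cf _ d2; have [M2 h2] := cg _ d2.
  exists (maxn M1 M2) => M; rewrite geq_max => /andP[/h1 {}h1 /h2 {}h2].
  rewrite -(@ler_pXn2r _ 2) ?nnegrE ?L2norm_ge0 ?(ltW d0)//.
  have -> : N (v - lincomb c M) ^+ 2 = Re (ip (v - lincomb c M) (v - lincomb c M)).
    by rewrite innerE.
  have pM (h : nat -> V -> R) : (forall k, HP k (h k)) -> forall f, Defs.harmonic unit_ball f ->
      ibl 1 (fun x => f x * f x) -> ibl 1 (fun x => (f x - hpart h M x) ^+ 2).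
    move=> Hh f' hf' ff'; have pp := hpart_polyfun M Hh.
    have i1 : ibl 1 (fun x => f' x * hpart h M x).
      apply: ibl_mul => //; first exact: harmonic_measurable.
        by apply: measurable_fun_rV; exact: continuous_polyfun.
      by apply: ibl_polyfun; pf.
    have i2 : ibl 1 (fun x => hpart h M x * hpart h M x) by apply: ibl_polyfun; pf.
    rewrite (_ : (fun _ => _) = fun x => f' x * f' x - 2 * (f' x * hpart h M x) + hpart h M x * hpart h M x).
      by ib.
    by apply/funext => x; ring.
  rewrite Re_inner (@eq_J _ _ _ _ _ (fun x => (f x - hpart hr M x) ^+ 2 + (g x - hpart hi M x) ^+ 2)).
    rewrite JD; [|exact: pM|exact: pM].
    by rewrite [leRHS](_ : _ = d ^+ 2 / 2 + d ^+ 2 / 2); [exact: lerD|field].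
  by move=> x x1; rewrite b2D b2N vx// lincomb_in//= -!expr2.
exists v; split=> // k l kl; apply/eqP; rewrite -subr_eq0; apply/eqP; apply: cmod_eq0.
apply: (@eps_eq0 R _ 1) => d /andP[d0 _]; have [M0 hM] := cv d d0.
pose M := maxn M0 k.+1.
rewrite ger0_norm ?cmod_ge0// mul1r.
have -> : c k l = ip (lincomb c M) (e k l) by rewrite ip_lincomb// leq_maxr.
rewrite -ipBl; apply: (le_trans (ip_cs _ _)); rewrite norm_e// mulr1.
by apply: hM; exact: leq_maxl.
Qed.

Lemma e_complete u : (forall k l, (l < hdim k)%N -> ip u (e k l) = 0) -> u = 0.
Proof.
move=> u0; have [hr hi] := b2_harmonic u; have /in_L2P[_ _ ir ii] := b2_L2 u.
have C f : Defs.harmonic unit_ball f -> ibl 1 (fun x => f x * f x) ->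
    (forall k l, (l < hdim k)%N -> J 1 (fun x => f x * he k l x) = 0) ->
    forall x, unit_ball x -> f x = 0.
  move=> hf ff f0; apply: (harmonic_complete hn nu_invariant nu_boundary hf ff) => k h Hh.
  have ph l := HP_polyfun (he_HP hn nu_invariant nu_boundary k l).
  rewrite (@eq_J _ _ _ _ _ (fun x => \sum_(l < hdim k)
     J 1 (fun y => h y * he k l y) * (f x * he k l x))); last first.
    move=> x _; rewrite (he_expand hn nu_invariant nu_boundary x Hh) mulr_sumr.
    by apply: eq_bigr => l _; rewrite mulrCA.
  have fh l : ibl 1 (fun x => f x * he k l x).
    apply: ibl_mul => //; first exact: harmonic_measurable.
      by apply: measurable_fun_rV; exact: continuous_polyfun (ph l).
    by apply: ibl_polyfun; have := ph l; move=> ?; pf.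
  rewrite (J_sum _ (F := fun (l : 'I_(hdim k)) x =>
     J 1 (fun y => h y * he k l y) * (f x * he k l x))); last by move=> l; exact: iblZ.
  by apply: big1 => l _; rewrite JZ// f0// mulr0.
apply: b2_eq => x x1; rewrite b20; apply: complex_ext => /=.
  by apply: (C _ hr ir) => // k l kl; have := u0 k l kl; rewrite ip_e => /(congr1 (@Re R)).
by apply: (C _ hi ii) => // k l kl; have := u0 k l kl; rewrite ip_e => /(congr1 (@Im R)).
Qed.

(** By Cauchy-Schwarz all coefficients are 0, so this definiteness rests on the completeness of the
    spherical harmonics. *)
Lemma hnorm_eq0 u : N u = 0 -> u = 0.
Proof.
move=> u0; apply: e_complete => k l kl; apply: cmod_eq0; apply/eqP.
by rewrite eq_le cmod_ge0 andbT (le_trans (ip_cs _ _))// u0 mul0r.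
Qed.

(** At the combination with coefficients [conjc (phi (e k l))], the value of [phi] is the square of
    the norm, and it is at most [C] times the norm. *)
Lemma bessel (phi : H -> R[i]) (C : R) :
  (forall a u v, phi (a *: u + v) = a * phi u + phi v) ->
  (forall u, cmod (phi u) <= C * N u) ->
  forall M, sqsum (fun k l => conjc (phi (e k l))) M <= C ^+ 2.
Proof.
move=> lphi bphi M; set c := fun k l => _.
have phi0 : phi 0 = 0.
  by have := lphi (-1) 0 0; rewrite scaler0 addr0 mulN1r addNr.
have phiD u v : phi (u + v) = phi u + phi v.
  by have := lphi 1 u v; rewrite scale1r mul1r.
have phiZ a u : phi (a *: u) = a * phi u by have := lphi a u 0; rewrite phi0 !addr0.
have E : phi (lincomb c M) = (sqsum c M)%:C.
  rewrite /lincomb (big_morph phi phiD phi0) /sqsum rmorph_sum; apply: eq_bigr => k _.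
  rewrite (big_morph phi phiD phi0) rmorph_sum; apply: eq_bigr => l _.
  by rewrite phiZ /c mulrC mulcJ sqmodJ.
have s0 : 0 <= sqsum c M.
  by apply: sumr_ge0 => k _; apply: sumr_ge0 => l _; exact: sqmod_ge0.
have := bphi (lincomb c M); rewrite E cmodR ger0_norm// -(norm_lincomb c M).
have := L2norm_ge0 nu (lincomb c M); move: (N _) => r r0 h.
have [->|rn] := eqVneq r 0; first by rewrite expr0n sqr_ge0.
have rp : 0 < r by rewrite lt_def rn.
by move: h; rewrite {1}expr2 ler_pM2r// => rC; rewrite lerXn2r ?nnegrE// (le_trans r0).
Qed.

Definition proj M u : H := lincomb (fun k l => ip u (e k l)) M.

Lemma projE M u : proj M u = \sum_(0 <= k < M) \sum_(l < hdim k) ip u (e k l) *: e k l.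
Proof. by []. Qed.

Lemma ip_proj M u k l : (l < hdim k)%N ->
  ip (proj M u) (e k l) = if (k < M)%N then ip u (e k l) else 0.
Proof. exact: ip_lincomb. Qed.

Lemma proj_cvg u (d : R) : 0 < d ->
  exists M0, forall M, (M0 <= M)%N -> N (u - proj M u) <= d.
Proof.
move=> d0; pose c k l := ip u (e k l).
have cB M : sqsum c M <= N u ^+ 2.
  apply: le_trans (@bessel (fun w => ip w u) (N u) _ _ M) => [|a w v|w].
  - by rewrite /sqsum; under [X in _ <= X]eq_bigr do under eq_bigr do rewrite -ipJ.
  - exact: ip_linl.
  - by rewrite mulrC; exact: ip_cs.
have [v [vc cv]] := riesz_fischer cB.
have uv : u = v.
  apply/eqP; rewrite -subr_eq0; apply/eqP; apply: e_complete => k l kl.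
  by rewrite ipBl vc// subrr.
have [M0 hM] := cv d d0; exists M0 => M MM.
by rewrite [X in X - _]uv; exact: hM.
Qed.

(** [riesz_fischer] provides [v] with the coefficients of [phi]; then [phi] and [ip _ v] agree on
    the projections of [u], and both are bounded. *)
Lemma riesz (phi : H -> R[i]) (C : R) :
  (forall a u v, phi (a *: u + v) = a * phi u + phi v) ->
  (forall u, cmod (phi u) <= C * N u) -> exists v, forall u, phi u = ip u v.
Proof.
move=> lphi bphi; have [v [vc _]] := riesz_fischer (bessel lphi bphi).
exists v => u; apply/eqP; rewrite -subr_eq0; apply/eqP.
pose psi w := phi w - ip w v.
have lpsi a w w' : psi (a *: w + w') = a * psi w + psi w'.
  by rewrite /psi lphi ip_linl; ring.
have psi0 : psi 0 = 0.
  by have := lpsi (-1) 0 0; rewrite scaler0 addr0 mulN1r addNr.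
have psiD w w' : psi (w + w') = psi w + psi w'.
  by have := lpsi 1 w w'; rewrite scale1r mul1r.
have psiZ a w : psi (a *: w) = a * psi w by have := lpsi a w 0; rewrite psi0 !addr0.
have psiP M : psi (proj M u) = 0.
  rewrite /proj /lincomb (big_morph psi psiD psi0) big1// => k _.
  rewrite (big_morph psi psiD psi0) big1// => l _.
  by rewrite psiZ /psi [ip _ v]ipJ vc// conjcK subrr mulr0.
apply: cmod_eq0; apply: (@eps_eq0 R _ (`|C| + N v)) => d /andP[d0 _].
have [M0 hM] := proj_cvg u d0; have := hM M0 (leqnn _) => {}hM.
rewrite -/(psi u) -(subrK (proj M0 u) u) psiD psiP addr0 ger0_norm ?cmod_ge0//.
have L0 := L2norm_ge0 nu.
apply: (le_trans (cmodD _ _)); rewrite cmodN.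
apply: (@le_trans _ _ (`|C| * N (u - proj M0 u) + N v * N (u - proj M0 u))).
  apply: lerD; first by apply: (le_trans (bphi _)); rewrite ler_wpM2r ?ler_norm.
  by rewrite mulrC; exact: ip_cs.
by rewrite -mulrDl ler_wpM2l// addr_ge0.
Qed.

(** The default of [xget] never shows for [h] in [L^2]: the functional [inner nu w h] of [w] is
    represented by an element of the Bergman space. *)
Lemma QprojP (h : V -> R[i]) : L2 h -> forall w, ip (Qproj nu h) w = inner nu h w.
Proof.
move=> Lh; have [|u|v vh] := @riesz (fun w => inner nu w h) (N h).
- by move=> a u w; exact: (inner_linl _ (b2_L2 u) (b2_L2 w)).
- by rewrite mulrC; exact: (cauchy_schwarz (b2_L2 u)).
have sub (v' w : H) : inner nu (fun x => h x - v' x) w = inner nu h w - ip v' w.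
  have E : (fun x => h x - v' x) = (fun x => -1 * v' x + h x).
    by apply/funext => x; rewrite mulN1r addrC.
  by rewrite E (inner_linl (-1) (b2_L2 v') Lh (b2_L2 w)) mulN1r addrC.
have ex : exists v' : H, forall w : H, inner nu (fun x => h x - v' x) w = 0.
  exists v => w; rewrite sub (innerJ (b2_L2 w) Lh) vh -ipJ subrr; reflexivity.
rewrite /Qproj; case: xgetP => [v' _ Hv w|H0]; last by have [v' /H0] := ex.
by have := Hv w; rewrite sub => /eqP; rewrite subr_eq0 => /eqP.
Qed.

Lemma ip_inj u v : (forall w, ip u w = ip v w) -> u = v.
Proof.
move=> uv; apply/eqP; rewrite -subr_eq0; apply/eqP; apply: e_complete => k l _.
by rewrite ipBl uv subrr.
Qed.

End bergman_space.

(** * Bounded and compact operators *)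

Section operators.
Context {R : realType} {n : nat}.
Variable nu : probability (borel_rV R n) R.
Hypothesis hn : (2 <= n)%N.
Hypothesis nu_invariant : orthogonally_invariant nu.
Hypothesis nu_boundary : charges_boundary nu.
Local Notation ip := (inner nu).
Local Notation N := (L2norm nu).
Local Notation H := (b2 nu).
Local Notation e := (e hn nu_invariant nu_boundary).
Local Notation hdim := (hdim hn nu_invariant nu_boundary).
Local Notation proj := (proj hn nu_invariant nu_boundary).
Local Notation lincomb := (lincomb hn nu_invariant nu_boundary).
Local Notation sqsum := (sqsum hn nu_invariant nu_boundary).
Implicit Types (u v w : H) (S T K : H -> H) (a : R[i]) (k l M : nat) (d C : R).

Let L0 u : 0 <= N u := L2norm_ge0 nu u.

Section linearity.
Variable T : H -> H.
Hypothesis lT : linear T.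

Lemma op0 : T 0 = 0.
Proof. by have := lT (-1) 0 0; rewrite scaler0 addr0 scaleN1r addNr. Qed.

Lemma opD u v : T (u + v) = T u + T v.
Proof. by have := lT 1 u v; rewrite !scale1r. Qed.

Lemma opZ a u : T (a *: u) = a *: T u.
Proof. by have := lT a u 0; rewrite op0 !addr0. Qed.

Lemma opN u : T (- u) = - T u.
Proof. by rewrite -scaleN1r opZ scaleN1r. Qed.

Lemma opB u v : T (u - v) = T u - T v.
Proof. by rewrite opD opN. Qed.

Lemma op_sum I (s : seq I) (P : pred I) (F : I -> H) :
  T (\sum_(i <- s | P i) F i) = \sum_(i <- s | P i) T (F i).
Proof. exact: (big_morph _ opD op0). Qed.

End linearity.

Lemma bounded_opP T : bounded_op T -> linear T /\
  exists2 C, 0 <= C & forall u, N (T u) <= C * N u.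
Proof.
move=> [lT [C bT]]; split=> //; exists `|C| => // u.
by apply: (le_trans (bT u)); rewrite ler_wpM2r// ler_norm.
Qed.

Lemma bounded_op_lin a S T : bounded_op S -> bounded_op T -> bounded_op (a *: S + T).
Proof.
move=> /bounded_opP[lS [C C0 bS]] /bounded_opP[lT [D D0 bT]]; split.
  by move=> b u v; rewrite !fctE lS lT !scalerDr !scalerA [b * a]mulrC addrACA.
exists (cmod a * C + D) => u; rewrite !fctE; apply: (le_trans (hnormD _ _)).
by rewrite mulrDl hnormZ -mulrA lerD// ler_wpM2l// cmod_ge0.
Qed.

Lemma bounded_op0 : bounded_op (0 : H -> H).
Proof.
split=> [a u v|]; first by rewrite /= scaler0 addr0.
by exists 0 => u; rewrite hnorm0 mul0r.
Qed.

Lemma bounded_op_mul S T : bounded_op S -> bounded_op T -> bounded_op (op_mul S T).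
Proof.
move=> /bounded_opP[lS [C C0 bS]] /bounded_opP[lT [D D0 bT]]; split.
  by move=> b u v; rewrite /op_mul /= lT lS.
exists (C * D) => u; rewrite /op_mul /= -mulrA.
by apply: (le_trans (bS _)); rewrite ler_wpM2l.
Qed.

Lemma opnorm_le T C : 0 <= C -> (forall u, N (T u) <= C * N u) -> opnorm T <= C.
Proof.
move=> C0 bT; apply: ge_sup => [|_ [u /= u1 <-]].
  by exists (N (T 0)), 0 => //=; rewrite hnorm0.
by apply: (le_trans (bT u)); rewrite ler_piMr.
Qed.

Lemma opnormP T u : bounded_op T -> N (T u) <= opnorm T * N u.
Proof.
move=> /bounded_opP[lT [C C0 bT]].
have [u0|u0] := eqVneq (N u) 0.
  by apply: (le_trans (bT u)); rewrite u0 !mulr0.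
have up : 0 < N u by rewrite lt_def u0 L0.
have Nu : N (((N u)^-1)%:C *: u) = 1.
  by rewrite hnormZ cmodR gtr0_norm ?invr_gt0// mulVf.
have : N (T (((N u)^-1)%:C *: u)) <= opnorm T.
  apply: ub_le_sup; last by exists (((N u)^-1)%:C *: u) => //=; rewrite Nu.
  exists C => _ [w /= w1 <-]; apply: (le_trans (bT w)).
  by rewrite ler_piMr.
by rewrite opZ// hnormZ cmodR gtr0_norm ?invr_gt0// ler_pdivrMl// mulrC.
Qed.

Lemma adjoint_exists T : bounded_op T ->
  exists S, bounded_op S /\ forall u v, ip (T u) v = ip u (S v).
Proof.
move=> /bounded_opP[lT [C C0 bT]].
have ex v : exists w, forall u, ip (T u) v = ip u w.
  apply: (@riesz _ _ _ hn nu_invariant nu_boundary (fun u => ip (T u) v) (C * N v)).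
    by move=> a u w; rewrite lT ip_linl.
  move=> u; apply: (le_trans (ip_cs _ _)); rewrite mulrAC ler_wpM2r//.
have [S SP] := choice ex; exists S; split; last by move=> u v; exact: SP.
split.
  move=> a u v; apply: (ip_inj hn nu_invariant nu_boundary) => w.
  rewrite ip_linl [LHS]ipJ [ip (S u) w]ipJ [ip (S v) w]ipJ -!SP.
  by rewrite ipDr ipZr conjcD conjcM conjcK.
exists C => u; have [->|un] := eqVneq (N (S u)) 0; first exact: mulr_ge0.
have up : 0 < N (S u) by rewrite lt_def un L0.
rewrite -(ler_pM2l up) -expr2.
have -> : N (S u) ^+ 2 = cmod (ip (T (S u)) u).
  by rewrite SP innerE cmodR ger0_norm// sqr_ge0.
by apply: (le_trans (ip_cs _ _)); rewrite mulrA ler_wpM2r// mulrC.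
Qed.

Lemma adjointP T : bounded_op T ->
  bounded_op (adjoint T) /\ forall u v, ip (T u) v = ip u (adjoint T v).
Proof.
move=> /adjoint_exists[S SP]; rewrite /adjoint; case: xgetP => [S' _ //|no].
by have := no S SP.
Qed.

Lemma adjoint_unique T S : bounded_op T ->
  (forall u v, ip (T u) v = ip u (S v)) -> adjoint T = S.
Proof.
move=> /adjointP[_ aT] TS; apply/funext => v.
apply: (ip_inj hn nu_invariant nu_boundary) => w.
by rewrite [LHS]ipJ [RHS]ipJ -aT -TS.
Qed.

Definition tail M u : Prop := forall k l, (k < M)%N -> (l < hdim k)%N -> ip u (e k l) = 0.

Lemma proj_lin M : linear (proj M).
Proof.
move=> a u v; rewrite /proj /lincomb scaler_sumr -big_split; apply: eq_bigr => k _.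
rewrite scaler_sumr -big_split; apply: eq_bigr => l _ /=.
by rewrite ip_linl scalerDl scalerA.
Qed.

Lemma tail_proj M u : tail M (u - proj M u).
Proof. by move=> k l kM kl; rewrite ipBl ip_lincomb// kM subrr. Qed.

Lemma proj_tail M u : tail M u -> proj M u = 0.
Proof.
move=> tu; rewrite /proj /lincomb big_nat_cond big1// => k /andP[/andP[_ kM] _].
by rewrite big1// => l _; rewrite tu// scale0r.
Qed.

Lemma proj_in M u x : unit_ball x -> proj M u x =
  hpart (fun k x => \sum_(l < hdim k) Re (ip u (e k l)) * he hn nu_invariant nu_boundary k l x) M x +i*
  hpart (fun k x => \sum_(l < hdim k) Im (ip u (e k l)) * he hn nu_invariant nu_boundary k l x) M x.
Proof. exact: lincomb_in. Qed.

Lemma sqr_norm_proj M u : N (proj M u) ^+ 2 = sqsum (fun k l => ip u (e k l)) M.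
Proof. exact: norm_lincomb. Qed.

Lemma norm_proj M u : N (proj M u) <= N u.
Proof.
rewrite -(@ler_pXn2r _ 2) ?nnegrE// norm_lincomb.
apply: le_trans (@bessel _ _ _ hn nu_invariant nu_boundary (fun w => ip w u) (N u) _ _ M).
- by rewrite /sqsum; under [X in _ <= X]eq_bigr do under eq_bigr do rewrite -ipJ.
- by move=> a w w'; exact: ip_linl.
- by move=> w; rewrite mulrC; exact: ip_cs.
Qed.

Lemma bounded_proj M : bounded_op (proj M).
Proof.
by split; [exact: proj_lin|exists 1 => u; rewrite mul1r; exact: norm_proj].
Qed.

Lemma ip_tail_proj M u w : tail M u -> ip u (proj M w) = 0.
Proof.
move=> tu; rewrite /proj /lincomb ip_sumr big_nat_cond big1// => k /andP[/andP[_ kM] _].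
by rewrite ip_sumr big1// => l _; rewrite ipZr tu// mulr0.
Qed.

Lemma pythagoras u v : ip u v = 0 -> N (u + v) ^+ 2 = N u ^+ 2 + N v ^+ 2.
Proof.
move=> uv; have E w : N w ^+ 2 = Re (ip w w) by rewrite innerE.
by rewrite !E ipDl !ipDr uv [ip v u]ipJ uv conjc0 addr0 add0r ReD.
Qed.

Lemma norm_tail M u : N (u - proj M u) <= N u.
Proof.
rewrite -(@ler_pXn2r _ 2) ?nnegrE//.
have := pythagoras (ip_tail_proj u (@tail_proj M u)).
by rewrite subrK => ->; rewrite lerDl sqr_ge0.
Qed.

(** The working form of compactness, by [compactP]. *)
Definition tailsmall T : Prop := forall d, 0 < d ->
  exists M, forall u, tail M u -> N (T u) <= d * N u.

(** Along an ultrafilter all the coefficients of a bounded sequence converge at once; this stands in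
    for a diagonal extraction. *)
Lemma ultra_bounded_cvg (F : set_system nat) (c : nat -> R) (B : R) : UltraFilter F ->
  (forall m, `|c m| <= B) -> exists l : R, c @ F --> l.
Proof.
move=> UF cB; have [|l [_ cl]] := @segment_compact R (- B) B (c @ F) _ _.
  suff : F (c @^-1` `[- B, B]%classic) by [].
  by apply: filterE => m; rewrite /= in_itv/= -ler_norml; exact: cB.
exists l => A nA; have [//|FA] := in_ultra_setVsetC (c @^-1` A) UF.
by have [y [/= ? ?]] := cl (~` A) A FA nA.
Qed.

Lemma tailsmall_compact T : bounded_op T -> tailsmall T -> compact_op T.
Proof.
move=> bT sT; split=> // u [B uB]; have [lT [C C0 TC]] := bounded_opP bT.
have [F [UF FF]] := ultraFilterLemma (eventually_filter).
have pF : ProperFilter F by exact: ultra_proper.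
have fF : Filter F by exact: filter_filter.
have cex k l : exists z : R[i], (fun m => Re (ip (u m) (e k l))) @ F --> Re z /\
    (fun m => Im (ip (u m) (e k l))) @ F --> Im z.
  have bc m : cmod (ip (u m) (e k l)) <= B * N (e k l).
    by apply: (le_trans (ip_cs _ _)); rewrite ler_wpM2r.
  have [r cr] := ultra_bounded_cvg UF (fun m => le_trans (Re_le_cmod _) (bc m)).
  have [i ci] := ultra_bounded_cvg UF (fun m => le_trans (Im_le_cmod _) (bc m)).
  by exists (r +i* i).
have [c0 c0P] := choice (fun kl : nat * nat => cex kl.1 kl.2).
pose c k l := c0 (k, l).
have cP k l : (fun m => sqmod (ip (u m) (e k l) - c k l)) @ F --> (0 : R).
  have [cr ci] := c0P (k, l).
  rewrite (_ : (fun m => _) = fun m => (Re (ip (u m) (e k l)) - Re (c k l)) ^+ 2 +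
     (Im (ip (u m) (e k l)) - Im (c k l)) ^+ 2); last first.
    by apply/funext => m; rewrite /sqmod !cE.
  rewrite (_ : 0 = 0 ^+ 2 + 0 ^+ 2 :> R); last by rewrite expr0n addr0.
  apply: cvgD.
    apply: (@cvg_comp _ _ _ _ (fun x : R => x ^+ 2) _ (nbhs (0 : R))); last exact: exprn_continuous.
    by have := cvgB cr (cvg_cst (Re (c k l))); rewrite subrr; exact.
  apply: (@cvg_comp _ _ _ _ (fun x : R => x ^+ 2) _ (nbhs (0 : R))); last exact: exprn_continuous.
  by have := cvgB ci (cvg_cst (Im (c k l))); rewrite subrr; exact.
have cS M : (fun m => sqsum (fun k l => ip (u m) (e k l) - c k l) M) @ F --> (0 : R).
  rewrite (_ : 0 = \sum_(0 <= k < M) \sum_(l < hdim k) (0 : R)); last first.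
    by rewrite big1// => k _; rewrite big1.
  apply: (@cvg_big _ _ +%R _ _ _ _ _ _ _ _ _) => [|k _]; first exact: add_continuous.
  by apply: (@cvg_big _ _ +%R _ _ _ _ _ _ _ _ _) => [|l _]; [exact: add_continuous|exact: cP].
have B0 : 0 <= B := le_trans (L0 _) (uB 0%N).
(* From [|w|^2 <= 2 |z|^2 + 2 |z - w|^2], with an index [m] for which the squares of the differences
   sum to at most 1. *)
have cB M : sqsum c M <= 2 * B ^+ 2 + 2.
  have near1 := @cvgr_le _ _ F fF _ _ (cS M) 1 ltr01.
  have [m hm] := filter_ex near1.
  apply: (@le_trans _ _ (2 * sqsum (fun k l => ip (u m) (e k l)) M +
     2 * sqsum (fun k l => ip (u m) (e k l) - c k l) M)).
    rewrite /sqsum !mulr_sumr -big_split; apply: ler_sum => k _ /=.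
    rewrite !mulr_sumr -big_split; apply: ler_sum => l _ /=.
    move: (ip _ _) (c k l) => z w; rewrite /sqmod !cE.
    have := sqr_ge0 (2 * Re z - Re w); have := sqr_ge0 (2 * Im z - Im w); nra.
  have := norm_lincomb hn nu_invariant nu_boundary (fun k l => ip (u m) (e k l)) M.
  have := norm_proj M (u m); rewrite /proj => h1 h2.
  have h3 : sqsum (fun k l => ip (u m) (e k l)) M <= B ^+ 2.
    by rewrite -h2 lerXn2r ?nnegrE// (le_trans h1).
  lra.
have [v [vc _]] := riesz_fischer cB.
(* A set of the ultrafilter contains indices beyond any [p.2], which makes the extraction
   increasing. The error splits into a tail, small by [tailsmall], and a projection, small by
   [cS]. *)
have freq (p : nat * nat) : exists m, (p.2 < m)%N /\ N (b2val (T (u m) - T v)) <= p.1.+1%:R^-1.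
  set d : R := p.1.+1%:R^-1; have d0 : 0 < d by rewrite invr_gt0.
  have D0 : 0 < B + N v + 1 by rewrite ltr_wpDl// addr_ge0.
  have [M tM] := sT (d / 2 / (B + N v + 1)) (divr_gt0 (divr_gt0 d0 (ltr0Sn _ _)) D0).
  have C10 : 0 < C + 1 by rewrite ltr_wpDl.
  have q0 : 0 < (d / 2 / (C + 1)) ^+ 2 by rewrite exprn_gt0// !divr_gt0.
  have near1 := @cvgr_le _ _ F fF _ _ (cS M) _ q0.
  have near2 : F [set m | (p.2 < m)%N] by apply: FF; exists p.2.+1.
  have [m [h1 h2]] := filter_ex (filterI near1 near2).
  exists m; split=> //; rewrite -(opB lT); set w := u m - v.
  have wB : N w <= B + N v by apply: (le_trans (hnormB _ _)); rewrite lerD2r.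
  rewrite -(subrK (proj M w) w) (opD lT); apply: (le_trans (hnormD _ _)).
  rewrite [leRHS](_ : _ = d / 2 + d / 2); last by field.
  apply: lerD.
    apply: (le_trans (tM _ (@tail_proj M w))).
    rewrite mulrAC ler_pdivrMr// ler_wpM2l ?(ltW (divr_gt0 d0 _))//.
    by apply: (le_trans (norm_tail M w)); rewrite (le_trans wB)// lerDl.
  apply: (le_trans (TC _)); apply: (@le_trans _ _ (C * (d / 2 / (C + 1)))).
    rewrite ler_wpM2l// -(@ler_pXn2r _ 2) ?nnegrE ?(ltW (divr_gt0 (divr_gt0 d0 _) C10))//.
    rewrite norm_lincomb; apply: le_trans h1; rewrite /sqsum.
    rewrite big_nat_cond [leRHS]big_nat_cond; apply: ler_sum => k _; apply: ler_sum => l _.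
    by rewrite /w ipBl vc.
  rewrite mulrA ler_pdivrMr// mulrC ler_wpM2l ?(ltW (divr_gt0 d0 _))//.
  by rewrite lerDl.
have [g gP] := choice freq.
pose phi := fix phi j := if j is j'.+1 then g (j'.+1, phi j') else g (0%N, 0%N).
have phiP j : N (b2val (T (u (phi j)) - T v)) <= j.+1%:R^-1.
  by case: j => [|j] /=; [have [_] := gP (0%N, 0%N)|have [_] := gP (j.+1, phi j)].
exists phi, (T v); split.
  apply: homo_ltn => [? ? ?|j]; first exact: ltn_trans.
  by have [] := gP (j.+1, phi j).
have sq : \forall j \near \oo, (0 : R) <= N (b2val (T (u (phi j)) - T v)) <= j.+1%:R^-1.
  by apply: nearW => j; rewrite L0 phiP.
exact: (squeeze_cvgr sq (cvg_cst 0) (@cvg_harmonic R)).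
Qed.

(** Otherwise there are tail vectors of norm at most 1, of orders tending to infinity, with images
    of norm at least [d]. A subsequence of the images tends to some [v]; as tail vectors tend weakly
    to 0, [v = 0], a contradiction. *)
Lemma compact_tailsmall T : compact_op T -> tailsmall T.
Proof.
move=> [bT cT]; have [lT _] := bounded_opP bT; have [_ aT] := adjointP bT.
apply: contrapT => /existsNP[d /not_implyP[d0 /forallNP no]].
have ex M : exists u, [/\ tail M u, N u <= 1 & d <= N (T u)].
  have /existsNP[u /not_implyP[tu /negP]] := no M; rewrite -ltNge => dT.
  have [u0|u0] := eqVneq (N u) 0.
    by move: dT; rewrite (hnorm_eq0 hn nu_invariant nu_boundary u0) op0// hnorm0 mulr0 ltxx.
  have up : 0 < N u by rewrite lt_def u0 L0.
  exists (((N u)^-1)%:C *: u); split.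
  - by move=> k l kM kl; rewrite ipZl tu// mulr0.
  - by rewrite hnormZ cmodR gtr0_norm ?invr_gt0// mulVf.
  - by rewrite opZ// hnormZ cmodR gtr0_norm ?invr_gt0// ler_pdivlMl// mulrC ltW.
have [u uP] := choice ex.
have [|phi [v [hphi cv]]] := cT u; first by exists 1 => M; have [] := uP M.
have ge_phi j : (j <= phi j)%N.
  elim: j => // j IH; apply: (leq_ltn_trans IH); exact: hphi.
suff v0 : N v = 0.
  have := cvgr_lt _ cv d d0 => -[m _ /(_ m (leqnn m))] /=.
  have [_ _ dT] := uP (phi m).
  rewrite (hnorm_eq0 hn nu_invariant nu_boundary v0) subr0 ltNge dT; exact: notF.
apply/eqP; rewrite -sqrf_eq0; apply/eqP; apply: (@eps_eq0 R _ (N v + 1)) => r /andP[r0 _].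
have [M0 hM] := proj_cvg hn nu_invariant nu_boundary (adjoint T v) r0.
have [M1 _ hM1] := cvgr_lt _ cv r r0.
pose m := maxn M0 M1.
have h1 := hM1 m (leq_maxr _ _); rewrite /= in h1.
have h2 := hM (phi m) (leq_trans (leq_maxl _ _) (ge_phi m)).
have [tu u1 _] := uP (phi m); set w := u (phi m) in h1 tu u1.
rewrite ger0_norm ?sqr_ge0//.
have -> : N v ^+ 2 = cmod (ip v v) by rewrite innerE cmodR ger0_norm ?sqr_ge0.
(* The tail vector [w] is orthogonal to the projection, so subtracting it is free and leaves a small
   vector. *)
have -> : ip v v = ip w (adjoint T v - proj (phi m) (adjoint T v)) - ip (T w - v) v.
  by rewrite ipBr ip_tail_proj// subr0 -aT ipBl; ring.
apply: (le_trans (cmodD _ _)); rewrite cmodN mulrDl addrC mul1r; apply: lerD.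
  by apply: (le_trans (ip_cs _ _)); rewrite mulrC ler_wpM2l// ltW.
apply: (le_trans (ip_cs _ _)); apply: le_trans h2.
by rewrite ler_piMl.
Qed.

Lemma compactP T : compact_op T <-> bounded_op T /\ tailsmall T.
Proof.
split=> [cT|[bT sT]]; last exact: tailsmall_compact.
by split; [case: cT|exact: compact_tailsmall].
Qed.

Lemma tail_le M M' u : (M <= M')%N -> tail M' u -> tail M u.
Proof. by move=> MM tu k l kM; apply: tu; exact: leq_trans MM. Qed.

Lemma compact_lin a S T : compact_op S -> compact_op T -> compact_op (a *: S + T).
Proof.
move=> /compactP[bS sS] /compactP[bT sT]; apply/compactP; split.
  exact: bounded_op_lin.
move=> d d0; have a0 : 0 < cmod a + 1 by rewrite ltr_wpDl ?cmod_ge0.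
have [M1 h1] := sS (d / (cmod a + 1) / 2) (divr_gt0 (divr_gt0 d0 a0) (ltr0Sn _ _)).
have [M2 h2] := sT (d / 2) (divr_gt0 d0 (ltr0Sn _ _)).
exists (maxn M1 M2) => u tu; rewrite !fctE; apply: (le_trans (hnormD _ _)).
rewrite [leRHS](_ : _ = d / 2 * N u + d / 2 * N u); last by field.
apply: lerD; last by apply/h2/(tail_le _ tu); exact: leq_maxr.
rewrite hnormZ; apply: (@le_trans _ _ (cmod a * (d / (cmod a + 1) / 2 * N u))).
  by rewrite ler_wpM2l ?cmod_ge0//; apply/h1/(tail_le _ tu); exact: leq_maxl.
rewrite mulrA ler_wpM2r//.
rewrite (_ : _ * _ = d / 2 * (cmod a / (cmod a + 1))); last by field; rewrite gt_eqF.
rewrite ler_piMr ?(ltW (divr_gt0 d0 _))// ler_pdivrMr// mul1r lerDl; exact: ler01.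
Qed.

Lemma compact0 : compact_op (0 : H -> H).
Proof.
apply/compactP; split; first exact: bounded_op0.
by move=> d d0; exists 0%N => u _; rewrite hnorm0 mulr_ge0// ltW.
Qed.

Lemma compactZ a S : compact_op S -> compact_op (a *: S).
Proof. by move=> /(compact_lin a)/(_ compact0); rewrite addr0. Qed.

Lemma compactD S T : compact_op S -> compact_op T -> compact_op (S + T).
Proof. by move=> cS cT; have := compact_lin 1 cS cT; rewrite scale1r. Qed.

Lemma compactB S T : compact_op S -> compact_op T -> compact_op (S - T).
Proof. by move=> cS /(compactZ (-1)); rewrite scaleN1r; exact: compactD. Qed.

Lemma compact_mull S K : bounded_op S -> compact_op K -> compact_op (op_mul S K).
Proof.
move=> bS /compactP[bK sK]; apply/compactP; split; first exact: bounded_op_mul.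
have [_ [C C0 SC]] := bounded_opP bS; have C1 : 0 < C + 1 by rewrite ltr_wpDl.
move=> d d0; have [M hM] := sK (d / (C + 1)) (divr_gt0 d0 C1).
exists M => u /hM h; apply: (le_trans (SC _)).
apply: (@le_trans _ _ (C * (d / (C + 1) * N u))); first by rewrite ler_wpM2l.
rewrite (_ : C * _ = C / (C + 1) * (d * N u)); last by field; rewrite gt_eqF.
by rewrite ler_piMl ?mulr_ge0 ?(ltW d0)// ler_pdivrMr// mul1r lerDl.
Qed.

Lemma compact_mulr S K : bounded_op S -> compact_op K -> compact_op (op_mul K S).
Proof.
move=> bS [bK cK]; split; first exact: bounded_op_mul.
have [_ [C C0 SC]] := bounded_opP bS.
move=> u [B uB]; have [|phi [v h]] := cK (S \o u); last by exists phi, v.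
by exists (C * B) => k; apply: (le_trans (SC _)); rewrite ler_wpM2l.
Qed.

(** [|K^* u|^2 = <K K^* u, u>] and [K K^*] is compact; this is where [d^2] comes from. *)
Lemma compact_adjoint K : compact_op K -> compact_op (adjoint K).
Proof.
move=> cK; have [bK _] := cK; have [bA aK] := adjointP bK.
have [bKA sKA] := (compactP _).1 (compact_mulr bA cK).
apply/compactP; split=> // d d0; have [M hM] := sKA (d ^+ 2) (exprn_gt0 2 d0).
exists M => u /hM h; rewrite -(@ler_pXn2r _ 2) ?nnegrE ?mulr_ge0// ?(ltW d0)//.
have -> : N (adjoint K u) ^+ 2 = cmod (ip (K (adjoint K u)) u).
  by rewrite aK innerE cmodR ger0_norm// sqr_ge0.
by apply: (le_trans (ip_cs _ _)); rewrite exprMn [N u ^+ 2]expr2 mulrA ler_wpM2r.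
Qed.

Lemma compact_closed T : bounded_op T ->
  (forall d, 0 < d -> exists2 S, compact_op S & forall u, N (T u - S u) <= d * N u) ->
  compact_op T.
Proof.
move=> bT aT; apply/compactP; split=> // d d0.
have d2 : 0 < d / 2 by rewrite divr_gt0.
have [S /compactP[_ sS] TS] := aT _ d2; have [M hM] := sS _ d2.
exists M => u tu; rewrite -(subrK (S u) (T u)); apply: (le_trans (hnormD _ _)).
rewrite [leRHS](_ : _ = d / 2 * N u + d / 2 * N u); last by field.
by apply: lerD; [exact: TS|exact: hM].
Qed.

Lemma compact_norm_closed : norm_closed (compact_ops nu).
Proof.
move=> T bT aT; apply: compact_closed => // d d0; have [S cS TS] := aT d d0.
exists S => // u; have bTS : bounded_op (T - S).
  have [bS _] := cS; have := bounded_op_lin (-1) bS bT; rewrite scaleN1r addrC; exact.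
by apply: (le_trans (opnormP u bTS)); rewrite ler_wpM2r// ltW.
Qed.

End operators.

(** * Ratios of consecutive moments *)

Section moment_ratios.
Context {R : realType} {n : nat}.
Variable nu : probability (borel_rV R n) R.
Hypothesis hn : (2 <= n)%N.
Hypothesis nu_invariant : orthogonally_invariant nu.
Hypothesis nu_boundary : charges_boundary nu.
Local Notation J := (J nu).
Local Notation ibl := (ibl nu).
Local Notation mom := (mom nu 1).
Implicit Types (k l m : nat) (r s : R).

Definition lam k : R := mom k.+1 / mom k.

Let m0 k : 0 < mom k := mom_gt0 nu_boundary k.

Lemma mom_lam k : mom k.+1 = lam k * mom k.
Proof. by rewrite /lam divfK// gt_eqF. Qed.

Lemma lam_gt0 k : 0 < lam k.
Proof. exact: divr_gt0. Qed.

Lemma mom_quadratic (c : R) k :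
  J 1 (fun x => (sqn x - c) ^+ 2 * sqn x ^+ k) = mom k.+2 - 2 * c * mom k.+1 + c ^+ 2 * mom k.
Proof.
have pS := @polyfun_sqn R n.
have pX m : ibl 1 (fun x => sqn x ^+ m) by apply: ibl_polyfun; pf.
rewrite /mom -!JZ// -JB//; last exact: iblZ.
rewrite -JD//; [|by ib|by ib].
by apply: eq_J => x _; rewrite !exprS; ring.
Qed.

(** Log-convexity of the moments: the integral of [(|x|^2 - lam k)^2 |x|^(2k)] is nonnegative. *)
Lemma lam_homo : {homo lam : k l / (k <= l)%N >-> k <= l}.
Proof.
apply: homo_leq => // [? ? ?|k]; first exact: le_trans.
have := @J_ge0 _ _ nu 1 (fun x => (sqn x - lam k) ^+ 2 * sqn x ^+ k).
rewrite mom_quadratic => /(_ (fun x _ => mulr_ge0 (sqr_ge0 _) (exprn_ge0 k (sqn_ge0 x)))).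
rewrite !mom_lam (_ : _ + _ = lam k * mom k * (lam k.+1 - lam k)); last by ring.
by rewrite pmulr_rge0 ?subr_ge0// mulr_gt0// lam_gt0.
Qed.

Lemma lam_le1 k : lam k <= 1.
Proof.
have pS := @polyfun_sqn R n.
rewrite /lam ler_pdivrMr// mul1r; apply: le_J; [by apply: ibl_polyfun; pf..|].
move=> x x1; rewrite exprS ler_piMl ?exprn_ge0 ?sqn_ge0//.
rewrite -sqr_enorm; apply: exprn_ile1; [exact: enorm_ge0|exact: ltW].
Qed.

Lemma mom_le_pow k s : (forall l, lam l <= s) -> mom k <= s ^+ k * mom 0.
Proof.
move=> ls; elim: k => [|k IH]; first by rewrite mul1r.
rewrite mom_lam exprS -mulrA; apply: ler_pM => //; first exact/ltW/lam_gt0.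
exact: ltW.
Qed.

(** If all the ratios stayed below [s], the moments would decay at least like [s^k], against the
    lower bound [a r^(2k)] with [r^2 = (1 + s) / 2 > s]. *)
Lemma lam_cvg1 s : s < 1 -> exists M, forall k, (M <= k)%N -> s < lam k.
Proof.
move=> s1; apply: contrapT => /forallNP no.
have ls l : lam l <= s.
  have /existsNP[k /not_implyP[lk /negP]] := no l; rewrite -leNgt.
  exact: le_trans (lam_homo lk).
have s0 : 0 < s := lt_le_trans (lam_gt0 0) (ls 0%N).
pose r := Num.sqrt ((1 + s) / 2).
have r2 : r ^+ 2 = (1 + s) / 2 by rewrite sqr_sqrtr//; lra.
have r01 : 0 < r < 1 by apply: sqrt_01; apply/andP; split; lra.
have [t [a [/andP[_ t1] a0] ak]] := mom_lower_bound nu_boundary r01.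
pose x := (1 + s) / 2 / s - 1.
have x0 : 0 < x by rewrite subr_gt0 ltr_pdivlMr//; lra.
have B k : a * (1 + k%:R * x) <= mom 0.
  apply: le_trans (_ : a * (1 + x) ^+ k <= _).
    by rewrite ler_wpM2l ?(ltW a0)//; apply: bernoulli_ineq; exact: ltW.
  rewrite addrC subrK expr_div_n mulrA ler_pdivrMr ?exprn_gt0// mulrC.
  by rewrite -r2 -exprM mulrC; apply: le_trans (ak k 1 (ltW t1)) _; rewrite mulrC; exact: mom_le_pow.
have ax : 0 < a * x by exact: mulr_gt0.
have := B (Num.bound (mom 0 / (a * x))).
have := archi_boundP (ltW (divr_gt0 (m0 0) ax)).
rewrite ltr_pdivrMr// => h1 h2.
by have := lt_le_trans h1 (le_trans _ h2); rewrite ltxx => F; apply: notF; apply: F; nra.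
Qed.

(** Some ball of radius [t < 1] has positive measure, and there [1 - |x|^2 >= 1 - t^2]. *)
Lemma lam0_lt1 : lam 0 < 1.
Proof.
have pS := @polyfun_sqn R n.
suff : 0 < mom 0 - mom 1 by rewrite subr_gt0 /lam ltr_pdivrMr// mul1r.
have [m hm] : exists m, 0 < J (1 - m.+2%:R^-1) (fun x => sqn x ^+ 0).
  have c := J_cvg (@ibl_polyfun _ _ nu 1 (fun x => sqn x ^+ 0) ltac:(pf)).
  have [M _ HM] := cvgr_gt _ c 0 (m0 0); exists M; exact: (HM M (leqnn M)).
pose t : R := 1 - m.+2%:R^-1; rewrite -/t in hm.
have t01 : 0 < t < 1.
  by rewrite subr_gt0 invf_lt1// ltr1n/= ltrBlDr ltrDl invr_gt0.
have /andP[t0 t1] := t01.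
have c0 : 0 < 1 - t ^+ 2 by rewrite subr_gt0 exprn_ilt1// ltW.
apply: (@lt_le_trans _ _ ((1 - t ^+ 2) * J t (fun x => sqn x ^+ 0))).
  exact: mulr_gt0.
have iB : ibl 1 (fun x => sqn x ^+ 0 - sqn x ^+ 1) by apply: ibl_polyfun; pf.
have iBt : ibl t (fun x => sqn x ^+ 0 - sqn x ^+ 1) by apply: ibl_polyfun; pf.
rewrite /mom -JB; [|by apply: ibl_polyfun; pf..].
apply: (@le_trans _ _ (J t (fun x => sqn x ^+ 0 - sqn x ^+ 1))).
  rewrite -JZ; last by apply: ibl_polyfun; pf.
  apply: le_J => //; first by apply: iblZ; apply: ibl_polyfun; pf.
  move=> x xt; rewrite expr0 expr1 mulr1 lerB// -sqr_enorm.
  by apply: lerXn2r; rewrite ?nnegrE ?enorm_ge0 ?ltW.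
rewrite /J /Rintegral fine_le//.
- by apply: integrable_fin_num => //; exact: measurable_ball_of.
- by apply: integrable_fin_num => //; exact: measurable_ball_of.
apply: ge0_subset_integral.
- exact: measurable_ball_of.
- exact: measurable_ball_of.
- by have /integrableP[] := iB.
- move=> x x1; rewrite lee_fin expr0 expr1 subr_ge0 -sqr_enorm.
  by apply: exprn_ile1; [exact: enorm_ge0|exact: ltW].
- by move=> x xt; exact: lt_trans xt t1.
Qed.

(** Equality would give [|x|^2] variance 0, so all the ratios would equal [lam 0 < 1], against
    [lam_cvg1]. *)
Lemma lam0_lt_lam1 : lam 0 < lam 1.
Proof.
rewrite lt_neqAle lam_homo// andbT; apply/eqP => E.
have pS := @polyfun_sqn R n.
have Q0 : J 1 (fun x => (sqn x - lam 0) ^+ 2 * sqn x ^+ 0) = 0.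
  by rewrite mom_quadratic (mom_lam 1) -E (mom_lam 0); ring.
have S k : mom k.+1 = lam 0 * mom k.
  have iq : ibl 1 (fun x => (sqn x - lam 0) ^+ 2) by apply: ibl_polyfun; pf.
  have ik m : ibl 1 (fun x => sqn x ^+ m) by apply: ibl_polyfun; pf.
  apply/eqP; rewrite -subr_eq0; apply/eqP; apply: (@eps_eq0 R _ (mom (k.*2))) => d /andP[d0 _].
  rewrite /mom -JZ// -JB//; last exact: iblZ.
  set f := fun x => _.
  (* [sg A B <= A^2 / d + d B^2] and the integral of [A^2] is 0; as [d] is arbitrary, this replaces
     an almost everywhere argument. *)
  have bound (sg : R) : sg ^+ 2 = 1 -> sg * J 1 f <= mom k.*2 * d.
    move=> sg1; rewrite -JZ; last by rewrite /f; ib.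
    apply: (@le_trans _ _ (J 1 (fun x => d^-1 * (sqn x - lam 0) ^+ 2 + d * sqn x ^+ k.*2))).
      apply: le_J => [||x _]; [by rewrite /f; ib|by ib|].
      rewrite -[k.*2]addnn exprD /f exprS -mulrBl -subr_ge0.
      move: (sqn x - lam 0) (sqn x ^+ k) => A B.
      have -> : d^-1 * A ^+ 2 + d * (B * B) - sg * (A * B) =
        d^-1 * ((A - sg * d * B / 2) ^+ 2 + (1 - sg ^+ 2 / 4) * (d * B) ^+ 2).
        by field; rewrite gt_eqF.
      rewrite mulr_ge0 ?invr_ge0 ?(ltW d0)// addr_ge0 ?sqr_ge0// mulr_ge0 ?sqr_ge0//.
      by rewrite sg1; lra.
    rewrite JD; [|by ib..]; rewrite !JZ//.
    have -> : J 1 (fun x => (sqn x - lam 0) ^+ 2) = 0.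
      by rewrite -[RHS]Q0; apply: eq_J => x _; rewrite mulr1.
    by rewrite mulr0 add0r mulrC.
  rewrite ler_norml; apply/andP; split.
    by have := bound (-1); rewrite sqrrN expr1n mulN1r lerNl => /(_ erefl).
  by have := bound 1; rewrite expr1n mul1r; exact.
have [M /(_ M (leqnn M))] := lam_cvg1 lam0_lt1.
by rewrite {2}/lam S mulfK ?ltxx// gt_eqF.
Qed.

End moment_ratios.

(** * Continuous functions on the closed ball *)

Section ball_functions.
Context {R : realType} {n : nat}.
Local Notation V := 'rV[R]_n.
Local Notation BV := (borel_rV R n).
Local Notation cb := (@continuous_closed_ball R n).
Implicit Types (f g : V -> R[i]) (p q : V -> R) (x y z : V).

Lemma cbP f : cb f <-> {within closed_unit_ball, continuous (fun x => Re (f x))} /\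
  {within closed_unit_ball, continuous (fun x => Im (f x))}.
Proof. exact: continuous_complexP. Qed.

Lemma cbD f g : cb f -> cb g -> cb (fun x => f x + g x).
Proof.
move=> /cbP[fr fi] /cbP[gr gi]; apply/cbP; split.
  rewrite (_ : (fun _ => _) = (fun x => Re (f x) + Re (g x))).
    by move=> x; apply: cvgD; [exact: fr|exact: gr].
  by apply/funext => x; rewrite cE.
rewrite (_ : (fun _ => _) = (fun x => Im (f x) + Im (g x))).
  by move=> x; apply: cvgD; [exact: fi|exact: gi].
by apply/funext => x; rewrite cE.
Qed.

Lemma cbM f g : cb f -> cb g -> cb (fun x => f x * g x).
Proof.
move=> /cbP[fr fi] /cbP[gr gi]; apply/cbP; split.
  rewrite (_ : (fun _ => _) = (fun x => Re (f x) * Re (g x) - Im (f x) * Im (g x))).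
    by move=> x; apply: cvgB; apply: cvgM; [exact: fr|exact: gr|exact: fi|exact: gi].
  by apply/funext => x; rewrite cE.
rewrite (_ : (fun _ => _) = (fun x => Re (f x) * Im (g x) + Im (f x) * Re (g x))).
  by move=> x; apply: cvgD; apply: cvgM; [exact: fr|exact: gi|exact: fi|exact: gr].
by apply/funext => x; rewrite cE.
Qed.

Lemma cbJ f : cb f -> cb (fun x => conjc (f x)).
Proof.
move=> /cbP[fr fi]; apply/cbP; split.
  by rewrite (_ : (fun _ => _) = (fun x => Re (f x)))//; apply/funext => x; rewrite cE.
rewrite (_ : (fun _ => _) = (fun x => - Im (f x))).
  by move=> x; apply: cvgN; exact: fi.
by apply/funext => x; rewrite cE.
Qed.

Lemma cb_cst (c : R[i]) : cb (fun=> c).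
Proof. by apply/cbP; split; move=> x; exact: cvg_cst. Qed.

Lemma cbZ (c : R[i]) f : cb f -> cb (fun x => c * f x).
Proof. exact/cbM/cb_cst. Qed.

Lemma cbB f g : cb f -> cb g -> cb (fun x => f x - g x).
Proof.
move=> cf cg; rewrite (_ : (fun _ => _) = fun x => f x + (-1) * g x).
  exact/cbD/cbZ.
by apply/funext => x; rewrite mulN1r.
Qed.

Lemma cb_real p : {within closed_unit_ball, continuous p} -> cb (fun x => (p x)%:C).
Proof. by move=> cp; apply/cbP; split=> //= x; exact: cvg_cst. Qed.

Lemma cb_polyfun p : polyfun p -> cb (fun x => (p x)%:C).
Proof.
by move=> pp; apply: cb_real; apply: continuous_subspaceT; exact: continuous_polyfun.
Qed.

Lemma within_comp (A : set V) (h : R -> R) p : continuous h ->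
  {within A, continuous p} -> {within A, continuous (fun x => h (p x))}.
Proof.
by move=> ch cp x; apply: (@continuous_comp _ _ _ (p : subspace A -> R) h);
  [exact: cp|exact: ch].
Qed.

Lemma cb_sqmod f : cb f -> {within closed_unit_ball, continuous (fun x => sqmod (f x))}.
Proof.
move=> /cbP[fr fi] x; rewrite /sqmod.
by apply: cvgD; [apply: (within_comp (@exprn_continuous R 2) fr)
  |apply: (within_comp (@exprn_continuous R 2) fi)].
Qed.

Lemma cb_cmod f : cb f -> {within closed_unit_ball, continuous (fun x => cmod (f x))}.
Proof. by move=> cf; exact: (within_comp (@sqrt_continuous R) (cb_sqmod cf)). Qed.

Lemma within_ball_bounded p : {within closed_unit_ball, continuous p} ->
  exists2 B : R, 0 <= B & forall x, enorm x <= 1 -> `|p x| <= B.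
Proof.
move=> cp; have [q pq qp] := weierstrass_ball cp ltr01.
have [B qB] := polyfun_bounded 1 pq.
exists `|B + 1| => // x x1; rewrite -[p x](subrK (q x)) addrC.
apply: (le_trans (ler_normD _ _)); apply: (le_trans (lerD (qB x x1) (qp x x1))).
exact: ler_norm.
Qed.

Lemma within_ball_measurable p : {within closed_unit_ball, continuous p} ->
  measurable_fun (ball_of 1 : set BV) p.
Proof.
move=> cp; apply: (@eq_measurable_fun _ _ BV R _ (p \o retract)) => [x|].
  by rewrite inE => /ltW x1; rewrite /= retract_id.
by apply: measurable_fun_rV; exact: within_ball_retract.
Qed.

Lemma cb_multiplier f (C : R) : cb f -> 0 <= C ->
  (forall x, unit_ball x -> cmod (f x) <= C) -> multiplier f C.
Proof.
by move=> /cbP[fr fi] C0 fC; split=> //; exact: within_ball_measurable.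
Qed.

Lemma cb_bounded f : cb f -> exists2 C : R, 0 <= C & multiplier f C.
Proof.
move=> cf; have [C C0 fC] := within_ball_bounded (cb_cmod cf).
exists C => //; apply: cb_multiplier => // x x1.
by apply: le_trans (fC x (ltW x1)); exact: ler_norm.
Qed.

(** Within [r] of the sphere, uniform continuity compares [p x] with the value at [x / |x|]. Further
    inside [1 - |x|^2 >= r], so a large multiple of it absorbs the bound of [p]. *)
Lemma boundary_control p (c d : R) : {within closed_unit_ball, continuous p} -> 0 < d ->
  (forall x, unit_sphere x -> p x <= c) ->
  exists2 C : R, 0 <= C & forall x, enorm x <= 1 -> p x <= c + d + C * (1 - sqn x).
Proof.
move=> cp d0 pc; have [B B0 pB] := within_ball_bounded cp.
have [r1 r10 rF] := uniform_modulus 1 (within_ball_retract cp) d0.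
pose r := Num.min r1 1; have r0 : 0 < r by rewrite lt_min r10 ltr01.
have rr1 : r <= 1 by rewrite ge_min lexx orbT.
have Bc : 0 <= B + `|c| by rewrite addr_ge0.
have C0 : 0 <= (B + `|c|) / r by rewrite divr_ge0// ltW.
exists ((B + `|c|) / r) => // x x1.
have e0 := enorm_ge0 x; have sE : sqn x = enorm x ^+ 2 by rewrite sqr_enorm.
have s1 : sqn x <= 1 by rewrite sE exprn_ile1.
have s0 : 0 <= 1 - sqn x by rewrite subr_ge0.
have C1 := mulr_ge0 C0 s0.
have [xr|xr] := ltP (1 - enorm x) r; last first.
  have h : enorm x ^+ 2 <= enorm x by rewrite expr2 ler_piMl.
  have := pB x x1; have := ler_norm (p x); have := ler_norm (- c); rewrite normrN.
  have : B + `|c| <= (B + `|c|) / r * (1 - sqn x).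
    rewrite -mulrA ler_peMr// ler_pdivlMl// mulr1 sE; lra.
  lra.
have ex0 : 0 < enorm x by lra.
have xi0 : 0 <= (enorm x)^-1 by rewrite invr_ge0.
pose z := (enorm x)^-1 *: x.
have z1 : enorm z = 1 by rewrite /z enormZ// mulVf// gt_eqF.
suff H1 : `|p z - p x| < d.
  have := pc z z1; move: H1; rewrite ltr_norml => /andP[? ?]; lra.
have -> : p z = (p \o retract) z by rewrite /= retract_id// z1.
have -> : p x = (p \o retract) x by rewrite /= retract_id.
apply: (rF x z x1) => i; apply: (@le_lt_trans _ _ (1 - enorm x)); last first.
  by apply: (lt_le_trans xr); rewrite ge_min lexx.
rewrite mxE -[X in _ - X]mul1r -mulrBl normrM.
apply: (@le_trans _ _ (`|(enorm x)^-1 - 1| * enorm x)).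
  by rewrite ler_wpM2l//; exact: coord_le_enorm.
rewrite ger0_norm ?subr_ge0 ?invf_ge1// mulrBl mulVf ?mul1r// gt_eqF//.
Qed.

End ball_functions.

(** * Toeplitz operators *)

Section toeplitz_operators.
Context {R : realType} {n : nat}.
Variable nu : probability (borel_rV R n) R.
Hypothesis hn : (2 <= n)%N.
Hypothesis nu_invariant : orthogonally_invariant nu.
Hypothesis nu_boundary : charges_boundary nu.
Local Notation V := 'rV[R]_n.
Local Notation J := (J nu).
Local Notation ibl := (ibl nu).
Local Notation ip := (inner nu).
Local Notation N := (L2norm nu).
Local Notation L2 := (in_L2 nu).
Local Notation H := (b2 nu).
Local Notation cb := (@continuous_closed_ball R n).
Local Notation T := (@toeplitz R n nu).
Local Notation e := (e hn nu_invariant nu_boundary).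
Local Notation he := (he hn nu_invariant nu_boundary).
Local Notation hdim := (hdim hn nu_invariant nu_boundary).
Local Notation lam := (lam nu).
Implicit Types (u v w : H) (f g : V -> R[i]) (p q : V -> R) (x y : V) (a : R[i]).
Implicit Types (k l M : nat) (d C : R).

Lemma L2_cb f u : cb f -> L2 (fun x => f x * u x).
Proof. by move=> /cb_bounded[C _ /multiplier_L2/(_ (b2_L2 u))[]]. Qed.

Lemma T_ip f u w : cb f -> ip (T f u) w = inner nu (fun x => f x * u x) w.
Proof. by move=> cf; apply: (QprojP hn nu_invariant nu_boundary); exact: L2_cb. Qed.

Lemma L2B (u v : V -> R[i]) : L2 u -> L2 v -> L2 (fun x => u x - v x).
Proof.
move=> Lu Lv; have := L2_lin (-1) Lv Lu.
by rewrite (_ : (fun _ => _) = fun x => u x - v x)//; apply/funext => x; rewrite mulN1r addrC.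
Qed.

(** Pythagoras, since [h - Q h] is orthogonal to the Bergman space. *)
Lemma Q_best (h : V -> R[i]) w : L2 h ->
  N (fun x => h x - Qproj nu h x) <= N (fun x => h x - w x) /\
  N (Qproj nu h) <= N h.
Proof.
move=> Lh; set v := Qproj nu h; have vP := QprojP hn nu_invariant nu_boundary Lh.
have Lhv : L2 (fun x => h x - v x) by apply: L2B => //; exact: b2_L2.
have orth w' : inner nu (fun x => h x - v x) (w' : H) = 0.
  have E : (fun x => h x - v x) = (fun x => -1 * v x + h x).
    by apply/funext => x; rewrite mulN1r addrC.
  by rewrite E inner_linl ?vP// ?mulN1r ?addNr//; exact: b2_L2.
have P w' : N (fun x => 1 * (h x - v x) + (w' : H) x) ^+ 2 =
    N (fun x => h x - v x) ^+ 2 + N w' ^+ 2.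
  rewrite sqr_L2norm_lin//; last exact: b2_L2.
  by rewrite orth mulr0 mulr0 addr0 /sqmod /= expr1n expr0n addr0 mul1r.
split; rewrite -(@ler_pXn2r _ 2) ?nnegrE ?L2norm_ge0//.
  rewrite (_ : (fun x => h x - w x) = fun x => 1 * (h x - v x) + (v - w : H) x).
    by rewrite (P (v - w)) lerDl sqr_ge0.
  by apply/funext => x; rewrite mul1r b2D b2N addrA subrK.
rewrite [X in _ <= N X ^+ 2](_ : _ = fun x => 1 * (h x - v x) + v x).
  by rewrite (P v) lerDr sqr_ge0.
by apply/funext => x; rewrite mul1r subrK.
Qed.

Lemma L2norm_mono (h h' : V -> R[i]) : L2 h -> L2 h' ->
  (forall x, unit_ball x -> sqmod (h x) <= sqmod (h' x)) -> N h <= N h'.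
Proof.
move=> Lh Lh' hh; rewrite /L2norm ler_wsqrtr//.
have iS (g : V -> R[i]) : L2 g -> ibl 1 (fun x => sqmod (g x)).
  by move=> /in_L2P[_ _ ir ii]; apply: eq_ibl (iblD ir ii) => x _; rewrite -!expr2.
by apply: (@le_J _ _ nu 1) => //; exact: iS.
Qed.

Lemma T_norm f C u : cb f -> multiplier f C -> N (T f u) <= C * N u.
Proof.
move=> cf mf; have [_] := multiplier_L2 mf (b2_L2 u).
by apply: le_trans; have [_] := Q_best 0 (L2_cb u cf).
Qed.

Lemma T_linear f : cb f -> linear (T f).
Proof.
move=> cf a u v; apply: (ip_inj hn nu_invariant nu_boundary) => w.
rewrite ip_linl (T_ip (a *: u + v) w cf) (T_ip u w cf) (T_ip v w cf).
rewrite -(inner_linl a (L2_cb u cf) (L2_cb v cf) (b2_L2 w)).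
have -> // : (fun x => f x * (a *: u + v) x) = fun x => a * (f x * u x) + f x * v x.
by apply/funext => x; rewrite b2D b2Z mulrDr mulrCA.
Qed.

Lemma T_bounded f : cb f -> bounded_op (T f).
Proof.
move=> cf; split; first exact: T_linear.
by have [C _ mf] := cb_bounded cf; exists C => u; exact: T_norm.
Qed.

Lemma T_lin f g a : cb f -> cb g -> T (fun x => a * f x + g x) = a *: T f + T g.
Proof.
move=> cf cg; apply/funext => u; apply: (ip_inj hn nu_invariant nu_boundary) => w.
have -> : (a *: T f + T g) u = a *: T f u + T g u by [].
rewrite ip_linl (T_ip u w (cbD (cbZ cf) cg)) (T_ip u w cf) (T_ip u w cg).
rewrite -(inner_linl a (L2_cb u cf) (L2_cb u cg) (b2_L2 w)).
have -> // : (fun x => (a * f x + g x) * u x) = fun x => a * (f x * u x) + g x * u x.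
by apply/funext => x; rewrite mulrDl mulrA.
Qed.

Lemma T_adjoint f : cb f -> adjoint (T f) = T (fun x => conjc (f x)).
Proof.
move=> cf; apply: (adjoint_unique hn nu_invariant nu_boundary (T_bounded cf)) => u v.
rewrite T_ip// [RHS]ipJ T_ip; last exact: cbJ.
by rewrite inner_mul (innerJ (L2_cb v (cbJ cf)) (b2_L2 u)).
Qed.

Lemma T_cst a : T (fun=> a) = fun u => a *: u.
Proof.
apply/funext => u; apply: (ip_inj hn nu_invariant nu_boundary) => w.
rewrite T_ip; last exact: cb_cst.
by congr (inner nu _ _).
Qed.

Lemma T_in_b2 f u v : cb f -> (forall x, unit_ball x -> f x * u x = v x) -> T f u = v.
Proof.
move=> cf fg; apply: (ip_inj hn nu_invariant nu_boundary) => w.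
rewrite !T_ip//; apply: complex_ext; rewrite (Re_inner, Im_inner) (Re_inner, Im_inner);
  by apply: eq_J => x x1; rewrite fg.
Qed.

Definition sqf : V -> R[i] := fun x => (sqn x)%:C.

Lemma cb_sqf : cb sqf.
Proof. exact/cb_polyfun/polyfun_sqn. Qed.

Lemma T_sqf k l : (l < hdim k)%N -> T sqf (e k l) = (lam k)%:C *: e k l.
Proof.
move=> kl; have ph k l := HP_polyfun (he_HP hn nu_invariant nu_boundary k l).
have pS := @polyfun_sqn R n.
have m0 : mom nu 1 k != 0 by rewrite gt_eqF// (mom_gt0 nu_boundary).
suff E k' l' : (l' < hdim k')%N -> ip (T sqf (e k l)) (e k' l') =
    (lam k)%:C * ((k == k') && (l == l'))%:R.
  apply/eqP; rewrite -subr_eq0; apply/eqP.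
  apply: (e_complete (hn := hn) (nu_invariant := nu_invariant) (nu_boundary := nu_boundary)) => k' l' kl'.
  by rewrite ipBl E// ipZl e_orthonormal// subrr.
move=> kl'; rewrite ip_e.
have TE : T sqf (e k l) = T sqf (e k l) by [].
have I : ip (T sqf (e k l)) (e k' l') =
    (J 1 (fun x => sqn x ^+ 1 * (he k l x * he k' l' x)))%:C.
  rewrite T_ip; last exact: cb_sqf.
  apply: complex_ext; rewrite (Re_inner, Im_inner) /=.
    by apply: eq_J => x x1; rewrite /sqf !eE// !cE /=; ring.
  rewrite (@eq_J _ _ _ _ _ (fun=> 0)); first by rewrite /J /Rintegral integral0.
  by move=> x x1; rewrite /sqf !eE// !cE /=; ring.
rewrite -ip_e I; have [kk|kk] := eqVneq k k'; last first.
  by rewrite (HP_orth nu_invariant 1 1 hn _ _ kk) ?mulr0//; exact: he_HP.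
subst k'; apply: complex_ext; rewrite !cE /= ?mul0r ?mulr0 ?subr0 ?addr0; last first.
  by case: eqP; rewrite /= ?mulr0 ?mul0r ?addr0.
apply: (mulIf m0); rewrite (J_scaling hn nu_invariant); [|exact: he_HP..].
rewrite he_orthonormal// add1n (mom_lam nu_boundary).
by case: eqP => _; rewrite /= !(mulr1, mulr0, mul0r, subr0).
Qed.

End toeplitz_operators.

(* Unfolding the norms makes unification of unequal norms very slow. *)
Opaque L2norm inner proj lincomb e toeplitz Qproj.

(** Shares an error [a] with a factor bounded by [C]; dividing by [C + 1] spares the case
    [C = 0]. *)
Lemma mul_div_succ_le (R : realType) (C a b : R) : 0 <= C -> 0 <= a -> 0 <= b ->
  C * (a / (C + 1) * b) <= a * b.
Proof.
move=> C0 a0 b0; have C1 : 0 < C + 1 by rewrite ltr_wpDl.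
rewrite (_ : C * _ = C / (C + 1) * (a * b)); last by field; rewrite gt_eqF.
by rewrite ler_piMl ?mulr_ge0// ler_pdivrMr// mul1r lerDl.
Qed.

Lemma le_of_sqr (R : realType) (a b : R) : 0 <= b -> a ^+ 2 <= b ^+ 2 -> a <= b.
Proof. by move=> b0 ab; apply: le_trans (ler_norm a) _; rewrite -(ger0_norm b0) -ler_sqr ?real_normK ?num_real ?nnegrE. Qed.

(** * Hankel operators *)

Section hankel_operators.
Context {R : realType} {n : nat}.
Variable nu : probability (borel_rV R n) R.
Hypothesis hn : (2 <= n)%N.
Hypothesis nu_invariant : orthogonally_invariant nu.
Hypothesis nu_boundary : charges_boundary nu.
Local Notation V := 'rV[R]_n.
Local Notation ip := (inner nu).
Local Notation N := (L2norm nu).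
Local Notation L2 := (in_L2 nu).
Local Notation H := (b2 nu).
Local Notation cb := (@continuous_closed_ball R n).
Local Notation T := (@toeplitz R n nu).
Local Notation e := (e hn nu_invariant nu_boundary).
Local Notation hdim := (hdim hn nu_invariant nu_boundary).
Local Notation proj := (proj hn nu_invariant nu_boundary).
Local Notation sqsum := (sqsum hn nu_invariant nu_boundary).
Local Notation tail := (tail hn nu_invariant nu_boundary).
Local Notation lam := (lam nu).
Local Notation sqf := (@sqf R n).
Implicit Types (u v w : H) (f g : V -> R[i]) (p q : V -> R) (x y : V) (a : R[i]).
Implicit Types (k l M : nat) (d C : R).

Let L0 (u : V -> R[i]) : 0 <= N u := L2norm_ge0 nu u.

(** Parseval for the projections, then a limit. It estimates operators that are diagonal in the
    basis. *)
Lemma norm_le_coef u v C : 0 <= C ->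
  (forall k l, (l < hdim k)%N -> sqmod (ip u (e k l)) <= C ^+ 2 * sqmod (ip v (e k l))) ->
  N u <= C * N v.
Proof.
move=> C0 uv; apply/ler_addgt0Pr => d d0.
have [M hM] := proj_cvg hn nu_invariant nu_boundary u d0.
have {}hM := hM M (leqnn M).
rewrite -(subrK (proj M u) u) addrC; apply: (le_trans (hnormD _ _)).
apply: lerD => //; apply: (@le_trans _ _ (C * N (proj M v))); last first.
  by rewrite ler_wpM2l// norm_proj.
have h0 : 0 <= C * N (proj M v) by exact: mulr_ge0.
have E w := sqr_norm_proj hn nu_invariant nu_boundary M w.
move: (E u) (E v) h0; move: (N (proj M u)) (N (proj M v)) => r s Er Es h0.
apply: (le_of_sqr h0); rewrite exprMn Er Es /sqsum mulr_sumr; apply: ler_sum => k _; rewrite mulr_sumr; apply: ler_sum => l _.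
exact: uv.
Qed.

Lemma ip_T_sqf u k l : (l < hdim k)%N -> ip (T sqf u) (e k l) = (lam k)%:C * ip u (e k l).
Proof.
move=> kl; have [_ aT] := adjointP hn nu_invariant nu_boundary
  (T_bounded hn nu_invariant nu_boundary cb_sqf).
have selfadj : (fun x => conjc (sqf x)) = sqf.
  by apply/funext => x; rewrite /sqf conjc_real.
rewrite aT (T_adjoint hn nu_invariant nu_boundary cb_sqf) selfadj.
by rewrite T_sqf// ipZr conjc_real.
Qed.

Definition dfct : V -> R[i] := fun x => (1 - sqn x)%:C.

Lemma polyfun_dfct : polyfun (fun x : V => 1 - sqn x).
Proof. by have := @polyfun_sqn R n; move=> ?; pf. Qed.

Lemma cb_dfct : cb dfct.
Proof. exact/cb_polyfun/polyfun_dfct. Qed.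

Lemma T_dfct u : T dfct u = u - T sqf u.
Proof.
have -> : dfct = fun x => (-1) * sqf x + 1.
  by apply/funext => x; rewrite /dfct /sqf rmorphB rmorph1 mulN1r addrC.
rewrite (T_lin hn nu_invariant nu_boundary (-1) cb_sqf (@cb_cst _ _ 1)).
rewrite (T_cst hn nu_invariant nu_boundary 1).
have -> : (-1 *: T sqf + (fun u : H => 1 *: u)) u = -1 *: T sqf u + 1 *: u by [].
by rewrite scaleN1r scale1r addrC.
Qed.

Lemma ip_T_dfct u k l : (l < hdim k)%N ->
  ip (T dfct u) (e k l) = (1 - lam k)%:C * ip u (e k l).
Proof. by move=> kl; rewrite T_dfct ipBl ip_T_sqf// rmorphB rmorph1 mulrBl mul1r. Qed.

Lemma norm_T_dfct M u : tail M u -> N (T dfct u) <= (1 - lam M) * N u.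
Proof.
move=> tu; apply: norm_le_coef => [|k l kl]; first by rewrite subr_ge0 lam_le1.
rewrite ip_T_dfct// sqmodM; have [kM|kM] := ltnP k M.
  by rewrite tu// -!sqr_cmod cmod0 expr0n !mulr0.
rewrite ler_wpM2r ?sqmod_ge0// /sqmod /= expr0n addr0.
have l1 := lam_le1 nu_boundary k; have ll := lam_homo nu_boundary kM.
by rewrite lerXn2r ?nnegrE ?subr_ge0// ?(le_trans ll)// lerB.
Qed.

(** As [0 <= 1 - |x|^2 <= 1], the square norm of the product is at most [<T dfct u, u>]: the
    diagonal Toeplitz operator controls the whole multiplication at the cost of a square root, hence
    the threshold [1 - d^2] for [lam]. *)
Lemma tail_dfct d : 0 < d ->
  exists M, forall u, tail M u -> N (fun x => dfct x * u x) <= d * N u.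
Proof.
move=> d0; have d2 : 1 - d ^+ 2 < 1 by rewrite ltrBlDr ltrDl exprn_gt0.
have [M hM] := lam_cvg1 nu_boundary d2; exists M => u tu.
have Lu := L2_cb u cb_dfct.
have h1 : N (fun x => dfct x * u x) ^+ 2 <= Re (ip (T dfct u) u).
  rewrite (T_ip hn nu_invariant nu_boundary u u cb_dfct).
  have -> : N (fun x => dfct x * u x) ^+ 2 = Re (inner nu (fun x => dfct x * u x) (fun x => dfct x * u x)).
    by rewrite innerE.
  have [i1 i2 _ _] := L2_ibl Lu Lu; have [i3 i4 _ _] := L2_ibl Lu (b2_L2 u).
  rewrite !Re_inner; apply: le_J; [by ib|by ib|].
  move=> x x1; have s1 : 0 <= 1 - sqn x <= 1.
    rewrite subr_ge0 lerBlDr lerDl sqn_ge0 andbT -sqr_enorm.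
    by apply: exprn_ile1; [exact: enorm_ge0|exact: ltW].
  rewrite /dfct !cE /=; move: (1 - sqn x) (Re (u x)) (Im (u x)) s1 => s a b /andP[s0 s1].
  have -> : (s * a - 0 * b) * (s * a - 0 * b) + (s * b + 0 * a) * (s * b + 0 * a) =
    s * (s * (a * a + b * b)) by ring.
  have -> : (s * a - 0 * b) * a + (s * b + 0 * a) * b = 1 * (s * (a * a + b * b)) by ring.
  by rewrite ler_wpM2r// mulr_ge0// addr_ge0// -expr2 sqr_ge0.
rewrite -(@ler_pXn2r _ 2) ?nnegrE ?mulr_ge0// ?(ltW d0)//.
apply: (le_trans h1); apply: (le_trans (ler_norm _)).
apply: (le_trans (Re_le_cmod _)); apply: (le_trans (ip_cs _ _)).
rewrite exprMn [N u ^+ 2]expr2 mulrA ler_wpM2r//; apply: (le_trans (norm_T_dfct tu)).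
by rewrite ler_wpM2r//; have := hM M (leqnn M); lra.
Qed.

Lemma boundary_tail f C d : cb f -> 0 <= C -> 0 < d ->
  (forall x, unit_sphere x -> cmod (f x) <= C) ->
  exists M, forall u, tail M u -> N (fun x => f x * u x) <= (C + d) * N u.
Proof.
move=> cf C0 d0 fC; have d2 : 0 < d / 2 by rewrite divr_gt0.
have [B B0 fB] := boundary_control (cb_cmod cf) d2 fC.
have B1 : 0 < B + 1 by rewrite ltr_wpDl.
have [M hM] := tail_dfct (divr_gt0 d2 B1); exists M => u /hM h.
have Ld := L2_cb u cb_dfct.
have Lg := L2_lin B%:C Ld (L2_lin (C + d / 2)%:C (b2_L2 u) (L2_0 nu)).
apply: (@le_trans _ _ (N (fun x => B%:C * (dfct x * u x) + ((C + d / 2)%:C * u x + 0)))).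
  apply: L2norm_mono => //; first exact: L2_cb.
  move=> x x1.
  have -> : B%:C * (dfct x * u x) + ((C + d / 2)%:C * u x + 0) =
      (B * (1 - sqn x) + (C + d / 2))%:C * u x.
    by rewrite /dfct addr0 mulrA -mulrDl -!rmorphM -rmorphD.
  rewrite !sqmodM ler_wpM2r ?sqmod_ge0// -!sqr_cmod cmodR.
  rewrite lerXn2r ?nnegrE ?cmod_ge0//; apply: le_trans (ler_norm _).
  by rewrite addrC; apply: fB; exact: ltW.
have LB := L2_lin B%:C Ld (L2_0 nu).
apply: (le_trans (L2normD _ _)); [|exact: (L2_lin (C + d / 2)%:C (b2_L2 u) (L2_0 nu))|].
  by have := LB; under eq_fun do rewrite addr0.
have -> : (fun x => (C + d / 2)%:C * u x + 0) = (fun x => (C + d / 2)%:C * u x).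
  by apply/funext => x; rewrite addr0.
rewrite !L2normZ//; last exact: b2_L2.
rewrite !cmodR !ger0_norm//; last by rewrite addr_ge0// ltW.
rewrite [leRHS](_ : _ = d / 2 * N u + (C + d / 2) * N u); last by field.
rewrite lerD2r; apply: (@le_trans _ _ (B * (d / 2 / (B + 1) * N u))).
  by rewrite ler_wpM2l.
by apply: mul_div_succ_le => //; exact: ltW.
Qed.

Lemma T_boundary0_compact f : cb f -> (forall x, unit_sphere x -> f x = 0) ->
  compact_op (T f).
Proof.
move=> cf f0; apply/(compactP hn nu_invariant nu_boundary); split.
  exact: T_bounded.
move=> d d0; have [|M hM] := @boundary_tail f 0 d cf (lexx 0) d0.
  by move=> x /f0 ->; rewrite cmod0.
exists M => u /hM; rewrite add0r; apply: le_trans.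
by have [] := Q_best hn nu_invariant nu_boundary 0 (L2_cb u cf).
Qed.

Definition hankel f u : V -> R[i] := fun x => f x * u x - T f u x.

Lemma L2_hankel f u : cb f -> L2 (hankel f u).
Proof. by move=> cf; apply: L2B; [exact: L2_cb|exact: b2_L2]. Qed.

Lemma hankel_best f u w : cb f -> N (hankel f u) <= N (fun x => f x * u x - w x).
Proof.
by move=> cf; have [] := Q_best hn nu_invariant nu_boundary w (L2_cb u cf).
Qed.

Lemma hankel_norm f C u : cb f -> multiplier f C -> N (hankel f u) <= C * N u.
Proof.
move=> cf mf; apply: (le_trans (hankel_best u 0 cf)).
have -> : (fun x => f x * u x - (0 : H) x) = fun x => f x * u x.
  by apply/funext => x; rewrite b20 subr0.
by have [] := multiplier_L2 mf (b2_L2 u).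
Qed.

Lemma hankelD f u v : cb f -> N (hankel f (u + v)) <= N (hankel f u) + N (hankel f v).
Proof.
move=> cf; rewrite (_ : hankel f (u + v) = fun x => hankel f u x + hankel f v x).
  by apply: L2normD; exact: L2_hankel.
apply/funext => x; rewrite /hankel (opD (T_linear hn nu_invariant nu_boundary cf)).
by rewrite !b2D mulrDr opprD addrACA.
Qed.

Definition htail f : Prop := forall d, 0 < d ->
  exists M, forall u, tail M u -> N (hankel f u) <= d * N u.

(** The difference is the projection of [g * hankel f u], and projecting does not increase the
    norm. *)
Lemma semicommutator_norm f g C u : cb f -> cb g -> multiplier g C ->
  N (b2val (T (fun x => g x * f x) u - T g (T f u))) <= C * N (hankel f u).
Proof.
move=> cf cg mg; have [Lgh h] := multiplier_L2 mg (L2_hankel u cf).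
suff E : T (fun x => g x * f x) u - T g (T f u) = Qproj nu (fun x => g x * hankel f u x).
  rewrite E; apply: le_trans h.
  by have [] := Q_best hn nu_invariant nu_boundary 0 Lgh.
apply: (ip_inj hn nu_invariant nu_boundary) => w.
rewrite ipBl (T_ip hn nu_invariant nu_boundary u w (cbM cg cf)).
rewrite (T_ip hn nu_invariant nu_boundary (T f u) w cg) (QprojP hn nu_invariant nu_boundary Lgh).
have -> : (fun x => g x * hankel f u x) =
    fun x => -1 * (g x * T f u x) + (g x * f x) * u x.
  by apply/funext => x; rewrite /hankel; ring.
rewrite (inner_linl (-1) (L2_cb (T f u) cg) (L2_cb u (cbM cg cf)) (b2_L2 w)).
by rewrite mulN1r addrC.
Qed.

Lemma semicommutator_compact f g : cb f -> cb g -> htail f ->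
  compact_op (op_mul (T g) (T f) - T (fun x => g x * f x)).
Proof.
move=> cf cg hf; have [C C0 mg] := cb_bounded cg.
have bT := T_bounded hn nu_invariant nu_boundary (cbM cg cf).
apply/(compactP hn nu_invariant nu_boundary); split.
  have := bounded_op_lin (-1) bT (bounded_op_mul (T_bounded hn nu_invariant nu_boundary cg)
    (T_bounded hn nu_invariant nu_boundary cf)).
  by rewrite scaleN1r addrC.
move=> d d0; have C1 : 0 < C + 1 by rewrite ltr_wpDl.
have [M hM] := hf _ (divr_gt0 d0 C1); exists M => u /hM h.
have -> : (op_mul (T g) (T f) - T (fun x => g x * f x)) u =
    - (T (fun x => g x * f x) u - T g (T f u)) by rewrite opprB.
rewrite hnormN; apply: (le_trans (semicommutator_norm u cf cg mg)).
apply: (@le_trans _ _ (C * (d / (C + 1) * N u))); first by rewrite ler_wpM2l.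
by apply: mul_div_succ_le => //; exact: ltW.
Qed.

(** Comparing with [T f (T g u)] splits the Hankel operator of the product into [f] times that of
    [g] and that of [f] at [T g u]. The vector [T g u] is not a tail, but [proj M2] after [T g] is
    compact, so its low degrees are small when [u] is a tail. *)
Lemma htailM f g : cb f -> cb g -> htail f -> htail g -> htail (fun x => f x * g x).
Proof.
move=> cf cg hf hg d d0.
have [C C0 mf] := cb_bounded cf; have [D D0 mg] := cb_bounded cg.
have C1 : 0 < C + 1 by rewrite ltr_wpDl.
have D1 : 0 < D + 1 by rewrite ltr_wpDl.
have d3 : 0 < d / 3 by rewrite divr_gt0.
have [M1 h1] := hg _ (divr_gt0 d3 C1); have [M2 h2] := hf _ (divr_gt0 d3 D1).
have : compact_op (op_mul (proj M2) (T g)).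
  apply: (compact_mulr (T_bounded hn nu_invariant nu_boundary cg)).
  apply/(compactP hn nu_invariant nu_boundary); split; first exact: bounded_proj.
  move=> r r0; exists M2 => u tu.
  rewrite (proj_tail tu).
  by rewrite hnorm0 mulr_ge0// ltW.
move=> /(compactP hn nu_invariant nu_boundary)[_ /(_ _ (divr_gt0 d3 C1))[M3 h3]].
exists (maxn M1 M3) => u tu.
have {}h1 := h1 u (tail_le (leq_maxl _ _) tu); have {}h3 := h3 u (tail_le (leq_maxr _ _) tu).
set w := T g u; have cfg := cbM cf cg.
apply: (le_trans (hankel_best u (T f w) cfg)).
have -> : (fun x => f x * g x * u x - T f w x) =
    fun x => f x * hankel g u x + hankel f w x.
  by apply/funext => x; rewrite /hankel -/w; ring.
have [L1 n1] := multiplier_L2 mf (L2_hankel u cg).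
apply: (le_trans (L2normD L1 (L2_hankel w cf))).
have n2 : N (hankel f w) <= d / 3 * N u + d / 3 * N u.
  rewrite -(subrK (proj M2 w) w); apply: (le_trans (hankelD _ _ cf)); apply: lerD.
    apply: (le_trans (h2 _ (@tail_proj _ _ _ _ _ _ M2 w))).
    apply: (@le_trans _ _ (d / 3 / (D + 1) * (D * N u))).
      rewrite ler_wpM2l ?(ltW (divr_gt0 d3 D1))//; apply: le_trans (norm_tail _ _ _ _ _) _.
      exact: T_norm.
    by rewrite mulrCA; apply: mul_div_succ_le => //; exact: ltW.
  apply: (le_trans (hankel_norm _ cf mf)).
  apply: (@le_trans _ _ (C * (d / 3 / (C + 1) * N u))); first by rewrite ler_wpM2l.
  by apply: mul_div_succ_le => //; exact: ltW.
rewrite [leRHS](_ : _ = d / 3 * N u + (d / 3 * N u + d / 3 * N u)); last by field.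
apply: lerD => //; apply: (le_trans n1).
apply: (@le_trans _ _ (C * (d / 3 / (C + 1) * N u))); first by rewrite ler_wpM2l.
by apply: mul_div_succ_le => //; exact: ltW.
Qed.

Lemma htailD f g : cb f -> cb g -> htail f -> htail g -> htail (fun x => f x + g x).
Proof.
move=> cf cg hf hg d d0; have d2 : 0 < d / 2 by rewrite divr_gt0.
have [M1 h1] := hf _ d2; have [M2 h2] := hg _ d2.
exists (maxn M1 M2) => u tu.
have {}h1 := h1 u (tail_le (leq_maxl _ _) tu); have {}h2 := h2 u (tail_le (leq_maxr _ _) tu).
apply: (le_trans (hankel_best u (T f u + T g u) (cbD cf cg))).
have -> : (fun x => (f x + g x) * u x - (T f u + T g u) x) = fun x => hankel f u x + hankel g u x.
  by apply/funext => x; rewrite /hankel b2D mulrDl opprD addrACA.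
apply: (le_trans (L2normD (L2_hankel u cf) (L2_hankel u cg))).
rewrite [leRHS](_ : _ = d / 2 * N u + d / 2 * N u); last by field.
exact: (lerD h1 h2).
Qed.

Lemma htail_cst a : htail (fun=> a).
Proof.
move=> d d0; exists 0%N => u _; apply: (le_trans (hankel_best u (a *: u) (@cb_cst _ _ a))).
have -> : (fun x => a * u x - (a *: u) x) = (0 : H).
  by apply/funext => x; rewrite b2Z b20 subrr.
by rewrite hnorm0 mulr_ge0// ltW.
Qed.

Lemma htail_approx f : cb f ->
  (forall d, 0 < d -> exists2 g, cb g /\ htail g & forall x, unit_ball x -> cmod (f x - g x) <= d) ->
  htail f.
Proof.
move=> cf fapp d d0; have d2 : 0 < d / 2 by rewrite divr_gt0.
have [g [cg hg] fg] := fapp _ d2; have [M hM] := hg _ d2.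
exists M => u /hM h; apply: (le_trans (hankel_best u (T g u) cf)).
have -> : (fun x => f x * u x - T g u x) = fun x => (f x - g x) * u x + hankel g u x.
  by apply/funext => x; rewrite /hankel; ring.
have mfg : multiplier (fun x => f x - g x) (d / 2).
  exact: (cb_multiplier (cbB cf cg) (ltW d2) fg).
have [L1 n1] := multiplier_L2 mfg (b2_L2 u).
apply: (le_trans (L2normD L1 (L2_hankel u cg))).
rewrite [leRHS](_ : _ = d / 2 * N u + d / 2 * N u); last by field.
exact: (lerD n1 h).
Qed.

End hankel_operators.

(** * Hankel operators of coordinates, polynomials and continuous functions *)

Section compact_semicommutators.
Context {R : realType} {n : nat}.
Variable nu : probability (borel_rV R n) R.
Hypothesis hn : (2 <= n)%N.
Hypothesis nu_invariant : orthogonally_invariant nu.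
Hypothesis nu_boundary : charges_boundary nu.
Local Notation V := 'rV[R]_n.
Local Notation J := (J nu).
Local Notation ip := (inner nu).
Local Notation N := (L2norm nu).
Local Notation H := (b2 nu).
Local Notation cb := (@continuous_closed_ball R n).
Local Notation T := (@toeplitz R n nu).
Local Notation e := (e hn nu_invariant nu_boundary).
Local Notation he := (he hn nu_invariant nu_boundary).
Local Notation hdim := (hdim hn nu_invariant nu_boundary).
Local Notation proj := (proj hn nu_invariant nu_boundary).
Local Notation tail := (tail hn nu_invariant nu_boundary).
Local Notation lam := (lam nu).
Local Notation htail := (htail hn nu_invariant nu_boundary).
Implicit Types (u v w : H) (f g : V -> R[i]) (p q : V -> R) (x y : V) (a : R[i]).
Implicit Types (k l M : nat) (d C : R) (hr hi : nat -> V -> R).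

Let L0 (u : V -> R[i]) : 0 <= N u := L2norm_ge0 nu u.

Lemma hpart_hpoly hr M : (forall k, HP k (hr k)) -> hpoly (hpart hr M).
Proof.
move=> Hh; elim: M => [|M IH].
  by rewrite (_ : hpart hr 0 = fun=> 0); [exact: hpoly0|apply/funext => x; rewrite /hpart big_geq].
rewrite (_ : hpart hr M.+1 = fun x => hr M x + hpart hr M x); first exact: (hpolyD (Hh M) IH).
by apply/funext => x; rewrite /hpart big_nat_recr//= addrC.
Qed.

Lemma hfin_exists hr hi M : (forall k, HP k (hr k)) -> (forall k, HP k (hi k)) ->
  {u : H | forall x, unit_ball x -> u x = hpart hr M x +i* hpart hi M x}.
Proof.
move=> Hr Hi; have pr := hpart_polyfun M Hr; have pi := hpart_polyfun M Hi.
have m : cut (hpart hr M) (hpart hi M) \in harmonic_L2 nu.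
  apply: cut_mem; [exact/(hpoly_harmonic hn)/hpart_hpoly|exact/(hpoly_harmonic hn)/hpart_hpoly|..].
    by apply: ibl_polyfun; pf.
  by apply: ibl_polyfun; pf.
by exists (B2 m) => x x1; rewrite /= cut_in.
Qed.

Lemma hfin_norm hr hi M u : (forall k, HP k (hr k)) -> (forall k, HP k (hi k)) ->
  (forall x, unit_ball x -> u x = hpart hr M x +i* hpart hi M x) ->
  N u ^+ 2 = \sum_(0 <= k < M) J 1 (fun x => hr k x * hr k x) +
             \sum_(0 <= k < M) J 1 (fun x => hi k x * hi k x).
Proof.
move=> Hr Hi uE; have pr := hpart_polyfun M Hr; have pi := hpart_polyfun M Hi.
have -> : N u ^+ 2 = Re (ip u u) by rewrite innerE.
rewrite -!(hpart_sqr hn nu_invariant)// -JD; [|by apply: ibl_polyfun; pf..].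
by rewrite Re_inner; apply: eq_J => x x1; rewrite uE.
Qed.

Lemma J_hpart_he hr M k l : (forall k, HP k (hr k)) -> hr k = (fun=> 0) ->
  J 1 (fun x => hpart hr M x * he k l x) = 0.
Proof.
move=> Hr r0; have He := he_HP hn nu_invariant nu_boundary k l.
have ph := HP_polyfun He; have pr j := HP_polyfun (Hr j).
under eq_fun do rewrite /hpart mulr_suml.
rewrite (J_sum _ (F := fun j x => hr j x * he k l x)); last first.
  by move=> j; have ? := pr j; apply: ibl_polyfun; pf.
rewrite big1// => j _; have [->|jk] := eqVneq j k.
  rewrite r0 (@eq_J _ _ _ _ _ (fun=> 0)); first by rewrite /J /Rintegral integral0.
  by move=> x _; rewrite mul0r.
rewrite -[RHS](HP_orth nu_invariant 1 0 hn (Hr j) He jk).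
by apply: eq_J => x _; rewrite mul1r.
Qed.

Lemma hfin_tail hr hi M M' u : (forall k, HP k (hr k)) -> (forall k, HP k (hi k)) ->
  (forall x, unit_ball x -> u x = hpart hr M x +i* hpart hi M x) ->
  (forall k, (k < M')%N -> hr k = (fun=> 0) /\ hi k = (fun=> 0)) -> tail M' u.
Proof.
move=> Hr Hi uE z k l kM kl; have [r0 i0] := z k kM; rewrite ip_e.
have -> : J 1 (fun x => Re (u x) * he k l x) = 0.
  by rewrite -[RHS](J_hpart_he M l Hr r0); apply: eq_J => x x1; rewrite uE.
have -> // : J 1 (fun x => Im (u x) * he k l x) = 0.
by rewrite -[RHS](J_hpart_he M l Hi i0); apply: eq_J => x x1; rewrite uE.
Qed.

Section lowering.
Variables (i : 'I_n) (hr : nat -> V -> R).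
Hypothesis Hr : forall k, HP k (hr k).

Definition lowered k : V -> R := fun x => @hcoef R n k.+1 * pd (hr k.+1) i x.
(** Indexed by its own degree, hence the shift. *)
Definition raised k : V -> R := if k is k'.+1 then raise k' i (hr k') else fun=> 0.

Lemma HP_lowered k : HP k (lowered k).
Proof. exact: HPZ (HP_pd hn i (Hr k.+1)). Qed.

Lemma HP_raised k : HP k (raised k).
Proof. by case: k => [|k]; [exact: HP0|exact: HPraise]. Qed.

Lemma coord_hpart M x : x ord0 i * hpart hr M.+1 x =
  hpart raised M.+2 x + sqn x * hpart lowered M x.
Proof.
have E0 : pd (hr 0) i = fun=> 0 := HP_pd0 i (Hr 0).
have -> : hpart raised M.+2 x = \sum_(0 <= k < M.+1) raise k i (hr k) x.
  by rewrite /hpart big_nat_recl//= add0r.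
rewrite /hpart !mulr_sumr [LHS]big_nat_recl// [X in _ = X + _]big_nat_recl// -addrA.
rewrite -big_split; congr (_ + _); first by rewrite /raise E0 !mulr0 subr0.
by apply: eq_bigr => k _ /=; rewrite /raise /lowered; ring.
Qed.

(** [HP_pd_le] gives the factor [(lam k)^-1]; its value at 0 bounds it uniformly in [k]. *)
Lemma J_lowered k : J 1 (fun x => lowered k x * lowered k x) <=
  (lam 0)^-1 * J 1 (fun x => hr k.+1 x * hr k.+1 x).
Proof.
have ph := HP_polyfun (Hr k.+1).
have E : J 1 (fun x => lowered k x * lowered k x) =
    @hcoef R n k.+1 ^+ 2 * J 1 (fun x => pd (hr k.+1) i x * pd (hr k.+1) i x).
  rewrite -JZ; last by apply: ibl_polyfun; pf.
  by apply: eq_J => x _; rewrite /lowered; ring.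
have := HP_pd_le hn nu_invariant nu_boundary i (Hr k.+1); rewrite -E.
rewrite (mom_lam nu_boundary) mulrA ler_pM2r ?(mom_gt0 nu_boundary)// => h.
have l0 := lam_gt0 nu_boundary 0; rewrite ler_pdivlMl// mulrC; apply: le_trans h.
by rewrite ler_wpM2l ?J_sqr_ge0//; exact: lam_homo.
Qed.

Lemma sum_J_lowered M : \sum_(0 <= k < M) J 1 (fun x => lowered k x * lowered k x) <=
  (lam 0)^-1 * \sum_(0 <= k < M.+1) J 1 (fun x => hr k x * hr k x).
Proof.
rewrite [in leRHS]big_nat_recl//= mulrDr mulr_sumr -[leLHS]add0r lerD//.
  by rewrite mulr_ge0 ?J_sqr_ge0// invr_ge0 ltW// lam_gt0.
by apply: ler_sum => k _; exact: J_lowered.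
Qed.

End lowering.

Lemma proj_hfin M u : exists hr hi, [/\ forall k, HP k (hr k), forall k, HP k (hi k),
  forall x, unit_ball x -> proj M u x = hpart hr M x +i* hpart hi M x &
  forall k, (forall l, (l < hdim k)%N -> ip u (e k l) = 0) -> hr k = (fun=> 0) /\ hi k = (fun=> 0)].
Proof.
have HH (c : nat -> nat -> R) k : HP k (fun x => \sum_(l < hdim k) c k l * he k l x).
  apply: (@HP_sum _ _ _ _ _ _ (fun (l : 'I_(hdim k)) x => c k l * he k l x)) => l.
  exact/HPZ/he_HP.
exists (fun k x => \sum_(l < hdim k) Re (ip u (e k l)) * he k l x).
exists (fun k x => \sum_(l < hdim k) Im (ip u (e k l)) * he k l x).
split; [exact: (HH (fun k l => Re (ip u (e k l))))
  |exact: (HH (fun k l => Im (ip u (e k l))))|by move=> x x1; exact: proj_in|].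
by move=> k z; split; apply/funext => x; rewrite big1// => l _; rewrite z// mul0r.
Qed.

(** Projecting first makes all the sums finite, with bounds independent of [M]. Differentiation
    loses one degree, hence [tail M'] from [tail M'.+1]. *)
Lemma hankel_coord_proj i M M' u : tail M'.+1 u ->
  exists v, [/\ tail M' v, N v ^+ 2 <= (lam 0)^-1 * N (proj M.+1 u) ^+ 2 &
    N (hankel (nu := nu) (fun x => (x ord0 i)%:C) (proj M.+1 u)) <= N (fun x => dfct x * v x)].
Proof.
move=> tu; have [hr [hi [Hr Hi pE z]]] := proj_hfin M.+1 u.
have [v vE] := hfin_exists M (HP_lowered i Hr) (HP_lowered i Hi).
have [g gE] := hfin_exists M.+2 (HP_raised i Hr) (HP_raised i Hi).
exists v; split.
- apply: (hfin_tail (HP_lowered i Hr) (HP_lowered i Hi) vE) => k kM.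
  have [|r0 i0] := z k.+1; first by move=> l kl; exact: tu.
  by split; apply/funext => x; rewrite /lowered ?r0 ?i0 pd_cst mulr0.
- rewrite (hfin_norm (HP_lowered i Hr) (HP_lowered i Hi) vE) (hfin_norm Hr Hi pE) mulrDr.
  by apply: lerD; exact: sum_J_lowered.
have cx : cb (fun x => (x ord0 i)%:C) by exact/cb_polyfun/polyfun_coord.
apply: (le_trans (hankel_best hn nu_invariant nu_boundary _ (g + v) cx)).
have Lx := L2_cb (proj M.+1 u) cx.
apply: L2norm_mono; [by apply: L2B => //; exact: b2_L2|exact: (L2_cb v cb_dfct)|].
move=> x x1; rewrite b2D (pE x x1) (vE x x1) (gE x x1).
have Er := coord_hpart i Hr M x; have Ei := coord_hpart i Hi M x.
rewrite /dfct /sqmod !cE /= !mul0r !subr0 !addr0 Er Ei.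
set A := hpart _ M x; set B := hpart _ M x; set s := sqn x.
by rewrite le_eqVlt; apply/orP; left; apply/eqP; ring.
Qed.

Lemma htail_coord i : htail (fun x => (x ord0 i)%:C).
Proof.
move=> d d0; have l0 := lam_gt0 nu_boundary 0.
(* Chosen so that [L^2 >= (lam 0)^-1], which turns the bound on the square of [N v] into
   [N v <= L * N u]. *)
pose L := (lam 0)^-1 + 1; have L1 : 0 < L by rewrite addr_gt0// invr_gt0.
have LL : (lam 0)^-1 <= L ^+ 2.
  have : 0 < (lam 0)^-1 by rewrite invr_gt0.
  by rewrite /L; move: (lam 0)^-1 => r r0; nra.
have [M hM] := tail_dfct hn nu_invariant nu_boundary (divr_gt0 d0 L1).
exists M.+1 => u tu; apply/ler_addgt0Pr => r r0.
have cx : cb (fun x => (x ord0 i)%:C) by exact/cb_polyfun/polyfun_coord.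
have mx : multiplier (fun x : V => (x ord0 i)%:C) 1.
  apply: cb_multiplier => // x x1; rewrite cmodR.
  by apply: (le_trans (coord_le_enorm _ _)); exact: ltW.
have [M' hM'] := proj_cvg hn nu_invariant nu_boundary u r0.
have {}hM' := hM' M'.+1 (leqnSn _).
have [v [tv nv hv]] := hankel_coord_proj i M' tu.
rewrite -{1}(subrK (proj M'.+1 u) u) addrC.
apply: (le_trans (hankelD hn nu_invariant nu_boundary _ _ cx)); apply: lerD; last first.
  apply: (le_trans (hankel_norm hn nu_invariant nu_boundary _ cx mx)).
  by rewrite mul1r.
apply: (le_trans hv); apply: (le_trans (hM v tv)).
have nv' : N v <= L * N u.
  apply: (@le_trans _ _ (L * N (proj M'.+1 u))); last first.
    by apply: ler_wpM2l; [exact: ltW|exact: norm_proj].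
  move: nv (L0 (proj M'.+1 u)); move: (N v) (N (proj M'.+1 u)) => a b ab b0.
  apply: le_of_sqr; first by rewrite mulr_ge0// ltW.
  by rewrite exprMn; apply: (le_trans ab); rewrite ler_wpM2r// sqr_ge0.
apply: (@le_trans _ _ (d / L * (L * N u))).
  by apply: ler_wpM2l => //; rewrite divr_ge0// ltW.
by rewrite mulrA divfK// gt_eqF.
Qed.

Lemma htail_polyfun p : polyfun p -> htail (fun x => (p x)%:C).
Proof.
elim=> [c|i|q r pq hq pr hr|q r pq hq pr hr].
- exact: htail_cst.
- exact: htail_coord.
- rewrite (_ : (fun _ => _) = fun x => (q x)%:C + (r x)%:C).
    by apply: htailD => //; exact: cb_polyfun.
  by apply/funext => x; rewrite rmorphD.
- rewrite (_ : (fun _ => _) = fun x => (q x)%:C * (r x)%:C).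
    by apply: htailM => //; exact: cb_polyfun.
  by apply/funext => x; rewrite rmorphM.
Qed.

Lemma htail_cb f : cb f -> htail f.
Proof.
move=> cf; apply: htail_approx => // d d0; have d2 : 0 < d / 2 by rewrite divr_gt0.
have /cbP[cr ci] := cf.
have [p pp fp] := weierstrass_ball cr d2; have [q pq fq] := weierstrass_ball ci d2.
have cp := cb_polyfun pp; have cq := cb_polyfun pq.
have hp := htail_polyfun pp; have hq := htail_polyfun pq.
have ciq : cb (fun x => 'i * (q x)%:C) by exact: cbZ.
exists (fun x => (p x)%:C + 'i * (q x)%:C).
  split; first exact: cbD.
  apply: (htailD cp ciq hp); apply: (htailM (@cb_cst _ _ 'i) cq _ hq).
  exact: htail_cst.
move=> x /ltW x1; apply: (le_trans (cmod_le _)).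
rewrite !cE /= !mul0r !mul1r !sub0r ?oppr0 ?addr0 ?add0r.
rewrite [leRHS](_ : _ = d / 2 + d / 2); last by field.
apply: lerD; first by rewrite ?mulr0 ?subr0 ?oppr0 ?addr0; exact: fp.
by rewrite ?mulr0 ?subr0 ?oppr0 ?addr0 ?add0r; exact: fq.
Qed.

Lemma toeplitz_semicommutator f g : cb f -> cb g ->
  compact_op (op_mul (T f) (T g) - T (fun x => f x * g x)).
Proof. by move=> cf cg; apply: semicommutator_compact => //; exact: htail_cb. Qed.

End compact_semicommutators.

Lemma scale_sub_add (K : pzRingType) (W : lmodType K) (a : K) (x y z w : W) :
  a *: x + z - (a *: y + w) = a *: (x - y) + (z - w).
Proof. by rewrite scalerBr opprD addrACA. Qed.

Lemma closed_sphere (R : realType) (n : nat) : closed (@unit_sphere R n).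
Proof.
rewrite (_ : unit_sphere = (@enorm R n) @^-1` [set r | r = 1])//.
by apply: closed_comp => [x _|]; [exact: continuous_enorm|exact: closed_eq].
Qed.

Lemma compact_sphere (R : realType) (n : nat) : compact (@unit_sphere R n).
Proof.
apply: (subclosed_compact (@closed_sphere R n) (compact_closed_ball (t := 1))).
by move=> x /= ->.
Qed.

(** * Symbols *)

Section symbols.
Context {R : realType} {n : nat}.
Variable nu : probability (borel_rV R n) R.
Hypothesis hn : (2 <= n)%N.
Hypothesis nu_invariant : orthogonally_invariant nu.
Hypothesis nu_boundary : charges_boundary nu.
Local Notation V := 'rV[R]_n.
Local Notation J := (J nu).
Local Notation ibl := (ibl nu).
Local Notation ip := (inner nu).
Local Notation N := (L2norm nu).
Local Notation H := (b2 nu).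
Local Notation cb := (@continuous_closed_ball R n).
Local Notation T := (@toeplitz R n nu).
Local Notation e := (e hn nu_invariant nu_boundary).
Local Notation he := (he hn nu_invariant nu_boundary).
Local Notation hdim := (hdim hn nu_invariant nu_boundary).
Local Notation tail := (tail hn nu_invariant nu_boundary).
Local Notation zonal := (zonal hn nu_invariant nu_boundary).
Local Notation lam := (lam nu).
Local Notation mom := (mom nu).
Implicit Types (u v w : H) (S K A : H -> H) (f g : V -> R[i]) (p q : V -> R) (x y z : V) (a : R[i]).
Implicit Types (k l m M : nat) (d C c : R).

Let L0 (u : V -> R[i]) : 0 <= N u := L2norm_ge0 nu u.

(** Equality with a Toeplitz operator modulo compact operators. Only the values of [f] on the sphere
    are determined, see [symbol_uniq]. *)
Definition symbol S f : Prop := cb f /\ compact_op (S - T f).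

Lemma symbol_toeplitz f : cb f -> symbol (T f) f.
Proof. by move=> cf; split=> //; rewrite subrr; exact: compact0. Qed.

Lemma T_0 : T (fun=> 0) = 0.
Proof.
by rewrite (T_cst hn nu_invariant nu_boundary); apply/funext => u; rewrite scale0r.
Qed.

Lemma symbol_compact K : compact_op K -> symbol K (fun=> 0).
Proof. by move=> cK; split; [exact: cb_cst|rewrite T_0 subr0]. Qed.

Lemma symbol_bounded S f : symbol S f -> bounded_op S.
Proof.
move=> [cf [bS _]]; have := bounded_op_lin 1 bS (T_bounded hn nu_invariant nu_boundary cf).
by rewrite scale1r subrK.
Qed.

Lemma symbol_lin a S S' f g : symbol S f -> symbol S' g ->
  symbol (a *: S + S') (fun x => a * f x + g x).
Proof.
move=> [cf kS] [cg kS']; split; first exact: cbD (cbZ cf) cg.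
rewrite (T_lin hn nu_invariant nu_boundary a cf cg).
by rewrite scale_sub_add; exact: (compact_lin hn nu_invariant nu_boundary a kS kS').
Qed.

Lemma symbolB S S' f g : symbol S f -> symbol S' g -> symbol (S - S') (fun x => f x - g x).
Proof.
move=> sS sS'; have := symbol_lin (-1) sS' sS; rewrite scaleN1r addrC.
by rewrite (_ : (fun _ => _) = fun x => f x - g x)//; apply/funext => x; rewrite mulN1r addrC.
Qed.

Lemma symbolM S S' f g : symbol S f -> symbol S' g ->
  symbol (op_mul S S') (fun x => f x * g x).
Proof.
move=> sS sS'; have [cf kS] := sS; have [cg kS'] := sS'.
have bS := symbol_bounded sS; have bS' := symbol_bounded sS'.
have bg := T_bounded hn nu_invariant nu_boundary cg.
split; first exact: cbM.
have -> : op_mul S S' - T (fun x => f x * g x) = op_mul S (S' - T g) +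
   (op_mul (S - T f) (T g) + (op_mul (T f) (T g) - T (fun x => f x * g x))).
  apply/funext => u; rewrite !fctE /op_mul !fctE /= (opB (proj1 bS)).
  by rewrite addrA [X in _ = X + _]addrA subrK !addrA subrK.
apply: (compactD hn nu_invariant nu_boundary).
  exact: (compact_mull hn nu_invariant nu_boundary bS kS').
apply: (compactD hn nu_invariant nu_boundary); first exact: (compact_mulr bg kS).
exact: toeplitz_semicommutator.
Qed.

Lemma symbol_adjoint S f : symbol S f -> symbol (adjoint S) (fun x => conjc (f x)).
Proof.
move=> sS; have [cf kS] := sS; have bS := symbol_bounded sS.
have bf := T_bounded hn nu_invariant nu_boundary cf.
split; first exact: cbJ.
have kA := compact_adjoint hn nu_invariant nu_boundary kS.
suff <- : adjoint (S - T f) = adjoint S - T (fun x => conjc (f x)) by [].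
apply: (adjoint_unique hn nu_invariant nu_boundary); first by case: kS.
move=> u v; have [_ aS] := adjointP hn nu_invariant nu_boundary bS.
have [_ aT] := adjointP hn nu_invariant nu_boundary bf.
rewrite (T_adjoint hn nu_invariant nu_boundary cf) in aT.
have -> : (S - T f) u = S u - T f u by [].
have -> : (adjoint S - T (fun x => conjc (f x))) v = adjoint S v - T (fun x => conjc (f x)) v by [].
by rewrite ipBl ipBr aS aT.
Qed.

Lemma hdim_gt0 k : (0 < hdim k)%N.
Proof.
rewrite lt0n; apply/eqP => h0; have [h Hh [x]] := HP_neq0 k hn (R := R).
by rewrite (he_expand hn nu_invariant nu_boundary x Hh) h0 big_ord0 eqxx.
Qed.

Lemma tail_e k l : (l < hdim k)%N -> tail k (e k l).
Proof.
move=> kl k' l' kk kl'; rewrite e_orthonormal//.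
by rewrite gtn_eqF.
Qed.

(* Compare the traces of both sides on the space of spherical harmonics of degree [k]. *)
Lemma boundary_trace p K d : {within closed_unit_ball, continuous p} -> compact_op K ->
  (forall u, Re (ip (T (fun x => (p x)%:C) u) u) <= Re (ip (K u) u)) -> 0 < d ->
  exists M, forall k, (M <= k)%N -> J 1 (fun x => p x * sqn x ^+ k) <= d * mom 1 k.
Proof.
move=> cp /(compactP hn nu_invariant nu_boundary)[_ sK] pK d0.
have cP := cb_real cp; have [B B0 pB] := within_ball_bounded cp.
have [M hM] := sK d d0; exists M => k Mk.
have ip1 q : polyfun q -> ibl 1 (fun x => p x * q x).
  move=> pq; apply: ibl_mul; [exact: within_ball_measurable|..].
  - by apply: measurable_fun_rV; exact: continuous_polyfun.
  - apply: (@ibl_bounded _ _ _ _ _ (B * B)).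
      by apply: measurable_funM; exact: within_ball_measurable.
    by move=> x /ltW x1; rewrite normrM; apply: ler_pM => //; exact: pB.
  - by apply: ibl_polyfun; pf.
have pS := @polyfun_sqn R n.
have ph l := HP_polyfun (he_HP hn nu_invariant nu_boundary k l).
have E l : (l < hdim k)%N -> J 1 (fun x => p x * he k l x ^+ 2) <= d.
  move=> kl; have -> : J 1 (fun x => p x * he k l x ^+ 2) =
      Re (ip (T (fun x => (p x)%:C) (e k l)) (e k l)).
    rewrite (T_ip hn nu_invariant nu_boundary (e k l) (e k l) cP) Re_inner.
    by apply: eq_J => x x1; rewrite !eE// !cE /=; ring.
  apply: (le_trans (pK _)); apply: (le_trans (ler_norm _)).
  apply: (le_trans (Re_le_cmod _)); apply: (le_trans (ip_cs _ _)).
  have tk := tail_le Mk (tail_e kl).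
  by have := hM _ tk; rewrite norm_e// !mulr1.
have Z : J 1 (fun x => p x * zonal k x) <= (hdim k)%:R * d.
  rewrite (@eq_J _ _ _ _ _ (fun x => \sum_(l < hdim k) p x * he k l x ^+ 2)); last first.
    by move=> x _; rewrite /zonal mulr_sumr.
  rewrite (J_sum _ (F := fun (l : 'I_(hdim k)) x => p x * he k l x ^+ 2)); last first.
    by move=> l; have ? := ph l; apply: ip1; pf.
  rewrite mulr_natl -[X in _ *+ X]card_ord -sumr_const; apply: ler_sum => l _.
  exact: E.
have m0 := mom_gt0 nu_boundary k.
have h0 : (0 : R) < (hdim k)%:R by rewrite ltr0n hdim_gt0.
rewrite -(ler_pM2l h0).
have -> : (hdim k)%:R * J 1 (fun x => p x * sqn x ^+ k) =
    J 1 (fun x => p x * zonal k x) * mom 1 k.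
  rewrite -JZ; last by apply: ip1; pf.
  rewrite mulrC -JZ.
    by apply: eq_J => x _; rewrite mulrCA -(zonalE hn nu_invariant nu_boundary); ring.
  apply: (ip1 (zonal k)); apply: (@polyfun_sum R n 'I_(hdim k) _ _ (fun (l : 'I_(hdim k)) x => he k l x ^+ 2)) => l.
  by have ? := ph l; pf.
by rewrite mulrA; apply: ler_wpM2r; [exact: ltW|exact: Z].
Qed.

(* Where [p] is large on the sphere, finitely many rotations of [p] add up to a
   function that is large on the whole sphere; all of them have the same integrals
   against [|x|^(2k)]. *)
Lemma boundary_nonpos p K : {within closed_unit_ball, continuous p} -> compact_op K ->
  (forall x, enorm x <= 1 -> 0 <= p x) ->
  (forall u, Re (ip (T (fun x => (p x)%:C) u) u) <= Re (ip (K u) u)) ->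
  forall x, unit_sphere x -> p x <= 0.
Proof.
move=> cp cK p0 pK z z1; rewrite leNgt; apply/negP => pz.
pose F := p \o retract; have cF : continuous F := within_ball_retract cp.
have F0 x : 0 <= F x by apply: p0; exact: retract_ball.
pose c := p z / 2; have c0 : 0 < c by rewrite divr_gt0.
pose U (M : 'M[R]_n) : set V := [set x | c < F (x *m M)].
have cS := @compact_sphere R n; rewrite compact_cover in cS.
have [||D' D'D cov] := cS _ [set M : 'M[R]_n | M *m M^T = 1%:M] U.
- move=> M _; rewrite (_ : U M = (fun x : V => F (x *m M)) @^-1` [set r | c < r])//.
  apply: open_comp => [x _|]; last exact: open_gt.
  by apply: (@continuous_comp _ _ _ (fun x : V => x *m M) F); [exact: continuous_rot|exact: cF].
- move=> x x1; have xz : sqn x = sqn z by rewrite -!sqr_enorm x1 z1.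
  have [M MM xM] := rotation_transitive xz; exists M => //.
  rewrite /U /= xM /F /= retract_id ?z1// /c ltr_pdivrMr// mulr_natr mulr2n ltrDl.
  exact: pz.
pose s : seq 'M[R]_n := finmap.enum_fset D'.
pose G x := \sum_(M <- s) F (x *m M).
have cG : continuous G.
  move=> x; rewrite /G; elim: (s) => [|M s' IH].
    by under eq_fun do rewrite big_nil; exact: cst_continuous.
  under eq_fun do rewrite big_cons.
  apply: (@continuousD _ _ _ (fun y : V => F (y *m M))
    (fun y : V => \sum_(M <- s') F (y *m M))); last exact: IH.
  by apply: (@continuous_comp _ _ _ (fun x : V => x *m M) F); [exact: continuous_rot|exact: cF].
have Gc x : unit_sphere x -> - G x <= - c.
  move=> /cov[M MD cM]; have Ms : M \in s by [].
  rewrite lerN2 /G (big_rem M)//=; apply: le_trans (ltW cM) _.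
  by rewrite lerDl; apply: sumr_ge0.
have c2 : 0 < c / 2 by rewrite divr_gt0.
have [C C0 GC] := boundary_control (continuous_subspaceT (fun x => cvgN (cG x))) c2 Gc.
(* The lower bound [c] of [G] on the sphere leaves [c / 2] after the error allowed in [GC]. The
   integrals of the rotated functions account for at most [c / 8], and the term in [1 - |x|^2] for
   at most [c / 8]: too little. *)
pose d := c / 8 / ((size s)%:R + 1).
have s1 : (0 : R) < (size s)%:R + 1 by rewrite ltr_wpDl.
have d0 : 0 < d by rewrite !divr_gt0.
have [M1 hM1] := boundary_trace cp cK pK d0.
have C1 : 0 < C + 1 by rewrite ltr_wpDl.
have l1 : 1 - c / 8 / (C + 1) < 1 by rewrite ltrBlDr ltrDl !divr_gt0.
have [M2 hM2] := lam_cvg1 nu_boundary l1.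
pose k := maxn M1 M2.
have {}hM1 := hM1 k (leq_maxl _ _); have {}hM2 := hM2 k (leq_maxr _ _).
have m0 := mom_gt0 nu_boundary k.
have pS := @polyfun_sqn R n.
have [B B0 FB] : exists2 B : R, 0 <= B & forall x, `|F x| <= B.
  have [B B0 pB] := within_ball_bounded cp; exists B => // x; apply: pB.
  exact: retract_ball.
have iF (Q : 'M[R]_n) : ibl 1 (fun x => F (x *m Q) * sqn x ^+ k).
  have cFM : continuous (fun x : V => F (x *m Q)).
    by move=> x; apply: (@continuous_comp _ _ _ (fun x : V => x *m Q) F); [exact: continuous_rot|exact: cF].
  apply: (@ibl_bounded _ _ _ _ _ B).
    apply: measurable_funM; first exact: measurable_fun_rV.
    by apply: measurable_fun_rV; apply: continuous_polyfun; pf.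
  move=> x x1; rewrite normrM -[leRHS]mulr1; apply: ler_pM => //.
  rewrite ger0_norm ?exprn_ge0 ?sqn_ge0//; apply: exprn_ile1; first exact: sqn_ge0.
  by rewrite -sqr_enorm; apply: exprn_ile1; [exact: enorm_ge0|exact: ltW].
have rot (Q : 'M[R]_n) : Q \in s -> J 1 (fun x => F (x *m Q) * sqn x ^+ k) = J 1 (fun x => p x * sqn x ^+ k).
  move=> /D'D; rewrite inE => /= QQ.
  rewrite -[RHS](@eq_J _ _ _ _ (fun x => F x * sqn x ^+ k)); last first.
    by move=> x /ltW x1; rewrite /F /= retract_id.
  rewrite -(@J_rot _ _ _ nu_invariant 1 Q (fun x => F x * sqn x ^+ k) B)//.
  - by apply: eq_J => x _; rewrite sqn_rot.
  - apply: measurable_funM; first exact: measurable_fun_rV.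
    by apply: measurable_fun_rV; apply: continuous_polyfun; pf.
  - move=> x x1; rewrite normrM -[leRHS]mulr1; apply: ler_pM => //.
    rewrite ger0_norm ?exprn_ge0 ?sqn_ge0//; apply: exprn_ile1; first exact: sqn_ge0.
    by rewrite -sqr_enorm; apply: exprn_ile1; [exact: enorm_ge0|exact: ltW].
have JG : J 1 (fun x => G x * sqn x ^+ k) <= (size s)%:R * (d * mom 1 k).
  rewrite (@eq_J _ _ _ _ _ (fun x => \sum_(M <- s) F (x *m M) * sqn x ^+ k)); last first.
    by move=> x _; rewrite /G mulr_suml.
  rewrite (J_sum _ (F := fun (Q : 'M[R]_n) x => F (x *m Q) * sqn x ^+ k))//.
  rewrite big_seq (eq_bigr _ rot) -big_seq big_const_seq count_predT iter_addr addr0.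
  by rewrite mulr_natl lerMn2r hM1 orbT.
have iG : ibl 1 (fun x => G x * sqn x ^+ k).
  apply: eq_ibl (@ibl_sum _ _ _ 1 _ s (fun (Q : 'M[R]_n) x => F (x *m Q) * sqn x ^+ k) iF) => x _.
  by rewrite /G mulr_suml.
have low : (c / 2) * mom 1 k - C * (mom 1 k - mom 1 k.+1) <= J 1 (fun x => G x * sqn x ^+ k).
  have ik j : ibl 1 (fun x => sqn x ^+ j) by apply: ibl_polyfun; pf.
  rewrite {2 3}/mom -JB// -JZ; last by ib.
  rewrite -[c / 2 * _]JZ//; rewrite -JB; [|by ib..].
  apply: le_J => //; first by ib.
  move=> x x1; have h : - G x <= - c + c / 2 + C * (1 - sqn x) := GC x (ltW x1).
  rewrite exprS; have := exprn_ge0 k (sqn_ge0 x); move: (sqn x ^+ k) => P P0.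
  move: (sqn x) (G x) h => Q g h.
  have -> : c / 2 * P - C * (P - Q * P) = (c / 2 - C * (1 - Q)) * P by ring.
  by rewrite ler_wpM2r//; lra.
have mE : mom 1 k - mom 1 k.+1 = (1 - lam k) * mom 1 k.
  by rewrite (mom_lam nu_boundary); ring.
have := le_trans low JG; rewrite mE [C * _]mulrA -mulrBl [leRHS]mulrA ler_pM2r//.
have sd : (size s)%:R * d <= c / 8.
  rewrite -[X in _ * X]mulr1 -[leRHS]mulr1 /d.
  by apply: mul_div_succ_le => //; rewrite divr_ge0// ltW.
have Cl : C * (1 - lam k) <= c / 8.
  apply: (@le_trans _ _ (C * (c / 8 / (C + 1) * 1))).
    by rewrite ler_wpM2l// mulr1; lra.
  apply: (@le_trans _ _ (c / 8 * 1)); last by rewrite mulr1.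
  by apply: mul_div_succ_le => //; rewrite divr_ge0// ltW.
by lra.
Qed.

(* With [phi = max (|f|^2 - c^2) 0], the operator
   [T_phi A^* A T_phi - c^2 T_phi^2 <= 0] has symbol [phi^3]. *)
Lemma symbol_boundary_le A f c : symbol A f -> 0 <= c ->
  (forall u, N (A u) <= c * N u) -> forall x, unit_sphere x -> cmod (f x) <= c.
Proof.
move=> sA c0 Ac x x1; have [cf _] := sA.
pose q x : R := sqmod (f x) - c ^+ 2; pose phi x : R := Num.max (q x) 0.
have cq : {within closed_unit_ball, continuous q}.
  by move=> y; apply: cvgB; [exact: (cb_sqmod cf)|exact: cvg_cst].
have cphi : {within closed_unit_ball, continuous phi}.
  apply: (@within_comp _ _ _ (fun r : R => Num.max r 0) q) => // r.
  by apply: continuous_max; [exact: cvg_id|exact: cst_continuous].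
pose P x : R[i] := (phi x)%:C; have cP : cb P := cb_real cphi.
have sP : symbol (T P) P := symbol_toeplitz cP.
have sB := symbolM sP (symbolM (symbol_adjoint sA) (symbolM sA sP)).
have sD := symbol_lin (- (c ^+ 2)%:C) (symbolM sP sP) sB.
pose h x := - (c ^+ 2)%:C * (P x * P x) + P x * (conjc (f x) * (f x * P x)).
rewrite -/h in sD.
have hE : h = fun x => (phi x ^+ 3)%:C.
  apply/funext => y; rewrite /h /P.
  have -> : (phi y)%:C * (conjc (f y) * (f y * (phi y)%:C)) = (phi y * sqmod (f y) * phi y)%:C.
    by apply: complex_ext; rewrite /sqmod !cE /=; ring.
  rewrite -!rmorphM -rmorphN -rmorphM -rmorphD; congr (_%:C).
  (* Hence [phi^2 (|f|^2 - c^2) = phi^3]: the two outer factors turn a symbol of unknown sign into a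
     nonnegative one, as [boundary_nonpos] requires. *)
  have pq : phi y * q y = phi y ^+ 2.
    rewrite /phi; have [q0|q0] := leP (q y) 0; first by rewrite mul0r expr0n.
    by rewrite expr2.
  have -> : phi y ^+ 3 = phi y * (phi y * q y) by rewrite pq -exprS.
  by rewrite /q; ring.
rewrite hE in sD; set D := _ + _ in sD.
have [_ kD] := sD; set K := D - _ in kD.
have cphi3 : {within closed_unit_ball, continuous (fun x => phi x ^+ 3)}.
  exact: (within_comp (@exprn_continuous R 3) cphi).
have phi0 y : 0 <= phi y by rewrite /phi le_max lexx orbT.
have kN : compact_op (-1 *: K) := compactZ hn nu_invariant nu_boundary (-1) kD.
have ineq u : Re (ip (T (fun x => (phi x ^+ 3)%:C) u) u) <= Re (ip ((-1 *: K) u) u).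
  have -> : (-1 *: K) u = T (fun x => (phi x ^+ 3)%:C) u - D u.
    have -> : (-1 *: K) u = -1 *: (D u - T (fun x => (phi x ^+ 3)%:C) u) by [].
    by rewrite scaleN1r opprB.
  (* It remains to see that [D] is nonpositive: with [w = T P u], the form [<D u, u>] is
     [|A w|^2 - c^2 |w|^2]. *)
  rewrite ipBl ReD ReN lerDl oppr_ge0.
  have -> : D u = - (c ^+ 2)%:C *: T P (T P u) + T P (adjoint A (A (T P u))) by [].
  set w := T P u.
  have PP v : ip (T P v) u = ip v w.
    have [_ aP] := adjointP hn nu_invariant nu_boundary (T_bounded hn nu_invariant nu_boundary cP).
    rewrite aP (T_adjoint hn nu_invariant nu_boundary cP); congr (inner nu _ (b2val (T _ u))).
    by apply/funext => y; rewrite conjc_real.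
  have [_ aA] := adjointP hn nu_invariant nu_boundary (symbol_bounded sA).
  rewrite ip_linl !PP [ip (adjoint A (A w)) w]ipJ -aA !innerE conjc_real -rmorphN -rmorphM -rmorphD /=.
  have := Ac w; have := L0 (A w); have := L0 w.
  move: (N w) (N (A w)) => r s r0 s0 rs.
  by rewrite mulNr addrC subr_le0 -exprMn lerXn2r ?nnegrE ?mulr_ge0.
have := boundary_nonpos cphi3 kN (fun y _ => exprn_ge0 3 (phi0 y)) ineq x1.
move=> p3; have {p3} pz : phi x = 0.
  have : phi x ^+ 3 == 0 by rewrite eq_le p3 exprn_ge0.
  by rewrite expf_eq0 => /andP[_ /eqP].
have : q x <= 0 by rewrite -pz /phi le_max lexx.
rewrite subr_le0 -sqr_cmod => h2; exact: le_of_sqr.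
Qed.

End symbols.

(** * Compact operators in the Toeplitz algebra *)

Section compact_ideal.
Context {R : realType} {n : nat}.
Variable nu : probability (borel_rV R n) R.
Hypothesis hn : (2 <= n)%N.
Hypothesis nu_invariant : orthogonally_invariant nu.
Hypothesis nu_boundary : charges_boundary nu.
Local Notation V := 'rV[R]_n.
Local Notation J := (J nu).
Local Notation ip := (inner nu).
Local Notation N := (L2norm nu).
Local Notation H := (b2 nu).
Local Notation cb := (@continuous_closed_ball R n).
Local Notation T := (@toeplitz R n nu).
Local Notation e := (e hn nu_invariant nu_boundary).
Local Notation he := (he hn nu_invariant nu_boundary).
Local Notation hdim := (hdim hn nu_invariant nu_boundary).
Local Notation proj := (proj hn nu_invariant nu_boundary).
Local Notation tail := (tail hn nu_invariant nu_boundary).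
Local Notation lam := (lam nu).
Local Notation sqf := (@sqf R n).
Local Notation dfct := (@dfct R n).
Implicit Types (u v w : H) (S K : H -> H) (f g : V -> R[i]) (h p q : V -> R) (x y z : V) (a : R[i]).
Implicit Types (k l m M : nat) (d C c : R) (A I : set (H -> H)).

Let L0 (u : V -> R[i]) : 0 <= N u := L2norm_ge0 nu u.

Definition rank_one k l k' l' : H -> H := fun u => ip u (e k' l') *: e k l.

Lemma subspace_sum I J (s : seq J) (P : pred J) (F : J -> H -> H) : op_subspace I ->
  (forall j, P j -> I (F j)) -> I (\sum_(j <- s | P j) F j).
Proof.
move=> [I0 IL] IF; elim/big_rec: _ => // j S Pj IS.
by rewrite -[F j]scale1r; apply: IL => //; exact: IF.
Qed.

Lemma op_sum_apply J (s : seq J) (P : pred J) (F : J -> H -> H) u :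
  (\sum_(j <- s | P j) F j) u = \sum_(j <- s | P j) F j u.
Proof. exact: (big_morph (fun S : H -> H => S u)). Qed.

(** The compression of [K] by [proj M] is a finite combination of [rank_one] operators. It is close
    to [K] since both [K] and [adjoint K] are small on tails; the latter controls the high degrees
    in the range of [K]. *)
Lemma compact_in I : op_subspace I -> norm_closed I ->
  (forall k l k' l', (l < hdim k)%N -> (l' < hdim k')%N -> I (rank_one k l k' l')) ->
  compact_ops nu `<=` I.
Proof.
move=> sI cI rI K cK; have [bK _] := cK; have [lK _] := bounded_opP bK.
apply: cI => // d d0; have d4 : 0 < d / 4 by rewrite divr_gt0.
have [_ aK] := adjointP hn nu_invariant nu_boundary bK.
have [_ sK] := (compactP hn nu_invariant nu_boundary _).1 cK.
have [_ sKA] := (compactP hn nu_invariant nu_boundary _).1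
  (compact_adjoint hn nu_invariant nu_boundary cK).
have [M1 h1] := sK _ d4; have [M2 h2] := sKA _ d4.
pose M := maxn M1 M2.
pose KM : H -> H := \sum_(0 <= k' < M) \sum_(l' < hdim k') \sum_(0 <= k < M) \sum_(l < hdim k)
  ip (K (e k' l')) (e k l) *: rank_one k l k' l'.
have KME u : KM u = proj M (K (proj M u)).
  rewrite /KM op_sum_apply [in RHS](projE _ _ _ M u) (op_sum lK).
  rewrite (op_sum (proj_lin _ _ _ _)); apply: eq_bigr => k' _.
  rewrite op_sum_apply (op_sum lK) (op_sum (proj_lin _ _ _ _)); apply: eq_bigr => l' _.
  rewrite op_sum_apply (opZ lK) (opZ (proj_lin _ _ _ _)) projE scaler_sumr.
  apply: eq_bigr => k _; rewrite op_sum_apply scaler_sumr; apply: eq_bigr => l _.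
  by rewrite !scalerA mulrC -scalerA.
exists KM.
  do 4! (apply: subspace_sum => // ? _); rewrite -[_ *: _]addr0.
  by apply: (proj2 sI); [exact: rI|exact: (proj1 sI)].
have d2 : d / 2 < d by rewrite ltr_pdivrMr// ltr_pMr// ltr1n.
apply: le_lt_trans d2; apply: opnorm_le => [|u]; first by rewrite ltW// divr_gt0.
have -> : (K - KM) u = K (u - proj M u) + (K (proj M u) - proj M (K (proj M u))).
  have -> : (K - KM) u = K u - KM u by [].
  by rewrite KME (opB lK) addrA subrK.
apply: (le_trans (hnormD _ _)).
rewrite [leRHS](_ : _ = d / 4 * N u + d / 4 * N u); last by field.
apply: lerD.
  apply: (le_trans (h1 _ (tail_le (leq_maxl _ _) (@tail_proj _ _ _ _ _ _ M u)))).
  by apply: ler_wpM2l; [exact: ltW|exact: norm_tail].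
set w := proj M u; set z := K w - proj M (K w).
have tz : tail M z by exact: tail_proj.
have wu : N w <= N u by exact: norm_proj.
apply: (@le_trans _ _ (d / 4 * N w)); last by apply: ler_wpM2l => //; exact: ltW.
(* [z] is the tail of [K w], so [<K w, z> = <z, z>]; moving [K] to the other side lets [adjoint K]
   act on a tail. *)
have zz : N z ^+ 2 = cmod (ip (adjoint K z) w).
  have -> : ip (adjoint K z) w = conjc (ip (K w) z) by rewrite ipJ aK.
  have -> : ip (K w) z = ip z z.
    rewrite -[X in ip (b2val X) z](subrK (proj M (K w))) ipDl [ip (proj M _) z]ipJ.
    by rewrite ip_tail_proj// conjc0 addr0.
  by rewrite cmodJ innerE cmodR ger0_norm// sqr_ge0.
have [z0|z0] := eqVneq (N z) 0.
  by rewrite z0; apply: mulr_ge0 => //; exact: ltW.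
have zp : 0 < N z by rewrite lt_def z0 L0.
rewrite -(ler_pM2l zp) -expr2 zz; apply: (le_trans (ip_cs _ _)).
rewrite mulrA; apply: ler_wpM2r => //; rewrite mulrC.
exact: (h2 _ (tail_le (leq_maxr _ _) tz)).
Qed.

Lemma one_exists : {u : H | forall x, unit_ball x -> u x = 1}.
Proof.
have [u uE] := @hfin_exists _ _ nu hn (fun k => if k is 0%N then fun=> 1 else fun=> 0)
  (fun=> fun=> 0) 1 (fun k => match k with 0%N => HP1 | k'.+1 => HP0 k'.+1 end) (fun k => HP0 k).
by exists u => x x1; rewrite uE// /hpart !big_nat1.
Qed.

Definition one : H := sval one_exists.

Lemma oneE x : unit_ball x -> one x = 1.
Proof. exact: (svalP one_exists). Qed.

Lemma HP_ip k h u : HP k h -> (forall x, unit_ball x -> u x = (h x)%:C) ->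
  forall k' l, k' != k -> ip u (e k' l) = 0.
Proof.
move=> Hh uh k' l kk; rewrite ip_e.
have He := he_HP hn nu_invariant nu_boundary k' l.
have -> : J 1 (fun x => Re (u x) * he k' l x) = 0.
  rewrite eq_sym in kk; rewrite -[RHS](HP_orth nu_invariant 1 0 hn Hh He kk).
  by apply: eq_J => x x1; rewrite uh//= mul1r.
have -> // : J 1 (fun x => Im (u x) * he k' l x) = 0.
rewrite (@eq_J _ _ _ _ _ (fun=> 0)) => [|x x1]; first by rewrite /J /Rintegral integral0.
by rewrite uh//= mul0r.
Qed.

Lemma T_sqf_HP k h u : HP k h -> (forall x, unit_ball x -> u x = (h x)%:C) ->
  T sqf u = (lam k)%:C *: u.
Proof.
move=> Hh uh; apply/eqP; rewrite -subr_eq0; apply/eqP.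
apply: (e_complete (hn := hn) (nu_invariant := nu_invariant) (nu_boundary := nu_boundary)) => k' l kl.
rewrite ipBl ipZl ip_T_sqf//; have [->|kk] := eqVneq k' k; first by rewrite subrr.
by rewrite (HP_ip Hh uh l kk) !mulr0 subrr.
Qed.

(** The inverse of the square norm of the constant 1, as the kernel of degree 0. *)
Definition kap : R := zonal hn nu_invariant nu_boundary 0 0.

Lemma kap_gt0 : 0 < kap.
Proof.
have m0 := mom_gt0 nu_boundary 0.
rewrite -(pmulr_lgt0 _ m0) /kap zonalE expr0 mulr1 ltr0n; exact: hdim_gt0.
Qed.

Lemma proj1E u : proj 1 u = (kap%:C * ip u one) *: one.
Proof.
have he0 l x : he 0 l x = he 0 l 0.
  by have [c ->] := HP_cst (he_HP hn nu_invariant nu_boundary 0 l).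
have e0 l : e 0 l = (he 0 l 0)%:C *: one.
  by apply: b2_eq => x x1; rewrite b2Z oneE// eE// he0 mulr1.
rewrite projE big_nat1 /kap /zonal rmorph_sum mulr_suml scaler_suml.
apply: eq_bigr => l _; rewrite e0 ipZr conjc_real scalerA rmorphXn; congr (_ *: _).
by rewrite expr2 mulrC mulrA.
Qed.

(* [T dfct] is diagonal with entries [1 - lam k], so the powers of its multiple with
   first entry 1 tend to [proj 1]. *)
Lemma P0_in A : op_subspace A -> norm_closed A ->
  (forall S K, A S -> A K -> A (op_mul S K)) -> A (T dfct) -> A (proj 1).
Proof.
move=> sA cA mA Ad; apply: cA; first exact: bounded_proj.
have l01 := lam0_lt1 nu_boundary; have l0 : 0 < 1 - lam 0 by rewrite subr_gt0.
pose s k : R := (1 - lam k) / (1 - lam 0).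
pose S : H -> H := ((1 - lam 0)^-1)%:C *: T dfct.
(* [Sp m] is the power [m.+1], starting from [S], since [A] is not supposed to contain the
   identity. *)
pose Sp := fix Sp m := if m is m'.+1 then op_mul S (Sp m') else S.
have AS : A S.
  by rewrite /S -[_ *: _]addr0; apply: (proj2 sA) => //; exact: (proj1 sA).
have ASp m : A (Sp m) by elim: m => [|m IH] //=; exact: mA.
have ipS u k l : (l < hdim k)%N -> ip (S u) (e k l) = (s k)%:C * ip u (e k l).
  move=> kl; have -> : S u = ((1 - lam 0)^-1)%:C *: T dfct u by [].
  by rewrite ipZl ip_T_dfct// mulrA -rmorphM [_^-1 * _]mulrC.
have ipSp m u k l : (l < hdim k)%N -> ip (Sp m u) (e k l) = (s k ^+ m.+1)%:C * ip u (e k l).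
  move=> kl; elim: m => [|m IH]; first exact: ipS.
  have -> : Sp m.+1 u = S (Sp m u) by [].
  by rewrite ipS// IH mulrA -rmorphM -exprS.
(* It bounds all the diagonal entries after the first, and is below 1 because [lam 0 < lam 1]; the
   powers converge at the rate [r^m]. *)
pose r := s 1%N.
have lm := lam_homo nu_boundary.
have r0 : 0 <= r by rewrite divr_ge0 ?(ltW l0)// subr_ge0 lam_le1.
have r1 : r < 1.
  by rewrite /r /s ltr_pdivrMr// mul1r ltrD2l ltrN2; exact: lam0_lt_lam1.
move=> d d0; have [m hm] : exists m, r ^+ m.+1 < d.
  have c := @cvg_geometric R 1 r; rewrite ger0_norm// in c; have {c} := c r1.
  move=> /cvgr_lt/(_ _ d0)[m0 _ hm0]; exists m0; have := hm0 m0.+1 (leqnSn _).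
  by rewrite /= /geometric /mk_sequence /= mul1r.
exists (Sp m) => //; apply: le_lt_trans hm; apply: opnorm_le => [|u]; first exact: exprn_ge0.
have -> : (proj 1 - Sp m) u = proj 1 u - Sp m u by [].
apply: norm_le_coef => [|k l kl]; first exact: exprn_ge0.
rewrite ipBl ipSp// ip_proj//.
case: ltnP => k1.
  have -> : k = 0%N by lia.
  rewrite /s divff ?expr1n ?mul1r ?subrr; last by rewrite gt_eqF.
  by rewrite -sqr_cmod cmod0 expr0n mulr_ge0 ?sqr_ge0 ?sqmod_ge0.
rewrite sub0r -sqr_cmod cmodN sqr_cmod sqmodM ler_wpM2r ?sqmod_ge0//.
have sk0 : 0 <= s k by rewrite divr_ge0 ?(ltW l0)// subr_ge0 lam_le1.
have skr : s k <= r.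
  by rewrite /r /s ler_pM2r ?invr_gt0// lerD2l lerN2; exact: lm.
rewrite /sqmod /= expr0n addr0 lerXn2r ?nnegrE ?exprn_ge0//.
by rewrite lerXn2r ?nnegrE.
Qed.

(** The operator [T_h] sends 1 to [h] and is self-adjoint because [h] is real; [kap^-1] compensates
    the factor in [proj1E]. *)
Lemma rank_oneE k l k' l' : rank_one k l k' l' = (kap^-1)%:C *:
  op_mul (T (fun x => (he k l x)%:C)) (op_mul (proj 1) (T (fun x => (he k' l' x)%:C))).
Proof.
have ch k0 l0 : cb (fun x => (he k0 l0 x)%:C).
  exact/cb_polyfun/HP_polyfun/(he_HP hn nu_invariant nu_boundary).
have Te k0 l0 : T (fun x => (he k0 l0 x)%:C) one = e k0 l0.
  by apply: T_in_b2 => // x x1; rewrite oneE// mulr1 eE.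
apply/funext => u; rewrite /rank_one.
have -> : ((kap^-1)%:C *: op_mul (T (fun x => (he k l x)%:C))
   (op_mul (proj 1) (T (fun x => (he k' l' x)%:C)))) u =
   (kap^-1)%:C *: T (fun x => (he k l x)%:C) (proj 1 (T (fun x => (he k' l' x)%:C) u)) by [].
rewrite proj1E (opZ (T_linear hn nu_invariant nu_boundary (ch k l))) Te scalerA mulrA -rmorphM.
rewrite mulVf ?gt_eqF ?kap_gt0// mul1r; congr (_ *: _).
have [_ aT] := adjointP hn nu_invariant nu_boundary (T_bounded hn nu_invariant nu_boundary (ch k' l')).
rewrite aT (T_adjoint hn nu_invariant nu_boundary (ch k' l')) -(Te k' l').
by congr (inner nu _ (b2val (T _ one))); apply/funext => x; rewrite conjc_real.
Qed.

(** 1 and [x_i] are eigenvectors of [T sqf], so the commutator sends 1 to [(lam 1 - lam 0) x_i]; the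
    outer factors then turn [x_i] into [kap] times its square norm times 1. *)
Lemma commutator_P0 i : exists2 a : R[i], a != 0 &
  a *: proj 1 = op_mul (proj 1) (op_mul (T (fun x => (x ord0 i)%:C))
    (op_mul (op_mul (T sqf) (T (fun x => (x ord0 i)%:C)) -
             op_mul (T (fun x => (x ord0 i)%:C)) (T sqf)) (proj 1))).
Proof.
set X := fun x : V => _; have cX : cb X by exact/cb_polyfun/polyfun_coord.
have lX := T_linear hn nu_invariant nu_boundary cX.
have lS := T_linear hn nu_invariant nu_boundary (@cb_sqf R n).
pose w := T X one.
have wE x : unit_ball x -> w x = (x ord0 i)%:C.
  move=> x1; have [v vE] := @hfin_exists _ _ nu hn (fun k => if k is 1%N then fun x => x ord0 i else fun=> 0)
    (fun=> fun=> 0) 2 (fun k => match k with 1%N => HP_coord i | k' => HP0 k' end) (fun k => HP0 k).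
  have -> : w = v.
    apply: T_in_b2 => // y y1; rewrite oneE// mulr1 vE// /hpart !big_nat_recr//= !big_geq//.
    by rewrite !add0r.
  by rewrite vE// /hpart !big_nat_recr//= !big_geq// !add0r.
have Sw : T sqf w = (lam 1)%:C *: w := T_sqf_HP (HP_coord i) wE.
have S1 : T sqf one = (lam 0)%:C *: one := T_sqf_HP HP1 oneE.
(* Norm 0 would make [w] vanish at every point of the ball, and it does not at [e_i / 2]. *)
have w0 : 0 < N w.
  rewrite lt_def L0 andbT; apply/eqP => /(hnorm_eq0 hn nu_invariant nu_boundary) w0.
  pose x : V := 2^-1 *: 'e_i.
  have x1 : unit_ball x.
    rewrite /unit_ball /= enormZ ?invr_ge0// enormE (_ : sqn _ = 1).
      by rewrite sqrtr1 mulr1 invf_lt1// ltr1n.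
    rewrite /sqn (bigD1 i)//= mxE !eqxx expr1n big1 ?addr0// => j ji.
    by rewrite mxE (negbTE ji) andbF expr0n.
  have := wE x x1; rewrite w0 b20 !mxE !eqxx mulr1 => /(congr1 (@Re R))/=/eqP.
  by rewrite eq_sym invr_eq0 pnatr_eq0.
pose c := (lam 1 - lam 0) * kap * N w ^+ 2.
have c0 : 0 < c.
  by rewrite !mulr_gt0 ?kap_gt0 ?exprn_gt0// subr_gt0; exact: lam0_lt_lam1.
exists c%:C; first by apply/eqP => /(congr1 (@Re R))/= c00; rewrite c00 ltxx in c0.
apply/funext => u.
have -> : (op_mul (proj 1) (op_mul (T X)
    (op_mul (op_mul (T sqf) (T X) - op_mul (T X) (T sqf)) (proj 1)))) u =
    proj 1 (T X (T sqf (T X (proj 1 u)) - T X (T sqf (proj 1 u)))) by [].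
have -> : (c%:C *: proj 1) u = c%:C *: proj 1 u by [].
rewrite [proj 1 u]proj1E; set b := _ * _.
rewrite !(opZ lX) !(opZ lS) -/w S1 Sw !(opZ lX) -/w !scalerA -scalerBl (opZ lX).
rewrite (opZ (proj_lin _ _ _ _)) proj1E !scalerA; congr (_ *: _).
have [_ aX] := adjointP hn nu_invariant nu_boundary (T_bounded hn nu_invariant nu_boundary cX).
have -> : ip (T X w) one = (N w ^+ 2)%:C.
  rewrite aX (T_adjoint hn nu_invariant nu_boundary cX) -innerE.
  by congr (inner nu _ (b2val (T _ one))); apply/funext => x; rewrite /X conjc_real.
have -> : c%:C = ((lam 1)%:C - (lam 0)%:C) * kap%:C * (N w ^+ 2)%:C by rewrite /c -rmorphB -!rmorphM.
by move: b => b; ring.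
Qed.

Lemma toeplitz_in_algebra f : cb f -> toeplitz_algebra nu (T f).
Proof. by move=> cf A [_]; apply; exists f. Qed.

Lemma compact_sub_algebra : compact_ops nu `<=` toeplitz_algebra nu.
Proof.
move=> K cK A [cA GA]; have [_ sA _ _ nA] := cA.
have mA : forall S1 S2, A S1 -> A S2 -> A (op_mul S1 S2) by case: cA.
have TA f : cb f -> A (T f) by move=> cf; apply: GA; exists f.
apply: (compact_in sA nA) cK => k l k' l' kl kl'.
have ch k0 l0 : cb (fun x => (he k0 l0 x)%:C).
  exact/cb_polyfun/HP_polyfun/(he_HP hn nu_invariant nu_boundary).
have PA : A (proj 1) by apply: P0_in => //; apply: TA; exact: cb_dfct.
rewrite rank_oneE -[_ *: _]addr0; apply: (proj2 sA); last exact: (proj1 sA).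
by apply: (mA); [exact: TA|apply: (mA) => //; exact: TA].
Qed.

Lemma compact_sub_commutator : compact_ops nu `<=` commutator_ideal nu.
Proof.
move=> K cK I [[_ sI mI nI] GI].
have [i _] : exists i : 'I_n, True by exists (Ordinal (ltn_trans (ltnSn 0) hn)).
have cX : cb (fun x => (x ord0 i)%:C) by exact/cb_polyfun/polyfun_coord.
have P0T : toeplitz_algebra nu (proj 1).
  apply: compact_sub_algebra; apply/(compactP hn nu_invariant nu_boundary).
  split; first exact: bounded_proj.
  by move=> d d0; exists 1%N => u tu; rewrite proj_tail// hnorm0 mulr_ge0// ltW.
have PI : I (proj 1).
  have [a a0 aP] := commutator_P0 i.
  have : I (a *: proj 1).
    rewrite aP; apply: (mI _ _ P0T _).1; apply: (mI _ _ (toeplitz_in_algebra cX) _).1.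
    apply: (mI _ _ P0T _).2; apply: GI; exists sqf; first exact: cb_sqf.
    by exists (fun x => (x ord0 i)%:C).
  move=> IaP; have := (proj2 sI) a^-1 _ 0 IaP (proj1 sI).
  by rewrite addr0 scalerA mulVf// scale1r.
apply: (compact_in sI nI) cK => k l k' l' kl kl'.
have ch k0 l0 : cb (fun x => (he k0 l0 x)%:C).
  exact/cb_polyfun/HP_polyfun/(he_HP hn nu_invariant nu_boundary).
rewrite rank_oneE -[_ *: _]addr0; apply: (proj2 sI); last exact: (proj1 sI).
apply: (mI _ _ (toeplitz_in_algebra (ch k l)) _).1.
exact: (mI _ _ (toeplitz_in_algebra (ch k' l')) PI).2.
Qed.

End compact_ideal.

(** * The symbol map *)

Section sphere_functions.
Context {R : realType} {n : nat}.
Local Notation V := 'rV[R]_n.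
Local Notation S := (set_type (@unit_sphere R n)).
Local Notation cb := (@continuous_closed_ball R n).

(** The Tietze theorem for the compact sphere. The function [h] takes the default value 0 off the
    sphere, where continuity is not asked. *)
Lemma sphere_extend (g : S -> R) : continuous g ->
  exists2 q : V -> R, continuous q & forall s : S, q (\val s) = g s.
Proof.
move=> cg; pose h : V -> R := valL_ 0 g.
have ch : {within unit_sphere, continuous h} by exact/subspace_valL_continuousP'.
have [M [_ hM]] := compact_bounded (continuous_compact ch (@compact_sphere R n)).
have M1 : M < `|M| + 1 by apply: le_lt_trans (ler_norm M) _; rewrite ltrDl.
have [|q [hq cq _]] := @continuous_bounded_extension V R pseudometric_normal _
  (@closed_sphere R n) h (`|M| + 1) (ltr_wpDl (normr_ge0 M) ltr01) ch.
  by move=> x x1; apply: (hM _ M1); exists x.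
by exists q => // s; rewrite -hq; [rewrite -[g](valLK 0)|exact: (svalP s)].
Qed.

Lemma cb_sphere (f : V -> R[i]) : cb f -> continuous (fun s : S => f (\val s)).
Proof.
move=> cf; apply/(@subspace_sigL_continuousP _ unit_sphere _ f).
by apply: (continuous_subspaceW _ cf) => x x1; rewrite /closed_unit_ball /= (x1 : enorm x = 1).
Qed.

Lemma sphere_extend_cb (g : S -> R[i]) : continuous g ->
  exists2 f : V -> R[i], cb f & forall s : S, f (\val s) = g s.
Proof.
move=> /continuous_complexP[/sphere_extend[p cp pE] /sphere_extend[q cq qE]].
exists (fun x => p x +i* q x)%C; last by move=> s; rewrite pE qE; case: (g s).
by apply/cbP; split; apply: continuous_subspaceT.
Qed.

(* The limit is [sup_m (p m - r m)], which avoids Cauchy sequences. *)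
Lemma sphere_limit (p : nat -> S -> R) (r : nat -> R) : (forall m, continuous (p m)) ->
  (forall d : R, 0 < d -> exists m, r m < d) ->
  (forall m l s, `|p m s - p l s| <= r m + r l) ->
  exists2 q : S -> R, continuous q & forall m s, `|q s - p m s| <= r m.
Proof.
move=> cp r0 pr; pose A s := [set p m s - r m | m in [set: nat]].
pose q s := sup (A s).
have pq m l s : p m s - r m <= p l s + r l.
  by have := pr m l s; rewrite ler_norml => /andP[_]; lra.
have A0 s : A s !=set0 by exists (p 0 s - r 0), 0%N.
have qE m s : `|q s - p m s| <= r m.
  rewrite ler_norml; apply/andP; split.
    rewrite lerBrDr addrC; apply: ub_le_sup; last by exists m.
    by exists (p 0 s + r 0) => _ [l _ <-].
  by rewrite lerBlDr addrC; apply: ge_sup => // _ [l _ <-].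
exists q => // s; apply/(@cvgrPdist_lt _ _ _ _ (nbhs_filter s)) => d d0.
have [m rm] := r0 (d / 3) (divr_gt0 d0 (ltr0Sn _ _)).
have /(@cvgrPdist_lt _ _ _ _ (nbhs_filter s))/(_ (d / 3) (divr_gt0 d0 (ltr0Sn _ _))) := cp m s.
apply: filterS => t pst; have := qE m s; have := qE m t; move: pst.
rewrite !ler_norml ltr_norml => /andP[? ?] /andP[? ?] /andP[? ?].
by rewrite ltr_norml; apply/andP; split; lra.
Qed.

End sphere_functions.

(** * The Toeplitz algebra and its symbols on the sphere *)

Section toeplitz_algebra_symbols.
Context {R : realType} {n : nat}.
Variable nu : probability (borel_rV R n) R.
Hypothesis hn : (2 <= n)%N.
Hypothesis nu_invariant : orthogonally_invariant nu.
Hypothesis nu_boundary : charges_boundary nu.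
Local Notation V := 'rV[R]_n.
Local Notation N := (L2norm nu).
Local Notation H := (b2 nu).
Local Notation cb := (@continuous_closed_ball R n).
Local Notation T := (@toeplitz R n nu).
Local Notation S := (set_type (@unit_sphere R n)).
Implicit Types (u v w : H) (A K : H -> H) (f g : V -> R[i]) (x y z : V) (a : R[i]).
Implicit Types (k l m M : nat) (d C c : R).

(** [A - A = 0] has symbol [f - g], and [symbol_boundary_le] applies with [c = 0]. *)
Lemma symbol_uniq A f g : symbol A f -> symbol A g ->
  forall x, unit_sphere x -> f x = g x.
Proof.
move=> sf sg x x1; apply/eqP; rewrite -subr_eq0; apply/eqP/cmod_eq0.
apply/eqP; rewrite eq_le cmod_ge0 andbT.
have s0 := symbolB hn nu_invariant nu_boundary sf sg.
apply: (symbol_boundary_le hn nu_invariant nu_boundary s0 (lexx 0) _ x1) => u.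
by rewrite subrr hnorm0 mul0r.
Qed.

Lemma symbol0_compact A f : symbol A f -> (forall x, unit_sphere x -> f x = 0) -> compact_op A.
Proof.
move=> [cf kA] f0; rewrite -[A](subrK (T f)).
apply: (compactD hn nu_invariant nu_boundary kA).
exact: (T_boundary0_compact hn nu_invariant nu_boundary cf f0).
Qed.

(** [symbol_boundary_le] makes the symbols a Cauchy sequence on the sphere, and only there. The
    limit is formed on the sphere, then extended to the ball; any extension does, since
    [boundary_tail] sees boundary values only. *)
Lemma symbol_norm_closed : norm_closed [set A : H -> H | exists f, symbol A f].
Proof.
move=> A bA appr; pose r m : R := m.+1%:R^-1.
have r_gt0 m : 0 < r m by rewrite invr_gt0 ltr0n.
have r0 d : 0 < d -> exists m, r m < d.
  move=> d0; have [m _ hm] := near_infty_natSinv_lt (PosNum d0).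
  by exists m; exact: (hm m (leqnn m)).
have /choice[Af Afr] m : exists Bf : (H -> H) * (V -> R[i]),
    symbol Bf.1 Bf.2 /\ forall u, N (b2val (A u - Bf.1 u)) <= r m * N u.
  have [B [f sB] AB] := appr _ (r_gt0 m); exists (B, f); split=> // u.
  have bB := symbol_bounded hn nu_invariant nu_boundary sB.
  have bAB : bounded_op (A - B).
    by have := bounded_op_lin (-1) bB bA; rewrite scaleN1r addrC; exact.
  have -> : A u - B u = (A - B) u by [].
  apply: (le_trans (opnormP u bAB)); apply: ler_wpM2r; [exact: L2norm_ge0|exact: ltW].
pose B m := (Af m).1; pose f m := (Af m).2.
have sB m : symbol (B m) (f m) by case: (Afr m).
have AB m u : N (b2val (A u - B m u)) <= r m * N u by case: (Afr m).
have fr m l x : unit_sphere x -> cmod (f m x - f l x) <= r m + r l.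
  move=> x1; have s := symbolB hn nu_invariant nu_boundary (sB m) (sB l).
  apply: (symbol_boundary_le hn nu_invariant nu_boundary s _ _ x1).
    by apply: addr_ge0; exact: ltW.
  move=> u; have -> : (B m - B l) u = (A u - B l u) - (A u - B m u).
    have -> : (B m - B l) u = B m u - B l u by [].
    by rewrite opprB [RHS]addrC addrA subrK.
  apply: (le_trans (hnormB _ _)); rewrite mulrDl addrC.
  exact: (lerD (AB m u) (AB l u)).
have fS m := cb_sphere (proj1 (sB m)).
have [p cp pE] : exists2 p : S -> R, continuous p &
    forall m s, `|p s - Re (f m (\val s))| <= r m.
  apply: sphere_limit => // [m|m l s]; first by have /continuous_complexP[] := fS m.
  apply: le_trans (fr m l _ (set_valP s)); have := Re_le_cmod (f m (\val s) - f l (\val s)).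
  by rewrite !cE.
have [q cq qE] : exists2 q : S -> R, continuous q &
    forall m s, `|q s - Im (f m (\val s))| <= r m.
  apply: sphere_limit => // [m|m l s]; first by have /continuous_complexP[] := fS m.
  apply: le_trans (fr m l _ (set_valP s)); have := Im_le_cmod (f m (\val s) - f l (\val s)).
  by rewrite !cE.
have [g cg gE] : exists2 g, cb g & forall s : S, g (\val s) = (p s +i* q s)%C.
  by apply: sphere_extend_cb; apply/continuous_complexP.
have fg m x : unit_sphere x -> cmod (f m x - g x) <= r m + r m.
  move=> x1; apply: (le_trans (cmod_le _)); rewrite !cE.
  have := gE (exist _ x (mem_set x1)); rewrite /= => ->.
  rewrite distrC [X in _ + X]distrC.
  exact: (lerD (pE m (exist _ x (mem_set x1))) (qE m (exist _ x (mem_set x1)))).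
have bT := T_bounded hn nu_invariant nu_boundary cg.
exists g; split=> //; apply/(compactP hn nu_invariant nu_boundary); split.
  by have := bounded_op_lin (-1) bT bA; rewrite scaleN1r addrC; exact.
(* Five errors below: [r m] three times, and [d / 5] for each of the two tail estimates. *)
move=> d d0; have d5 : 0 < d / 5 by rewrite divr_gt0.
have [m rm] := r0 _ d5; have [cf kB] := sB m.
have cfg : cb (fun x => f m x - g x) := cbB cf cg.
have [M1 h1] := boundary_tail hn nu_invariant nu_boundary cfg
  (addr_ge0 (ltW (r_gt0 m)) (ltW (r_gt0 m))) d5 (fg m).
have [_ sK] := (compactP hn nu_invariant nu_boundary _).1 kB.
have [M2 h2] := sK _ d5.
exists (maxn M1 M2) => u tu.
have t1 := h1 u (tail_le (leq_maxl _ _) tu); have t2 := h2 u (tail_le (leq_maxr _ _) tu).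
have t3 : N (T (fun x => f m x - g x) u) <= (r m + r m + d / 5) * N u.
  by apply: le_trans t1; have [_] := Q_best hn nu_invariant nu_boundary 0 (L2_cb u cfg).
have TE : T (fun x => f m x - g x) u = T (f m) u - T g u.
  have := T_lin hn nu_invariant nu_boundary (-1) cg cf.
  rewrite (_ : (fun _ => _) = fun x => f m x - g x); last first.
    by apply/funext => x; rewrite mulN1r addrC.
  by move=> ->; rewrite scaleN1r addrC.
have -> : (A - T g) u = (A u - B m u) + ((B m - T (f m)) u + T (fun x => f m x - g x) u).
  have -> : (B m - T (f m)) u = B m u - T (f m) u by [].
  have -> : (A - T g) u = A u - T g u by [].
  by rewrite TE [X in _ = _ + X]addrA subrK [RHS]addrA subrK.
apply: (le_trans (hnormD _ _)).
apply: (le_trans (lerD (AB m u) (le_trans (hnormD _ _) (lerD t2 t3)))).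
rewrite -!mulrDl; apply: ler_wpM2r; first exact: L2norm_ge0.
by move: rm; lra.
Qed.

Lemma symbol_cstar : cstar_subalgebra [set A : H -> H | exists f, symbol A f].
Proof.
split.
- by move=> A [f sA]; exact: (symbol_bounded hn nu_invariant nu_boundary sA).
- split=> [|a A B [f sA] [g sB]].
    by exists (fun=> 0); apply: (symbol_compact hn nu_invariant nu_boundary); exact: compact0.
  exists (fun x => a * f x + g x).
  exact: (symbol_lin hn nu_invariant nu_boundary a sA sB).
- move=> A B [f sA] [g sB]; exists (fun x => f x * g x).
  exact: (symbolM hn nu_invariant nu_boundary sA sB).
- move=> A [f sA]; exists (fun x => conjc (f x)).
  exact: (symbol_adjoint hn nu_invariant nu_boundary sA).
- exact: symbol_norm_closed.
Qed.

Lemma algebra_symbolP A : toeplitz_algebra nu A <-> exists f, symbol A f.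
Proof.
split=> [|[f [cf kA]]].
  apply: (smallest_sub symbol_cstar) => _ [f cf <-]; exists f.
  exact: (symbol_toeplitz hn nu_invariant nu_boundary cf).
move=> B [cB GB]; have [_ [_ lB] _ _ _] := cB.
rewrite -[A](subrK (T f)) -[A - _]scale1r; apply: lB; last by apply: GB; exists f.
exact: (compact_sub_algebra hn nu_invariant nu_boundary kA (conj cB GB)).
Qed.

(** A commutator is the difference of two semicommutators, since [f g = g f]. *)
Lemma commutator_ideal_compact : commutator_ideal nu = compact_ops nu.
Proof.
apply/seteqP; split; last exact: (compact_sub_commutator hn nu_invariant nu_boundary).
apply: smallest_sub.
  split.
  - exact: (compact_sub_algebra hn nu_invariant nu_boundary).
  - split; first exact: compact0.
    by move=> a A B; exact: (compact_lin hn nu_invariant nu_boundary a).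
  - move=> A K /algebra_symbolP[f /(symbol_bounded hn nu_invariant nu_boundary) bA] kK.
    split; first exact: (compact_mull hn nu_invariant nu_boundary bA kK).
    exact: (compact_mulr bA kK).
  - exact: (compact_norm_closed hn nu_invariant nu_boundary).
move=> _ [f cf [g cg <-]].
have k1 := toeplitz_semicommutator hn nu_invariant nu_boundary cf cg.
have k2 := toeplitz_semicommutator hn nu_invariant nu_boundary cg cf.
have := compactB hn nu_invariant nu_boundary k1 k2.
rewrite (_ : (fun x => g x * f x) = fun x => f x * g x).
  by rewrite opprB addrA subrK.
by apply/funext => x; rewrite mulrC.
Qed.

(** [symbol_uniq] makes the choice of a symbol immaterial; the default 0 shows only outside the
    Toeplitz algebra. *)
Definition sphere_symbol A : S -> R[i] :=
  fun s => xget (fun=> 0) [set f | symbol A f] (\val s).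

Lemma sphere_symbolE A f : symbol A f -> sphere_symbol A = fun s => f (\val s).
Proof.
move=> sA; apply/funext => s; rewrite /sphere_symbol; case: xgetP => [g _ sg|/(_ f)//].
exact: (symbol_uniq sg sA (set_valP s)).
Qed.

End toeplitz_algebra_symbols.

Theorem theorem4p3 (R : realType) (n : nat) (hn : (2 <= n)%N)
    (nu : probability (borel_rV R n) R)
    (nu_ball : carried_by_ball nu)
    (nu_regular : regular_on_ball nu)
    (nu_invariant : orthogonally_invariant nu)
    (nu_boundary : charges_boundary nu) :
  (* (1) *)
  commutator_ideal nu = compact_ops nu /\
  (* (2) *)
  (forall T : b2 nu -> b2 nu, toeplitz_algebra nu T ->
     exists f : 'rV[R]_n -> R[i], exists K : b2 nu -> b2 nu,
       [/\ continuous_closed_ball f, compact_ops nu K & T = toeplitz f + K]) /\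
  (exists p : (b2 nu -> b2 nu) -> (set_type (@unit_sphere R n) -> R[i]),
     [/\ star_hom op_mul adjoint op_mul adjoint
           (compact_ops nu) (toeplitz_algebra nu) id,
         star_hom op_mul adjoint sphere_mul sphere_conj
           (toeplitz_algebra nu) continuous_sphere p &
         short_exact (compact_ops nu) (toeplitz_algebra nu) continuous_sphere
           id p]).
Proof.
have CK := commutator_ideal_compact hn nu_invariant nu_boundary.
have AP := algebra_symbolP hn nu_invariant nu_boundary.
have KA := compact_sub_algebra hn nu_invariant nu_boundary.
have pE := sphere_symbolE hn nu_invariant nu_boundary.
split=> //; split.
  move=> A /AP[f [cf kA]]; exists f, (A - toeplitz f); split=> //.
  by rewrite addrC subrK.
exists (@sphere_symbol R n nu); split.
- split=> [A kA|a A B _ _|A B _ _|A _].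
  + exact: (KA A kA).
  + exact: erefl.
  + exact: erefl.
  + exact: erefl.
- split.
  + by move=> A /AP[f sA]; rewrite (pE _ _ sA); exact: (cb_sphere (proj1 sA)).
  + move=> a A B /AP[f sA] /AP[g sB].
    rewrite (pE _ _ sA) (pE _ _ sB).
    by rewrite (pE _ _ (symbol_lin hn nu_invariant nu_boundary a sA sB)).
  + move=> A B /AP[f sA] /AP[g sB].
    rewrite (pE _ _ sA) (pE _ _ sB).
    by rewrite (pE _ _ (symbolM hn nu_invariant nu_boundary sA sB)).
  + move=> A /AP[f sA]; rewrite (pE _ _ sA).
    by rewrite (pE _ _ (symbol_adjoint hn nu_invariant nu_boundary sA)).
- split.
  + by [].
  + rewrite image_id; apply/seteqP; split=> [K kK|A [/AP[f sA]] /=].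
      split; first exact: KA.
      by rewrite /= (pE _ _ (symbol_compact hn nu_invariant nu_boundary kK)).
    rewrite (pE _ _ sA) => f0; apply: (symbol0_compact hn nu_invariant nu_boundary sA) => x x1.
    by have /= := congr1 (fun h => h (exist _ x (mem_set x1))) f0.
  + apply/seteqP; split=> [_ [A /AP[f sA] <-]|g cg].
      by rewrite (pE _ _ sA); exact: (cb_sphere (proj1 sA)).
    have [f cf fg] := sphere_extend_cb cg; exists (toeplitz f).
      exact: toeplitz_in_algebra.
    rewrite (pE _ _ (symbol_toeplitz hn nu_invariant nu_boundary cf)).
    by apply/funext => s; rewrite fg.
Qed.
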